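(* Let $\xi:\partial\widetilde\lambda\to\mathcal F(\mathbb K^d)$ be $\lambda$-transverse and locally $\lambda$-Hölder continuous. Then $\xi$ admits a unique compatible slithering map $\Sigma:\widetilde\Lambda^2\to\mathrm{SL}_d(\mathbb K)$. Moreover, if $\xi$ is $\rho$-equivariant for some representation $\rho:\Gamma\to\mathrm{PGL}_d(\mathbb K)$, then $\Sigma$ is $\rho$-equivariant: $\Sigma(\gamma g_1,\gamma g_2)=\rho(\gamma)\Sigma(g_1,g_2)\rho(\gamma)^{-1}$ for all $\gamma\in\Gamma$, $g_1,g_2\in\widetilde\Lambda$.
   Context: $S$ is a closed oriented surface of genus $\ge2$, $\Gamma=\pi_1(S)$, with a fixed hyperbolic metric; $\widetilde S\cong\mathbb H^2$, $\partial\widetilde S$ its circle at infinity with counterclockwise cyclic order $\prec$ and visual metric $d_\infty$. $\lambda$ is a maximal geodesic lamination on $S$; $\widetilde\lambda$ its lift, $\widetilde\Lambda$ its set of leaves, $\partial\widetilde\lambda$ the set of endpoints of leaves, $\widetilde\Lambda^o\subset(\partial\widetilde\lambda)^2$ the oriented leaves $\mathsf g=(\mathsf g^+,\mathsf g^-)$ with product metric. $\mathbb K\in\{\mathbb R,\mathbb C\}$, $\mathcal F(\mathbb K^d)$ complete flags; $F,G$ transverse if $F^j+G^{d-j}=\mathbb K^d$ for all $j$. $\xi$ is $\lambda$-transverse if $\xi(\mathsf g^+),\xi(\mathsf g^-)$ are transverse for every $\mathsf g\in\widetilde\Lambda^o$, and locally $\lambda$-Hölder continuous if $\mathsf g\mapsto(\xi(\mathsf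 g^+),\xi(\mathsf g^-))$ is locally Hölder on $\widetilde\Lambda^o$. For leaves $g_1,g_2$ of $\widetilde\lambda$, a leaf $h$ separates them if it crosses neither and meets a segment joining them ($g_i$ separate $g_1,g_2$); $Q(g_1,g_2)$ is the set of such leaves. Oriented leaves $\mathsf g_1,\mathsf g_2$ are coherently oriented if $\mathsf g_2^+\preceq\mathsf g_1^+\prec\mathsf g_1^-\preceq\mathsf g_2^-\prec\mathsf g_2^+$ or $\mathsf g_1^+\preceq\mathsf g_2^+\prec\mathsf g_2^-\preceq\mathsf g_1^-\prec\mathsf g_1^+$. A slithering map compatible with $\xi$ is $\Sigma:\widetilde\Lambda^2\to\mathrm{SL}_d(\mathbb K)$ such that: (1) $\Sigma(g,g)=\mathrm{id}$, $\Sigma(g_1,g_2)=\Sigma(g_2,g_1)^{-1}$, and $\Sigma(g_1,g_2)\Sigma(g_2,g_3)=\Sigma(g_1,g_3)$ whenever $g_2$ separates $g_1,g_3$; (2) for all leaves $g_1,g_2$ there are $A,\nu>0$ with $\|\Sigma(\ell_1,\ell_2)-\Sigma(h_1,h_2)\|\le A\,d_\infty((\ell_1,\ell_2),(h_1,h_2))^\nu$ for all $\ell_i,h_i\in Q(g_1,g_2)$ (operator norm; distance on leaves induced from $d_\infty$ on oriented leaves); (3) $\Sigma(g_1,g_2)$ is unipotent whenever $g_1,g_2$ share an endpoint; (4) if $\mathsf g_1,\mathsf g_2$ are coherently oriented with underlying leaves $g_1,g_2$, then $\Sigma(g_1,g_2)$ sends $(\xi(\mathsf g_2^+),\xi(\mathsf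 g_2^-))$ to $(\xi(\mathsf g_1^+),\xi(\mathsf g_1^-))$. *)

(* Defs.v *)
From HB Require Import structures.
From mathcomp Require Import all_boot all_algebra.
From mathcomp Require Import all_classical all_reals all_analysis.
From mathcomp Require Import complex.

Set Implicit Arguments.
Unset Strict Implicit.
Unset Printing Implicit Defensive.

Import GRing.Theory Num.Theory.
Local Open Scope ring_scope.
Local Open Scope classical_set_scope.

(* Model of the hyperbolic plane: the Poincare disk {z : |z| < 1} in R[i].  *)
(* Its circle at infinity is the unit circle; isometries are the Moebius    *)
(* maps of PSU(1,1).  pi_1(S) of the closed hyperbolic surface S is the     *)
(* cocompact torsion-free Fuchsian group Gamma given by uniformization; we  *)
(* store Gamma as its full preimage in SU(1,1) (so it contains +-1).        *)

Section Geometry.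
Variable R : realType.

Definition cabs (z : R[i]) : R :=
  let: Complex a b := z in Num.sqrt (a ^+ 2 + b ^+ 2).

Definition expi (t : R) : R[i] := Complex (cos t) (sin t).

Definition circle : set R[i] := [set z | cabs z = 1].

Definition ccw_angle (a x : R[i]) (t : R) : Prop :=
  0 <= t /\ t < 2 * pi /\ x = a * expi t.

Definition ccw3 (a b c : R[i]) : Prop :=
  exists tb tc, [/\ ccw_angle a b tb, ccw_angle a c tc, 0 < tb & tb < tc].

Definition carc (p q : R[i]) : set R[i] :=
  [set x | x = p \/ x = q \/ ccw3 p x q].

(* the (unoriented) geodesic with endpoints x, y, recorded by its endpoints *)
Definition geod (x y : R[i]) : set R[i] := [set z | z = x \/ z = y].

Definition crosses (g h : set R[i]) : Prop :=
  exists x y u v, [/\ g = geod x y, h = geod u v, ccw3 x u y & ccw3 y v x].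

Definition su11 (g : 'M[R[i]]_2) : Prop :=
  [/\ g ord_max ord0 = conjc (g ord0 ord_max),
      g ord_max ord_max = conjc (g ord0 ord0) & \det g = 1].

Definition mob (g : 'M[R[i]]_2) (z : R[i]) : R[i] :=
  (g ord0 ord0 * z + g ord0 ord_max) / (g ord_max ord0 * z + g ord_max ord_max).

(* Gamma (full preimage in SU(1,1)) is a discrete, torsion-free (in PSU(1,1)),
   cocompact subgroup: i.e. Gamma/{+-1} = pi_1 S for a closed hyperbolic S. *)
Definition cocompact_fuchsian (G : set 'M[R[i]]_2) : Prop :=
  [/\
      [/\ (forall g, G g -> su11 g), G 1%:M, G (- 1%:M),
          (forall g h, G g -> G h -> G (g *m h)) &
          (forall g, G g -> G (invmx g))],
      (forall B : R, finite_set [set g | G g /\ forall i j, cabs (g i j) <= B]),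
      (forall (g : 'M[R[i]]_2) (n : nat), G g -> (0 < n)%N ->
          g ^+ n = 1 \/ g ^+ n = - 1 -> g = 1 \/ g = - 1) &
      (exists r : R, r < 1 /\ forall z, cabs z < 1 ->
          exists g w, [/\ G g, cabs w <= r & z = mob g w])].

Definition lifted_lamination (G : set 'M[R[i]]_2) (L : set (set R[i])) : Prop :=
  [/\ (forall g, L g -> exists x y, [/\ circle x, circle y, x <> y & g = geod x y]),
      (forall g h, L g -> L h -> ~ crosses g h),
      (forall c g, G c -> L g -> L (mob c @` g)) &
      (forall x y, circle x -> circle y -> x <> y ->
         (forall e : R, 0 < e -> exists u v,
             [/\ L (geod u v), cabs (u - x) < e & cabs (v - y) < e]) ->
         L (geod x y))].

Definition maximal_lamination (G : set 'M[R[i]]_2) (L : set (set R[i])) : Prop :=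
  lifted_lamination G L /\
  forall L', lifted_lamination G L' -> L `<=` L' -> L' = L.

Definition bdry (L : set (set R[i])) : set R[i] := [set x | exists g, L g /\ g x].

(* oriented leaves g = (g^+, g^-) *)
Definition oleaf (L : set (set R[i])) (p m : R[i]) : Prop := L (geod p m) /\ p <> m.

(* product metric on oriented leaves; the visual metric d_infty is replaced
   by the (bi-Lipschitz equivalent) chordal metric |x - y| *)
Definition dol (p m p' m' : R[i]) : R := Num.max (cabs (p - p')) (cabs (m - m')).

Definition separates (L : set (set R[i])) (h g1 g2 : set R[i]) : Prop :=
  L h /\ exists p q, [/\ p <> q, h = geod p q, g1 `<=` carc p q & g2 `<=` carc q p].

Definition coherent (p1 m1 p2 m2 : R[i]) : Prop :=
  (exists t2 t3 t4, [/\ ccw_angle p2 p1 t2, ccw_angle p2 m1 t3,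
                        ccw_angle p2 m2 t4 & t2 < t3 <= t4]) \/
  (exists t2 t3 t4, [/\ ccw_angle p1 p2 t2, ccw_angle p1 m2 t3,
                        ccw_angle p1 m1 t4 & t2 < t3 <= t4]).

End Geometry.

(* Flags in K^d.  A flag is F : nat -> 'M[K]_d, F j being a matrix whose     *)
(* row space is the j-dimensional subspace F^j (j = 0..d).  A matrix A acts  *)
(* on column vectors x |-> A x, i.e. on row spaces by u |-> u A^T.           *)

Section Flags.
Variables (K : fieldType) (d : nat).

Definition is_flag (F : nat -> 'M[K]_d) : Prop :=
  (forall j, (j <= d)%N -> \rank (F j) = j) /\
  (forall j, (j < d)%N -> (F j <= F j.+1)%MS).

Definition transverse (F G : nat -> 'M[K]_d) : Prop :=
  forall j, (j <= d)%N -> (1%:M <= F j + G (d - j)%N)%MS.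

Definition flag_act (A : 'M[K]_d) (F : nat -> 'M[K]_d) : nat -> 'M[K]_d :=
  fun j => F j *m A^T.

Definition flag_eq (F G : nat -> 'M[K]_d) : Prop :=
  forall j, (j <= d)%N -> (F j == G j)%MS.

Definition trunc_rows (j : nat) (M : 'M[K]_d) : 'M[K]_d :=
  \matrix_(i < d, k < d) (if (i < j)%N then M i k else 0).

Definition frame_of (F : nat -> 'M[K]_d) (M : 'M[K]_d) : Prop :=
  M \in unitmx /\ forall j, (j <= d)%N -> (F j == trunc_rows j M)%MS.

Definition unipotent (M : 'M[K]_d) : Prop :=
  exists k : nat, (M - 1%:M) ^+ k = 0.

End Flags.

Section Slithering.
Variables (R : realType) (K : fieldType) (nK : K -> R) (d : nat).

(* max-entry norm (equivalent to the operator norm) *)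
Definition mxnorm (M : 'M[K]_d) : R :=
  \big[Num.max/0]_(i < d) \big[Num.max/0]_(j < d) nK (M i j).

(* xi is locally lambda-Hoelder: near every oriented leaf, g |-> (xi g^+, xi g^-)
   admits Hoelder lifts to adapted frames (equivalently, is Hoelder into the
   flag manifold F(K^d) with any Riemannian metric). *)
Definition loc_holder (L : set (set R[i])) (xi : R[i] -> nat -> 'M[K]_d) : Prop :=
  forall p0 m0, oleaf L p0 m0 ->
  exists (e A nu : R) (Mp Mm : R[i] -> R[i] -> 'M[K]_d),
    [/\ 0 < e, 0 < nu,
     (forall p m, oleaf L p m -> dol p m p0 m0 < e ->
        frame_of (xi p) (Mp p m) /\ frame_of (xi m) (Mm p m)) &
     (forall p m p' m', oleaf L p m -> dol p m p0 m0 < e ->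
        oleaf L p' m' -> dol p' m' p0 m0 < e ->
        mxnorm (Mp p m - Mp p' m') <= A * powR (dol p m p' m') nu /\
        mxnorm (Mm p m - Mm p' m') <= A * powR (dol p m p' m') nu)].

Definition slithering (L : set (set R[i])) (xi : R[i] -> nat -> 'M[K]_d)
    (S : set R[i] -> set R[i] -> 'M[K]_d) : Prop :=
  [/\
      (forall g1 g2, L g1 -> L g2 -> \det (S g1 g2) = 1),
      [/\ (forall g, L g -> S g g = 1%:M),
          (forall g1 g2, L g1 -> L g2 -> S g1 g2 = invmx (S g2 g1)) &
          (forall g1 g2 g3, L g1 -> L g2 -> L g3 -> separates L g2 g1 g3 ->
              S g1 g2 *m S g2 g3 = S g1 g3)],
      (* (2) Hoelder on Q(g1,g2)^2; the distance between unoriented leaves is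
         the minimum over orientations, realized by quantifying over all
         endpoint labellings *)
      (forall g1 g2, L g1 -> L g2 -> exists A nu : R, 0 < A /\ 0 < nu /\
         forall a1 b1 a2 b2 c1 e1 c2 e2 : R[i],
           separates L (geod a1 b1) g1 g2 -> separates L (geod a2 b2) g1 g2 ->
           separates L (geod c1 e1) g1 g2 -> separates L (geod c2 e2) g1 g2 ->
           mxnorm (S (geod a1 b1) (geod a2 b2) - S (geod c1 e1) (geod c2 e2))
             <= A * powR (Num.max (dol a1 b1 c1 e1) (dol a2 b2 c2 e2)) nu),
      (forall g1 g2, L g1 -> L g2 -> (exists x, g1 x /\ g2 x) ->
          unipotent (S g1 g2)) &
      (forall p1 m1 p2 m2, oleaf L p1 m1 -> oleaf L p2 m2 -> coherent p1 m1 p2 m2 ->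
          flag_eq (flag_act (S (geod p1 m1) (geod p2 m2)) (xi p2)) (xi p1) /\
          flag_eq (flag_act (S (geod p1 m1) (geod p2 m2)) (xi m2)) (xi m1))].

(* rho : Gamma -> PGL_d(K), given by matrix representatives *)
Definition proj_rep (G : set 'M[R[i]]_2) (rho : 'M[R[i]]_2 -> 'M[K]_d) : Prop :=
  [/\ (forall c, G c -> rho c \in unitmx),
      (forall c c', G c -> G c' ->
          exists k : K, k != 0 /\ rho (c *m c') = k *: (rho c *m rho c')) &
      (exists k : K, k != 0 /\ rho (- 1%:M) = k *: 1%:M)].

Definition xi_equivariant (G : set 'M[R[i]]_2) (L : set (set R[i]))
    (rho : 'M[R[i]]_2 -> 'M[K]_d) (xi : R[i] -> nat -> 'M[K]_d) : Prop :=
  forall c x, G c -> bdry L x -> flag_eq (xi (mob c x)) (flag_act (rho c) (xi x)).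

Definition Sigma_equivariant (G : set 'M[R[i]]_2) (L : set (set R[i]))
    (rho : 'M[R[i]]_2 -> 'M[K]_d) (S : set R[i] -> set R[i] -> 'M[K]_d) : Prop :=
  forall c g1 g2, G c -> L g1 -> L g2 ->
    S (mob c @` g1) (mob c @` g2) = rho c *m S g1 g2 *m invmx (rho c).

End Slithering.

Definition slithering_theorem (R : realType) (K : fieldType) (nK : K -> R) : Prop :=
  forall (G : set 'M[R[i]]_2) (L : set (set R[i])) (d : nat)
         (xi : R[i] -> nat -> 'M[K]_d),
    cocompact_fuchsian G -> maximal_lamination G L ->
    (forall x, bdry L x -> is_flag (xi x)) ->
    (forall p m, oleaf L p m -> transverse (xi p) (xi m)) ->
    loc_holder nK L xi ->
    exists S : set R[i] -> set R[i] -> 'M[K]_d,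
      [/\ slithering nK L xi S,
          (forall S', slithering nK L xi S' ->
             forall g1 g2, L g1 -> L g2 -> S' g1 g2 = S g1 g2) &
          (forall rho : 'M[R[i]]_2 -> 'M[K]_d,
             proj_rep G rho -> xi_equivariant G L rho xi ->
             Sigma_equivariant G L rho S)].

(* Main.v *)
Require Import Defs.
From HB Require Import structures.
From mathcomp Require Import all_boot all_algebra.
From mathcomp Require Import all_classical all_reals all_analysis.
From mathcomp Require Import complex.
From mathcomp Require Import all_order ring lra.
Import Order.TTheory GRing.Theory Num.Theory Normc.
Local Open Scope ring_scope.

(** The leaves separating two given leaves are parametrised by a closed subset of an interval whose gaps are
    the ideal triangles crossed on the way. Across a gap the two leaves share an endpoint, and unipotency
    together with compatibility with [xi] determines the slithering map; the global map is the ordered product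
    of these elementary ones. By Hoelder continuity the factor of a gap of length [l] is within [O(l^nu)] of the
    identity, and the product converges because the parametrising set is porous and has boundedly many gaps in
    each dyadic range of lengths.

    Both geometric facts come from cocompactness. Renormalising a strip in which leaves are too dense would
    give in the limit a fan of leaves through a common endpoint; renormalising gaps turns them into thick ideal
    triangles, of which there are finitely many modulo the group. That gaps are ideal triangles is maximality:
    a non-triangular complementary region has a boundary axis, and a simple diagonal of the region is obtained
    by a surgery argument applied to a closest pair of translates of this axis. *)

(** The ordered product of non-commuting matrices is never formed. Two transverse flags determine a
    frame up to rescaling its [d] vectors, and across a gap, where one flag is common, the change of
    frame is triangular. Rescaling the vectors so that all these triangular matrices have diagonal 1
    leaves [d] commutative scalar products; the slithering map is the change between such parallel
    frames, and it inherits their Hoelder continuity.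

    Since the Hoelder exponent may be arbitrarily small, uniqueness needs more than a parameter set
    of measure zero: a Hoelder function unchanged across all gaps could still be a Cantor staircase.
    Porosity together with the bound on the number of gaps excludes this.

    The lamination is maximal only among laminations invariant under the group. A geodesic crossed
    by no leaf can therefore be added only if it is also disjoint from its own translates; this is
    the obstacle that the surgery argument overcomes. *)

Set Implicit Arguments.
Unset Strict Implicit.
Unset Printing Implicit Defensive.

(** * Adapted frames *)

Section AdaptedFrames.
Variables (K : fieldType) (d : nat).
Implicit Types (F G : nat -> 'M[K]_d) (A B M N V X Y : 'M[K]_d).

Local Notation pid := (@pid_mx K d d).
Local Notation copid := (@copid_mx K d).

Definition lower X := forall i k : 'I_d, (i < k)%N -> X i k = 0.
Definition upper X := lower X^T.

Lemma lower_mul X Y : lower X -> lower Y -> lower (X *m Y).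
Proof.
move=> lX lY i k ik; rewrite mxE big1 // => j _.
case: (ltnP i j) => ij; first by rewrite lX // mul0r.
by rewrite lY ?mulr0 // (leq_ltn_trans ij).
Qed.

Lemma lower_mul_diag X Y i : lower X -> lower Y ->
  (X *m Y) i i = X i i * Y i i.
Proof.
move=> lX lY; rewrite mxE (bigD1 i) //= big1 ?addr0 // => j ji.
case: (ltngtP i j) => ij; [by rewrite lX // mul0r|by rewrite lY // mulr0|].
by move/eqP: ji; case; apply/val_inj.
Qed.

Lemma upper_mul_diag X Y i : upper X -> upper Y ->
  (X *m Y) i i = X i i * Y i i.
Proof.
move=> uX uY; have := lower_mul_diag i uY uX.
by rewrite -trmx_mul !mxE mulrC => ->.
Qed.

Lemma lower_det X : lower X -> \det X = \prod_i X i i.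
Proof. by move=> lX; apply: det_trig; apply/is_trig_mxP => i k; apply: lX. Qed.

Lemma upper_det X : upper X -> \det X = \prod_i X i i.
Proof.
move=> uX; rewrite -det_tr lower_det //.
by apply: eq_bigr => i _; rewrite mxE.
Qed.

Lemma lower_unit_diag X i : lower X -> X \in unitmx -> X i i != 0.
Proof.
move=> lX; rewrite unitmxE lower_det // unitfE => /prodf_neq0 h.
exact: h.
Qed.

Lemma upper_unit_diag X i : upper X -> X \in unitmx -> X i i != 0.
Proof.
move=> uX; rewrite -unitmx_tr => uT.
by have := lower_unit_diag i uX uT; rewrite mxE.
Qed.

Lemma lowerD1 X : lower X -> lower (X - 1%:M).
Proof.
move=> lX i k ik; rewrite !mxE lX //.
by rewrite (_ : (i == k) = false) ?subr0 //; apply/eqP => e; rewrite e ltnn in ik.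
Qed.

Lemma lower_exp X n : lower X -> lower (X ^+ n).
Proof.
move=> lX; elim: n => [|n IH].
  rewrite expr0 => i k ik; rewrite -[1]/(1%:M) mxE.
  by case: eqP => // e; rewrite e ltnn in ik.
by rewrite exprS; apply: lower_mul.
Qed.

Lemma lower_exp_diag X n i : lower X -> (X ^+ n) i i = X i i ^+ n.
Proof.
move=> lX; elim: n => [|n IH]; first by rewrite !expr0 -[1]/(1%:M) mxE eqxx.
by rewrite !exprS lower_mul_diag ?IH //; apply: lower_exp.
Qed.

(** The diagonal of [(X - 1)^k] consists of the k-th powers of [X i i - 1], and a field has no
    nilpotents. *)
Lemma lower_unipotent_diag X i : lower X -> unipotent X -> X i i = 1.
Proof.
move=> lX [k hk]; have := lower_exp_diag k i (lowerD1 lX).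
rewrite hk !mxE eqxx => /esym/eqP; rewrite expf_eq0 => /andP[_].
by rewrite subr_eq0 => /eqP.
Qed.

Lemma trmxX X n : (X ^+ n)^T = X^T ^+ n.
Proof.
elim: n => [|n IH]; first by rewrite !expr0 trmx1.
by rewrite exprS exprSr trmx_mul IH.
Qed.

Lemma unipotent_tr X : unipotent X -> unipotent X^T.
Proof.
move=> [k hk]; exists k.
by rewrite -(trmx1 K d) -linearB /= -trmxX hk trmx0.
Qed.

Lemma conj_exp B X n : B \in unitmx ->
  (invmx B *m X *m B) ^+ n = invmx B *m X ^+ n *m B.
Proof.
move=> uB; elim: n => [|n IH].
  by rewrite !expr0 -[(1 : 'M[K]_d)]/(1%:M) mulmx1 mulVmx.
rewrite !exprS IH -![_ * _]/(_ *m _) !mulmxA; congr (_ *m _ *m _).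
by rewrite mulmxK.
Qed.

Lemma unipotent_conj B X : B \in unitmx ->
  unipotent X -> unipotent (invmx B *m X *m B).
Proof.
move=> uB [k hk]; exists k.
have -> : invmx B *m X *m B - 1%:M = invmx B *m (X - 1%:M) *m B.
  by rewrite mulmxBr mulmx1 mulmxBl mulVmx.
by rewrite conj_exp // hk mulmx0 mul0mx.
Qed.

Lemma upper_unipotent_diag X i : upper X -> unipotent X -> X i i = 1.
Proof.
by move=> uX /unipotent_tr pX; have := lower_unipotent_diag i uX pX; rewrite mxE.
Qed.

Lemma lower_diag1_unipotent X : lower X -> (forall i, X i i = 1) -> unipotent X.
Proof.
move=> lX dX; exists d; apply/matrixP => i j; rewrite [RHS]mxE.
(* Each factor [X - 1] pushes the support one diagonal further down; after [d] factors nothing is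
   left. *)
have h n (i' j' : 'I_d) : (i' < j' + n)%N -> ((X - 1%:M) ^+ n) i' j' = 0.
  elim: n i' j' => [|n IH] i' j'.
    rewrite addn0 expr0 -[(1 : 'M[K]_d)]/(1%:M) mxE.
    by case: eqP => // ->; rewrite ltnn.
  rewrite addnS ltnS exprS => hij; rewrite -[_ * _]/(_ *m _) mxE big1 // => l _.
  case: (ltngtP i' l) => il.
  - by rewrite (lowerD1 lX) // mul0r.
  - by rewrite IH ?mulr0 //; apply: leq_trans il hij.
  - have -> : l = i' by apply/val_inj.
    by rewrite !mxE eqxx dX subrr mul0r.
by apply: h; apply: leq_trans (ltn_ord i) (leq_addl _ _).
Qed.

Lemma upper_diag1_unipotent X : upper X -> (forall i, X i i = 1) -> unipotent X.
Proof.
move=> uX dX; rewrite -[X]trmxK; apply/unipotent_tr/lower_diag1_unipotent => //.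
by move=> i; rewrite mxE.
Qed.

Lemma invmx_mul A B : A \in unitmx -> B \in unitmx -> invmx (A *m B) = invmx B *m invmx A.
Proof.
move=> uA uB; have uAB : A *m B \in unitmx by rewrite unitmx_mul uA.
have e : A *m B *m (invmx B *m invmx A) = 1%:M by rewrite mulmxA mulmxK // mulmxV.
by rewrite -[RHS](mulKmx uAB) e mulmx1.
Qed.

(** Row [i] of an adapted [A] spans the line in which F^(i+1) meets G^(d-i), so two adapted frames
    differ by rescaling rows ([adapted_diag]). *)
Definition adapted F G A :=
  A \in unitmx /\ forall j, (j <= d)%N ->
    (F j == pid j *m A)%MS /\ (G (d - j)%N == copid j *m A)%MS.

Lemma pid_mul_lower X j : lower X -> pid j *m X = pid j *m X *m pid j.
Proof.
move=> lX; apply/matrixP => i k; rewrite [RHS]mxE (bigD1 k) //= big1; last first.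
  by move=> l lk; rewrite [pid j l k]mxE (_ : (l == k :> nat) = false) ?mulr0 //; apply/negbTE.
rewrite addr0 [pid j k k]mxE eqxx /=.
case: ltnP => kj; first by rewrite mulr1.
rewrite mulr0 mxE big1 // => l _; rewrite [pid _ _ _]mxE.
case: eqP => [il|_] /=; last by rewrite mul0r.
case: ltnP => ij; last by rewrite mul0r.
by rewrite lX ?mulr0 // -il; apply: leq_trans ij kj.
Qed.

Lemma pid_mulE X j (i k : 'I_d) : (pid j *m X) i k = if (i < j)%N then X i k else 0.
Proof.
rewrite mxE (bigD1 i) //= big1; last first.
  by move=> l li; rewrite mxE eq_sym (negbTE (li : (l != i :> nat))) mul0r.
by rewrite mxE eqxx addr0; case: ltnP => _; rewrite ?mul1r ?mul0r.
Qed.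

Lemma copid_mulE X j (i k : 'I_d) : (copid j *m X) i k = if (i < j)%N then 0 else X i k.
Proof.
rewrite /copid_mx mulmxBl mul1mx; transitivity (X i k - (pid j *m X) i k); first by rewrite mxE [X in _ + X]mxE.
by rewrite pid_mulE; case: ltnP => _; rewrite ?subrr ?subr0.
Qed.

Lemma mul_pidE X j (i k : 'I_d) : (X *m pid j) i k = if (k < j)%N then X i k else 0.
Proof.
rewrite mxE (bigD1 k) //= big1; last first.
  by move=> l lk; rewrite mxE (negbTE (lk : (l != k :> nat))) mulr0.
by rewrite mxE eqxx addr0; case: ltnP => _; rewrite ?mulr1 ?mulr0.
Qed.

Lemma mul_copidE X j (i k : 'I_d) : (X *m copid j) i k = if (k < j)%N then 0 else X i k.
Proof.
rewrite /copid_mx mulmxBr mulmx1; transitivity (X i k - (X *m pid j) i k); first by rewrite mxE [X in _ + X]mxE.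
by rewrite mul_pidE; case: ltnP => _; rewrite ?subrr ?subr0.
Qed.

(** The first [i + 1] rows of [A] and of [B] span the same space, so row [i] of [B] involves no
    later row of [A]. *)
Lemma same_flag_lower F A B : A \in unitmx ->
  (forall j, (j <= d)%N -> (F j == pid j *m A)%MS) ->
  (forall j, (j <= d)%N -> (F j == pid j *m B)%MS) -> lower (B *m invmx A).
Proof.
move=> uA hA hB i k ik.
have h : (pid i.+1 *m B <= pid i.+1 *m A)%MS.
  by rewrite -(eqmxP (hA _ (ltn_ord i))) (eqmxP (hB _ (ltn_ord i))).
have [D hD] := submxP h.
have : pid i.+1 *m (B *m invmx A) = D *m pid i.+1.
  by rewrite mulmxA hD -!mulmxA mulmxV // mulmx1.
move/matrixP/(_ i k); rewrite pid_mulE mul_pidE ltnS leqnn ltnS.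
by rewrite leqNgt ik.
Qed.

Lemma same_flag_upper G A B : A \in unitmx ->
  (forall j, (j <= d)%N -> (G (d - j)%N == copid j *m A)%MS) ->
  (forall j, (j <= d)%N -> (G (d - j)%N == copid j *m B)%MS) -> upper (B *m invmx A).
Proof.
move=> uA hA hB i k ik; rewrite mxE.
have kd : (k <= d)%N by apply: ltnW.
have h : (copid k *m B <= copid k *m A)%MS.
  by rewrite -(eqmxP (hA _ kd)) (eqmxP (hB _ kd)).
have [D hD] := submxP h.
have : copid k *m (B *m invmx A) = D *m copid k.
  by rewrite mulmxA hD -!mulmxA mulmxV // mulmx1.
by move/matrixP/(_ k i); rewrite copid_mulE mul_copidE ltnn ik.
Qed.

Lemma adapted_act F G A V : V \in unitmx -> adapted F G A ->
  adapted (fun j => F j *m V) (fun j => G j *m V) (A *m V).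
Proof.
move=> uV [uA hA]; split; first by rewrite unitmx_mul uA.
move=> j /hA[h1 h2]; rewrite !mulmxA; split; apply/eqmxP; apply: eqmxMr; exact/eqmxP.
Qed.

Lemma adapted_eq F G F' G' A : flag_eq F F' -> flag_eq G G' ->
  adapted F G A -> adapted F' G' A.
Proof.
move=> hF hG [uA hA]; split=> // j jd; have [h1 h2] := hA j jd.
split; apply/eqmxP.
  by apply: eqmx_trans (eqmxP h1); apply/eqmx_sym/eqmxP/hF.
by apply: eqmx_trans (eqmxP h2); apply/eqmx_sym/eqmxP/hG/leq_subr.
Qed.

Lemma unit_mul_pid_rank A j : A \in unitmx -> (j <= d)%N -> \rank (pid j *m A) = j.
Proof. by move=> uA jd; rewrite mxrankMfree ?row_free_unit // rank_pid_mx. Qed.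

Lemma adapted_diag F G A B (i k : 'I_d) : adapted F G A -> adapted F G B -> i != k ->
  (B *m invmx A) i k = 0.
Proof.
move=> [uA hA] [uB hB] ik.
have hl := same_flag_lower uA (fun j jd => (hA j jd).1) (fun j jd => (hB j jd).1).
have hu := same_flag_upper uA (fun j jd => (hA j jd).2) (fun j jd => (hB j jd).2).
case: (ltngtP i k) => h; first exact: hl.
  by have := hu _ _ h; rewrite mxE.
by move/eqP: ik; case; apply/val_inj.
Qed.

Lemma adapted_scale F G A (c : 'I_d -> K) : (forall i, c i != 0) -> adapted F G A ->
  adapted F G (diag_mx (\row_i c i) *m A).
Proof.
move=> c0 [uA hA].
have uD : diag_mx (\row_i c i) \in unitmx.
  by rewrite unitmxE det_diag unitfE; apply/prodf_neq0 => i _; rewrite mxE.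
split; first by rewrite unitmx_mul uD.
have cD (P : 'M[K]_d) : is_diag_mx P -> (P *m (diag_mx (\row_i c i) *m A) == P *m A)%MS.
  move=> /is_diag_mxP hP; rewrite mulmxA.
  have -> : P *m diag_mx (\row_i c i) = diag_mx (\row_i c i) *m P.
    apply/matrixP => i j; rewrite mul_mx_diag mul_diag_mx !mxE.
    case: (altP (i =P j)) => [->|ij]; first by rewrite mulrC.
    by rewrite hP ?mul0r ?mulr0.
  by rewrite -mulmxA; apply/eqmxP; apply: eqmxMfull; rewrite row_full_unit.
have dp j : is_diag_mx (pid j).
  by apply/is_diag_mxP => i k ik; rewrite mxE (negbTE ik).
have dc j : is_diag_mx (copid j).
  apply/is_diag_mxP => i k ik; rewrite !mxE (negbTE ik).
  by rewrite (_ : (i == k) = false) ?subrr //; apply/eqP => e; rewrite e eqxx in ik.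
move=> j jd; have [h1 h2] := hA j jd; split; apply/eqmxP.
  by apply: eqmx_trans (eqmxP h1) _; apply/eqmx_sym/eqmxP/cD.
by apply: eqmx_trans (eqmxP h2) _; apply/eqmx_sym/eqmxP/cD.
Qed.

Definition shift_mx j : 'M[K]_d := \matrix_(i, k) ((i == k + j :> nat)%N)%:R.
(** The first [d - j] rows of [N] placed under the first [j] rows of [M]; for frames of transverse
    flags it is invertible ([stack_unit]). *)
Definition stack_mx j M N := pid j *m M + shift_mx j *m N.
(** With [S] the stack, [invmx S *m pid i *m S] is the projection to F^i along G^(d-i). The formula
    is rational in the entries of [M] and [N], which is what transfers Hoelder continuity to the
    adapted frame. *)
Definition aframe M N : 'M[K]_d :=
  \matrix_(i, k) (M *m (1%:M - invmx (stack_mx i M N) *m pid i *m stack_mx i M N)) i k.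

Lemma trunc_rowsE j M : trunc_rows j M = pid j *m M.
Proof. by apply/matrixP => i k; rewrite pid_mulE mxE. Qed.

Lemma pid_stack j M N : pid j *m stack_mx j M N = pid j *m M.
Proof.
apply/matrixP => i k; rewrite !pid_mulE; case: ltnP => // ij.
rewrite mxE pid_mulE ij mxE big1 ?addr0 // => l _.
rewrite mxE (_ : (_ == _) = false) ?mul0r //.
by apply/eqP => e; move: ij; rewrite e ltnNge leq_addl.
Qed.

Lemma copid_stack j M N : copid j *m stack_mx j M N = shift_mx j *m N.
Proof.
apply/matrixP => i k; rewrite copid_mulE; case: ltnP => ij.
  rewrite mxE big1 // => l _; rewrite mxE (_ : (_ == _) = false) ?mul0r //.
  by apply/eqP => e; move: ij; rewrite e ltnNge leq_addl.
by rewrite mxE pid_mulE ltnNge ij /= add0r.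
Qed.

Lemma shift_pid j N : (j <= d)%N -> (shift_mx j *m N <= pid (d - j) *m N)%MS.
Proof.
move=> jd.
have -> : shift_mx j = shift_mx j *m pid (d - j).
  apply/matrixP => i k; rewrite mul_pidE mxE; case: ltnP => // h.
  rewrite (_ : (_ == _) = false) //; apply/eqP => e.
  by have := ltn_ord i; rewrite e ltnNge -{1}(subnK jd) leq_add2r h.
by rewrite -mulmxA submxMl.
Qed.

Lemma shift_tr_pid j : (shift_mx j)^T *m shift_mx j = pid (d - j).
Proof.
apply/matrixP => i k; rewrite !mxE; under eq_bigr => l _ do rewrite !mxE.
case: (ltnP (i + j) d) => h; last first.
  rewrite big1; last first.
    move=> l _; rewrite (_ : (_ == _) = false) ?mul0r //; apply/eqP => e.
    by have := ltn_ord l; rewrite e ltnNge h.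
  by rewrite ltn_subRL addnC (ltnNge _ d) h andbF.
rewrite (bigD1 (Ordinal h)) //= big1; last first.
  move=> l hl; rewrite (_ : (_ == (i + j)%N) = false) ?mul0r //.
  by apply/negbTE; apply: contra hl => /eqP e; apply/eqP/val_inj.
by rewrite eqxx mul1r addr0 eqn_add2r ltn_subRL addnC h andbT.
Qed.

Lemma stack_unit F G M N j : transverse F G -> frame_of F M -> frame_of G N ->
  (j <= d)%N -> stack_mx j M N \in unitmx.
Proof.
move=> tr [uM hM] [uN hN] jd; rewrite -row_full_unit -sub1mx.
apply: submx_trans (tr j jd) _; rewrite addsmx_sub; apply/andP; split.
  by rewrite (eqmxP (hM j jd)) trunc_rowsE -(pid_stack j M N) submxMl.
rewrite (eqmxP (hN _ (leq_subr j d))) trunc_rowsE -shift_tr_pid -mulmxA.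
by rewrite -(copid_stack j M N) mulmxA submxMl.
Qed.

Lemma flag_le F i j : is_flag F -> (i <= j)%N -> (j <= d)%N -> (F i <= F j)%MS.
Proof.
move=> [_ hF]; elim: j => [|j IH]; first by rewrite leqn0 => /eqP->.
rewrite leq_eqVlt => /orP[/eqP->//|]; rewrite ltnS => ij jd.
by apply: submx_trans (IH ij (ltnW jd)) (hF _ jd).
Qed.

(* The i-th row is the i-th row of [M] projected to [G^(d-i)] along [F^i]. *)
Lemma aframe_adapted F G M N : is_flag F -> is_flag G -> transverse F G ->
  frame_of F M -> frame_of G N -> adapted F G (aframe M N).
Proof.
move=> fF fG tr fM fN; have su := stack_unit tr fM fN.
case: (fM) (fN) => [uM hM] [uN hN].
(* Row [i] of the new frame is row [i] of [M] minus a combination of earlier rows, so [T] is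
   unitriangular and the spans F^j are kept. *)
pose T : 'M[K]_d := \matrix_(i, k) ((i == k)%:R - (M *m invmx (stack_mx i M N) *m pid i) i k).
have lT : lower T.
  move=> i k ik; rewrite mxE mul_pidE ltnNge (ltnW ik) /= subr0.
  by rewrite (_ : (i == k) = false) //; apply/eqP => e; rewrite e ltnn in ik.
have dT i : T i i = 1 by rewrite mxE mul_pidE ltnn eqxx subr0.
have uT : T \in unitmx.
  by rewrite unitmxE lower_det // big1 ?unitr1 // => i _; rewrite dT.
have eT : aframe M N = T *m M.
  apply/matrixP => i k; rewrite mxE mulmxBr mulmx1 -[invmx _ *m pid i *m _]mulmxA pid_stack.
  rewrite mulmxA mulmxA; set X := M *m invmx _ *m pid i.
  have -> : (T *m M) i k = \sum_l (i == l)%:R * M l k - \sum_l X i l * M l k.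
    by rewrite mxE -sumrB; apply: eq_bigr => l _; rewrite mxE mulrBl.
  rewrite (bigD1 i) //= eqxx mul1r big1 ?addr0; last first.
    by move=> l li; rewrite eq_sym (negbTE li) mul0r.
  by rewrite mxE [X in _ + X]mxE mxE.
have uA : aframe M N \in unitmx by rewrite eT unitmx_mul uT.
have fl j : (j <= d)%N -> (pid j *m aframe M N <= F j)%MS.
  move=> jd; rewrite eT mulmxA pid_mul_lower // -mulmxA (eqmxP (hM j jd)).
  by rewrite trunc_rowsE submxMl.
have gl j : (j <= d)%N -> (copid j *m aframe M N <= G (d - j)%N)%MS.
  move=> jd; apply/row_subP => i.
  have -> : row i (copid j *m aframe M N) = if (i < j)%N then 0 else row i (aframe M N).
    by apply/rowP => k; rewrite mxE copid_mulE; case: ltnP => _; rewrite !mxE.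
  case: ltnP => ij; first exact: sub0mx.
  have id : (i <= d)%N by apply: ltnW.
  have -> : row i (aframe M N) = row i (M *m invmx (stack_mx i M N)) *m (shift_mx i *m N).
    rewrite -(copid_stack i M N) -row_mul.
    have -> : M *m invmx (stack_mx i M N) *m (copid i *m stack_mx i M N)
      = M *m (1%:M - invmx (stack_mx i M N) *m pid i *m stack_mx i M N).
      rewrite /copid_mx mulmxBl mul1mx !mulmxBr mulmx1 mulmxKV ?su //.
      by rewrite !mulmxA.
    by apply/rowP => k; rewrite !mxE.
  apply: submx_trans (submxMl _ _) _; apply: submx_trans (shift_pid _ id) _.
  rewrite -trunc_rowsE -(eqmxP (hN _ (leq_subr i d))).
  by apply: flag_le; rewrite ?leq_subr // leq_sub2l.
(* Both inclusions are equalities because the ranks agree. *)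
case: (fF) (fG) => [rF _] [rG _]; split=> // j jd; split; apply/andP; split.
- by rewrite -(geq_leqif (mxrank_leqif_sup (fl _ jd))) rF // unit_mul_pid_rank.
- exact: fl.
- rewrite -(geq_leqif (mxrank_leqif_sup (gl _ jd))) rG ?leq_subr //.
  by rewrite mxrankMfree ?row_free_unit // rank_copid_mx.
- exact: gl.
Qed.

End AdaptedFrames.

(** * Thin sets and absolute values *)

Section Thin.
Variable R : realType.
Implicit Types (X : set R) (a b : R).

Definition dy (n : nat) : R := (2^-1) ^+ n.

Lemma dy_gt0 n : 0 < dy n.
Proof. by rewrite exprn_gt0 // invr_gt0 ltr0n. Qed.

Lemma dyS n : dy n.+1 = dy n / 2.
Proof. by rewrite /dy exprSr. Qed.

Lemma dy_le m n : (m <= n)%N -> dy n <= dy m.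
Proof.
move=> mn; rewrite /dy ler_wiXn2l // ?invr_ge0 ?ler0n //.
by rewrite invf_le1 ?ltr0n // ler1n.
Qed.

Lemma expr_small (r e : R) : 0 <= r -> r < 1 -> 0 < e -> exists n, r ^+ n < e.
Proof.
move=> r0 r1 e0.
have := @cvg_geometric R 1 r; rewrite ger0_norm // => /(_ r1) /cvgrPdist_lt /(_ e e0)[n _ h].
exists n; have := h n (leqnn n).
by rewrite /geometric /= mul1r sub0r normrN ger0_norm // exprn_ge0.
Qed.

Lemma dy_small (e : R) : 0 < e -> exists n, dy n < e.
Proof. by move=> e0; apply: expr_small => //; lra. Qed.

Lemma dy_scale (x : R) : 0 < x -> x < 1 -> exists n, dy n.+1 <= x < dy n.
Proof.
move=> x0 x1.
have ex : exists n, dy n <= x by have [n hn] := dy_small x0; exists n; apply: ltW.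
case: (ex_minnP ex) => [[|n]] hn hmin; first by move: hn; rewrite /dy expr0 leNgt x1.
exists n; rewrite hn /= ltNge; apply/negP => h.
by have := hmin _ h; rewrite ltnn.
Qed.

(** With [q] the square root of [r], the term [n q^n] is bounded by the geometric series of [q],
    which leaves a factor [q^n] tending to 0. In the application the factor linear in [n] counts the
    gaps of length at least [dy n]. *)
Lemma ler_eq0_geom (A B D r : R) : 0 <= A -> 0 <= r -> r < 1 ->
  (forall n, A <= (B * n%:R + D) * r ^+ n) -> A = 0.
Proof.
move=> A0 r0 r1 h.
have B'0 : 0 <= `|B| + `|D| by rewrite addr_ge0.
have h' n : A <= (`|B| + `|D|) * n.+1%:R * r ^+ n.
  apply: le_trans (h n) _; rewrite ler_wpM2r ?exprn_ge0 //.
  rewrite mulrDl -natr1; apply: lerD.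
    rewrite mulrDr mulr1; apply: ler_wpDr => //.
    by rewrite ler_wpM2r // ?ler_norm.
  rewrite mulrDr mulr1; apply: ler_wpDl; first by rewrite mulr_ge0.
  exact: ler_norm.
have [r00|rn0] := eqVneq r 0.
  by have := h' 1%N; rewrite r00 expr1 mulr0 => A0'; apply/eqP; rewrite eq_le A0 A0'.
have rp : 0 < r by rewrite lt_neqAle eq_sym rn0.
pose q := Num.sqrt r.
have q0 : 0 < q by rewrite sqrtr_gt0.
have q2 : q ^+ 2 = r by rewrite sqr_sqrtr // ltW.
have q1 : q < 1 by rewrite -(@ltr_pXn2r _ 2) ?nnegrE ?ltW // q2 expr1n.
have bern n : n.+1%:R * q ^+ n <= (1 - q)^-1.
  have : n.+1%:R * q ^+ n <= \sum_(i < n.+1) q ^+ i.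
    rewrite -{1}[n.+1]card_ord -sumr_const mulr_suml.
    apply: ler_sum => i _; rewrite mul1r; apply: ler_wiXn2l; rewrite ?ltW //.
    by rewrite -ltnS ltn_ord.
  move=> /le_trans; apply.
  rewrite -[_^-1]mul1r ler_pdivlMr ?subr_gt0 //.
  have -> : (\sum_(i < n.+1) q ^+ i) * (1 - q) = 1 - q ^+ n.+1.
    move: (subrX1 q n.+1) => e2; rewrite -opprB -[in RHS]opprB e2 mulrC mulNr.
    by congr (- (_ * _)).
  by rewrite gerBl exprn_ge0 // ltW.
apply/eqP; rewrite eq_le A0 andbT leNgt; apply/negP => Ap.
pose e := A / ((`|B| + `|D| + 1) / (1 - q)).
have e0 : 0 < e.
  by rewrite divr_gt0 // divr_gt0 ?subr_gt0 // ltr_wpDl.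
have [n hn] := expr_small (ltW q0) q1 e0.
have := h' n; rewrite leNgt => /negP; apply.
rewrite -q2 -exprM mulnC muln2 -addnn exprD.
have -> : (`|B| + `|D|) * n.+1%:R * (q ^+ n * q ^+ n) =
   (`|B| + `|D|) * (n.+1%:R * q ^+ n) * q ^+ n by ring.
have qn0 : 0 <= q ^+ n by rewrite exprn_ge0 // ltW.
have q1' : 0 <= (1 - q)^-1 by rewrite invr_ge0 subr_ge0 ltW.
apply: le_lt_trans (_ : (`|B| + `|D| + 1) / (1 - q) * q ^+ n < A).
  apply: ler_wpM2r => //; apply: ler_pM => //; rewrite ?lerDl //.
  by rewrite mulr_ge0 // exprn_ge0 // ltW.
by rewrite mulrC -ltr_pdivlMr // divr_gt0 ?subr_gt0 // ltr_wpDl.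
Qed.

Lemma powR_dy n (nu : R) : powR (dy n) nu = powR (2^-1) nu ^+ n.
Proof.
have h0 : 0 <= (2^-1 : R) by rewrite invr_ge0 ler0n.
elim: n => [|n IH]; first by rewrite /dy !expr0 powR1.
by rewrite dyS powRM ?IH ?exprSr // ltW // dy_gt0.
Qed.

Lemma powR_half_lt1 (nu : R) : 0 < nu -> powR (2^-1) nu < 1.
Proof.
move=> n0; have h : 2^-1 < 1 :> R by lra.
have h0 : 0 <= 2^-1 :> R by lra.
by have := gt0_ltr_powR n0 h0 ler01 h; rewrite powR1.
Qed.

Definition gap X a b := [/\ X a, X b, a < b & forall x, X x -> ~~ (a < x < b)].

Definition seq_closed X := forall t,
  (forall e : R, 0 < e -> exists s, X s /\ `|s - t| < e) -> X t.

(** The interval is half-open so that every gap is shorter than 1 and falls into one of the dyadic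
    ranges, as [dy_scale] requires. *)
Definition thin X := [/\
  forall s, X s -> 0 <= s < 1,
  seq_closed X,
  exists2 c : R, 0 < c & forall x y, X x -> X y -> x < y ->
     exists a b, [/\ gap X a b, x <= a, b <= y & c * (y - x) <= b - a] &
  exists N : nat, forall n (l : seq (R * R)), uniq l ->
    (forall g, g \in l -> gap X g.1 g.2 /\ dy n.+1 <= g.2 - g.1 < dy n) ->
    (size l <= N)%N].

(** Removing one element satisfying [P] lowers the bound, hence the induction on [N]. It turns the
    bound on numbers of gaps into actual finite lists of gaps. *)
Lemma bounded_list (T : eqType) (P : T -> Prop) (N : nat) :
  (forall l : seq T, uniq l -> (forall x, x \in l -> P x) -> (size l <= N)%N) ->
  exists l : seq T, [/\ uniq l, (size l <= N)%N & forall x, x \in l <-> P x].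
Proof.
elim: N P => [|N IH] P h.
  exists [::]; split => // x; split => // Px.
  by have := h [:: x] erefl; rewrite /= => /(_ _)/negP; case=> // y; rewrite inE => /eqP->.
case: (pselect (exists x, P x)) => [[x Px]|np]; last first.
  by exists [::]; split=> // x; split => // Px; case: np; exists x.
have [l [ul sl hl]] : exists l : seq T, [/\ uniq l, (size l <= N)%N & forall y, y \in l <-> P y /\ y != x].
  apply: IH => l ul hl; have := h (x :: l); rewrite /= ltnS; apply.
    by rewrite ul andbT; apply/negP => /hl[_]; rewrite eqxx.
  by move=> y; rewrite inE => /orP[/eqP->//|/hl[]].
exists (x :: l); split => //=.
  by rewrite ul andbT; apply/negP => /hl[_]; rewrite eqxx.
move=> y; rewrite inE; split=> [/orP[/eqP->//|/hl[]//]|Py].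
by case: eqVneq => //= yx; apply/hl.
Qed.

Lemma gap_lists X : thin X -> exists (N : nat) (G : nat -> seq (R * R)),
  [/\ forall n, (size (G n) <= N)%N, forall n, uniq (G n) &
   forall n g, g \in G n <-> gap X g.1 g.2 /\ dy n.+1 <= g.2 - g.1 < dy n].
Proof.
move=> [_ _ _ [N hN]]; exists N.
have h n := bounded_list (hN n).
have [G hG] := choice h.
by exists G; split=> n; case: (hG n).
Qed.

End Thin.

Section AbsoluteValue.
Variables (R : realType) (K : fieldType) (nK : K -> R).

(** Treats the real and the complex field at once. Completeness is stated for sequences with
    geometrically small increments, rate of convergence included, which is the form in which
    infinite products need it. *)
Record absval : Prop := AbsVal {
  avM : forall x y, nK (x * y) = nK x * nK y;
  avD : forall x y, nK (x + y) <= nK x + nK y;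
  avN : forall x, nK (- x) = nK x;
  av0 : nK 0 = 0;
  av1 : nK 1 = 1;
  av_eq0 : forall x, nK x = 0 -> x = 0;
  av_ge0 : forall x, 0 <= nK x;
  av_complete : forall (u : nat -> K) (C r : R), 0 <= r -> r < 1 ->
    (forall n, nK (u n.+1 - u n) <= C * r ^+ n) ->
    exists l, forall n, nK (u n - l) <= C * r ^+ n / (1 - r) }.

Hypothesis aK : absval.

Lemma av_sub x y : nK (x - y) = nK (y - x).
Proof. by rewrite -(avN aK) opprB. Qed.

Lemma av_tri x y z : nK (x - z) <= nK (x - y) + nK (y - z).
Proof. by apply: le_trans _ (avD aK _ _); rewrite addrA subrK. Qed.

(** Induction on the list: if [t] is the deviation of the first factor and the rest is within [2 S]
    of 1, with [t + S] at most 1/2, the cross term is at most [t]. *)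
Lemma av_prod_near1 (T : eqType) (s : seq T) (p : pred T) (c : T -> K) (S : R) :
  \sum_(g <- s | p g) nK (c g - 1) <= S -> S <= 1/2 ->
  nK (\prod_(g <- s | p g) c g - 1) <= 2 * S.
Proof.
move=> h S2; apply: le_trans (_ : 2 * \sum_(g <- s | p g) nK (c g - 1) <= _); last by lra.
have {S S2 h} := le_trans h S2.
elim: s => [|g s IH]; first by rewrite !big_nil subrr (av0 aK) mulr0.
rewrite !big_cons; case: ifP => // _.
set t := nK _; set S := \sum_(_ <- _ | _) _; set P := \prod_(_ <- _ | _) _.
have t0 : 0 <= t by apply: av_ge0.
have S0 : 0 <= S by apply: sumr_ge0 => i _; apply: av_ge0.
move=> tS; have {}IH : nK (P - 1) <= 2 * S by apply: IH; rewrite -/S; lra.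
have -> : c g * P - 1 = (c g - 1) * (P - 1) + (c g - 1) + (P - 1) by ring.
apply: le_trans (avD aK _ _) _; apply: le_trans (lerD (avD aK _ _) (lexx _)) _.
rewrite (avM aK) -/t; have : t * nK (P - 1) <= t * 1 by rewrite ler_wpM2l //; lra.
lra.
Qed.

(** The induction measure for splitting an interval at a gap [g]: the gaps on its left and on its
    right are disjoint families inside the original one, and both miss [g]. *)
Lemma count_split (T : eqType) (l : seq T) (p1 p2 p : pred T) g :
  (forall x, p1 x -> p x) -> (forall x, p2 x -> p x) -> (forall x, p1 x -> ~~ p2 x) ->
  g \in l -> p g -> ~~ p1 g -> ~~ p2 g -> (count p1 l + count p2 l < count p l)%N.
Proof.
move=> h1 h2 h12 gl pg n1 n2.
have e0 (q1 q2 : pred T) : (forall x, q1 x -> ~~ q2 x) ->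
    (count q1 l + count q2 l = count (predU q1 q2) l)%N.
  move=> q12; rewrite -count_predUI (_ : count (predI q1 q2) l = 0)%N ?addn0 //.
  apply/eqP; rewrite -leqn0 leqNgt -has_count; apply/hasPn => x _ /=.
  by apply/negP => /andP[/q12/negP].
have lt0 : (0 < count (pred1 g) l)%N by rewrite -has_count; apply/hasP; exists g => /=.
rewrite -addn1; apply: leq_trans (leq_add (leqnn _) lt0) _.
rewrite e0 // e0; last first.
  move=> x /=; apply: contraTN => /eqP ->; by rewrite negb_or n1.
by apply: sub_count => x /= /orP[/orP[/h1|/h2]|/eqP->].
Qed.

(* Split at the gaps of size [>= dy n]: their number grows linearly in [n] while the pieces left
   have length [O(dy n)] by porosity. *)
Lemma holder_gap_const (X : set R) (f : R -> K) (C nu x0 y0 : R) :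
  thin X -> 0 < nu -> X x0 -> X y0 -> x0 <= y0 ->
  (forall s t, X s -> X t -> x0 <= s -> s <= t -> t <= y0 ->
     nK (f s - f t) <= C * powR `|s - t| nu) ->
  (forall a b, gap X a b -> x0 <= a -> b <= y0 -> f a = f b) ->
  f x0 = f y0.
Proof.
move=> tX nu0 Xx0 Xy0 xy0 hf gf.
have [N [G [sG _ mG]]] := gap_lists tX.
have [X01 _ [c c0 por] _] := tX.
pose H n := flatten [seq G k | k <- iota 0 n].
have sH n : (size (H n) <= N * n)%N.
  rewrite /H; elim: n => [|n IH]; first by rewrite muln0.
  rewrite -addn1 iotaD map_cat flatten_cat size_cat mulnDr muln1 leq_add //= cats0.
  exact: sG.
have mH n a b : gap X a b -> dy R n <= b - a -> (a, b) \in H n.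
  move=> gab dn; have [Xa Xb ab _] := gab.
  have [//||k /andP[k1 k2]] := @dy_scale _ (b - a); first by rewrite subr_gt0.
    by have := X01 _ Xa; have := X01 _ Xb; lra.
  apply/flattenP; exists (G k); last by apply/mG; rewrite /= k1 k2.
  apply: map_f; rewrite mem_iota /= add0n ltnNge; apply/negP => nk.
  by have := dy_le R nk; lra.
pose cnt n x y := count (fun g : R * R => [&& x <= g.1, g.1 < g.2 & g.2 <= y]) (H n).
have C0 x y : X x -> X y -> x0 <= x -> x < y -> y <= y0 -> 0 <= C.
  move=> Xx Xy x0x xy yy0; have h := hf _ _ Xx Xy x0x (ltW xy) yy0.
  have p : 0 < powR `|x - y| nu by rewrite powR_gt0 // normr_gt0 subr_eq0 lt_eqF.
  by rewrite -(pmulr_lge0 _ p); apply: le_trans h; apply: av_ge0.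
case: (ltgtP x0 y0) xy0 => // [xy0 _|-> //]; last first.
have {}C0 := C0 _ _ Xx0 Xy0 (lexx _) xy0 (lexx _).
(* [m] is the fuel of an induction on the number of listed gaps. If the gap given by porosity is
   shorter than [dy n], the whole interval is shorter than [dy n / c] and the Hoelder bound applies
   directly. *)
have main n m : forall x y, X x -> X y -> x0 <= x -> x <= y -> y <= y0 -> (cnt n x y < m)%N ->
    nK (f x - f y) <= (cnt n x y).+1%:R * (C * powR (dy R n / c) nu).
  have D0 : 0 <= C * powR (dy R n / c) nu by rewrite mulr_ge0 // powR_ge0.
  elim: m => [|m IH] // x y Xx Xy x0x xy yy0 hc.
  move: xy; rewrite le_eqVlt => /orP[/eqP->|xy]; first by rewrite subrr (av0 aK) mulr_ge0.
  have [a [b [gab xa yb cab]]] := por _ _ Xx Xy xy.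
  case: (ltP (b - a) (dy R n)) => [small|big].
  - apply: le_trans (hf _ _ Xx Xy x0x (ltW xy) yy0) _.
    apply: le_trans (_ : C * powR (dy R n / c) nu <= _).
      apply: ler_wpM2l => //; apply: ge0_ler_powR; rewrite ?nnegrE ?(ltW nu0) ?normr_ge0 //.
        by rewrite divr_ge0 // ltW // dy_gt0.
      rewrite ler_pdivlMr // ltr0_norm ?subr_lt0 // opprB mulrC; lra.
    by rewrite ler_peMl // ler1n.
  - have [Xa Xb ab _] := gab.
    have hcc : (cnt n x a + cnt n b y < cnt n x y)%N.
      apply: (@count_split _ _ _ _ _ (a, b)); rewrite /= ?xa ?yb ?ab //.
      - by move=> g /and3P[-> -> /= h]; lra.
      - by move=> g /and3P[h -> ->]; rewrite !andbT; lra.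
      - move=> g /and3P[h1 h2 h3]; apply/negP => /and3P[h4 _ h5]; lra.
      - exact: mH.
      - by rewrite -ltNge.
      - by rewrite leNgt ab.
    have c1 : (cnt n x a < m)%N by rewrite -ltnS; apply: leq_ltn_trans (leq_trans _ hcc) hc; rewrite ltnS leq_addr.
    have c2 : (cnt n b y < m)%N by rewrite -ltnS; apply: leq_ltn_trans (leq_trans _ hcc) hc; rewrite ltnS leq_addl.
    have i1 := IH _ _ Xx Xa x0x xa (ltac:(lra)) c1.
    have i2 := IH _ _ Xb Xy (ltac:(lra)) yb yy0 c2.
    apply: le_trans (av_tri _ (f a) _) _; rewrite (gf a b) // in i1 *; try lra.
    apply: le_trans (lerD i1 i2) _; rewrite -mulrDl -natrD ler_wpM2r // ler_nat addSn addnS.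
    by rewrite ltnS.
apply/eqP; rewrite -subr_eq0; apply/eqP/(av_eq0 aK).
(* At most [N * n] gaps are listed, so the error is of order [n r^n], with [r] the power [nu] of
   1/2. *)
apply: (@ler_eq0_geom _ _ (N%:R * (C * powR c^-1 nu)) (C * powR c^-1 nu) (powR 2^-1 nu)).
- exact: av_ge0.
- exact: powR_ge0.
- exact: powR_half_lt1.
move=> n; apply: le_trans (main n _ _ _ Xx0 Xy0 (lexx _) (ltW xy0) (lexx _) (ltnSn _)) _.
rewrite powRM ?invr_ge0 ?(ltW c0) ?(ltW (dy_gt0 _ _)) // powR_dy.
have -> : (N%:R * (C * powR c^-1 nu) * n%:R + C * powR c^-1 nu) * powR 2^-1 nu ^+ n =
  (N * n).+1%:R * (C * (powR 2^-1 nu ^+ n * powR c^-1 nu)).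
  by rewrite -[(N * n).+1%:R]natr1 natrM; ring.
rewrite ler_wpM2r //; last by rewrite ler_nat ltnS; apply: leq_trans (count_size _ _) (sH n).
by rewrite !mulr_ge0 ?exprn_ge0 ?powR_ge0.
Qed.
End AbsoluteValue.

(** * Products over gaps *)

Section GapProduct.
Variables (R : realType) (K : fieldType) (nK : K -> R).
Hypothesis aK : absval nK.

(* [d x] is the product of [c a b] over all gaps [(a,b)] of [X] in [[u,x]]. *)
Lemma gap_product (X : set R) (C nu : R) :
  thin X -> 0 < nu -> 0 <= C ->
  exists m : nat, forall (c : R -> R -> K) (u v : R), v - u < dy R m ->
  (forall a b, gap X a b -> u <= a -> b <= v -> nK (c a b - 1) <= C * powR (b - a) nu) ->
  exists (d : R -> K) (C' : R),
   [/\ 0 <= C', forall x, X x -> u <= x <= v -> 1/2 <= nK (d x) <= 3/2,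
    forall a b, gap X a b -> u <= a -> b <= v -> d b = c a b * d a &
    forall x y, X x -> X y -> u <= x <= v -> u <= y <= v ->
      nK (d x - d y) <= C' * powR `|x - y| nu].
Proof.
move=> tX nu0 C0.
have [N [G [sG uG mG]]] := gap_lists tX.
pose r := powR (2^-1 : R) nu.
have r0 : 0 <= r by apply: powR_ge0.
have r1 : r < 1 by apply: powR_half_lt1.
have rE k : powR (dy R k) nu = r ^+ k by rewrite powR_dy.
have rle m n : (m <= n)%N -> r ^+ n <= r ^+ m by move=> h; rewrite ler_wiXn2l // ltW.
pose E := N%:R * C; have E0 : 0 <= E by rewrite mulr_ge0.
have s0 : 0 < 1 - r by rewrite subr_gt0.
(* Tail of a geometric series: the gaps of all levels from [k] on contribute at most [S k]. *)
pose S k := E * r ^+ k / (1 - r).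
have S0 k : 0 <= S k by rewrite /S !mulr_ge0 ?exprn_ge0 ?invr_ge0 ?(ltW s0).
have SS k : S k = E * r ^+ k + S k.+1.
  rewrite /S exprS; field; by rewrite gt_eqF.
have Sle m n : (m <= n)%N -> S n <= S m.
  by move=> h; rewrite /S ler_wpM2r ?invr_ge0 ?(ltW s0) // ler_wpM2l // rle.
(* With [S m] at most 1/4 every partial product stays within 1/2 of 1, hence away from 0. The choice
   is made before [c], [u] and [v] are given. *)
have [m hm1] : exists m, S m <= 1/4.
  have E1 : 0 < E + 1 by lra.
  have e0 : 0 < (1/4) * ((1 - r) / (E + 1)) by rewrite mulr_gt0 ?divr_gt0.
  have [m h1] := expr_small r0 r1 e0; exists m.
  rewrite /S ler_pdivrMr //; move: h1; rewrite mulrA ltr_pdivlMr //.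
  have := exprn_ge0 m r0; move: (r ^+ m) => q; nra.
exists m => c u v uv hc.
pose H n := flatten [seq G k | k <- iota 0 n].
have HS n : H n.+1 = H n ++ G n.
  by rewrite /H -addn1 iotaD map_cat flatten_cat /= cats0.
have mH n g : g \in H n -> exists2 k, (k < n)%N & g \in G k.
  by move=> /flattenP[l /mapP[k]]; rewrite mem_iota /= add0n => kn -> gk; exists k.
have uH n : uniq (H n).
  elim: n => // n IH; rewrite HS cat_uniq IH uG andbT /=.
  apply/hasPn => g gn; apply/negP => /mH[k kn gk].
  have /mG[_ /andP[_ h1]] := gn; have /mG[_ /andP[h2 _]] := gk.
  by have := dy_le R kn; lra.
pose cc (g : R * R) := c g.1 g.2.
pose pr n (p : pred (R * R)) := \prod_(g <- H n | p g) cc g.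
have hG k (p : pred (R * R)) : (forall g, p g -> u <= g.1 /\ g.2 <= v) ->
    \sum_(g <- G k | p g) nK (cc g - 1) <= E * r ^+ k.
  move=> pu; rewrite big_seq_cond.
  apply: le_trans (_ : \sum_(g <- G k | (g \in G k) && p g) C * r ^+ k <= _).
    apply: ler_sum => g /andP[/mG[gg /andP[_ g2]] /pu[h1 h2]].
    apply: le_trans (hc _ _ gg h1 h2) _; rewrite -rE ler_wpM2l //.
    have [_ _ lt _] := gg.
    apply: ge0_ler_powR; rewrite ?nnegrE ?(ltW nu0) ?(ltW g2) ?(ltW (dy_gt0 _ _)) //; lra.
  rewrite -big_seq_cond big_const_seq iter_addr addr0 -mulr_natl mulrA.
  apply: ler_wpM2r; first by rewrite exprn_ge0.
  by apply: ler_wpM2r => //; rewrite ler_nat; apply: leq_trans (count_size _ _) (sG k).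
have hH n k (p : pred (R * R)) : (forall g, p g -> u <= g.1 /\ g.2 <= v) ->
    (forall l g, g \in G l -> p g -> (k <= l)%N) ->
    \sum_(g <- H n | p g) nK (cc g - 1) <= S k.
  move=> pu pk.
  have : \sum_(g <- H n | p g) nK (cc g - 1) <= S k - S (maxn k n).
    elim: n => [|n IH]; first by rewrite big_nil maxn0 subrr.
    rewrite HS big_cat /=; case: (leqP k n) => kn.
      have kn1 : (k <= n.+1)%N by apply: leqW.
      move: IH; rewrite (maxn_idPr kn) (maxn_idPr kn1) (SS n) => IH.
      by have := hG n _ pu; lra.
    rewrite (maxn_idPl kn); move: IH; rewrite (maxn_idPl (ltnW kn)) => IH.
    rewrite [X in _ + X]big_seq_cond [X in _ + X]big1 ?addr0 // => g /andP[g1 g2].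
    by have := pk _ _ g1 g2; rewrite leqNgt kn.
  move=> /le_trans; apply; have := S0 (maxn k n); lra.
pose pre x : pred (R * R) := fun g => [&& u <= g.1, g.1 < g.2 & g.2 <= x].
pose btw x y : pred (R * R) := fun g => [&& x <= g.1, g.1 < g.2 & g.2 <= y].
(* A gap inside [[u,v]] is shorter than [dy m], so only levels from [m] on occur. *)
have hm l g : g \in G l -> u <= g.1 -> g.2 <= v -> (m <= l)%N.
  move=> /mG[_ /andP[h1 _]] h2 h3; rewrite leqNgt; apply/negP => lm.
  by have := dy_le R lm; lra.
pose dn n x := pr n (pre x).
have pre_uv x : x <= v -> forall g, pre x g -> u <= g.1 /\ g.2 <= v.
  by move=> xv g /and3P[h1 h2 h3]; split=> //; lra.
have btw_uv x y : u <= x -> y <= v -> forall g, btw x y g -> u <= g.1 /\ g.2 <= v.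
  by move=> xv yv g /and3P[h1 h2 h3]; split=> //; lra.
have dn1 n x : x <= v -> nK (dn n x - 1) <= 1/2.
  move=> xv; have /= h := hH n m _ (pre_uv x xv) (fun l g gl pg => hm l g gl (pre_uv _ xv _ pg).1 (pre_uv _ xv _ pg).2).
  apply: le_trans (av_prod_near1 aK h _) _; lra.
have dnle n x : x <= v -> nK (dn n x) <= 3/2.
  move=> xv; have := dn1 n x xv; have := avD aK (dn n x - 1) 1.
  by rewrite subrK (av1 aK); lra.
have dnS n x : x <= v -> nK (dn n.+1 x - dn n x) <= 3 * E * r ^+ n.
  move=> xv; have er : 0 <= E * r ^+ n by rewrite mulr_ge0 // exprn_ge0.
  rewrite /dn /pr HS big_cat /= -/(pr n _) -/(dn n x).
  case: (leqP m n) => mn; last first.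
    rewrite big_seq_cond [X in _ * X]big1 ?mulr1 ?subrr ?(av0 aK); first lra.
    move=> g /andP[g1 g2]; have := hm _ _ g1 (pre_uv _ xv _ g2).1 (pre_uv _ xv _ g2).2.
    by rewrite leqNgt mn.
  rewrite -[X in _ - X]mulr1 -mulrBr (avM aK).
  have h := av_prod_near1 aK (hG n _ (pre_uv x xv)).
  have h' : nK (\prod_(i <- G n | pre x i) cc i - 1) <= 2 * (E * r ^+ n).
    apply: h; have := Sle _ _ mn; rewrite (SS n); have := S0 n.+1; lra.
  apply: le_trans (_ : 3 / 2 * (2 * (E * r ^+ n)) <= _); last lra.
  by apply: ler_pM => //; rewrite ?av_ge0 // dnle.
have [d hd] : exists d : R -> K, forall x, x <= v -> forall n, nK (dn n x - d x) <= 3 * E * r ^+ n / (1 - r).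
  have h x : exists l, x <= v -> forall n, nK (dn n x - l) <= 3 * E * r ^+ n / (1 - r).
    case: (leP x v) => xv; last by exists 0.
    have [l hl] := av_complete aK r0 r1 (fun n => dnS n x xv).
    by exists l.
  by have [d hd] := choice h; exists d.
have lim0 (z : K) (B : R) : (forall n, nK z <= B * r ^+ n) -> z = 0.
  move=> h; apply: (av_eq0 aK); apply: (@ler_eq0_geom _ _ 0 B r) => //; first exact: av_ge0.
  by move=> n; rewrite mul0r add0r.
have limle (z : K) (b B : R) : (forall n, nK z <= b + B * r ^+ n) -> nK z <= b.
  move=> h; rewrite -subr_le0 leNgt; apply/negP => hp.
  have e : nK z - b = 0.
    apply: (@ler_eq0_geom _ _ 0 B r) => //; first exact: ltW.
    by move=> n; rewrite mul0r add0r lerBlDl.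
  by rewrite e ltxx in hp.
have d1 x : x <= v -> nK (d x - 1) <= 1/2.
  move=> xv; apply: (limle _ _ (3 * E / (1 - r))) => n.
  apply: le_trans (av_tri aK _ (dn n x) _) _; rewrite addrC; apply: lerD; first exact: dn1.
  rewrite (av_sub aK); apply: le_trans (hd _ xv n) _.
  by rewrite le_eqVlt; apply/orP; left; apply/eqP; ring.
have dle x : x <= v -> nK (d x) <= 3/2.
  move=> xv; have := d1 x xv; have := avD aK (d x - 1) 1.
  by rewrite subrK (av1 aK); lra.
have dspl n x y : X x -> u <= x -> x <= y -> dn n y = dn n x * pr n (btw x y).
  move=> Xx ux xy; rewrite /dn /pr.
  rewrite (bigID (pre x)) /=; congr (_ * _).
    apply: eq_bigl => g; rewrite /pre; apply/andP/idP => [[_ //]|/and3P[h1 h2 h3]].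
    by rewrite h1 h2 h3 (le_trans h3 xy).
  rewrite big_seq_cond [RHS]big_seq_cond; apply: eq_bigl => g.
  case gH: (g \in H n) => //=; have [k _ /mG[[_ _ lt ng] _]] := mH _ _ gH.
  rewrite /pre /btw lt /=; apply/idP/idP.
    move=> /andP[/andP[h1 h2]]; rewrite h1 h2 /= -ltNge => h3; rewrite andbT leNgt.
    by apply/negP => h4; have := ng _ Xx; rewrite h4 h3.
  move=> /andP[h1 h2]; rewrite (le_trans ux h1) h2 /= -ltNge; lra.
(* [d y] arises from [d x] by the factors of the gaps between [x] and [y] alone. *)
have duple x y : X x -> u <= x -> x <= y -> y <= v -> forall k, (forall l g, g \in G l -> btw x y g -> (k <= l)%N) ->
   S k <= 1/2 -> nK (d y - d x) <= 3 * S k.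
  move=> Xx ux xy yv k hk Sk; apply: (limle _ _ (3 * E / (1 - r) * 2)) => n.
  apply: le_trans (av_tri aK _ (dn n y) _) _.
  apply: le_trans (lerD (lexx _) (av_tri aK _ (dn n x) _)) _.
  have xv := le_trans xy yv; have h1 := hd _ yv n; have h2 := hd _ xv n.
  rewrite (av_sub aK) addrA; apply: le_trans (_ : nK (dn n y - dn n x) + (3 * E * r ^+ n / (1 - r) * 2) <= _).
    by lra.
  apply: lerD; last by rewrite le_eqVlt; apply/orP; left; apply/eqP; ring.
  rewrite (dspl n x y) // -[X in _ - X]mulr1 -mulrBr (avM aK).
  have h := av_prod_near1 aK (hH n k _ (btw_uv x y ux yv) hk) Sk.
  apply: le_trans (_ : 3 / 2 * (2 * S k) <= _); last lra.
  by apply: ler_pM => //; rewrite ?av_ge0 // dnle.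
(* Let [k] be the dyadic level of [y - x]. Gaps between [x] and [y] have level at least [k], so
   their effect is bounded by a multiple of [S k], which is of order [(y - x)^nu]. *)
have hold x y : X x -> X y -> u <= x -> x <= y -> y <= v ->
    nK (d x - d y) <= 3 * E / (1 - r) / r * powR `|x - y| nu.
  move=> Xx Xy ux; rewrite le_eqVlt => /orP[/eqP-> yv|xy yv].
    rewrite subrr (av0 aK) mulr_ge0 ?powR_ge0 //.
    by rewrite !mulr_ge0 ?invr_ge0 // ltW.
  have [X01 _ _ _] := tX.
  have [||k /andP[k1 k2]] := @dy_scale _ (y - x); first by rewrite subr_gt0.
    by have := X01 _ Xx; have := X01 _ Xy; lra.
  have mk : (m <= k)%N.
    by rewrite leqNgt; apply/negP => km; have := dy_le R km; lra.
  rewrite (av_sub aK).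
  apply: le_trans (duple x y Xx ux (ltW xy) yv k _ _) _.
  - move=> l g /mG[_ /andP[h1 h2]] /and3P[h3 h4 h5]; rewrite leqNgt; apply/negP => lk.
    by have := dy_le R lk; lra.
  - by have := Sle _ _ mk; lra.
  have rp : 0 < r by rewrite powR_gt0 // invr_gt0 ltr0n.
  have -> : 3 * S k = 3 * E / (1 - r) / r * r ^+ k.+1.
    by rewrite /S exprS; field; rewrite !gt_eqF.
  apply: ler_wpM2l; first by rewrite !mulr_ge0 ?invr_ge0 // ltW.
  rewrite -rE; apply: ge0_ler_powR; rewrite ?nnegrE ?(ltW nu0) ?(ltW (dy_gt0 _ _)) ?normr_ge0 //.
  by rewrite ltr0_norm ?subr_lt0 // opprB.
exists d, (3 * E / (1 - r) / r); split.
- by rewrite !mulr_ge0 ?invr_ge0 // ltW.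
- move=> x Xx /andP[ux xv]; rewrite dle // andbT.
  have := d1 x xv; have := avD aK (1 - d x) (d x); rewrite subrK (av1 aK) (av_sub aK); lra.
- move=> a b gab ua bv; have [Xa Xb ab ng] := gab.
  have av : a <= v by lra.
  have [X01 _ _ _] := tX.
  have [||k k12] := @dy_scale _ (b - a); first by rewrite subr_gt0.
    by have := X01 _ Xa; have := X01 _ Xb; lra.
  have gk : (a, b) \in G k by apply/mG.
  (* [(a,b)] is the only gap within [[a,b]], and it is listed as soon as [n] exceeds its level
     [k]. *)
  have eqn n : (k < n)%N -> dn n b = c a b * dn n a.
    move=> kn; rewrite (dspl n a b) // ?(ltW ab) // mulrC; congr (_ * _).
    have gH : (a, b) \in H n.
      by apply/flattenP; exists (G k) => //; apply: map_f; rewrite mem_iota.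
    rewrite /pr -big_filter (bigD1_seq (a, b)) ?filter_uniq ?uH //=; last first.
      by rewrite mem_filter gH /btw /= !lexx ab.
    rewrite big_seq_cond big1 ?mulr1 // => g /andP[]; rewrite mem_filter => /andP[h1].
    move=> /mH[l _ /mG[[g1 g2 g3 g4] _]] h2.
    case/negP: h2; move: h1 => /and3P[h1 _ h2].
    have e1 : g.1 = a.
      by apply/eqP; rewrite eq_le h1 andbT leNgt; apply/negP => h; have := ng _ g1; rewrite h /= => /negP; apply; lra.
    have e2 : g.2 = b.
      by apply/eqP; rewrite eq_le h2 /= leNgt; apply/negP => h; have := ng _ g2; rewrite h /= andbT => /negP; apply; lra.
    by rewrite -e1 -e2 -surjective_pairing.
  apply/eqP; rewrite -subr_eq0; apply/eqP.
  apply: (lim0 _ ((1 + nK (c a b)) * (3 * E / (1 - r)) / r ^+ k.+1)) => n.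
  have h1 := hd _ bv (k.+1 + n)%N; have h2 := hd _ av (k.+1 + n)%N.
  have e := eqn (k.+1 + n)%N (leq_addr _ _).
  have -> : d b - c a b * d a = (d b - dn (k.+1 + n)%N b) + c a b * (dn (k.+1 + n)%N a - d a).
    by rewrite e; ring.
  apply: le_trans (avD aK _ _) _; rewrite (avM aK) (av_sub aK).
  have rp : 0 < r by rewrite powR_gt0 // invr_gt0 ltr0n.
  apply: le_trans (_ : (1 + nK (c a b)) * (3 * E * r ^+ (k.+1 + n) / (1 - r)) <= _).
    rewrite mulrDl mul1r; apply: lerD => //; apply: ler_wpM2l => //; exact: av_ge0.
  have z0 : 0 <= 3 * E * r ^+ n / (1 - r) by rewrite !mulr_ge0 ?exprn_ge0 ?invr_ge0 ?(ltW s0).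
  have -> : (1 + nK (c a b)) * (3 * E / (1 - r)) / r ^+ k.+1 * r ^+ n = (1 + nK (c a b)) * (3 * E * r ^+ n / (1 - r)) / r ^+ k.+1 by ring.
  have c0 : 0 <= 1 + nK (c a b) by have := av_ge0 aK (c a b); lra.
  rewrite -[X in _ <= X]mulrA; apply: ler_wpM2l => //.
  rewrite ler_pdivlMr ?exprn_gt0 // exprD.
  have rk1 : r ^+ k.+1 <= 1 by rewrite exprn_ile1 // ltW.
  have rk0 : 0 <= r ^+ k.+1 by rewrite exprn_ge0.
  have -> : 3 * E * (r ^+ k.+1 * r ^+ n) / (1 - r) * r ^+ k.+1 = 3 * E * r ^+ n / (1 - r) * (r ^+ k.+1 * r ^+ k.+1) by ring.
  apply: ler_piMr => //; nra.
- move=> x y Xx Xy /andP[ux xv] /andP[uy yv].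
  have [xy|yx] := leP x y; first exact: hold.
  by rewrite (av_sub aK) distrC; apply: hold => //; apply: ltW.
Qed.

End GapProduct.

(** * Algebra of Hoelder functions *)

Section Hoelder.
Variables (R : realType) (K : fieldType) (nK : K -> R).
Hypothesis aK : absval nK.
Implicit Types (Y : set R) (f g : R -> K).

Definition hol Y f := exists C nu : R, [/\ 0 <= C, 0 < nu &
  forall s t, Y s -> Y t -> nK (f s - f t) <= C * powR `|s - t| nu].

Definition in01 Y := forall s, Y s -> 0 <= s < 1.

Lemma powR_exp_le (x nu mu : R) : 0 <= x -> x <= 1 -> 0 < mu -> mu <= nu -> powR x nu <= powR x mu.
Proof.
move=> x0 x1 m0 mn; move: x0; rewrite le_eqVlt => /orP[/eqP<-|x0].
  by rewrite !powR0 // gt_eqF // (lt_le_trans m0).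
rewrite -[nu](subrK mu) powRD; last by apply/implyP => _; rewrite gt_eqF.
apply: ler_piMl; rewrite ?powR_ge0 //.
have -> : 1 = powR 1 (nu - mu) by rewrite powR1.
by apply: ge0_ler_powR; rewrite ?nnegrE ?subr_ge0 ?ler01 ?(ltW x0).
Qed.

(** Distances in the unit interval are at most 1, so exponents may be lowered; this lets functions
    with different exponents be combined. *)
Lemma hol_exp Y f : in01 Y -> hol Y f -> exists C nu : R, [/\ 0 <= C, 0 < nu &
  forall mu, 0 < mu -> mu <= nu -> forall s t, Y s -> Y t -> nK (f s - f t) <= C * powR `|s - t| mu].
Proof.
move=> Y01 [C [nu [C0 n0 h]]]; exists C, nu; split=> // mu m0 mn s t Ys Yt.
apply: le_trans (h _ _ Ys Yt) _; apply: ler_wpM2l => //; apply: powR_exp_le => //.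
by have := Y01 _ Ys; have := Y01 _ Yt; case: (lerP s t); lra.
Qed.

Lemma hol_sub Y Y' f : (forall s, Y' s -> Y s) -> hol Y f -> hol Y' f.
Proof.
move=> sub [C [nu [C0 n0 h]]]; exists C, nu; split=> // s t /sub Ys /sub Yt; exact: h.
Qed.

Lemma hol_ext Y f g : (forall s, Y s -> f s = g s) -> hol Y f -> hol Y g.
Proof.
move=> e [C [nu [C0 n0 h]]]; exists C, nu; split=> // s t Ys Yt.
by rewrite -!e //; apply: h.
Qed.

Lemma hol_cst Y (c : K) : hol Y (fun=> c).
Proof. by exists 0, 1; split=> // s t _ _; rewrite subrr (av0 aK) mul0r. Qed.

Lemma hol_bounded Y f : in01 Y -> hol Y f -> exists2 B, 0 <= B & forall s, Y s -> nK (f s) <= B.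
Proof.
move=> Y01 [C [nu [C0 n0 h]]].
case: (pselect (exists s, Y s)) => [[s0 Y0]|nY]; last first.
  by exists 0 => // s Ys; case: nY; exists s.
exists (C + nK (f s0)) => [|s Ys]; first by rewrite addr_ge0 // av_ge0.
rewrite -[X in nK X](subrK (f s0)); apply: le_trans (avD aK _ _) _; rewrite lerD2r.
apply: le_trans (h _ _ Ys Y0) _; apply: ler_piMr => //.
have -> : 1 = powR 1 nu by rewrite powR1.
apply: ge0_ler_powR; rewrite ?nnegrE ?ler01 ?(ltW n0) //.
by have := Y01 _ Ys; have := Y01 _ Y0; case: (lerP s s0); lra.
Qed.

Lemma holD Y f g : in01 Y -> hol Y f -> hol Y g -> hol Y (fun s => f s + g s).
Proof.
move=> Y01 /(hol_exp Y01)[C [nu [C0 n0 h]]] /(hol_exp Y01)[C' [nu' [C0' n0' h']]].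
exists (C + C'), (Num.min nu nu'); split; [by rewrite addr_ge0|by rewrite lt_min n0|].
move=> s t Ys Yt; rewrite opprD addrACA mulrDl.
apply: le_trans (avD aK _ _) _; apply: lerD.
  by apply: h => //; [rewrite lt_min n0|rewrite ge_min lexx].
by apply: h' => //; [rewrite lt_min n0|rewrite ge_min lexx orbT].
Qed.

Lemma holM Y f g : in01 Y -> hol Y f -> hol Y g -> hol Y (fun s => f s * g s).
Proof.
move=> Y01 hf hg; have [B B0 hB] := hol_bounded Y01 hf; have [B' B0' hB'] := hol_bounded Y01 hg.
move: hf hg => /(hol_exp Y01)[C [nu [C0 n0 h]]] /(hol_exp Y01)[C' [nu' [C0' n0' h']]].
exists (C * B' + B * C'), (Num.min nu nu').
split; [by rewrite addr_ge0 // mulr_ge0|by rewrite lt_min n0|].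
move=> s t Ys Yt.
have -> : f s * g s - f t * g t = (f s - f t) * g s + f t * (g s - g t) by ring.
apply: le_trans (avD aK _ _) _; rewrite !(avM aK) mulrDl; apply: lerD.
  rewrite mulrAC; apply: ler_pM; rewrite ?av_ge0 ?hB' //.
  by apply: h => //; [rewrite lt_min n0|rewrite ge_min lexx].
rewrite -mulrA; apply: ler_pM; rewrite ?av_ge0 ?hB //.
by apply: h' => //; [rewrite lt_min n0|rewrite ge_min lexx orbT].
Qed.

Lemma holN Y f : hol Y f -> hol Y (fun s => - f s).
Proof.
move=> [C [nu [C0 n0 h]]]; exists C, nu; split=> // s t Ys Yt.
by rewrite -opprD (avN aK) h.
Qed.

Lemma hol_inv Y f (c : R) : 0 < c -> (forall s, Y s -> c <= nK (f s)) -> hol Y f ->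
  hol Y (fun s => (f s)^-1).
Proof.
move=> c0 hc [C [nu [C0 n0 h]]]; exists (C / c ^+ 2), nu; split=> //.
  by rewrite divr_ge0 // sqr_ge0.
move=> s t Ys Yt.
have ne s' : Y s' -> f s' != 0.
  by move=> /hc h'; apply/eqP => e; move: h'; rewrite e (av0 aK) leNgt c0.
have -> : (f s)^-1 - (f t)^-1 = (f t - f s) * ((f s)^-1 * (f t)^-1).
  by field; rewrite !ne.
have inv s' : Y s' -> nK (f s')^-1 <= c^-1.
  move=> Ys'; have e : nK (f s') * nK (f s')^-1 = 1 by rewrite -(avM aK) divff ?ne // (av1 aK).
  have := hc _ Ys'; have := av_ge0 aK (f s')^-1; move: e.
  move: (nK _) (nK _) => a b e b0 ca.
  by rewrite -[c^-1]mul1r -e ler_pdivlMr // mulrC ler_wpM2r.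
rewrite !(avM aK) (av_sub aK) mulrAC; apply: ler_pM; first exact: av_ge0.
- by rewrite mulr_ge0 // av_ge0.
- exact: h.
by rewrite expr2 invfM; apply: ler_pM; rewrite ?av_ge0 ?inv.
Qed.

Lemma hol_sum Y (I : Type) (r : seq I) (P : pred I) (F : I -> R -> K) : in01 Y ->
  (forall i, hol Y (F i)) -> hol Y (fun s => \sum_(i <- r | P i) F i s).
Proof.
move=> Y01 h; elim: r => [|i r IH].
  by apply: hol_ext (hol_cst Y 0) => s _; rewrite big_nil.
case Pi: (P i).
  by apply: hol_ext (holD Y01 (h i) IH) => s _; rewrite big_cons Pi.
by apply: hol_ext IH => s _; rewrite big_cons Pi.
Qed.

Lemma hol_prod Y (I : Type) (r : seq I) (P : pred I) (F : I -> R -> K) : in01 Y ->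
  (forall i, hol Y (F i)) -> hol Y (fun s => \prod_(i <- r | P i) F i s).
Proof.
move=> Y01 h; elim: r => [|i r IH].
  by apply: hol_ext (hol_cst Y 1) => s _; rewrite big_nil.
case Pi: (P i).
  by apply: hol_ext (holM Y01 (h i) IH) => s _; rewrite big_cons Pi.
by apply: hol_ext IH => s _; rewrite big_cons Pi.
Qed.

Definition holm m n Y (A : R -> 'M[K]_(m, n)) := forall i j, hol Y (fun s => A s i j).

Lemma holm_sub m n Y Y' (A : R -> 'M[K]_(m, n)) :
  (forall s, Y' s -> Y s) -> holm Y A -> holm Y' A.
Proof. by move=> h hA i j; apply: hol_sub h _. Qed.

Lemma holm_ext m n Y (A B : R -> 'M[K]_(m, n)) :
  (forall s, Y s -> A s = B s) -> holm Y A -> holm Y B.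
Proof. by move=> h hA i j; apply: hol_ext (hA i j) => s Ys; rewrite h. Qed.

Lemma holm_cst m n Y (A : 'M[K]_(m, n)) : holm Y (fun=> A).
Proof. by move=> i j; apply: hol_cst. Qed.

Lemma holm_mul m n p Y (A : R -> 'M[K]_(m, n)) (B : R -> 'M[K]_(n, p)) : in01 Y ->
  holm Y A -> holm Y B -> holm Y (fun s => A s *m B s).
Proof.
move=> Y01 hA hB i j.
apply: (@hol_ext _ (fun s => \sum_k A s i k * B s k j)); first by move=> s _; rewrite mxE.
by apply: hol_sum => // k; apply: holM.
Qed.

Lemma holm_add m n Y (A B : R -> 'M[K]_(m, n)) : in01 Y ->
  holm Y A -> holm Y B -> holm Y (fun s => A s + B s).
Proof.
move=> Y01 hA hB i j.
apply: (@hol_ext _ (fun s => A s i j + B s i j)); first by move=> s _; rewrite mxE.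
exact: holD.
Qed.

Lemma holm_opp m n Y (A : R -> 'M[K]_(m, n)) : holm Y A -> holm Y (fun s => - A s).
Proof.
move=> hA i j.
apply: (@hol_ext _ (fun s => - A s i j)); first by move=> s _; rewrite mxE.
exact: holN.
Qed.

Lemma hol_det n Y (A : R -> 'M[K]_n) : in01 Y -> holm Y A -> hol Y (fun s => \det (A s)).
Proof.
move=> Y01 hA; rewrite /determinant; apply: hol_sum => // p.
by apply: holM => //; [exact: hol_cst|apply: hol_prod].
Qed.

(** Cramer's rule: the entries of the inverse are cofactors divided by the determinant. *)
Lemma holm_inv n Y (A : R -> 'M[K]_n) (c : R) : in01 Y -> holm Y A ->
  (forall s, Y s -> A s \in unitmx) -> 0 < c -> (forall s, Y s -> c <= nK (\det (A s))) ->
  holm Y (fun s => invmx (A s)).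
Proof.
move=> Y01 hA uA c0 hc i j.
apply: (@hol_ext _ (fun s => (\det (A s))^-1 * \adj (A s) i j)).
  by move=> s Ys; rewrite /invmx uA // [RHS]mxE.
apply: holM => //; first by apply: hol_inv hc _ => //; apply: hol_det.
apply: (@hol_ext _ (fun s => (-1) ^+ (j + i) * \det (row' j (col' i (A s))))).
  by move=> s Ys; rewrite mxE.
apply: holM => //; first exact: hol_cst.
apply: hol_det => // k l.
by apply: (@hol_ext _ (fun s => A s (lift j k) (lift i l))) => // s _; rewrite !mxE.
Qed.

Definition near_set (X : set R) (s e : R) : set R := [set t | X t /\ `|t - s| < e].

Lemma hol_lower (X : set R) f s e : in01 X -> X s -> 0 < e -> hol (near_set X s e) f -> f s != 0 ->
  exists e' c : R, [/\ 0 < e', e' <= e, 0 < c & forall t, near_set X s e' t -> c <= nK (f t)].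
Proof.
move=> X01 Xs e0 [C [nu [C0 n0 h]]] fs.
have fp : 0 < nK (f s).
  by rewrite lt_neqAle av_ge0 // andbT eq_sym; apply/eqP => /(av_eq0 aK)/eqP; apply/negP.
have q0 : 0 < nK (f s) / 2 / (C + 1) by rewrite !divr_gt0 //; lra.
have [k hk] := expr_small (powR_ge0 (2^-1) nu) (powR_half_lt1 n0) q0.
exists (Num.min e (dy R k)), (nK (f s) / 2); split.
- by rewrite lt_min e0 dy_gt0.
- by rewrite ge_min lexx.
- by rewrite divr_gt0.
move=> t [Xt]; rewrite lt_min => /andP[te tk].
have := h s t (conj Xs _) (conj Xt te); rewrite subrr normr0 e0 => /(_ isT) h1.
have : C * powR `|s - t| nu <= nK (f s) / 2.
  apply: le_trans (_ : (C + 1) * (powR 2^-1 nu ^+ k) <= _); last first.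
    by move: hk; rewrite ltr_pdivlMr; [rewrite mulrC => /ltW|lra].
  apply: ler_pM; rewrite ?powR_ge0 // ?lerDl // -powR_dy.
  apply: ge0_ler_powR; rewrite ?nnegrE ?(ltW n0) ?(ltW (dy_gt0 _ _)) ?normr_ge0 //.
  by rewrite distrC ltW.
have := avD aK (f s - f t) (f t); rewrite subrK; lra.
Qed.

End Hoelder.

(** * Parallel frames *)

Section ParallelFrames.
Variables (R : realType) (K : fieldType) (nK : K -> R) (d : nat).
Hypothesis aK : absval nK.
Variables (X : set R) (F G : R -> nat -> 'M[K]_d).
Hypothesis tX : thin X.
Hypothesis fF : forall s, X s -> is_flag (F s).
Hypothesis fG : forall s, X s -> is_flag (G s).
Hypothesis tFG : forall s, X s -> transverse (F s) (G s).
Hypothesis gapFG : forall a b, gap X a b -> F a = F b \/ G a = G b.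
Hypothesis locFG : forall s, X s -> exists (e : R) (M N : R -> 'M[K]_d),
  [/\ 0 < e, forall t, near_set X s e t -> frame_of (F t) (M t) /\ frame_of (G t) (N t),
   holm nK (near_set X s e) M & holm nK (near_set X s e) N].

Let X01 : in01 X. Proof. by case: tX. Qed.
Let near01 s e : in01 (near_set X s e). Proof. by move=> t [/X01]. Qed.

Lemma uniform_eps (T : Type) (r : seq T) (P : T -> R -> Prop) :
  (forall i e e', P i e -> 0 < e' -> e' <= e -> P i e') ->
  (forall i, exists2 e, 0 < e & P i e) -> exists2 e, 0 < e & forall i, List.In i r -> P i e.
Proof.
move=> mono h; elim: r => [|i r [e e0 IH]]; first by exists 1.
have [e' e'0 hi] := h i; exists (Num.min e e'); first by rewrite lt_min e0.
move=> j /= [<-|/IH hj]; first by apply: mono hi _ _; rewrite ?lt_min ?e0 // ge_min lexx orbT.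
by apply: mono hj _ _; rewrite ?lt_min ?e0 // ge_min lexx.
Qed.

Lemma uniform_eps_ord (n : nat) (P : 'I_n -> R -> Prop) :
  (forall i e e', P i e -> 0 < e' -> e' <= e -> P i e') ->
  (forall i, exists2 e, 0 < e & P i e) -> exists2 e, 0 < e & forall i, P i e.
Proof.
move=> mono h; have [e e0 he] := uniform_eps (enum 'I_n) mono h.
exists e => // i; apply: he.
have : i \in enum 'I_n by rewrite mem_enum.
elim: (enum _) => //= j r IH; rewrite inE => /orP[/eqP->|/IH]; by [left|right].
Qed.

Lemma near_inv (n : nat) (s e : R) (A : R -> 'M[K]_n) : X s -> 0 < e ->
  holm nK (near_set X s e) A -> (forall t, near_set X s e t -> A t \in unitmx) ->
  exists2 e', 0 < e' <= e & holm nK (near_set X s e') (fun t => invmx (A t)).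
Proof.
move=> Xs e0 hA uA.
have ds : \det (A s) != 0.
  by rewrite -unitfE -unitmxE; apply: uA; split=> //; rewrite subrr normr0.
have [e' [c [e'0 e'e c0 hc]]] := hol_lower aK X01 Xs e0 (hol_det aK (@near01 s e) hA) ds.
have sub t : near_set X s e' t -> near_set X s e t by move=> [Xt te]; split=> //; lra.
exists e'; first by rewrite e'0.
apply: (holm_inv aK (@near01 s e') (holm_sub sub hA) _ c0 hc) => t /sub; exact: uA.
Qed.

(** Apply [aframe] to the Hoelder lifts. Every matrix inverted in it is invertible at [s], so its
    determinant is bounded below near [s]. *)
Lemma local_frame s : X s -> exists (e : R) (A : R -> 'M[K]_d),
  [/\ 0 < e, forall t, near_set X s e t -> adapted (F t) (G t) (A t),
   holm nK (near_set X s e) A & holm nK (near_set X s e) (fun t => invmx (A t))].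
Proof.
move=> Xs; have [e [M [N [e0 fMN hM hN]]]] := locFG Xs.
pose St (i : 'I_d) t := stack_mx i (M t) (N t).
have sub e1 e2 t : e2 <= e1 -> near_set X s e2 t -> near_set X s e1 t.
  by move=> h [Xt te]; split=> //; lra.
have uS i t : near_set X s e t -> St i t \in unitmx.
  move=> nt; have [f1 f2] := fMN t nt; apply: stack_unit f1 f2 _; last by apply: ltnW.
  by apply: tFG; case: nt.
have hS i : holm nK (near_set X s e) (St i).
  apply: holm_add => //; apply: holm_mul => //; exact: holm_cst.
have [e1 /andP[e10 e1e] hI] : exists2 e1, 0 < e1 <= e & forall i, holm nK (near_set X s e1) (fun t => invmx (St i t)).
  have [||e1 e10 h] := @uniform_eps_ord d (fun i e1 => holm nK (near_set X s e1) (fun t => invmx (St i t))).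
  - by move=> i a b h b0 ba; apply: holm_sub h => t; apply: sub.
  - move=> i; have [e' /andP[e'0 _] h] := near_inv Xs e0 (hS i) (uS i).
    by exists e'.
  - exists (Num.min e1 e); first by rewrite lt_min e10 e0 ge_min lexx orbT.
    by move=> i; apply: holm_sub (h i) => t; apply: sub; rewrite ge_min lexx.
have h1 : holm nK (near_set X s e1) (fun t => aframe (M t) (N t)).
  move=> i k; apply: (@hol_ext _ _ nK _ (fun t => (M t *m (1%:M - invmx (St i t) *m pid_mx i *m St i t)) i k)).
    by move=> t _; rewrite [RHS]mxE.
  have sb t : near_set X s e1 t -> near_set X s e t by apply: sub.
  have := @holm_mul _ _ _ aK _ _ _ _ M (fun t => 1%:M - invmx (St i t) *m pid_mx i *m St i t) (@near01 s e1).
  apply; first by apply: holm_sub hM.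
  apply: holm_add => //; first exact: holm_cst.
  apply: holm_opp => //; apply: holm_mul => //; last exact: holm_sub (hS i).
  by apply: holm_mul => //; apply: holm_cst.
have ad t : near_set X s e1 t -> adapted (F t) (G t) (aframe (M t) (N t)).
  move=> /(sub _ _ _ e1e) nt; have [f1 f2] := fMN t nt; have [Xt _] := nt.
  by apply: aframe_adapted; auto.
have [e' /andP[e'0 e'e] h2] := near_inv Xs e10 h1 (fun t nt => (ad t nt).1).
exists e', (fun t => aframe (M t) (N t)); split=> //.
- by move=> t nt; apply: ad; apply: sub nt.
- by apply: holm_sub h1 => t; apply: sub.
Qed.

Definition seg u v : set R := [set s | X s /\ u <= s <= v].

(** Across a gap one flag is common, so the change of adapted frame is triangular and unit diagonal
    means unipotent: the frame is carried along by the elementary slithering maps. *)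
Definition parallel u v (A : R -> 'M[K]_d) := [/\
  forall s, seg u v s -> adapted (F s) (G s) (A s),
  holm nK (seg u v) A, holm nK (seg u v) (fun s => invmx (A s)) &
  forall a b, gap X a b -> u <= a -> b <= v -> forall i, (A b *m invmx (A a)) i i = 1].

Let seg01 u v : in01 (seg u v). Proof. by move=> t [/X01]. Qed.

Lemma parallel_sub u v u' v' A : u <= u' -> v' <= v -> parallel u v A -> parallel u' v' A.
Proof.
move=> uu vv [h1 h2 h3 h4].
have sub s : seg u' v' s -> seg u v s by move=> [Xs /andP[a b]]; split=> //; apply/andP; split; lra.
split; [by move=> s /sub/h1|exact: holm_sub h2|exact: holm_sub h3|].
by move=> a b gab ua bv; apply: h4 => //; lra.
Qed.

Lemma gap_diag_neq0 a b A B i : gap X a b -> adapted (F a) (G a) A -> adapted (F b) (G b) B ->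
  (B *m invmx A) i i != 0.
Proof.
move=> gab [uA hA] [uB hB].
have u : B *m invmx A \in unitmx by rewrite unitmx_mul uB unitmx_inv.
case: (gapFG gab) => e.
  apply: lower_unit_diag => //; apply: (same_flag_lower (F := F a)) => // j jd; first by case: (hA j jd).
  by rewrite e; case: (hB j jd).
apply: upper_unit_diag => //; apply: (same_flag_upper (G := G a)) => // j jd; first by case: (hA j jd).
by rewrite e; case: (hB j jd).
Qed.

(** An adapted frame becomes parallel when its row [i] is divided by the product, over the gaps
    passed, of the [i]-th diagonal entries of the changes of frame. *)
Lemma local_parallel s : X s -> exists (e : R) A, 0 < e /\ parallel (s - e) (s + e) A.
Proof.
move=> Xs; have [e [A [e0 ad hA hI]]] := local_frame Xs.
(* [A b *m invmx (A a) - 1] equals [(A b - A a) *m invmx (A a)]; so the diagonal entries are as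
   close to 1 as [gap_product] requires. *)
have [C [nu [C0 nu0 hC]]] : exists C nu : R, [/\ 0 <= C, 0 < nu & forall i a b, near_set X s e a ->
    near_set X s e b -> nK ((A b *m invmx (A a)) i i - 1) <= C * powR `|b - a| nu].
  have hBall : exists B, 0 <= B /\ forall t i j, near_set X s e t -> nK (invmx (A t) i j) <= B.
    have hb i j := hol_bounded aK (@near01 s e) (hI i j).
    have hb' (p : 'I_d * 'I_d) : exists B, 0 <= B /\ forall t, near_set X s e t -> nK (invmx (A t) p.1 p.2) <= B.
      by have [B B0 h] := hb p.1 p.2; exists B.
    have [B hB] := choice hb'.
    exists (\sum_p B p); split; first by apply: sumr_ge0 => p _; case: (hB p).
    move=> t i j nt; apply: le_trans ((hB (i, j)).2 t nt) _.
    rewrite (bigD1 (i, j)) //= lerDl; apply: sumr_ge0 => p _; by case: (hB p).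
  have [B [B0 hB]] := hBall.
  have ha (p : 'I_d * 'I_d) : exists q : R * R, [/\ 0 <= q.1, 0 < q.2 & forall mu, 0 < mu -> mu <= q.2 ->
     forall t t', near_set X s e t -> near_set X s e t' -> nK (A t p.1 p.2 - A t' p.1 p.2) <= q.1 * powR `|t - t'| mu].
    have [C [nu [C0 nu0 h]]] := hol_exp (@near01 s e) (hA p.1 p.2).
    by exists (C, nu).
  have [q hq] := choice ha.
  have [nu nu0 hnu] := @uniform_eps _ (enum {: 'I_d * 'I_d}) (fun p nu => nu <= (q p).2)
    (fun p e e' h _ h' => le_trans h' h) (fun p => ex_intro2 _ _ (q p).2 (let: And3 _ h _ := hq p in h) (lexx _)).
  have {}hnu p : nu <= (q p).2.
    apply: hnu; have : p \in enum {: 'I_d * 'I_d} by rewrite mem_enum.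
    elim: (enum _) => //= j r IH; rewrite inE => /orP[/eqP->|/IH]; by [left|right].
  pose Cq := \sum_p (q p).1.
  have Cq0 p : (q p).1 <= Cq.
    rewrite /Cq (bigD1 p) //= lerDl; apply: sumr_ge0 => j _; by case: (hq j).
  have Cqp : 0 <= Cq by apply: sumr_ge0 => j _; case: (hq j).
  exists (d%:R * (Cq * B)), nu; split; rewrite ?mulr_ge0 //.
  move=> i a b na nb.
  have -> : (A b *m invmx (A a)) i i - 1 = ((A b - A a) *m invmx (A a)) i i.
    rewrite mulmxBl mulmxV; last by case: (ad a na).
    by rewrite [RHS]mxE [X in _ = _ + X]mxE [X in _ = _ - X]mxE eqxx.
  rewrite mxE; apply: le_trans (_ : \sum_(j < d) Cq * powR `|b - a| nu * B <= _); last first.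
    rewrite sumr_const card_ord -[X in X <= _]mulr_natl; rewrite le_eqVlt; apply/orP; left; apply/eqP; ring.
  have tri (I : finType) (f : I -> K) : nK (\sum_i f i) <= \sum_i nK (f i).
    elim/big_rec2: _ => [|j y1 y2 _ h]; first by rewrite (av0 aK).
    by apply: le_trans (avD aK _ _) _; rewrite lerD2l.
  apply: le_trans (tri _ _) _; apply: ler_sum => j _; rewrite (avM aK).
  apply: ler_pM; rewrite ?av_ge0 ?hB // !mxE.
  have [_ _ hh] := hq (i, j).
  apply: le_trans (hh nu nu0 (hnu _) b a nb na) _.
  by apply: ler_wpM2r; rewrite ?powR_ge0.
have [m hm] := gap_product aK tX nu0 C0.
(* Half of [e] keeps the segment in the domain of the frame; a quarter of [dy R m] keeps its length
   [2 dl] below the threshold of [gap_product]. *)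
pose dl := Num.min (e / 2) (dy R m / 4).
have dl0 : 0 < dl by rewrite lt_min !divr_gt0 ?dy_gt0.
have dle : dl <= e / 2 by rewrite ge_min lexx.
have dlm : dl <= dy R m / 4 by rewrite ge_min lexx orbT.
exists dl; pose u := s - dl; pose v := s + dl.
have sg t : seg u v t -> near_set X s e t.
  move=> [Xt /andP[h1 h2]]; split=> //; rewrite ltr_norml; apply/andP; split; rewrite /u /v in h1 h2; lra.
have uvm : v - u < dy R m by have := dy_gt0 R m; rewrite /u /v; lra.
have hd (i : 'I_d) : exists dd : R -> K, [/\ (forall x, seg u v x -> 1/2 <= nK (dd x)),
    (forall a b, gap X a b -> u <= a -> b <= v -> dd b = (A b *m invmx (A a)) i i * dd a) & hol nK (seg u v) dd].
  have [|dd [C' [C'0 d1 d2 d3]]] := hm (fun a b => (A b *m invmx (A a)) i i) u v uvm.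
    move=> a b gab ua bv; have [Xa Xb ab _] := gab.
    have -> : b - a = `|b - a| by rewrite ger0_norm // subr_ge0 ltW.
    apply: hC; apply: sg; split=> //; apply/andP; split; lra.
  exists dd; split=> //.
  - by move=> x [Xx uxv]; have /andP[] := d1 x Xx uxv.
  - by exists C', nu; split=> // x y [Xx h1] [Xy h2]; apply: d3.
have [dd hdd] := choice hd.
have dn0 i x : seg u v x -> dd i x != 0.
  move=> sx; have [h _ _] := hdd i; have := h x sx.
  by apply: contraTneq => ->; rewrite (av0 aK) -ltNge divr_gt0.
pose D t : 'M[K]_d := diag_mx (\row_i dd i t).
pose D' t : 'M[K]_d := diag_mx (\row_i (dd i t)^-1).
have hdi i : hol nK (seg u v) (fun t => (dd i t)^-1).
  have [h1 _ h3] := hdd i; apply: (hol_inv aK _ h1 h3); exact: divr_gt0.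
have DD t : seg u v t -> D' t *m D t = 1%:M.
  move=> st; rewrite /D /D' mulmx_diag -diag_const_mx; congr diag_mx.
  by apply/rowP => i; rewrite !mxE mulVf // dn0.
have uD t : seg u v t -> D' t \in unitmx by move=> st; have [] := mulmx1_unit (DD t st).
have iD t : seg u v t -> invmx (D' t) = D t.
  by move=> st; rewrite -[LHS]mulmx1 -(DD t st) mulKmx // uD.
have hdiag (f : 'I_d -> R -> K) : (forall i, hol nK (seg u v) (f i)) ->
    holm nK (seg u v) (fun t => diag_mx (\row_i f i t)).
  move=> hf i j; apply: (@hol_ext _ _ nK _ (fun t => if i == j then f i t else 0)).
    by move=> t _; rewrite !mxE; case: eqP => // ->.
  case: eqP => _; [exact: hf|exact: hol_cst].
exists (fun t => D' t *m A t); split=> //; rewrite -/u -/v; split.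
- move=> t st; apply: adapted_scale; last by apply: ad; apply: sg.
  by move=> i; rewrite invr_eq0 dn0.
- apply: holm_mul => //; first exact: hdiag.
  exact: holm_sub sg hA.
- apply: (@holm_ext _ _ nK _ _ _ (fun t => invmx (A t) *m D t)).
    move=> t st; rewrite -iD // -invmx_mul //; first exact: uD.
    by case: (ad t (sg t st)).
  apply: holm_mul => //; first exact: holm_sub sg hI.
  by apply: hdiag => i; case: (hdd i).
- move=> a b gab ua bv i; have [Xa Xb ab _] := gab.
  have sa : seg u v a by split=> //; apply/andP; split=> //; lra.
  have sb : seg u v b by split=> //; apply/andP; split=> //; lra.
  rewrite invmx_mul ?uD //; last by case: (ad a (sg a sa)).
  rewrite iD // mulmxA -[D' b *m A b *m invmx (A a)]mulmxA.
  rewrite mul_mx_diag mul_diag_mx !mxE.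
  have [_ h _] := hdd i; have := h a b gab ua bv; rewrite mxE => e1.
  by rewrite -mulrA -e1 mulVf // dn0.
Qed.

Lemma hol_glue u w v (f g : R -> K) : X w -> u <= w -> w <= v ->
  hol nK (seg u w) f -> hol nK (seg w v) g -> f w = g w ->
  hol nK (seg u v) (fun s => if s <= w then f s else g s).
Proof.
move=> Xw uw wv hf hg e.
have s01 a b : in01 (seg a b) by move=> t [/X01].
have [C [nu [C0 n0 h]]] := hol_exp (s01 _ _) hf.
have [C' [nu' [C0' n0' h']]] := hol_exp (s01 _ _) hg.
exists (C + C'), (Num.min nu nu'); split; [by rewrite addr_ge0|by rewrite lt_min n0|].
have m0 : 0 < Num.min nu nu' by rewrite lt_min n0.
have m1 : Num.min nu nu' <= nu by rewrite ge_min lexx.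
have m2 : Num.min nu nu' <= nu' by rewrite ge_min lexx orbT.
move: (Num.min nu nu') m0 m1 m2 => mu m0 m1 m2.
have aux s t : seg u v s -> seg u v t -> s <= w -> w < t ->
    nK (f s - g t) <= (C + C') * powR `|s - t| mu.
  move=> [Xs /andP[us sv]] [Xt /andP[ut tv]] sw wt.
  apply: le_trans (av_tri aK _ (f w) _) _; rewrite {2}e mulrDl; apply: lerD.
    apply: le_trans (h mu m0 m1 s w _ _) _; try by split=> //; apply/andP; split; lra.
    apply: ler_wpM2l => //; apply: ge0_ler_powR; rewrite ?nnegrE ?(ltW m0) ?normr_ge0 //.
    rewrite !ler0_norm; lra.
  apply: le_trans (h' mu m0 m2 w t _ _) _; try by split=> //; apply/andP; split; lra.
  apply: ler_wpM2l => //; apply: ge0_ler_powR; rewrite ?nnegrE ?(ltW m0) ?normr_ge0 //.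
  rewrite !ler0_norm; lra.
move=> s t hs ht; case: (leP s w) => sw; case: (leP t w) => tw.
- apply: le_trans (h mu m0 m1 s t _ _) _; try by [split; case: hs ht => [? /andP[? ?]] [? /andP[? ?]] //; apply/andP; split].
  by rewrite ler_wpM2r ?powR_ge0 // lerDl.
- exact: aux.
- by rewrite (av_sub aK) distrC; apply: aux.
- apply: le_trans (h' mu m0 m2 s t _ _) _; try by [split; case: hs ht => [? /andP[? ?]] [? /andP[? ?]] //; apply/andP; split=> //; apply: ltW].
  by rewrite ler_wpM2r ?powR_ge0 // lerDr.
Qed.

(** At [w] the two frames differ by a diagonal matrix [D]. Multiplying the second frame by this
    constant makes them agree, and conjugation by [D] does not affect diagonal entries. *)
Lemma parallel_glue u w v A B : X w -> u <= w -> w <= v ->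
  parallel u w A -> parallel w v B -> exists C, parallel u v C.
Proof.
move=> Xw uw wv [a1 a2 a3 a4] [b1 b2 b3 b4].
have sA : seg u w w by split=> //; rewrite uw lexx.
have sB : seg w v w by split=> //; rewrite wv lexx.
have [uA _] := a1 w sA; have [uB _] := b1 w sB.
have [D eD0] : exists D, D = A w *m invmx (B w) by eexists.
have uD : D \in unitmx by rewrite eD0 unitmx_mul uA unitmx_inv.
have eD : D = diag_mx (\row_i D i i).
  apply/matrixP => i j; case: (altP (i =P j)) => [->|ij].
    by rewrite [RHS]mxE [X in X *+ _]mxE eqxx mulr1n.
  by rewrite [RHS]mxE (negbTE ij) mulr0n eD0; exact: adapted_diag (b1 w sB) (a1 w sA) ij.
have D0 i : D i i != 0.
  apply: lower_unit_diag => // k l kl; rewrite eD0; apply: adapted_diag (b1 w sB) (a1 w sA) _.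
  by apply/eqP => e; rewrite e ltnn in kl.
pose Cf s := if s <= w then A s else D *m B s.
have Cw s : w <= s -> Cf s = D *m B s.
  rewrite /Cf => ws; case: leP => // sw.
  have -> : s = w by apply/eqP; rewrite eq_le sw.
  by rewrite eD0 mulmxKV.
have hDB : holm nK (seg w v) (fun s => D *m B s) by apply: holm_mul => //; apply: holm_cst.
have uBs s : seg w v s -> B s \in unitmx by move=> /b1[].
exists Cf; split.
- move=> s [Xs /andP[us sv]]; rewrite /Cf; case: leP => sw.
    by apply: a1; split=> //; rewrite us.
  by rewrite eD; apply: adapted_scale => //; apply: b1; split=> //; rewrite sv ltW.
- move=> i j; apply: (@hol_ext _ _ nK _ (fun s => if s <= w then A s i j else (D *m B s) i j)).
    by move=> s _; rewrite /Cf; case: leP.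
  by apply: hol_glue (a2 i j) (hDB i j) _ => //; rewrite eD0 mulmxKV.
- move=> i j; apply: (@hol_ext _ _ nK _ (fun s => if s <= w then invmx (A s) i j else (invmx (B s) *m invmx D) i j)).
    move=> s [Xs /andP[us sv]]; rewrite /Cf; case: leP => sw //.
    by rewrite invmx_mul // uBs //; split=> //; rewrite sv ltW.
  apply: hol_glue (a3 i j) _ _ => //.
    by have := holm_mul aK (@seg01 w v) b3 (holm_cst aK (seg w v) (invmx D)) => /(_ i j).
  by rewrite eD0 invmx_mul ?unitmx_inv // invmxK mulKmx.
- move=> a b gab ua bv i; have [Xa Xb ab ng] := gab.
  case: (leP b w) => bw.
    by rewrite /Cf bw (le_trans (ltW ab) bw); apply: a4.
  have wa : w <= a by rewrite leNgt; apply/negP => aw; have := ng w Xw; rewrite aw bw.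
  have sa : seg w v a by split=> //; apply/andP; split=> //; lra.
  rewrite !Cw //; last lra.
  rewrite invmx_mul ?uBs // mulmxA -[D *m B b *m _]mulmxA eD.
  have -> : invmx (diag_mx (\row_i D i i)) = diag_mx (\row_i (D i i)^-1).
    have e1 : diag_mx (\row_i D i i) *m diag_mx (\row_i (D i i)^-1) = 1%:M.
      rewrite mulmx_diag -diag_const_mx; congr diag_mx.
      by apply/rowP => k; rewrite !mxE divff.
    have u1 : diag_mx (\row_i D i i) \in unitmx by rewrite -eD.
    by rewrite -[RHS](mulKmx u1) e1 mulmx1.
  rewrite mul_mx_diag mul_diag_mx.
  have e1 := b4 a b gab wa bv i; move: e1; rewrite !mxE => ->.
  by rewrite mulr1 divff.
Qed.

(** Only the two ends of the gap are parameters, so every function is Hoelder and just the diagonal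
    has to be normalised. *)
Lemma gap_parallel a b : gap X a b -> exists A, parallel a b A.
Proof.
move=> gab; have [Xa Xb ab ng] := gab.
have fr s : X s -> exists A, adapted (F s) (G s) A.
  move=> Xs; have [e [A [e0 ad _ _]]] := local_frame Xs; exists (A s); apply: ad.
  by split=> //; rewrite subrr normr0.
have [A1 ad1] := fr a Xa; have [A2 ad2] := fr b Xb.
pose c i := (A2 *m invmx A1) i i.
have c0 i : c i != 0 by apply: gap_diag_neq0 ad1 ad2.
pose D := diag_mx (\row_i (c i)^-1).
have ad3 : adapted (F b) (G b) (D *m A2) by apply: adapted_scale => // i; rewrite invr_eq0.
have sg s : seg a b s -> s = a \/ s = b.
  move=> [Xs /andP[h1 h2]]; have := ng s Xs; rewrite negb_and -!leNgt => /orP[h|h].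
    by left; apply/eqP; rewrite eq_le h1 h.
  by right; apply/eqP; rewrite eq_le h2 h.
have two (f : R -> K) : hol nK (seg a b) f.
  exists (nK (f a - f b) / powR `|a - b| 1), 1; split=> //.
    by rewrite divr_ge0 ?powR_ge0 // av_ge0.
  have p : 0 < powR `|a - b| 1 by rewrite powR_gt0 // normr_gt0 subr_eq0 lt_eqF.
  move=> s t /sg[]-> /sg[]->; rewrite ?subrr ?(av0 aK) ?mulr_ge0 ?invr_ge0 ?powR_ge0 ?(av_ge0 aK) //.
    by rewrite divfK // gt_eqF.
  by rewrite [`|b - a|]distrC (av_sub aK) divfK // gt_eqF.
exists (fun s => if s == b then D *m A2 else A1); split.
- move=> s /sg[]->; first by rewrite lt_eqF.
  by rewrite eqxx.
- by move=> i j; apply: two.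
- by move=> i j; apply: two.
- move=> a' b' gab' aa bb i; have [Xa' Xb' ab' _] := gab'.
  have -> : a' = a.
    by case: (sg a') => //; [split=> //; apply/andP; split=> //; lra|move=> e; move: ab' bb; rewrite e; lra].
  have -> : b' = b.
    by case: (sg b') => //; [split=> //; apply/andP; split=> //; lra|move=> e; move: ab' aa; rewrite e; lra].
  rewrite eqxx lt_eqF // -mulmxA mul_diag_mx mxE [X in X * _]mxE.
  by rewrite -/(c i) mulVf.
Qed.

(** Continuity argument along the closed set [X]: the supremum [t0] of the reachable parameters is
    reachable by a local frame, and if it is not yet [v], what follows is a gap starting at [t0],
    which can be crossed. *)
Lemma parallel_exists u v : X u -> X v -> u <= v -> exists A, parallel u v A.
Proof.
move=> Xu Xv uv.
pose T : set R := fun t : R => [/\ X t, u <= t <= v & exists A, parallel u t A].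
have Tu : T u.
  split=> //; first by rewrite lexx.
  have [e [A [e0 pA]]] := local_parallel Xu; exists A; apply: parallel_sub pA; lra.
have hT : has_sup T.
  split; first by exists u.
  by exists v => t [_ /andP[_]].
pose t0 := sup T.
have tle (t : R) : T t -> t <= t0 by move=> Tt; apply: ub_le_sup => //; case: hT.
have t0v : t0 <= v by apply: ge_sup; [exists u|move=> t [_ /andP[_]]].
have ut0 : u <= t0 by apply: tle.
have adh e : 0 < e -> exists2 t, T t & t0 - e < t by move=> e0; apply: sup_adherent.
have Xt0 : X t0.
  have [_ cX _ _] := tX; apply: cX => e e0; have [t Tt te] := adh e e0.
  exists t; split; first by case: Tt.
  rewrite ltr_norml; have := tle t Tt; lra.
have [e [A [e0 pA]]] := local_parallel Xt0.
have [t1 Tt1 te] := adh e e0; have t1t0 := tle _ Tt1; have [Xt1 /andP[ut1 _] [A1 pA1]] := Tt1.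
have [B pB] : exists B, parallel u (t0 + e) B.
  by apply: (parallel_glue Xt1 ut1 _ pA1 (parallel_sub _ (lexx _) pA)); lra.
case: (leP v (t0 + e)) => vte; first by exists B; apply: parallel_sub pB.
have noT (t : R) : X t -> t0 < t -> t <= v -> t0 + e < t.
  move=> Xt tt tv; rewrite ltNge; apply/negP => te'.
  have : T t by split=> //; [apply/andP; split; lra|exists B; apply: parallel_sub pB].
  by move=> /tle; lra.
pose W : set R := fun t : R => X t /\ t0 < t <= v.
have Wv : W v by split=> //; apply/andP; split=> //; lra.
have hW : has_inf W by split; [exists v|exists t0 => t [_ /andP[/ltW]]].
pose t2 := inf W.
have t2le (t : R) : W t -> t2 <= t by move=> Wt; apply: ge_inf => //; case: hW.
have t02 : t0 + e <= t2.
  apply: lb_le_inf; first by exists v.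
  by move=> t [Xt /andP[a b]]; apply: ltW; apply: noT.
have Xt2 : X t2.
  have [_ cX _ _] := tX; apply: cX => e' e'0; have [t Wt tte] := inf_adherent e'0 hW.
  exists t; split; first by case: Wt.
  have := t2le _ Wt; rewrite ltr_norml -/t2 in tte *; lra.
have t2v : t2 <= v by apply: t2le.
have g : gap X t0 t2.
  split=> //; first lra.
  move=> x Xx; apply/negP => /andP[h1 h2].
  have : W x by split=> //; apply/andP; split=> //; lra.
  by move=> /t2le; lra.
have [A2 pA2] := gap_parallel g.
have [C pC] : exists C, parallel u t2 C.
  by apply: (parallel_glue Xt0 ut0 _ (parallel_sub (lexx _) _ pB) pA2); lra.
have : T t2 by split=> //; [apply/andP; split; lra|exists C].
by move=> /tle; lra.
Qed.

(** While [F] is constant all changes of frame are triangular for one flag, so diagonal entries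
    multiply; the entry is a Hoelder function of the parameter that no gap changes. This handles
    leaves with a common endpoint and infinitely many leaves between them. *)
Lemma parallel_fan_lower u v A s t i : parallel u v A -> X s -> X t -> u <= s -> s <= t -> t <= v ->
  (forall r, X r -> s <= r <= t -> F r = F s) -> (A t *m invmx (A s)) i i = 1.
Proof.
move=> [ad hA hI gA] Xs Xt us st tv fan.
have inseg r : X r -> s <= r <= t -> seg u v r.
  by move=> Xr /andP[h1 h2]; split=> //; apply/andP; split; lra.
have low r r' : X r -> X r' -> s <= r <= t -> s <= r' <= t -> lower (A r' *m invmx (A r)).
  move=> Xr Xr' h h'; have [uA a1] := ad r (inseg r Xr h); have [_ a2] := ad r' (inseg r' Xr' h').
  apply: (same_flag_lower (F := F s)) => // j jd; rewrite -?(fan r Xr h) //.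
    by case: (a1 j jd).
  by rewrite fan // -(fan r' Xr' h'); case: (a2 j jd).
have s1 : s <= s <= t by rewrite lexx.
have t1 : s <= t <= t by rewrite lexx st.
have uAs : A s \in unitmx by case: (ad s (inseg s Xs s1)).
have e0 : (A s *m invmx (A s)) i i = 1 by rewrite mulmxV // mxE eqxx.
rewrite -[RHS]e0; apply: esym.
have [C [nu [C0 nu0 h]]] : hol nK (seg u v) (fun r => (A r *m invmx (A s)) i i).
  have := holm_mul aK (@seg01 u v) hA (holm_cst aK _ (invmx (A s))); exact.
apply: (holder_gap_const aK (f := fun r => (A r *m invmx (A s)) i i) (C := C) tX nu0 Xs Xt st).
  by move=> a b Xa Xb sa ab bt; apply: h; apply: inseg => //; apply/andP; split; lra.
move=> a b gab sa bt; have [Xa Xb ab _] := gab.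
have a1 : s <= a <= t by apply/andP; split=> //; lra.
have b1 : s <= b <= t by apply/andP; split=> //; lra.
have uAa : A a \in unitmx by case: (ad a (inseg a Xa a1)).
have -> : A b *m invmx (A s) = (A b *m invmx (A a)) *m (A a *m invmx (A s)).
  by rewrite mulmxA mulmxKV.
rewrite (lower_mul_diag i (low a b Xa Xb a1 b1) (low s a Xs Xa s1 a1)).
have ua : u <= a by lra.
have bv : b <= v by lra.
by rewrite (gA a b gab ua bv) mul1r.
Qed.

Lemma parallel_fan_upper u v A s t i : parallel u v A -> X s -> X t -> u <= s -> s <= t -> t <= v ->
  (forall r, X r -> s <= r <= t -> G r = G s) -> (A t *m invmx (A s)) i i = 1.
Proof.
move=> [ad hA hI gA] Xs Xt us st tv fan.
have inseg r : X r -> s <= r <= t -> seg u v r.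
  by move=> Xr /andP[h1 h2]; split=> //; apply/andP; split; lra.
have up r r' : X r -> X r' -> s <= r <= t -> s <= r' <= t -> upper (A r' *m invmx (A r)).
  move=> Xr Xr' h h'; have [uA a1] := ad r (inseg r Xr h); have [_ a2] := ad r' (inseg r' Xr' h').
  apply: (same_flag_upper (G := G s)) => // j jd; rewrite -?(fan r Xr h) //.
    by case: (a1 j jd).
  by rewrite fan // -(fan r' Xr' h'); case: (a2 j jd).
have s1 : s <= s <= t by rewrite lexx.
have t1 : s <= t <= t by rewrite lexx st.
have uAs : A s \in unitmx by case: (ad s (inseg s Xs s1)).
have e0 : (A s *m invmx (A s)) i i = 1 by rewrite mulmxV // mxE eqxx.
rewrite -[RHS]e0; apply: esym.
have [C [nu [C0 nu0 h]]] : hol nK (seg u v) (fun r => (A r *m invmx (A s)) i i).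
  have := holm_mul aK (@seg01 u v) hA (holm_cst aK _ (invmx (A s))); exact.
apply: (holder_gap_const aK (f := fun r => (A r *m invmx (A s)) i i) (C := C) tX nu0 Xs Xt st).
  by move=> a b Xa Xb sa ab bt; apply: h; apply: inseg => //; apply/andP; split; lra.
move=> a b gab sa bt; have [Xa Xb ab _] := gab.
have a1 : s <= a <= t by apply/andP; split=> //; lra.
have b1 : s <= b <= t by apply/andP; split=> //; lra.
have uAa : A a \in unitmx by case: (ad a (inseg a Xa a1)).
have -> : A b *m invmx (A s) = (A b *m invmx (A a)) *m (A a *m invmx (A s)).
  by rewrite mulmxA mulmxKV.
rewrite (upper_mul_diag i (up a b Xa Xb a1 b1) (up s a Xs Xa s1 a1)).
have ua : u <= a by lra.
have bv : b <= v by lra.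
by rewrite (gA a b gab ua bv) mul1r.
Qed.

Lemma gap_triangular u v A a b : parallel u v A -> gap X a b -> u <= a -> b <= v ->
  lower (A b *m invmx (A a)) \/ upper (A b *m invmx (A a)).
Proof.
move=> [ad hA hI gA] gab ua bv; have [Xa Xb ab _] := gab.
have [uA a1] : adapted (F a) (G a) (A a) by apply: ad; split=> //; apply/andP; split; lra.
have [uB b1] : adapted (F b) (G b) (A b) by apply: ad; split=> //; apply/andP; split; lra.
case: (gapFG gab) => e; [left|right].
  by apply: (same_flag_lower (F := F a)) => // j jd; [case: (a1 j jd)|rewrite e; case: (b1 j jd)].
by apply: (same_flag_upper (G := G a)) => // j jd; [case: (a1 j jd)|rewrite e; case: (b1 j jd)].
Qed.

(** The determinant is again Hoelder and unchanged across gaps; this is why the transport lies in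
    SL_d. *)
Lemma parallel_det u v A s t : parallel u v A -> X s -> X t -> u <= s -> s <= t -> t <= v ->
  \det (A s) = \det (A t).
Proof.
move=> pA Xs Xt us st tv; have [ad hA hI gA] := pA.
have [C [nu [C0 nu0 h]]] := hol_det aK (@seg01 u v) hA.
apply: (holder_gap_const aK (f := fun r => \det (A r)) (C := C) tX nu0 Xs Xt st).
  move=> a b Xa Xb sa ab bt; apply: h; split=> //; apply/andP; split; lra.
move=> a b gab sa bt; have [Xa Xb ab _] := gab.
have ua : u <= a by lra.
have bv : b <= v by lra.
have uA : A a \in unitmx by case: (ad a) => //; split=> //; apply/andP; split; lra.
have e : \det (A b *m invmx (A a)) = 1.
  case: (gap_triangular pA gab ua bv) => tr; [rewrite lower_det //|rewrite upper_det //];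
  by apply: big1 => i _; apply: gA.
have : \det (A b *m invmx (A a) *m A a) = \det (A a) by rewrite det_mulmx e mul1r.
by rewrite mulmxKV.
Qed.

End ParallelFrames.

(** * Charts *)

Section MatrixNorm.
Variables (R : realType) (K : fieldType) (nK : K -> R) (d : nat).
Hypothesis aK : absval nK.

Lemma mxnorm_entry (A : 'M[K]_d) i j : nK (A i j) <= mxnorm nK A.
Proof.
rewrite /mxnorm; apply: le_trans (le_bigmax _ _ i) => /=.
exact: (le_bigmax _ (fun j => nK (A i j)) j).
Qed.

Lemma mxnorm_le (A : 'M[K]_d) B : 0 <= B -> (forall i j, nK (A i j) <= B) -> mxnorm nK A <= B.
Proof. by move=> B0 h; rewrite /mxnorm; apply: bigmax_le => // i _; apply: bigmax_le. Qed.

Lemma uniform_const (I : finType) (P : I -> R -> R -> Prop) :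
  (forall i C C' nu nu', P i C nu -> C <= C' -> 0 < nu' -> nu' <= nu -> P i C' nu') ->
  (forall i, exists C nu, [/\ 0 <= C, 0 < nu & P i C nu]) ->
  exists C nu, [/\ 0 <= C, 0 < nu & forall i, P i C nu].
Proof.
move=> mono h.
have [C [nu [C0 nu0 hP]]] : exists C nu, [/\ 0 <= C, 0 < nu & forall i, i \in enum I -> P i C nu].
  elim: (enum I) => [|i r [C [nu [C0 nu0 IH]]]]; first by exists 0, 1.
  have [C' [nu' [C0' nu0' hi]]] := h i.
  exists (C + C'), (Num.min nu nu'); split; [by rewrite addr_ge0|by rewrite lt_min nu0|].
  move=> j; rewrite inE => /orP[/eqP->|/IH hj].
    by apply: mono hi _ _ _; rewrite ?lerDr ?lt_min ?nu0 ?ge_min ?lexx ?orbT.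
  by apply: mono hj _ _ _; rewrite ?lerDl ?lt_min ?nu0 ?ge_min ?lexx.
by exists C, nu; split=> // i; apply: hP; rewrite mem_enum.
Qed.

Definition hol2 (Y : set R) (f : R -> R -> K) := exists C nu : R, [/\ 0 <= C, 0 < nu &
  forall s t s' t', Y s -> Y t -> Y s' -> Y t' ->
    nK (f s t - f s' t') <= C * powR (Num.max `|s - s'| `|t - t'|) nu].

Lemma hol2_mono (Y : set R) (f : R -> R -> K) C C' nu nu' : in01 Y ->
  (forall s t s' t', Y s -> Y t -> Y s' -> Y t' ->
    nK (f s t - f s' t') <= C * powR (Num.max `|s - s'| `|t - t'|) nu) ->
  C <= C' -> 0 <= C -> 0 < nu' -> nu' <= nu ->
  (forall s t s' t', Y s -> Y t -> Y s' -> Y t' ->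
    nK (f s t - f s' t') <= C' * powR (Num.max `|s - s'| `|t - t'|) nu').
Proof.
move=> Y01 h CC C0 n0 nn s t s' t' Ys Yt Ys' Yt'; apply: le_trans (h _ _ _ _ Ys Yt Ys' Yt') _.
apply: ler_pM => //; rewrite ?powR_ge0 //; apply: powR_exp_le => //.
rewrite ge_max; have := Y01 _ Ys; have := Y01 _ Yt; have := Y01 _ Ys'; have := Y01 _ Yt'.
by case: (lerP s s'); case: (lerP t t'); lra.
Qed.

Lemma hol2M (Y : set R) (f g : R -> K) : in01 Y -> hol nK Y f -> hol nK Y g ->
  hol2 Y (fun s t => f s * g t).
Proof.
move=> Y01 hf hg; have [B B0 hB] := hol_bounded aK Y01 hf; have [B' B0' hB'] := hol_bounded aK Y01 hg.
move: hf hg => /(hol_exp Y01)[C [nu [C0 n0 h]]] /(hol_exp Y01)[C' [nu' [C0' n0' h']]].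
exists (C * B' + B * C'), (Num.min nu nu').
split; [by rewrite addr_ge0 // mulr_ge0|by rewrite lt_min n0|].
have m0 : 0 < Num.min nu nu' by rewrite lt_min n0.
have m1 : Num.min nu nu' <= nu by rewrite ge_min lexx.
have m2 : Num.min nu nu' <= nu' by rewrite ge_min lexx orbT.
move: (Num.min nu nu') m0 m1 m2 => mu m0 m1 m2.
move=> s t s' t' Ys Yt Ys' Yt'.
have -> : f s * g t - f s' * g t' = (f s - f s') * g t + f s' * (g t - g t') by ring.
apply: le_trans (avD aK _ _) _; rewrite !(avM aK) mulrDl.
have p1 : powR `|s - s'| mu <= powR (Num.max `|s - s'| `|t - t'|) mu.
  by apply: ge0_ler_powR; rewrite ?nnegrE ?(ltW m0) ?normr_ge0 // ?le_max ?lexx ?normr_ge0.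
have p2 : powR `|t - t'| mu <= powR (Num.max `|s - s'| `|t - t'|) mu.
  by apply: ge0_ler_powR; rewrite ?nnegrE ?(ltW m0) ?normr_ge0 // ?le_max ?lexx ?normr_ge0 ?orbT.
apply: lerD.
  rewrite mulrAC; apply: ler_pM; rewrite ?av_ge0 ?hB' //.
  by apply: le_trans (h mu m0 m1 _ _ Ys Ys') _; apply: ler_wpM2l.
rewrite -mulrA; apply: ler_pM; rewrite ?av_ge0 ?hB //.
by apply: le_trans (h' mu m0 m2 _ _ Yt Yt') _; apply: ler_wpM2l.
Qed.

Lemma hol2_sum (Y : set R) (I : Type) (r : seq I) (F : I -> R -> R -> K) : in01 Y ->
  (forall i, hol2 Y (F i)) -> hol2 Y (fun s t => \sum_(i <- r) F i s t).
Proof.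
move=> Y01 h; elim: r => [|i r [C [nu [C0 n0 IH]]]].
  exists 0, 1; split=> // s t s' t' _ _ _ _.
  by rewrite !big_nil subrr (av0 aK) mul0r.
have [C' [nu' [C0' n0' hi]]] := h i.
exists (C' + C), (Num.min nu nu').
have m0 : 0 < Num.min nu nu' by rewrite lt_min n0.
split=> //; first by rewrite addr_ge0.
move=> s t s' t' Ys Yt Ys' Yt'; rewrite !big_cons opprD addrACA mulrDl.
apply: le_trans (avD aK _ _) _; apply: lerD.
  by apply: (hol2_mono Y01 hi (lexx _)) => //; rewrite ge_min lexx orbT.
by apply: (hol2_mono Y01 IH (lexx _)) => //; rewrite ge_min lexx.
Qed.

End MatrixNorm.

Section Chart.
Variable R : realType.
Implicit Types (L : set (set R[i])) (g h : set R[i]) (X : set R) (P M : R -> R[i]).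

Definition sepset L g1 g2 : set (set R[i]) := fun h => separates L h g1 g2.

(* Coordinates on the leaves separating [g1] and [g2]: the leaf with parameter [s] is oriented from
   [M s] to [P s], coherently in [s]. *)
Record chart L g1 g2 X P M (t1 : R) : Prop := Chart {
  ch_thin : thin X;
  ch_leaf : forall s, X s -> oleaf L (P s) (M s);
  ch_sep : forall h, separates L h g1 g2 <-> exists s, X s /\ h = geod (P s) (M s);
  ch_0 : X 0 /\ g1 = geod (P 0) (M 0);
  ch_1 : [/\ X t1, g2 = geod (P t1) (M t1) & forall s, X s -> s <= t1];
  ch_up : exists2 C : R, 0 <= C & forall s t, X s -> X t -> dol (P s) (M s) (P t) (M t) <= C * `|s - t|;
  ch_low : exists2 C : R, 0 <= C & forall s t a b c e, X s -> X t ->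
    geod a b = geod (P s) (M s) -> geod c e = geod (P t) (M t) -> `|s - t| <= C * dol a b c e;
  ch_gap : forall a b, gap X a b -> P a = P b \/ M a = M b;
  ch_share : forall s t, X s -> X t -> s <= t ->
    (exists x, geod (P s) (M s) x /\ geod (P t) (M t) x) ->
    (forall r, X r -> s <= r <= t -> P r = P s) \/ (forall r, X r -> s <= r <= t -> M r = M s);
  ch_coh : forall s t, X s -> X t -> coherent (P s) (M s) (P t) (M t);
  ch_coh_inv : forall s t p1 m1 p2 m2, X s -> X t -> geod p1 m1 = geod (P s) (M s) ->
    geod p2 m2 = geod (P t) (M t) -> coherent p1 m1 p2 m2 ->
    [/\ p1 = P s, m1 = M s, p2 = P t & m2 = M t] \/ [/\ p1 = M s, m1 = P s, p2 = M t & m2 = P t];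
  ch_sep_lt : forall s t, X s -> X t -> s <= t ->
    separates L (geod (P s) (M s)) (geod (P 0) (M 0)) (geod (P t) (M t)) }.

Variables (K : fieldType) (nK : K -> R) (d : nat).
Hypothesis aK : absval nK.
Variables (L : set (set R[i])) (xi : R[i] -> nat -> 'M[K]_d).
Hypothesis fxi : forall x, bdry L x -> is_flag (xi x).
Hypothesis txi : forall p m, oleaf L p m -> transverse (xi p) (xi m).
Hypothesis hxi : loc_holder nK L xi.
Variables (g1 g2 : set R[i]) (X : set R) (P M : R -> R[i]) (t1 : R).
Hypothesis chX : chart L g1 g2 X P M t1.

Let X01 : in01 X. Proof. by case: (ch_thin chX). Qed.

Lemma geodC (x y : R[i]) : geod x y = geod y x.
Proof. by apply/funext => z; apply/propext; split=> -[]; [right|left|right|left]. Qed.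

Lemma chart_flagP s : X s -> is_flag (xi (P s)).
Proof.
by move=> /(ch_leaf chX)[h _]; apply: fxi; exists (geod (P s) (M s)); split=> //; left.
Qed.
Lemma chart_flagM s : X s -> is_flag (xi (M s)).
Proof.
by move=> /(ch_leaf chX)[h _]; apply: fxi; exists (geod (P s) (M s)); split=> //; right.
Qed.
Lemma chart_transverse s : X s -> transverse (xi (P s)) (xi (M s)).
Proof. by move=> /(ch_leaf chX); apply: txi. Qed.

Lemma dol_ge0 (p m p' m' : R[i]) : 0 <= dol p m p' m'.
Proof. by rewrite /dol le_max; apply/orP; left; case: (p - p') => a b; apply: sqrtr_ge0. Qed.

(** The Lipschitz bound [ch_up] turns Hoelder lifts depending on leaves into Hoelder functions of
    the parameter. *)
Lemma chart_local s : X s -> exists (e : R) (A B : R -> 'M[K]_d),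
  [/\ 0 < e, forall t, near_set X s e t -> frame_of (xi (P t)) (A t) /\ frame_of (xi (M t)) (B t),
   holm nK (near_set X s e) A & holm nK (near_set X s e) B].
Proof.
move=> Xs; have [e [A [nu [Mp [Mm [e0 nu0 h1 h2]]]]]] := hxi (ch_leaf chX Xs).
have [C C0 hC] := ch_up chX.
have e'0 : 0 < e / (C + 1) by rewrite divr_gt0 // ltr_wpDl.
have nr t : near_set X s (e / (C + 1)) t -> oleaf L (P t) (M t) /\ dol (P t) (M t) (P s) (M s) < e.
  move=> [Xt ts]; split; first exact: ch_leaf chX _ Xt.
  apply: le_lt_trans (hC t s Xt Xs) _; move: ts; rewrite ltr_pdivlMr; last lra.
  by have := normr_ge0 (t - s); nra.
have bd t t' : near_set X s (e / (C + 1)) t -> near_set X s (e / (C + 1)) t' ->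
    A * powR (dol (P t) (M t) (P t') (M t')) nu <= `|A| * powR C nu * powR `|t - t'| nu.
  move=> [Xt _] [Xt' _]; rewrite -mulrA -powRM //.
  apply: le_trans (_ : `|A| * powR (dol (P t) (M t) (P t') (M t')) nu <= _).
    by rewrite ler_wpM2r ?powR_ge0 // ler_norm.
  apply: ler_wpM2l => //.
  apply: ge0_ler_powR; rewrite ?nnegrE ?(ltW nu0) ?dol_ge0 ?mulr_ge0 //; exact: hC.
have A0 : 0 <= `|A| * powR C nu by rewrite mulr_ge0 // powR_ge0.
exists (e / (C + 1)), (fun t => Mp (P t) (M t)), (fun t => Mm (P t) (M t)); split=> //.
- by move=> t /nr[ol1 ol2]; apply: h1.
- move=> i j; exists (`|A| * powR C nu), nu; split=> // t t' nt nt'.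
  have [ol1 ol2] := nr t nt; have [ol3 ol4] := nr t' nt'.
  have [hh _] := h2 _ _ _ _ ol1 ol2 ol3 ol4.
  apply: le_trans (bd _ _ nt nt'); apply: le_trans hh.
  by have := mxnorm_entry nK (Mp (P t) (M t) - Mp (P t') (M t')) i j; rewrite !mxE.
- move=> i j; exists (`|A| * powR C nu), nu; split=> // t t' nt nt'.
  have [ol1 ol2] := nr t nt; have [ol3 ol4] := nr t' nt'.
  have [_ hh] := h2 _ _ _ _ ol1 ol2 ol3 ol4.
  apply: le_trans (bd _ _ nt nt'); apply: le_trans hh.
  by have := mxnorm_entry nK (Mm (P t) (M t) - Mm (P t') (M t')) i j; rewrite !mxE.
Qed.

Let F s := xi (P s).
Let G s := xi (M s).

Lemma chart_gapFG a b : gap X a b -> F a = F b \/ G a = G b.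
Proof. by move=> /(ch_gap chX)[e|e]; [left|right]; rewrite /F /G e. Qed.

Lemma chart_parallel : exists A, parallel nK X F G 0 t1 A.
Proof.
have [X0 _] := ch_0 chX; have [X1 _ _] := ch_1 chX.
apply: (parallel_exists aK (ch_thin chX) chart_flagP chart_flagM chart_transverse chart_gapFG chart_local) => //.
by have /andP[] := X01 X1.
Qed.

Lemma chart_seg s : X s -> seg X 0 t1 s.
Proof.
move=> Xs; split=> //; have [_ _ h] := ch_1 chX; rewrite h // andbT.
by have /andP[] := X01 Xs.
Qed.

Lemma chart_geod_inj s t : X s -> X t -> geod (P s) (M s) = geod (P t) (M t) -> s = t.
Proof.
move=> Xs Xt e; have [C C0 h] := ch_low chX.
have := h s t (P s) (M s) (P s) (M s) Xs Xt erefl e.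
have -> : dol (P s) (M s) (P s) (M s) = 0.
  have c0 : @cabs R 0 = 0 by rewrite /cabs /= !expr0n /= addr0 sqrtr0.
  by rewrite /dol !subrr c0 /Num.max; case: ifP.
rewrite mulr0 => h0; apply/eqP; rewrite -subr_eq0 -normr_eq0 eq_le h0 /=; exact: normr_ge0.
Qed.

Section Existence.
Variable A : R -> 'M[K]_d.
Hypothesis pA : parallel nK X F G 0 t1 A.
Variable sig : set R[i] -> R.
Hypothesis sigP : forall s, X s -> sig (geod (P s) (M s)) = s.

(** Transposed because frames consist of rows while a matrix acts on columns: on rows,
    [invmx (A t) *m A s] takes the frame at [t] to the frame at [s]. *)
Definition frame_transport (g h : set R[i]) : 'M[K]_d := (invmx (A (sig h)) *m A (sig g))^T.

Let uA s : X s -> A s \in unitmx.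
Proof. by move=> /chart_seg; case: pA => ad _ _ _ /ad[]. Qed.

Lemma frame_transport_cocycle s t u : X s -> X t -> X u ->
  frame_transport (geod (P s) (M s)) (geod (P t) (M t)) *m
  frame_transport (geod (P t) (M t)) (geod (P u) (M u)) =
  frame_transport (geod (P s) (M s)) (geod (P u) (M u)).
Proof.
move=> Xs Xt Xu; rewrite /frame_transport !sigP // -trmx_mul; congr (_^T).
by rewrite mulmxA mulmxK // uA.
Qed.

Lemma frame_transport_id s : X s ->
  frame_transport (geod (P s) (M s)) (geod (P s) (M s)) = 1%:M.
Proof. by move=> Xs; rewrite /frame_transport !sigP // mulVmx ?trmx1 // uA. Qed.

(** One flag is constant between the two leaves, so the matrix is triangular, and the fan lemmas
    compute its diagonal. *)
Lemma share_unipotent s t : X s -> X t ->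
  (exists x, geod (P s) (M s) x /\ geod (P t) (M t) x) -> unipotent (A s *m invmx (A t)).
Proof.
have lowk r r' : X r -> X r' -> F r = F r' -> lower (A r *m invmx (A r')).
  move=> Xr Xr' e; have [ad _ _ _] := pA.
  have [u1 a1] := ad r (chart_seg Xr); have [u2 a2] := ad r' (chart_seg Xr').
  apply: (same_flag_lower (F := F r)) => // j jd; first by rewrite e; case: (a2 j jd).
  by case: (a1 j jd).
have upk r r' : X r -> X r' -> G r = G r' -> upper (A r *m invmx (A r')).
  move=> Xr Xr' e; have [ad _ _ _] := pA.
  have [u1 a1] := ad r (chart_seg Xr); have [u2 a2] := ad r' (chart_seg Xr').
  apply: (same_flag_upper (G := G r)) => // j jd; first by rewrite e; case: (a2 j jd).
  by case: (a1 j jd).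
have inv r r' : X r -> X r' -> (A r *m invmx (A r')) *m (A r' *m invmx (A r)) = 1%:M.
  by move=> Xr Xr'; rewrite mulmxA mulmxKV ?uA // mulmxV ?uA.
move=> Xs Xt sh; have ge0 r : X r -> 0 <= r by move=> /X01/andP[].
have le1 r : X r -> r <= t1.
  by have [_ _ h] := ch_1 chX; apply: h.
case: (leP s t) => st.
  case: (ch_share chX Xs Xt st sh) => fan.
    have e : F s = F t by rewrite /F (fan t) // st lexx.
    apply: lower_diag1_unipotent => [|i]; first exact: lowk.
    have h : (A t *m invmx (A s)) i i = 1.
      apply: (parallel_fan_lower aK (ch_thin chX) i pA) => //; rewrite ?ge0 ?le1 //.
      by move=> r Xr hr; rewrite /F (fan r).
    have := lower_mul_diag i (lowk _ _ Xs Xt e) (lowk _ _ Xt Xs (esym e)).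
    by rewrite inv // h mulr1 mxE eqxx.
  have e : G s = G t by rewrite /G (fan t) // st lexx.
  apply: upper_diag1_unipotent => [|i]; first exact: upk.
  have h : (A t *m invmx (A s)) i i = 1.
    apply: (parallel_fan_upper aK (ch_thin chX) i pA) => //; rewrite ?ge0 ?le1 //.
    by move=> r Xr hr; rewrite /G (fan r).
  have := upper_mul_diag i (upk _ _ Xs Xt e) (upk _ _ Xt Xs (esym e)).
  by rewrite inv // h mulr1 mxE eqxx.
have sh' : exists x, geod (P t) (M t) x /\ geod (P s) (M s) x by case: sh => x [h1 h2]; exists x.
case: (ch_share chX Xt Xs (ltW st) sh') => fan.
  apply: lower_diag1_unipotent => [|i]; first by apply: lowk => //; rewrite /F (fan s) // lexx ltW.
  apply: (parallel_fan_lower aK (ch_thin chX) i pA) => //; rewrite ?ge0 ?le1 ?ltW //.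
  by move=> r Xr hr; rewrite /F (fan r).
apply: upper_diag1_unipotent => [|i]; first by apply: upk => //; rewrite /G (fan s) // lexx ltW.
apply: (parallel_fan_upper aK (ch_thin chX) i pA) => //; rewrite ?ge0 ?le1 ?ltW //.
by move=> r Xr hr; rewrite /G (fan r).
Qed.

Lemma frame_transport_slithering : slithering nK (sepset L g1 g2) xi frame_transport.
Proof.
have Q h : sepset L g1 g2 h -> exists s, X s /\ h = geod (P s) (M s) by move=> /(ch_sep chX).
have [ad hA hI _] := pA.
have sub s : X s -> seg X 0 t1 s := @chart_seg s.
have hA' : holm nK X A by apply: holm_sub hA.
have hI' : holm nK X (fun s => invmx (A s)) by apply: holm_sub hI.
split.
- move=> h k /Q[s [Xs ->]] /Q[t [Xt ->]]; rewrite /frame_transport !sigP // det_tr det_mulmx.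
  have e : \det (A s) = \det (A t).
    have [X0 _] := ch_0 chX; have [_ _ le1] := ch_1 chX.
    have h0 r : X r -> \det (A 0) = \det (A r).
      move=> Xr; apply: (parallel_det aK (ch_thin chX) chart_gapFG pA) => //; first by have /andP[] := X01 Xr.
      exact: le1.
    by rewrite -(h0 s) // (h0 t).
  by rewrite e -det_mulmx mulVmx ?det1 // uA.
- split.
  + by move=> h /Q[s [Xs ->]]; apply: frame_transport_id.
  + move=> h k /Q[s [Xs ->]] /Q[t [Xt ->]].
    have e := frame_transport_cocycle Xt Xs Xt; rewrite frame_transport_id // in e.
    have [u1 u2] := mulmx1_unit e.
    by rewrite -[LHS]mul1mx -(mulVmx u1) -mulmxA e mulmx1.
  + by move=> h k l /Q[s [Xs ->]] /Q[t [Xt ->]] /Q[u [Xu ->]] _; apply: frame_transport_cocycle.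
- move=> h k Qh Qk.
  have [||C [nu [C0 nu0 hC]]] := @uniform_const R _ (fun (p : 'I_d * 'I_d) C nu => 0 <= C /\
      forall s t s' t', X s -> X t -> X s' -> X t' ->
      nK ((invmx (A t) *m A s) p.1 p.2 - (invmx (A t') *m A s') p.1 p.2) <= C * powR (Num.max `|s - s'| `|t - t'|) nu).
  + move=> p C C' nu nu' [C0 h1] CC n0 nn; split; first lra.
    exact: (hol2_mono (f := fun s t => (invmx (A t) *m A s) p.1 p.2) X01 h1 CC C0 n0 nn).
  + move=> p; have h1 : hol2 nK X (fun s t => \sum_j A s j p.2 * invmx (A t) p.1 j).
      apply: hol2_sum => // j; exact: hol2M.
    have [C [nu [C0 nu0 h2]]] := h1; exists C, nu; split=> //; split=> // s t s' t' Xs Xt Xs' Xt'.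
    have := h2 s t s' t' Xs Xt Xs' Xt'; rewrite !mxE.
    by under eq_bigr do rewrite mulrC; under [X in _ - X]eq_bigr do rewrite mulrC.
  have [Cl Cl0 hl] := ch_low chX.
  exists (C * powR Cl nu + 1), nu; split; first by rewrite ltr_wpDl // mulr_ge0 // powR_ge0.
  split=> // a1 b1 a2 b2 c1 e1 c2 e2 s1 s2 s3 s4.
  have [q1 [Xq1 E1]] := Q _ s1.1; have [q2 [Xq2 E2]] := Q _ s2.1.
  have [r1 [Xr1 E3]] := Q _ s3.1; have [r2 [Xr2 E4]] := Q _ s4.1.
  have l1 := hl _ _ _ _ _ _ Xq1 Xr1 E1 E3; have l2 := hl _ _ _ _ _ _ Xq2 Xr2 E2 E4.
  set D := Num.max _ _.
  have D1 : dol a1 b1 c1 e1 <= D by rewrite le_max lexx.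
  have D2 : dol a2 b2 c2 e2 <= D by rewrite le_max lexx orbT.
  have D0 : 0 <= D by apply: le_trans D1; apply: dol_ge0.
  apply: le_trans (_ : C * powR Cl nu * powR D nu <= _); last first.
    by rewrite ler_wpM2r ?powR_ge0 // lerDl.
  apply: mxnorm_le; first by rewrite !mulr_ge0 ?powR_ge0.
  move=> i j; rewrite E1 E2 E3 E4 /frame_transport !sigP //.
  have [_ h1] := hC (j, i); have := h1 q1 q2 r1 r2 Xq1 Xq2 Xr1 Xr2.
  rewrite /= => {}h1.
  have -> : ((invmx (A q2) *m A q1)^T - (invmx (A r2) *m A r1)^T) i j =
    (invmx (A q2) *m A q1) j i - (invmx (A r2) *m A r1) j i.
    by rewrite [LHS]mxE [X in X + _]mxE [X in _ + X]mxE [X in - X]mxE.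
  apply: le_trans h1 _; rewrite -mulrA -powRM //; apply: ler_wpM2l => //.
  apply: ge0_ler_powR; rewrite ?nnegrE ?(ltW nu0) ?mulr_ge0 // ?le_max ?normr_ge0 //.
  rewrite ge_max; apply/andP; split.
    by apply: le_trans l1 _; apply: ler_wpM2l.
  by apply: le_trans l2 _; apply: ler_wpM2l.
- move=> h k /Q[s [Xs ->]] /Q[t [Xt ->]] sh; rewrite /frame_transport !sigP //.
  apply: unipotent_tr.
  have -> : invmx (A t) *m A s = invmx (A t) *m (A s *m invmx (A t)) *m A t.
    by rewrite !mulmxA mulmxKV // uA.
  by apply: unipotent_conj; [exact: uA|exact: share_unipotent].
- move=> p1 m1 p2 m2 [/Q[s [Xs E1]] _] [/Q[t [Xt E2]] _] coh.
  have e1 : flag_eq (flag_act (frame_transport (geod (P s) (M s)) (geod (P t) (M t))) (xi (P t))) (xi (P s)).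
    move=> j jd; rewrite /flag_act /frame_transport !sigP // trmxK mulmxA.
    have [_ as_] := ad s (sub s Xs); have [_ at_] := ad t (sub t Xt).
    have [k1 _] := as_ j jd; have [k2 _] := at_ j jd.
    apply/eqmxP; apply: eqmx_trans (eqmx_sym (eqmxP k1)).
    apply: eqmx_trans (_ : (pid_mx j *m A t *m invmx (A t) *m A s :=: _)%MS); last by rewrite mulmxK // uA.
    by apply: eqmxMr; apply: eqmxMr; apply/eqmxP.
  have e2 : flag_eq (flag_act (frame_transport (geod (P s) (M s)) (geod (P t) (M t))) (xi (M t))) (xi (M s)).
    move=> j jd; rewrite /flag_act /frame_transport !sigP // trmxK mulmxA.
    have [_ as_] := ad s (sub s Xs); have [_ at_] := ad t (sub t Xt).
    have [_ k1] := as_ (d - j)%N (leq_subr _ _); have [_ k2] := at_ (d - j)%N (leq_subr _ _).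
    rewrite subKn // in k1 k2.
    apply/eqmxP; apply: eqmx_trans (eqmx_sym (eqmxP k1)).
    apply: eqmx_trans (_ : (copid_mx (d - j) *m A t *m invmx (A t) *m A s :=: _)%MS); last by rewrite mulmxK // uA.
    by apply: eqmxMr; apply: eqmxMr; apply/eqmxP.
  (* Reversing both orientations exchanges the roles of [P] and [M], and the same two flag
     identities serve. *)
  case: (ch_coh_inv chX Xs Xt E1 E2 coh) => [[-> -> -> ->]|[-> -> -> ->]]; first by split.
  by rewrite [geod (M s) _]geodC [geod (M t) _]geodC; split.
Qed.

End Existence.

(** Measured against the parallel frame, a slithering map is a matrix [W r] that is diagonal,
    because both carry adapted frames to adapted frames. It is 1 at 0, Hoelder, and unchanged across
    gaps, hence 1. *)
Lemma chart_transport_unique A T : parallel nK X F G 0 t1 A ->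
  slithering nK (sepset L g1 g2) xi T -> T g1 g2 = (invmx (A t1) *m A 0)^T.
Proof.
move=> pA [dT [idT invT coT] hT uT fT].
have [X0 e0] := ch_0 chX; have [X1 e1 le1] := ch_1 chX.
have Q s : X s -> sepset L g1 g2 (geod (P s) (M s)).
  by move=> Xs; apply/(ch_sep chX); exists s.
have [ad hA hI gA] := pA.
have sub s : X s -> seg X 0 t1 s := @chart_seg s.
have uA s : X s -> A s \in unitmx by move=> /sub/ad[].
have t10 : 0 <= t1 by have /andP[] := X01 X1.
pose V s t := (T (geod (P s) (M s)) (geod (P t) (M t)))^T.
have uV s t : X s -> X t -> V s t \in unitmx.
  by move=> Xs Xt; rewrite unitmx_tr unitmxE dT ?unitr1 //; apply: Q.
have adV s t : X s -> X t -> adapted (F s) (G s) (A t *m V s t).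
  move=> Xs Xt; have h := adapted_act (uV s t Xs Xt) (ad t (sub t Xt)).
  have ol1 : oleaf (sepset L g1 g2) (P s) (M s) by split; [exact: Q|case: (ch_leaf chX Xs)].
  have ol2 : oleaf (sepset L g1 g2) (P t) (M t) by split; [exact: Q|case: (ch_leaf chX Xt)].
  have [f1 f2] := fT _ _ _ _ ol1 ol2 (ch_coh chX Xs Xt).
  exact: adapted_eq f1 f2 h.
(* Across a gap [D] is diagonal, and its product with a triangular matrix of unit diagonal is
   conjugate to the unipotent map; this forces [D = 1]. *)
have gapV a b : gap X a b -> A b *m V a b = A a.
  move=> gab; have [Xa Xb ab _] := gab.
  have a0 : 0 <= a by have /andP[] := X01 Xa.
  have bt : b <= t1 by apply: le1.
  pose D := A b *m V a b *m invmx (A a).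
  have Dd (i k : 'I_d) : i != k -> D i k = 0.
    exact: adapted_diag (ad a (sub a Xa)) (adV a b Xa Xb).
  have lD : lower D by move=> i k ik; apply: Dd; apply/eqP => e; rewrite e ltnn in ik.
  have uD : upper D by move=> i k ik; rewrite mxE; apply: Dd; apply/eqP => e; rewrite e ltnn in ik.
  have sh : exists x, geod (P a) (M a) x /\ geod (P b) (M b) x.
    case: (ch_gap chX gab) => e; [exists (P a)|exists (M a)]; rewrite -?e; split; by [left|right|rewrite e; left|rewrite e; right].
  have un : unipotent (A a *m V a b *m invmx (A a)).
    have := unipotent_conj (B := invmx (A a)) _ (unipotent_tr (uT _ _ (Q a Xa) (Q b Xb) sh)).
    by rewrite invmxK unitmx_inv uA //; apply.
  have eD : A a *m V a b *m invmx (A a) = (A a *m invmx (A b)) *m D.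
    by rewrite /D !mulmxA mulmxKV // uA.
  have inv : (A a *m invmx (A b)) *m (A b *m invmx (A a)) = 1%:M.
    by rewrite mulmxA mulmxKV ?uA // mulmxV ?uA.
  have inv' : (A b *m invmx (A a)) *m (A a *m invmx (A b)) = 1%:M.
    by rewrite mulmxA mulmxKV ?uA // mulmxV ?uA.
  have D1 i : D i i = 1.
    have [_ as_] := ad a (sub a Xa); have [_ at_] := ad b (sub b Xb).
    have hg := gA a b gab a0 bt i.
    case: (chart_gapFG gab) => e.
      have l1 : lower (A b *m invmx (A a)).
        by apply: (same_flag_lower (F := F a)) => [|j jd|j jd]; [exact: uA|case: (as_ j jd)|rewrite e; case: (at_ j jd)].
      have l2 : lower (A a *m invmx (A b)).
        by apply: (same_flag_lower (F := F a)) => [|j jd|j jd]; [exact: uA|rewrite e; case: (at_ j jd)|case: (as_ j jd)].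
      have h1 := lower_mul_diag i l2 l1; rewrite inv mxE eqxx hg mulr1 in h1.
      have := lower_unipotent_diag i (lower_mul l2 lD); rewrite -eD => /(_ un).
      by rewrite eD lower_mul_diag // -h1 mul1r.
    have l1 : upper (A b *m invmx (A a)).
      by apply: (same_flag_upper (G := G a)) => [|j jd|j jd]; [exact: uA|case: (as_ j jd)|rewrite e; case: (at_ j jd)].
    have l2 : upper (A a *m invmx (A b)).
      by apply: (same_flag_upper (G := G a)) => [|j jd|j jd]; [exact: uA|rewrite e; case: (at_ j jd)|case: (as_ j jd)].
    have h1 := upper_mul_diag i l2 l1; rewrite inv mxE eqxx hg mulr1 in h1.
    have l3 : upper (A a *m invmx (A b) *m D) by rewrite /upper trmx_mul; apply: lower_mul.
    have := upper_unipotent_diag i l3; rewrite -eD => /(_ un).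
    by rewrite eD upper_mul_diag // -h1 mul1r.
  have D1m : D = 1%:M.
    apply/matrixP => i k; rewrite [RHS]mxE; case: (altP (i =P k)) => [->|ik]; first exact: D1.
    exact: Dd.
  by rewrite -[LHS](mulmxKV (uA a Xa)) -/D D1m mul1mx.
pose W r := A r *m V 0 r *m invmx (A 0).
have W0 : W 0 = 1%:M.
  by rewrite /W /V idT ?trmx1 ?mulmx1 ?mulmxV ?uA //; apply: Q.
have Wc r : X r -> W r = 1%:M.
  move=> Xr; have r0 : 0 <= r by have /andP[] := X01 Xr.
  have rt : r <= t1 by apply: le1.
  apply/matrixP => i k; rewrite [RHS]mxE; case: (altP (i =P k)) => [<-|ik]; last first.
    exact: adapted_diag (ad 0 (sub 0 X0)) (adV 0 r X0 Xr) ik.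
  have -> : 1%:R = W 0 i i by rewrite W0 mxE eqxx.
  have hV : holm nK X (fun r => V 0 r).
    have [B [nu [B0 [nu0 hB]]]] := hT _ _ (Q 0 X0) (Q t1 X1).
    have [C C0 hC] := ch_up chX.
    move=> k' l; exists (B * powR C nu), nu; split=> //; first by rewrite mulr_ge0 ?powR_ge0 // ltW.
    move=> s t Xs Xt.
    have sp q : X q -> separates (sepset L g1 g2) (geod (P q) (M q)) (geod (P 0) (M 0)) (geod (P t1) (M t1)).
      move=> Xq; have := Q q Xq; rewrite /sepset => sq; split=> //.
      by move: sq; rewrite e0 e1 => -[_].
    have := hB _ _ _ _ _ _ _ _ (sp 0 X0) (sp s Xs) (sp 0 X0) (sp t Xt) => h.
    rewrite /V; have h' := mxnorm_entry nK (T (geod (P 0) (M 0)) (geod (P s) (M s)) - T (geod (P 0) (M 0)) (geod (P t) (M t))) l k'.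
    rewrite !mxE in h'; rewrite !mxE; apply: le_trans h' _; apply: le_trans h _.
    rewrite -mulrA -powRM //; apply: ler_wpM2l; first exact: ltW.
    apply: ge0_ler_powR; rewrite ?nnegrE ?(ltW nu0) ?mulr_ge0 //.
      by rewrite le_max dol_ge0.
    rewrite ge_max hC // andbT; apply: le_trans (hC 0 0 X0 X0) _.
    by rewrite subrr normr0 mulr0 mulr_ge0.
  have hA' : holm nK X A by apply: holm_sub hA.
  have hW : holm nK X W.
    apply: holm_mul => //; last exact: holm_cst.
    exact: holm_mul.
  have [C [nu [C0 nu0 h]]] := hW i i.
  apply: esym; apply: (holder_gap_const aK (f := fun r => W r i i) (C := C) (ch_thin chX) nu0 X0 Xr r0).
    by move=> a b Xa Xb _ _ _; apply: h.
  move=> a b gab a0 br; have [Xa Xb ab _] := gab.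
  (* The cocycle rule applies because leaf [a] separates leaf 0 from leaf [b], by [ch_sep_lt]. *)
  have eV : V 0 b = V a b *m V 0 a.
    rewrite /V -trmx_mul coT //; try exact: Q.
    split; first exact: Q.
    by have [_] := ch_sep_lt chX Xa Xb (ltW ab).
  by rewrite /W eV mulmxA (gapV a b gab).
rewrite e0 e1 -[LHS]trmxK; congr (_^T).
have := Wc t1 X1; rewrite /W => h.
have h2 : A t1 *m V 0 t1 = A 0 by rewrite -[LHS](mulmxKV (uA 0 X0)) h mul1mx.
by rewrite -h2 mulKmx // uA.
Qed.

Lemma chart_slithering :
  (exists T, slithering nK (sepset L g1 g2) xi T) /\
  (forall T T', slithering nK (sepset L g1 g2) xi T -> slithering nK (sepset L g1 g2) xi T' ->
     T g1 g2 = T' g1 g2).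
Proof.
have [A pA] := chart_parallel; split; last first.
  by move=> T T' hT hT'; rewrite (chart_transport_unique pA hT) (chart_transport_unique pA hT').
have hs (h : set R[i]) : exists s, forall r, X r -> h = geod (P r) (M r) -> s = r.
  case: (pselect (exists r, X r /\ h = geod (P r) (M r))) => [[s [Xs ->]]|n].
    by exists s => r Xr e; apply: (chart_geod_inj Xs Xr e).
  by exists 0 => r Xr e; case: n; exists r.
have [sig hsig] := choice hs.
exists (frame_transport A sig); apply: frame_transport_slithering pA _ _.
by move=> s Xs; apply: hsig.
Qed.

End Chart.

(** * Angles on the circle *)

Section CircleAngles.
Variable R : realType.
Implicit Types (x y z o : R[i]) (a b c : R).

Lemma cabsE (z : R[i]) : cabs z = Num.sqrt (complex.Re z ^+ 2 + complex.Im z ^+ 2).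
Proof. by case: z. Qed.

Lemma cabsM x y : cabs (x * y) = cabs x * cabs y.
Proof.
case: x y => [a b] [c e]; rewrite /cabs /= -sqrtrM ?addr_ge0 ?sqr_ge0 //.
by congr Num.sqrt; ring.
Qed.

Lemma cabs_ge0 x : 0 <= cabs x.
Proof. by rewrite cabsE sqrtr_ge0. Qed.

Lemma cabs_normc x : cabs x = normc x.
Proof. by case: x. Qed.

Lemma cabsD x y : cabs (x + y) <= cabs x + cabs y.
Proof. by rewrite !cabs_normc le_normcD. Qed.

Lemma cabsN x : cabs (- x) = cabs x.
Proof. by rewrite !cabs_normc normcN. Qed.

Lemma cabs0 : cabs 0 = 0 :> R.
Proof. by rewrite cabs_normc normc0. Qed.

Lemma cabs1 : cabs 1 = 1 :> R.
Proof. by rewrite cabs_normc normc1. Qed.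

Lemma cabs_eq0 x : cabs x = 0 -> x = 0.
Proof. by rewrite cabs_normc => /eq0_normc. Qed.

Lemma cabs_sub x y : cabs (x - y) = cabs (y - x).
Proof. by rewrite -cabsN opprB. Qed.

Lemma cabs_tri x y z : cabs (x - z) <= cabs (x - y) + cabs (y - z).
Proof. by apply: le_trans (cabsD _ _); rewrite addrA subrK. Qed.

Lemma cabsV x : cabs x^-1 = (cabs x)^-1.
Proof. by rewrite !cabs_normc normcV. Qed.

Lemma cabsJ x : cabs (conjc x) = cabs x.
Proof. by case: x => a b; rewrite /cabs /= sqrrN. Qed.

Lemma cabs_sq x : cabs x ^+ 2 = complex.Re x ^+ 2 + complex.Im x ^+ 2.
Proof. by rewrite cabsE sqr_sqrtr // addr_ge0 ?sqr_ge0. Qed.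

Lemma cabs_expi a : cabs (expi a) = 1.
Proof. by rewrite /expi /cabs cos2Dsin2 sqrtr1. Qed.

Lemma expiD a b : expi (a + b) = expi a * expi b.
Proof. by rewrite /expi cosD sinD; apply/eqP; rewrite eq_complex /= [X in _ && (X == _)]addrC mulrC eqxx addrC mulrC eqxx. Qed.

Lemma expi0 : expi 0 = 1 :> R[i].
Proof. by rewrite /expi cos0 sin0. Qed.

Lemma expi2pi : expi (2 * pi) = 1 :> R[i].
Proof.
have -> : 2 * pi = pi *+ 2 :> R by rewrite mulr2n; ring.
by rewrite /expi cos2pi sin2pi.
Qed.

Lemma expi_neq0 a : expi a != 0.
Proof. by apply/eqP => e; have := cabs_expi a; rewrite e cabs0 => /eqP; rewrite eq_sym oner_eq0. Qed.

Lemma chord_expi a b : cabs (expi (2 * a) - expi (2 * b)) = 2 * `|sin (b - a)|.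
Proof.
have h : cabs (expi (2 * a) - expi (2 * b)) ^+ 2 = (2 * `|sin (b - a)|) ^+ 2.
  rewrite cabs_sq /expi /= exprMn real_normK ?num_real // sinB.
  have e2 (t : R) : 2 * t = t + t by ring.
  rewrite !e2 !cosD !sinD.
  have := cos2Dsin2 a; have := cos2Dsin2 b.
  move: (cos a) (sin a) (cos b) (sin b) => ca sa cb sb hb ha.
  transitivity ((ca ^+ 2 + sa ^+ 2 - (cb ^+ 2 + sb ^+ 2)) ^+ 2 + (2 * (sb * ca - cb * sa)) ^+ 2); first by ring.
  by rewrite ha hb; ring.
by apply/eqP; rewrite -(@eqrXn2 _ 2) ?h ?cabs_ge0 ?mulr_ge0.
Qed.

Lemma circle_expi a : circle (expi a).
Proof. exact: cabs_expi. Qed.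

Lemma circleM x y : circle x -> circle y -> circle (x * y).
Proof. by rewrite /circle /= cabsM => -> ->; rewrite mulr1. Qed.

Lemma circleV x : circle x -> circle x^-1.
Proof. by rewrite /circle /= cabsV => ->; rewrite invr1. Qed.

Lemma circle_neq0 x : circle x -> x != 0.
Proof. by move=> cx; apply/eqP => e; move: cx; rewrite /circle /= e cabs0 => /eqP; rewrite eq_sym oner_eq0. Qed.

Lemma expi_exists x : circle x -> exists2 t, 0 <= t < 2 * pi & x = expi t.
Proof.
case: x => c s; rewrite /circle /= => h.
have h2 : c ^+ 2 + s ^+ 2 = 1.
  by rewrite -[LHS]sqr_sqrtr ?addr_ge0 ?sqr_ge0 // h expr1n.
have c1 : -1 <= c <= 1.
  have : c ^+ 2 <= 1 by rewrite -h2 lerDl sqr_ge0.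
  by rewrite expr2; nra.
have hc : cos (acos c) = c by rewrite acosK // in_itv.
have hs : sin (acos c) = `|s|.
  by rewrite sin_acos // -h2 addrC addKr sqrtr_sqr.
have p0 := pi_gt0 R; have a0 := acos_ge0 c1; have ap := acos_lepi c1.
case: (ger0P s) hs => s0 hs.
  by exists (acos c); [apply/andP; split; lra|rewrite /expi hc hs].
exists (2 * pi - acos c).
  have : 0 < acos c.
    rewrite lt_neqAle a0 andbT eq_sym; apply/eqP => e; move: hs; rewrite e sin0; lra.
  by move=> ac; apply/andP; split; lra.
by rewrite expiD expi2pi mul1r /expi cosN sinN hc hs opprK.
Qed.

Lemma sin_sign a : -pi < a -> a < pi -> [/\ (0 < sin a) = (0 < a), (sin a < 0) = (a < 0) & (sin a == 0) = (a == 0)].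
Proof.
move=> a1 a2; case: (ltgtP a 0) => h.
- have : 0 < sin (- a) by apply: sin_gt0_pi; apply/andP; split; lra.
  rewrite sinN => s0; split; first by apply/negbTE; rewrite -leNgt; lra.
    by lra.
  by apply/negbTE; rewrite lt_eqF //; lra.
- have s0 : 0 < sin a by apply: sin_gt0_pi; apply/andP; split; lra.
  split=> //; first by apply/negbTE; rewrite -leNgt; lra.
  by apply/negbTE; rewrite gt_eqF.
- by rewrite h sin0 ltxx eqxx.
Qed.

Lemma expi_inj a b : 0 <= a < pi -> 0 <= b < pi -> expi (2 * a) = expi (2 * b) -> a = b.
Proof.
move=> /andP[a0 a1] /andP[b0 b1] e.
have := chord_expi a b; rewrite e subrr cabs0 => /esym/eqP.
rewrite mulf_eq0 pnatr_eq0 /= normr_eq0.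
have [||_ _ ->] := @sin_sign (b - a); [lra|lra|].
by rewrite subr_eq0 => /eqP.
Qed.

(* half of the counterclockwise angle from [o] to [x], in [[0,pi)] *)
Definition ha o x : R := xget 0 (fun t => 0 <= t < pi /\ x = o * expi (2 * t)).

Lemma haP o x : circle o -> circle x -> 0 <= ha o x < pi /\ x = o * expi (2 * ha o x).
Proof.
move=> co cx; have [t /andP[t0 t1] e] := expi_exists (circleM (circleV co) cx).
rewrite /ha; case: xgetP => [y -> //|h].
case: (h (t / 2)); split; first by apply/andP; split; lra.
by rewrite [2 * _]mulrC divfK ?pnatr_eq0 // -e mulVKf // circle_neq0.
Qed.

Lemma ha_ge0 o x : circle o -> circle x -> 0 <= ha o x.
Proof. by move=> co cx; have [/andP[]] := haP co cx. Qed.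

Lemma ha_ltpi o x : circle o -> circle x -> ha o x < pi.
Proof. by move=> co cx; have [/andP[]] := haP co cx. Qed.

Lemma haE o x : circle o -> circle x -> x = o * expi (2 * ha o x).
Proof. by move=> co cx; have [] := haP co cx. Qed.

Lemma ha_uniq o x a : circle o -> 0 <= a < pi -> x = o * expi (2 * a) -> ha o x = a.
Proof.
move=> co ha_ e; have cx : circle x by rewrite e; apply: circleM => //; apply: circle_expi.
have [h1 h2] := haP co cx; apply: expi_inj => //.
by apply: (mulfI (circle_neq0 co)); rewrite -h2.
Qed.

Lemma haK o a : circle o -> 0 <= a < pi -> ha o (o * expi (2 * a)) = a.
Proof. by move=> co h; apply: ha_uniq. Qed.

Lemma ha_inj o x y : circle o -> circle x -> circle y -> ha o x = ha o y -> x = y.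
Proof. by move=> co cx cy e; rewrite (haE co cx) (haE co cy) e. Qed.

Lemma ha_self o : circle o -> ha o o = 0.
Proof.
by move=> co; apply: ha_uniq => //; rewrite ?lexx ?pi_gt0 // mulr0 expi0 mulr1.
Qed.

Lemma circle1 : circle (1 : R[i]).
Proof. exact: cabs1. Qed.

Lemma expi2D a b : expi (2 * (a + b)) = expi (2 * a) * expi (2 * b).
Proof. by rewrite mulrDr expiD. Qed.

Lemma expi2Dpi a : expi (2 * (a + pi)) = expi (2 * a).
Proof. by rewrite expi2D expi2pi mulr1. Qed.

Lemma ha_base o x y : circle o -> circle x -> circle y ->
  ha x y = if ha o x <= ha o y then ha o y - ha o x else ha o y - ha o x + pi.
Proof.
move=> co cx cy; have [/andP[x0 x1] ex] := haP co cx; have [/andP[y0 y1] ey] := haP co cy.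
have e : y = x * expi (2 * (ha o y - ha o x)).
  by rewrite {1}ey {1}ex -mulrA -expi2D addrC subrK.
case: leP => h; apply: ha_uniq => //; try by apply/andP; split; lra.
by rewrite expi2Dpi.
Qed.

Lemma ccw_angleE o x t : circle o -> circle x -> ccw_angle o x t <-> t = 2 * ha o x.
Proof.
move=> co cx; have [/andP[h0 h1] e] := haP co cx; split=> [[t0 [t1 et]]|->].
  rewrite (@ha_uniq o x (t / 2)) // ?[2 * _]mulrC ?divfK ?pnatr_eq0 //.
  by apply/andP; split; lra.
by split; [lra|split; [lra|]].
Qed.

Definition cyc a b c := [|| (a < b) && (b < c), (b < c) && (c < a) | (c < a) && (a < b)].

Lemma ccw3_ha (a b c : R[i]) : circle a -> circle b -> circle c -> ccw3 a b c <-> 0 < ha a b < ha a c.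
Proof.
move=> ca cb cc; split=> [[tb [tc [/ccw_angleE h1 /ccw_angleE h2 h3 h4]]]|/andP[h1 h2]].
  by move: h3 h4; rewrite h1 // h2 // => h3 h4; apply/andP; split; lra.
exists (2 * ha a b), (2 * ha a c); split; [exact/ccw_angleE|exact/ccw_angleE|lra|lra].
Qed.

(** Cutting the circle at a base point turns cyclic order into linear inequalities between
    half-angles, which linear arithmetic can decide. *)
Lemma ccw3E o (a b c : R[i]) : circle o -> circle a -> circle b -> circle c ->
  ccw3 a b c <-> cyc (ha o a) (ha o b) (ha o c).
Proof.
move=> co ca cb cc; rewrite ccw3_ha // (ha_base co ca cb) (ha_base co ca cc).
have [/andP[? ?] _] := haP co ca; have [/andP[? ?] _] := haP co cb; have [/andP[? ?] _] := haP co cc.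
rewrite /cyc; case: (leP (ha o a) (ha o b)) => h1; case: (leP (ha o a) (ha o c)) => h2; split=> h3; lra.
Qed.

Definition btw a b c := (a < c < b) || (b < c < a).
Definition ext a b c := ((c < a) && (c < b)) || ((a < c) && (b < c)).
(** Crossing of the chords [a b] and [c e] in half-angles: one of [c] and [e] lies strictly between
    [a] and [b], the other strictly outside. *)
Definition spl a b c e := (btw a b c && ext a b e) || (ext a b c && btw a b e).

Lemma geod_eq x y u v : geod x y = geod u v -> (x = u /\ y = v) \/ (x = v /\ y = u).
Proof.
move=> e; have hx : geod u v x by rewrite -e; left.
have hy : geod u v y by rewrite -e; right.
have hu : geod x y u by rewrite e; left.
have hv : geod x y v by rewrite e; right.
case: hx hy hu hv => -> [] -> [] e1 [] e2; rewrite ?e1 ?e2; by [left|right].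
Qed.

Lemma crossesE o x y u v : circle o -> circle x -> circle y -> circle u -> circle v ->
  crosses (geod x y) (geod u v) <-> spl (ha o x) (ha o y) (ha o u) (ha o v).
Proof.
move=> co cx cy cu cv; split.
  move=> [x' [y' [u' [v' [e1 e2 h1 h2]]]]].
  case: (geod_eq e1) (geod_eq e2) h1 h2 => -[<- <-] [] [<- <-]; do 2 rewrite (ccw3E co) //;
  rewrite /spl /btw /ext /cyc; lra.
have cr (x' y' u' v' : R[i]) : ccw3 x' u' y' -> ccw3 y' v' x' -> crosses (geod x' y') (geod u' v').
  by move=> h1 h2; exists x', y', u', v'.
have gC (x' y' : R[i]) : geod x' y' = geod y' x' := geodC x' y'.
rewrite /spl => /orP[]/andP[]; rewrite /btw /ext => h1 h2.
  case/orP: h1 => h1.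
    by apply: cr; apply/(ccw3E co) => //; rewrite /cyc; lra.
  by rewrite gC; apply: cr; apply/(ccw3E co) => //; rewrite /cyc; lra.
case/orP: h2 => h2; rewrite (gC u).
  by apply: cr; apply/(ccw3E co) => //; rewrite /cyc; lra.
by rewrite gC; apply: cr; apply/(ccw3E co) => //; rewrite /cyc; lra.
Qed.

Lemma carcE o p q x : circle o -> circle p -> circle q -> circle x ->
  carc p q x <-> (if ha o p <= ha o q then ha o p <= ha o x <= ha o q
                  else (ha o p <= ha o x) || (ha o x <= ha o q)).
Proof.
move=> co cp cq cx; rewrite /carc /=; split.
  case=> [->|[->|]]; [case: leP; lra|case: leP; lra|].
  move=> /(ccw3E co cp cx cq); rewrite /cyc => h; case: (leP (ha o p) (ha o q)) => h'; lra.
case: (eqVneq (ha o x) (ha o p)) => [/(ha_inj co cx cp) ->|n1]; first by left.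
case: (eqVneq (ha o x) (ha o q)) => [/(ha_inj co cx cq) ->|n2]; first by right; left.
move=> h; right; right; apply/(ccw3E co cp cx cq).
move: h; rewrite !neq_lt in n1 n2; rewrite /cyc; case: (leP (ha o p) (ha o q)) => h' h; lra.
Qed.

End CircleAngles.

(** * Lifts of the circle to the plane *)

Section Moebius.
Variable R : realType.
Implicit Types (x y z u v w : R[i]) (g h : 'M[R[i]]_2).

(* Points of the circle are lifted to vectors of the real plane [R[i]]: [z] lifts [pt z], and SU(1,1) acts
   on lifts by real linear maps preserving the area form [om]. *)
Definition om z w : R := complex.Re z * complex.Im w - complex.Im z * complex.Re w.
Definition act g z : R[i] := g ord0 ord0 * z + g ord0 ord_max * conjc z.
(** The argument of [pt z] is twice that of [z], so real lines through 0 correspond to points of the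
    circle; [hv] picks a unit vector on the line. *)
Definition pt z : R[i] := z / conjc z.
Definition hv x : R[i] := expi (ha 1 x).
Definition rs (r : R) z : R[i] := Complex (r * complex.Re z) (r * complex.Im z).

Lemma omC z w : om z w = - om w z.
Proof. by rewrite /om; ring. Qed.

Lemma om_self z : om z z = 0.
Proof. by rewrite /om; ring. Qed.

Lemma rsE r z : rs r z = (Complex r 0) * z.
Proof. by case: z => a b; apply/eqP; rewrite eq_complex /= !mul0r subr0 addr0 !eqxx. Qed.

Lemma om_rsl r z w : om (rs r z) w = r * om z w.
Proof. by rewrite /om /=; ring. Qed.

Lemma om_rsr r z w : om z (rs r w) = r * om z w.
Proof. by rewrite /om /=; ring. Qed.

Lemma omDl z z' w : om (z + z') w = om z w + om z' w.
Proof. by case: z z' w => ? ? [? ?] [? ?]; rewrite /om /=; ring. Qed.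

Lemma omDr z w w' : om z (w + w') = om z w + om z w'.
Proof. by case: z w w' => ? ? [? ?] [? ?]; rewrite /om /=; ring. Qed.

Lemma om_le z w : `|om z w| <= cabs z * cabs w.
Proof.
rewrite -[X in X <= _]sqrtr_sqr -cabsM cabsE ler_sqrt ?addr_ge0 ?sqr_ge0 //.
case: z w => a b [c e]; rewrite /om /=.
have -> : (a * c - b * e) ^+ 2 + (a * e + b * c) ^+ 2 = (a * e - b * c) ^+ 2 + (a * c + b * e) ^+ 2 by ring.
by rewrite lerDl sqr_ge0.
Qed.

Lemma om_hv x y : om (hv x) (hv y) = sin (ha 1 y - ha 1 x).
Proof. by rewrite /om /hv /expi /= sinB; ring. Qed.

Lemma act_rs g r z : act g (rs r z) = rs r (act g z).
Proof.
rewrite /act !rsE mulrDr; congr (_ + _); first by rewrite mulrCA.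
have -> : conjc (Complex r 0 * z) = Complex r 0 * conjc z.
  by case: z => a b; apply/eqP; rewrite eq_complex /=; apply/andP; split; apply/eqP; ring.
by rewrite mulrCA.
Qed.

Lemma actD g z w : act g (z + w) = act g z + act g w.
Proof.
rewrite /act; case: z w => a b [c e].
have -> : conjc (Complex a b + Complex c e) = conjc (Complex a b) + conjc (Complex c e).
  by apply/eqP; rewrite eq_complex /= opprD !eqxx.
by ring.
Qed.

Lemma su11_det g : su11 g -> exists a b : R[i],
  [/\ g ord0 ord0 = a, g ord0 ord_max = b, g ord_max ord0 = conjc b, g ord_max ord_max = conjc a &
   (complex.Re a ^+ 2 + complex.Im a ^+ 2) - (complex.Re b ^+ 2 + complex.Im b ^+ 2) = 1].
Proof.
move=> [h1 h2 h3]; exists (g ord0 ord0), (g ord0 ord_max); split=> //.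
have e : \det g = g ord0 ord0 * g ord_max ord_max - g ord0 ord_max * g ord_max ord0.
  rewrite (expand_det_row _ ord0) !big_ord_recl big_ord0 addr0 /cofactor !det_mx11 !mxE /=.
  rewrite expr0 mul1r addn1 expr1 mulN1r mulrN.
  congr (g _ _ * g _ _ - g _ _ * g _ _); by apply/val_inj.
move: h3; rewrite e h1 h2; case: (g ord0 ord0) => a1 a2; case: (g ord0 ord_max) => b1 b2.
by move=> /eqP; rewrite eq_complex /= => /andP[/eqP <- _]; ring.
Qed.

Lemma om_act g z w : su11 g -> om (act g z) (act g w) = om z w.
Proof.
move=> /su11_det[a [b [e1 e2 _ _]]]; rewrite /act {}e1 {}e2 /om.
case: a b z w => a1 a2 [b1 b2] [z1 z2] [w1 w2] /= h.
rewrite -[RHS]mul1r -h; ring.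
Qed.

Lemma mat2_eq g h : g ord0 ord0 = h ord0 ord0 -> g ord0 ord_max = h ord0 ord_max ->
  g ord_max ord0 = h ord_max ord0 -> g ord_max ord_max = h ord_max ord_max -> g = h.
Proof.
move=> h1 h2 h3 h4; apply/matrixP => i j.
have k (l : 'I_2) : l = ord0 \/ l = ord_max.
  by case: l => -[|[|//]] hl; [left|right]; apply/val_inj.
by case: (k i) => ->; case: (k j) => ->.
Qed.

Lemma mulmx2E g h i j : (g *m h) i j = g i ord0 * h ord0 j + g i ord_max * h ord_max j.
Proof.
rewrite mxE !big_ord_recl big_ord0 addr0.
by congr (_ + g _ _ * h _ _); apply/val_inj.
Qed.

Lemma act_mul g h z : su11 h -> act (g *m h) z = act g (act h z).
Proof.
move=> /su11_det[a [b [e1 e2 e3 e4 _]]]; rewrite /act !mulmx2E {}e1 {}e2 {}e3 {}e4.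
case: a b z => a1 a2 [b1 b2] [z1 z2]; case: (g _ _) => c1 c2; case: (g _ _) => d1 d2.
by apply/eqP; rewrite eq_complex /=; apply/andP; split; apply/eqP; ring.
Qed.

Lemma act1 z : act 1%:M z = z.
Proof. by rewrite /act !mxE /= mul1r mul0r addr0. Qed.

Lemma actN g z : act (- g) z = - act g z.
Proof. by rewrite /act !mxE; ring. Qed.

Lemma conjc_neq0 z : z != 0 -> conjc z != 0.
Proof. by rewrite conjc_eq0. Qed.

Lemma act_neq0 g z : su11 g -> z != 0 -> act g z != 0.
Proof.
move=> sg z0; apply/eqP => e.
have h w : om z w = 0 by rewrite -(om_act _ _ sg) e /om /=; ring.
have h1 := h (Complex 1 0); have h2 := h (Complex 0 1).
case/eqP: z0; move: h1 h2; rewrite /om; case: z {h e} => a b /= h1 h2.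
by apply/eqP; rewrite eq_complex /=; apply/andP; split; apply/eqP; lra.
Qed.

Lemma conjc_act g z : su11 g -> conjc (act g z) = g ord_max ord0 * z + g ord_max ord_max * conjc z.
Proof.
move=> /su11_det[a [b [e1 e2 e3 e4 _]]]; rewrite /act {}e1 {}e2 {}e3 {}e4.
case: a b z => a1 a2 [b1 b2] [z1 z2].
by apply/eqP; rewrite eq_complex /=; apply/andP; split; apply/eqP; ring.
Qed.

Lemma mob_pt g z : su11 g -> z != 0 -> mob g (pt z) = pt (act g z).
Proof.
move=> sg z0; have c0 := conjc_neq0 z0; rewrite /mob /pt conjc_act // /act.
have a0 : act g z != 0 by apply: act_neq0.
have := conjc_neq0 a0; rewrite conjc_act // => d0.
by field; rewrite c0 d0.
Qed.

Lemma pt_hv x : circle x -> pt (hv x) = x.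
Proof.
move=> cx; rewrite [RHS](haE (circle1 R) cx) mul1r /pt /hv.
move: (ha 1 x) => a; have c0 := conjc_neq0 (expi_neq0 a).
apply: (mulIf c0); rewrite divfK //.
have -> : 2 * a = a + a by ring.
rewrite expiD /expi; have := cos2Dsin2 a; move: (cos a) (sin a) => c s h.
apply/eqP; rewrite eq_complex /=; apply/andP; split; apply/eqP.
  by rewrite -[LHS]mulr1 -h; ring.
by rewrite -[LHS]mulr1 -h; ring.
Qed.

Lemma cabs_hv x : cabs (hv x) = 1.
Proof. exact: cabs_expi. Qed.

Lemma hv_neq0 x : hv x != 0.
Proof. exact: expi_neq0. Qed.

Lemma circle_pt z : z != 0 -> circle (pt z).
Proof.
move=> z0; rewrite /circle /= /pt cabsM cabsV cabsJ divff //.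
by apply/eqP => /cabs_eq0/eqP; apply/negP.
Qed.

Lemma pt_eq z w : z != 0 -> w != 0 -> pt z = pt w <-> om z w = 0.
Proof.
move=> z0 w0; have cz := conjc_neq0 z0; have cw := conjc_neq0 w0.
rewrite /pt; split=> [/eqP|h].
  rewrite eqr_div //; case: z w {z0 w0 cz cw} => a b [c e] /eqP/eqP.
  by rewrite eq_complex /om /= => /andP[_ /eqP h]; lra.
apply/eqP; rewrite eqr_div //; case: z w h {z0 w0 cz cw} => a b [c e]; rewrite /om /= => h.
by rewrite eq_complex /=; apply/andP; split; apply/eqP; nra.
Qed.

Lemma om0_rs z w : z != 0 -> om z w = 0 -> exists r, w = rs r z.
Proof.
move=> z0 h; exists ((complex.Re z * complex.Re w + complex.Im z * complex.Im w) / (complex.Re z ^+ 2 + complex.Im z ^+ 2)).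
have n0 : complex.Re z ^+ 2 + complex.Im z ^+ 2 != 0.
  rewrite -cabs_sq expf_eq0 /=; apply/eqP => /cabs_eq0/eqP; exact/negP.
case: z w z0 h n0 => a b [c e] /= z0; rewrite /om /= => h n0.
apply/eqP; rewrite eq_complex /=; apply/andP; split; apply/eqP; apply: (mulIf n0).
  transitivity ((a * c + b * e) * a + b * (b * c - a * e)); first by ring.
  have -> : b * c - a * e = 0 by lra.
  by field.
transitivity ((a * c + b * e) * b + a * (a * e - b * c)); first by ring.
by rewrite h; field.
Qed.

Lemma lift_rs z : z != 0 -> exists2 r : R, r != 0 & z = rs r (hv (pt z)).
Proof.
move=> z0; have := pt_hv (circle_pt z0) => /(pt_eq (hv_neq0 _) z0) /(om0_rs (hv_neq0 _))[r e].
exists r => //; apply/eqP => r0; case/eqP: z0; rewrite e r0.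
by apply/eqP; rewrite eq_complex /= !mul0r !eqxx.
Qed.

Lemma om_hv_sign x y : circle x -> circle y ->
  [/\ (0 < om (hv x) (hv y)) = (ha 1 x < ha 1 y), (om (hv x) (hv y) < 0) = (ha 1 y < ha 1 x) &
   (om (hv x) (hv y) == 0) = (ha 1 x == ha 1 y)].
Proof.
move=> cx cy; rewrite om_hv; have [/andP[? ?] _] := haP (circle1 R) cx; have [/andP[? ?] _] := haP (circle1 R) cy.
have [||-> -> ->] := @sin_sign _ (ha 1 y - ha 1 x); [lra|lra|].
by rewrite subr_gt0 subr_lt0 subr_eq0 [ha 1 y == _]eq_sym.
Qed.

(** Each vector occurs twice in the product, so its sign depends only on the three points. *)
Lemma ccw3_om u v w : u != 0 -> v != 0 -> w != 0 ->
  ccw3 (pt u) (pt v) (pt w) <-> 0 < om u v * om v w * om u w.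
Proof.
move=> u0 v0 w0; have cu := circle_pt u0; have cv := circle_pt v0; have cw := circle_pt w0.
have [r r0 eu] := lift_rs u0; have [s s0 ev] := lift_rs v0; have [t t0 ew] := lift_rs w0.
rewrite (ccw3E (circle1 R)) //.
have [a1 a2 _] := om_hv_sign cu cv; have [b1 b2 _] := om_hv_sign cv cw; have [c1 c2 _] := om_hv_sign cu cw.
have e1 : om u v = r * s * om (hv (pt u)) (hv (pt v)).
  by move: eu ev; move: (hv _) (hv _) => ? ? -> ->; rewrite om_rsl om_rsr mulrA.
have e2 : om v w = s * t * om (hv (pt v)) (hv (pt w)).
  by move: ev ew; move: (hv _) (hv _) => ? ? -> ->; rewrite om_rsl om_rsr mulrA.
have e3 : om u w = r * t * om (hv (pt u)) (hv (pt w)).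
  by move: eu ew; move: (hv _) (hv _) => ? ? -> ->; rewrite om_rsl om_rsr mulrA.
rewrite e1 e2 e3.
have -> : r * s * om (hv (pt u)) (hv (pt v)) * (s * t * om (hv (pt v)) (hv (pt w))) *
   (r * t * om (hv (pt u)) (hv (pt w))) = (r * s * t) ^+ 2 * (om (hv (pt u)) (hv (pt v)) * om (hv (pt v)) (hv (pt w)) * om (hv (pt u)) (hv (pt w))) by ring.
rewrite pmulr_rgt0; last by rewrite exprn_even_gt0 //= !mulf_neq0.
move: a1 a2 b1 b2 c1 c2; move: (om (hv (pt u)) (hv (pt v))) (om (hv (pt v)) (hv (pt w))) (om (hv (pt u)) (hv (pt w))) => p q m.
move: (ha _ (pt u)) (ha _ (pt v)) (ha _ (pt w)) => a b c.
rewrite /cyc => a1 a2 b1 b2 c1 c2; split=> [/or3P[]/andP[h1 h2]|h].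
- have h3 := lt_trans h1 h2; rewrite -?a1 -?b1 -?c1 in h1 h2 h3; by rewrite !mulr_gt0.
- have h3 := lt_trans h1 h2; rewrite -?a2 -?b1 -?c2 in h1 h2 h3; by rewrite -mulrA nmulr_rgt0 // pmulr_rlt0.
- have h3 := lt_trans h1 h2; rewrite -?a1 -?b2 -?c2 in h1 h2 h3; by rewrite -mulrA pmulr_rgt0 // nmulr_rgt0.
- rewrite -a1 -b1 -c2; case: (ltgtP 0 p) h => [p0|p0|<-]; last by rewrite !mul0r ltxx.
    rewrite -mulrA pmulr_rgt0 //; case: (ltgtP 0 q) => [q0|q0|<-] //; last by rewrite mul0r ltxx.
    by rewrite nmulr_rgt0 // => ->; rewrite orbT.
  rewrite -mulrA nmulr_rgt0 //; case: (ltgtP 0 q) => [q0|q0|<-] //; last by rewrite mul0r ltxx.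
    by rewrite pmulr_rlt0 // => ->.
  rewrite nmulr_rlt0 // => m0; exfalso.
  rewrite a2 in p0; rewrite b2 in q0; rewrite c1 in m0.
  by have := lt_trans q0 p0; rewrite ltNge (ltW m0).
Qed.
End Moebius.

(** * Separation *)

Section Separation.
Variable R : realType.
Variable L : set (set R[i]).
Hypothesis leafL : forall g, L g -> exists x y, [/\ circle x, circle y, x <> y & g = geod x y].
Hypothesis ncL : forall g h, L g -> L h -> ~ crosses g h.
Implicit Types (o p m x y : R[i]) (g h k l : set R[i]).

Lemma leaf_circle x y : L (geod x y) -> [/\ circle x, circle y & x <> y].
Proof.
move=> /leafL[u [v [cu cv uv /geod_eq[[-> ->]|[-> ->]]]]]; split=> //.
by move=> e; apply: uv.
Qed.

Lemma separates_sym h g k : separates L h g k -> separates L h k g.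
Proof.
move=> [Lh [p [q [pq e h1 h2]]]]; split=> //.
by exists q, p; split=> //; [move=> e1; apply: pq|rewrite e geodC].
Qed.

(** Normal form of two uncrossed leaves: counterclockwise from [o] come [p1], [p2], [m2], [m1],
    where only [p2] and [m2] must differ. The leaves separating them run from the arc [p1 p2] to the
    arc [m2 m1] ([separatesE]). *)
Definition labelled o g1 g2 p1 m1 p2 m2 := [/\ g1 = geod p1 m1, g2 = geod p2 m2,
  [/\ circle o, circle p1, circle m1, circle p2 & circle m2] &
  ha o p1 <= ha o p2 /\ ha o p2 < ha o m2 <= ha o m1].

Lemma labelledI o g1 g2 p1 m1 p2 m2 : g1 = geod p1 m1 -> g2 = geod p2 m2 ->
  circle o -> circle p1 -> circle m1 -> circle p2 -> circle m2 ->
  ha o p1 <= ha o p2 -> ha o p2 < ha o m2 -> ha o m2 <= ha o m1 -> labelled o g1 g2 p1 m1 p2 m2.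
Proof. by move=> *; split=> //; split=> //; apply/andP. Qed.

Lemma separatesE o g1 g2 p1 m1 p2 m2 h : labelled o g1 g2 p1 m1 p2 m2 ->
  separates L h g1 g2 <-> L h /\ exists p m, [/\ circle p, circle m, h = geod p m,
    ha o p1 <= ha o p <= ha o p2 & ha o m2 <= ha o m <= ha o m1].
Proof.
move=> [-> -> [co cp1 cm1 cp2 cm2] [q1 q2]]; split.
  move=> [Lh [p [q [pq e h1 h2]]]]; split=> //.
  have [cp cq _] : [/\ circle p, circle q & p <> q] by apply: leaf_circle; rewrite -e.
  have a1 := h1 p1 (or_introl erefl); have a2 := h1 m1 (or_intror erefl).
  have a3 := h2 p2 (or_introl erefl); have a4 := h2 m2 (or_intror erefl).
  move: a1 a2 a3 a4 => /(carcE co cp cq cp1) a1 /(carcE co cp cq cm1) a2.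
  move=> /(carcE co cq cp cp2) a3 /(carcE co cq cp cm2) a4.
  have npq : ha o p != ha o q by apply/eqP => /(ha_inj co cp cq).
  move: npq; rewrite neq_lt => /orP[lt|lt].
    have lt' := lt; rewrite ltNge in lt'.
    rewrite (ltW lt) in a1 a2; rewrite (negbTE lt') in a3 a4.
    by exists p, q; split=> //; lra.
  have lt' := lt; rewrite ltNge in lt'.
  rewrite (ltW lt) in a3 a4; rewrite (negbTE lt') in a1 a2.
  by exists q, p; split=> //; [rewrite e geodC|lra|lra].
move=> [Lh [p [m [cp cm e h1 h2]]]]; split=> //; exists m, p.
have lt : ha o p < ha o m by lra.
have lt' := lt; rewrite ltNge in lt'.
split; [|by rewrite e geodC| |].
- by move=> me; move: lt; rewrite me ltxx.
- move=> z [->|->]; apply/(carcE co) => //; rewrite (negbTE lt'); lra.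
- move=> z [->|->]; apply/(carcE co) => //; rewrite (ltW lt); lra.
Qed.

(** Cut the circle at the endpoint [a] of [g1]. If [g2] does not lie on the arc from [a] to the
    other endpoint [b], it lies on the arc from [b] to [a], and cutting at [b] gives the normal
    form. *)
Lemma label_exists g1 g2 : L g1 -> L g2 -> exists p1 m1 p2 m2, labelled p1 g1 g2 p1 m1 p2 m2.
Proof.
move=> L1 L2; have := ncL L1 L2; have [a [b [ca cb ab e1]]] := leafL L1; have [c [e [cc ce ne e2]]] := leafL L2.
wlog lt : c e cc ce ne e2 / ha a c < ha a e.
  move=> wl; case: (ltgtP (ha a c) (ha a e)) => [lt|lt|/(ha_inj ca cc ce)//]; first exact: (wl c e).
  by apply: (wl e c) => //; [move=> h; apply: ne|rewrite e2 geodC].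
have b0 : 0 < ha a b.
  rewrite lt_neqAle ha_ge0 // andbT -(ha_self ca); apply/eqP => /(ha_inj ca ca cb); exact: ab.
rewrite e1 e2 => /(crossesE ca ca cb cc ce)/negP nc.
have c0 := ha_ge0 ca cc; have epi := ha_ltpi ca ce; have bpi := ha_ltpi ca cb.
case: (leP (ha a e) (ha a b)) => eb.
  by exists a, b, c, e; apply: labelledI; rewrite ?ha_self.
have cb' : ha a c = 0 \/ ha a b <= ha a c.
  case: (leP (ha a b) (ha a c)) => h; [by right|left].
  apply/eqP; rewrite eq_le c0 andbT leNgt; apply/negP => h2.
  by case/negP: nc; rewrite ha_self // /spl /btw /ext; lra.
have be := ha_base ca cb ce; have bc := ha_base ca cb cc; have ba := ha_base ca cb ca.
rewrite ha_self // in ba; rewrite (ltW eb) in be; rewrite leNgt b0 /= in ba.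
case: cb' => hc.
  rewrite hc leNgt b0 /= in bc.
  by exists b, a, e, c; apply: labelledI; rewrite ?ha_self ?ba ?be ?bc //; first [exact: geodC|lra].
rewrite hc in bc; by exists b, a, c, e; apply: labelledI; rewrite ?ha_self ?ba ?be ?bc //; first [exact: geodC|lra].
Qed.

(** In the labelling of [g1] and [g2] the leaves [h] and [k] are nested in one of two orders, and a
    leaf between them has its endpoints in smaller arcs. *)
Lemma separates_trans g1 g2 h k l : L g1 -> L g2 -> separates L h g1 g2 -> separates L k g1 g2 ->
  separates L l h k -> separates L l g1 g2.
Proof.
move=> L1 L2; have [p1 [m1 [p2 [m2 lab]]]] := label_exists L1 L2; have [_ _ [co cp1 cm1 cp2 cm2] [q1 q2]] := lab.
move=> /(separatesE _ lab)[Lh [p [m [cp cm eh b1 b2]]]] /(separatesE _ lab)[Lk [p' [m' [cp' cm' ek b3 b4]]]] sl.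
apply/(separatesE _ lab).
have nc : ~ crosses h k by apply: ncL.
rewrite eh ek in nc; move: nc => /(crossesE co cp cm cp' cm')/negP nc.
rewrite /spl /btw /ext in nc.
have : ((ha p1 p <= ha p1 p') && (ha p1 m' <= ha p1 m)) || ((ha p1 p' <= ha p1 p) && (ha p1 m <= ha p1 m')) by lra.
case/orP => /andP[h1 h2].
  have lab' : labelled p1 h k p m p' m' by apply: labelledI => //; lra.
  have [Ll [x [y [cx cy el c1 c2]]]] := (separatesE _ lab').1 sl.
  by split=> //; exists x, y; split=> //; lra.
have lab' : labelled p1 k h p' m' p m by apply: labelledI => //; lra.
have [Ll [x [y [cx cy el c1 c2]]]] := (separatesE _ lab').1 (separates_sym sl).
by split=> //; exists x, y; split=> //; lra.
Qed.

Lemma separates_l g1 g2 : L g1 -> L g2 -> separates L g1 g1 g2.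
Proof.
move=> L1 L2; have [p1 [m1 [p2 [m2 lab]]]] := label_exists L1 L2; have [e1 _ [co cp1 cm1 cp2 cm2] [q1 q2]] := lab.
by apply/(separatesE _ lab); split=> //; exists p1, m1; split=> //; lra.
Qed.

Lemma separates_r g1 g2 : L g1 -> L g2 -> separates L g2 g1 g2.
Proof. by move=> L1 L2; apply: separates_sym; apply: separates_l. Qed.

End Separation.

(** * Crossing and distances under Moebius maps *)

Section MoebiusAction.
Variable R : realType.
Implicit Types (x y z u v w : R[i]) (g h : 'M[R[i]]_2).

Lemma btw_om x y z : circle x -> circle y -> circle z ->
  btw (ha 1 x) (ha 1 y) (ha 1 z) = (0 < om (hv x) (hv z) * om (hv z) (hv y)) /\
  ext (ha 1 x) (ha 1 y) (ha 1 z) = (om (hv x) (hv z) * om (hv z) (hv y) < 0).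
Proof.
move=> cx cy cz; have [a1 a2 a3] := om_hv_sign cx cz; have [b1 b2 b3] := om_hv_sign cz cy.
rewrite /btw /ext -a1 -a2 -b1 -b2; move: (om (hv x) (hv z)) (om (hv z) (hv y)) => p q {a1 a2 a3 b1 b2 b3}.
case: (ltgtP 0 p) => [p0|p0|<-]; rewrite ?mul0r ?ltxx /= ?andbF ?orbF; last by split.
  by rewrite pmulr_rgt0 // pmulr_rlt0 // ?andbT ?andbF ?orbF; split.
by rewrite nmulr_rgt0 // nmulr_rlt0 // ?andbT ?andbF ?orbF; split.
Qed.

Lemma om_lift4 (a b c e : R[i]) : a != 0 -> b != 0 -> c != 0 -> e != 0 -> exists2 k : R, 0 < k &
  om a c * om c b * (om a e * om e b) =
  k * (om (hv (pt a)) (hv (pt c)) * om (hv (pt c)) (hv (pt b)) * (om (hv (pt a)) (hv (pt e)) * om (hv (pt e)) (hv (pt b)))).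
Proof.
move=> a0 b0 c0 e0.
have [r r0 ea] := lift_rs a0; have [s s0 eb] := lift_rs b0.
have [t t0 ec] := lift_rs c0; have [q q0 ee] := lift_rs e0.
exists ((r * s * t * q) ^+ 2); first by rewrite exprn_even_gt0 //= !mulf_neq0.
move: ea eb ec ee; move: (hv _) (hv _) (hv _) (hv _) => ? ? ? ? -> -> -> ->.
by rewrite !om_rsl !om_rsr; ring.
Qed.

Lemma crosses_om (a b c e : R[i]) : a != 0 -> b != 0 -> c != 0 -> e != 0 ->
  crosses (geod (pt a) (pt b)) (geod (pt c) (pt e)) <-> om a c * om c b * (om a e * om e b) < 0.
Proof.
move=> a0 b0 c0 e0; have [k k0 ->] := om_lift4 a0 b0 c0 e0.
have ca := circle_pt a0; have cb := circle_pt b0; have cc := circle_pt c0; have ce := circle_pt e0.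
rewrite (crossesE (circle1 R)) // pmulr_rlt0 // /spl.
have [-> ->] := btw_om ca cb cc; have [-> ->] := btw_om ca cb ce.
move: (om (hv (pt a)) (hv (pt c)) * _) (om (hv (pt a)) (hv (pt e)) * _) => p q.
case: (ltgtP 0 p) => [p0|p0|<-]; last by rewrite mul0r ltxx.
  by rewrite pmulr_rlt0 //= ?orbF ?andbT.
by rewrite nmulr_rlt0 //= ?orbF ?andbT.
Qed.

Lemma chord_om z w : z != 0 -> w != 0 -> cabs (pt z - pt w) = 2 * `|om z w| / (cabs z * cabs w).
Proof.
move=> z0 w0; have cz := conjc_neq0 z0; have cw := conjc_neq0 w0.
have nz (t : R[i]) : t != 0 -> cabs t != 0.
  by move=> t0; apply/eqP => /cabs_eq0/eqP; apply/negP.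
have -> : pt z - pt w = (z * conjc w - w * conjc z) / (conjc z * conjc w).
  by rewrite /pt; field; rewrite cz cw.
rewrite cabsM cabsV cabsM !cabsJ; congr (_ / _).
case: z w {z0 w0 cz cw} => a b [c e]; rewrite /cabs /om /=.
have -> : (a * c - b * - e - (c * a - e * - b)) = 0 by ring.
have -> : a * - e + b * c - (c * - b + e * a) = - (2 * (a * e - b * c)) by ring.
by rewrite expr0n add0r sqrrN sqrtr_sqr normrM ger0_norm.
Qed.

(** Its inverse square is the derivative of [g] along the circle at [x]; [chord_mob] is the
    two-point form of this. *)
Definition nz g x : R := cabs (act g (hv x)).

Lemma nz_gt0 g x : su11 g -> 0 < nz g x.
Proof.
move=> sg; rewrite lt_neqAle cabs_ge0 andbT eq_sym; apply/eqP => /cabs_eq0/eqP.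
by apply/negP; apply: act_neq0 => //; apply: hv_neq0.
Qed.

Lemma mob_hv g x : su11 g -> circle x -> mob g x = pt (act g (hv x)).
Proof. by move=> sg cx; rewrite -{1}(pt_hv cx) mob_pt // hv_neq0. Qed.

Lemma circle_mob g x : su11 g -> circle x -> circle (mob g x).
Proof. by move=> sg cx; rewrite mob_hv //; apply: circle_pt; apply: act_neq0 => //; apply: hv_neq0. Qed.

Lemma chord_hv x y : circle x -> circle y -> cabs (x - y) = 2 * `|om (hv x) (hv y)|.
Proof.
move=> cx cy; rewrite -{1}(pt_hv cx) -{1}(pt_hv cy) chord_om ?hv_neq0 // !cabs_hv.
by rewrite mulr1 divr1.
Qed.

Lemma chord_mob g x y : su11 g -> circle x -> circle y ->
  cabs (mob g x - mob g y) = cabs (x - y) / (nz g x * nz g y).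
Proof.
move=> sg cx cy; rewrite !mob_hv // chord_om ?act_neq0 ?hv_neq0 // om_act //.
by rewrite chord_hv.
Qed.

Lemma mob_inj g x y : su11 g -> circle x -> circle y -> mob g x = mob g y -> x = y.
Proof.
move=> sg cx cy e; have := chord_mob sg cx cy; rewrite e subrr cabs0 => /esym/eqP.
rewrite mulf_eq0 invr_eq0 mulf_eq0 (gt_eqF (nz_gt0 x sg)) (gt_eqF (nz_gt0 y sg)) !orbF => /eqP/cabs_eq0/eqP.
by rewrite subr_eq0 => /eqP.
Qed.

Lemma mob1 x : mob 1%:M x = x.
Proof. by rewrite /mob !mxE /= mul1r mul0r !add0r addr0 divr1. Qed.

Lemma mob_mul g h x : su11 g -> su11 h -> circle x -> mob (g *m h) x = mob g (mob h x).
Proof.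
move=> sg sh cx; have h0 := hv_neq0 x; have a0 := act_neq0 sh h0.
rewrite -{1 2}(pt_hv cx) (mob_pt sh) // (mob_pt sg) //.
rewrite {1}/mob /pt -!act_mul //.
have e : act (g *m h) (hv x) != 0 by rewrite act_mul //; apply: act_neq0.
have ec : conjc (act (g *m h) (hv x)) = (g *m h) ord_max ord0 * hv x + (g *m h) ord_max ord_max * conjc (hv x).
  rewrite act_mul // conjc_act //; have [a [b [e1 e2 e3 e4 _]]] := su11_det sh.
  rewrite !mulmx2E e1 e2 e3 e4 conjc_act // /act e1 e2 e3 e4.
  by ring.
have := conjc_neq0 e; rewrite ec => d0; have c0 := conjc_neq0 h0.
by rewrite /act; field; rewrite c0 d0.
Qed.

Lemma ccw3_mob g x y z : su11 g -> circle x -> circle y -> circle z ->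
  ccw3 (mob g x) (mob g y) (mob g z) <-> ccw3 x y z.
Proof.
move=> sg cx cy cz; rewrite !mob_hv // ccw3_om ?act_neq0 ?hv_neq0 // !om_act //.
by rewrite -ccw3_om ?hv_neq0 // !pt_hv.
Qed.

Lemma crosses_mob g x y z w : su11 g -> circle x -> circle y -> circle z -> circle w ->
  crosses (geod (mob g x) (mob g y)) (geod (mob g z) (mob g w)) <-> crosses (geod x y) (geod z w).
Proof.
move=> sg cx cy cz cw; rewrite !mob_hv // crosses_om ?act_neq0 ?hv_neq0 // !om_act //.
by rewrite -crosses_om ?hv_neq0 // !pt_hv.
Qed.

Lemma mob_geod g x y : (fun t => exists2 z, geod x y z & mob g z = t) = geod (mob g x) (mob g y).
Proof.
apply/funext => t; apply/propext; split=> [[z [->|->] <-]|[->|->]]; [by left|by right| |].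
  by exists x => //; left.
by exists y => //; right.
Qed.

Lemma image_mob_geod g x y : (mob g @` geod x y)%classic = geod (mob g x) (mob g y).
Proof. exact: mob_geod. Qed.

Lemma carc_mob g x y z : su11 g -> circle x -> circle y -> circle z ->
  carc x y z -> carc (mob g x) (mob g y) (mob g z).
Proof.
move=> sg cx cy cz [->|[->|h]]; [by left|by right; left|right; right].
exact/ccw3_mob.
Qed.

(** Expand [z] in the unimodular basis [v, w]: the coefficients are area forms, bounded by [B] times
    the length of [z]. *)
Lemma act_bound g v w z B : su11 g -> om v w = 1 -> cabs v <= B -> cabs w <= B ->
  cabs (act g v) <= B -> cabs (act g w) <= B -> cabs (act g z) <= 2 * B ^+ 2 * cabs z.
Proof.
move=> sg e vB wB gv gw.
have ez : z = rs (om z w) v + rs (om v z) w.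
  move: e; case: v w z {vB wB gv gw} => a b [c d'] [p q]; rewrite /om /= => e.
  by apply/eqP; rewrite eq_complex /=; apply/andP; split; apply/eqP; rewrite -[LHS]mulr1 -e; ring.
have B0 : 0 <= B by apply: le_trans vB; apply: cabs_ge0.
have cr r (t : R[i]) : cabs (rs r t) = `|r| * cabs t.
  by rewrite rsE cabsM /cabs expr0n addr0 sqrtr_sqr.
rewrite {1}ez actD !act_rs; apply: le_trans (cabsD _ _) _; rewrite !cr.
have h1 : `|om z w| <= cabs z * B by apply: le_trans (om_le _ _) _; rewrite ler_wpM2l ?cabs_ge0.
have h2 : `|om v z| <= B * cabs z by apply: le_trans (om_le _ _) _; rewrite ler_wpM2r ?cabs_ge0.
have h3 := ler_pM (normr_ge0 _) (cabs_ge0 _) h1 gv.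
have h4 := ler_pM (normr_ge0 _) (cabs_ge0 _) h2 gw.
lra.
Qed.

End MoebiusAction.

(** * Fuchsian groups *)

Section Fuchsian.
Variable R : realType.
Implicit Types (x y z u v w : R[i]) (g h : 'M[R[i]]_2).
Variable G : set 'M[R[i]]_2.
Hypothesis fG : cocompact_fuchsian G.

Lemma G_su11 g : G g -> su11 g.
Proof. by case: fG => -[h _ _ _ _] _ _ _; apply: h. Qed.
Lemma G_1 : G 1%:M.
Proof. by case: fG => -[_ h _ _ _] _ _ _. Qed.
Lemma G_mul g h : G g -> G h -> G (g *m h).
Proof. by case: fG => -[_ _ _ k _] _ _ _; apply: k. Qed.
Lemma G_inv g : G g -> G (invmx g).
Proof. by case: fG => -[_ _ _ _ k] _ _ _; apply: k. Qed.
Lemma G_exp g n : G g -> G (g ^+ n).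
Proof. by move=> Gg; elim: n => [|n IH]; [exact: G_1|rewrite exprS; exact: G_mul]. Qed.

Lemma su11_unit g : su11 g -> g \in unitmx.
Proof. by move=> [_ _ h]; rewrite unitmxE h unitr1. Qed.

Lemma G_unit g : G g -> g \in unitmx.
Proof. by move=> /G_su11 /su11_unit. Qed.

Lemma act_invK g z : G g -> act (invmx g) (act g z) = z.
Proof. by move=> Gg; rewrite -act_mul ?mulVmx ?act1 ?G_unit //; apply: G_su11. Qed.

Lemma act_Kinv g z : G g -> act g (act (invmx g) z) = z.
Proof. by move=> Gg; rewrite -act_mul ?mulmxV ?act1 ?G_unit //; apply: G_su11; apply: G_inv. Qed.

Lemma mob_invK g x : G g -> circle x -> mob (invmx g) (mob g x) = x.
Proof.
move=> Gg cx; rewrite -mob_mul ?mulVmx ?mob1 ?G_unit //; apply: G_su11 => //; exact: G_inv.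
Qed.

Lemma mob_Kinv g x : G g -> circle x -> mob g (mob (invmx g) x) = x.
Proof.
move=> Gg cx; rewrite -mob_mul ?mulmxV ?mob1 ?G_unit //; apply: G_su11 => //; exact: G_inv.
Qed.

Lemma cabs_rs r z : cabs (rs r z) = `|r| * cabs z.
Proof. by rewrite rsE cabsM /cabs expr0n addr0 sqrtr_sqr. Qed.

(** Bounds on a unimodular basis and on its image bound the matrix entries, so discreteness leaves
    finitely many elements. The finiteness arguments below go through this list. *)
Lemma discrete_list B : exists s : seq 'M[R[i]]_2, forall g v w, G g -> om v w = 1 ->
  cabs v <= B -> cabs w <= B -> cabs (act g v) <= B -> cabs (act g w) <= B -> g \in s.
Proof.
have [_ /(_ (2 * B ^+ 2)) /finite_seqP[s hs] _ _] := fG.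
exists s => g v w Gg e vB wB gv gw; have sg := G_su11 Gg.
have : [set` s]%classic g; last by [].
rewrite -hs; split=> //.
have h1 := act_bound (Complex 1 0) sg e vB wB gv gw.
have h2 := act_bound (Complex 0 1) sg e vB wB gv gw.
have c1 : cabs (Complex 1 0) = 1 :> R by rewrite /cabs expr0n addr0 expr1n sqrtr1.
have c2 : cabs (Complex 0 1) = 1 :> R by rewrite /cabs expr0n add0r expr1n sqrtr1.
rewrite c1 mulr1 in h1; rewrite c2 mulr1 in h2.
have [a [b [e1 e2 e3 e4 _]]] := su11_det sg.
have half (t t' t'' : R[i]) : t + t = t' + t'' -> cabs t' <= 2 * B ^+ 2 -> cabs t'' <= 2 * B ^+ 2 -> cabs t <= 2 * B ^+ 2.
  move=> et b1 b2; have : cabs (t + t) = 2 * cabs t.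
    have -> : t + t = rs 2 t by rewrite rsE; case: (t) => p q; apply/eqP; rewrite eq_complex /=; apply/andP; split; apply/eqP; ring.
    by rewrite cabs_rs ger0_norm.
  by rewrite et => h; have := cabsD t' t''; lra.
have ci (t : R[i]) : cabs (Complex 0 1 * t) = cabs t by rewrite cabsM c2 mul1r.
have ba : cabs a <= 2 * B ^+ 2.
  apply: (half a (act g (Complex 1 0)) (- (Complex 0 1 * act g (Complex 0 1)))) => //; last by rewrite cabsN ci.
  rewrite /act e1 e2; case: (a) (b) => a1 a2 [b1 b2].
  by apply/eqP; rewrite eq_complex /=; apply/andP; split; apply/eqP; ring.
have bb : cabs b <= 2 * B ^+ 2.
  apply: (half b (act g (Complex 1 0)) (Complex 0 1 * act g (Complex 0 1))) => //; last by rewrite ci.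
  rewrite /act e1 e2; case: (a) (b) => a1 a2 [b1 b2].
  by apply/eqP; rewrite eq_complex /=; apply/andP; split; apply/eqP; ring.
have k (l : 'I_2) : l = ord0 \/ l = ord_max.
  by case: l => -[|[|//]] hl; [left|right]; apply/val_inj.
by move=> i j; case: (k i) => ->; case: (k j) => ->; rewrite ?e1 ?e2 ?e3 ?e4 ?cabsJ.
Qed.

Lemma disk_bound (k l q : R) : k ^+ 2 - l ^+ 2 = 1 -> 0 <= q -> q < 1 -> 0 <= k -> 0 <= l ->
  l <= q * k -> k <= 1 / (1 - q ^+ 2).
Proof.
rewrite !expr2 => h q0 q1 k0 l0 lq.
have q2 : 0 < 1 - q * q by nra.
rewrite ler_pdivlMr //.
have h1 : l * l <= q * k * (q * k) by apply: ler_pM.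
have l2 : 0 <= l * l by apply: mulr_ge0.
have k2 : 1 <= k * k by lra.
have k3 : 1 <= k by nra.
have k4 : k * k * (1 - q * q) <= 1 by lra.
have k5 : 0 <= k * (1 - q * q) * (k - 1) by rewrite !mulr_ge0 //; lra.
lra.
Qed.

(** Unimodular bases of the real plane correspond to elements of SL(2,R), so this expresses
    compactness of its quotient by the group. *)
Lemma cocompact_basis : exists2 C : R, 1 <= C & forall v w, om v w = 1 ->
  exists g, [/\ G g, cabs (act g v) <= C & cabs (act g w) <= C].
Proof.
have [_ _ _ [r [r1 hr]]] := fG.
pose r' := Num.max r 0.
have r'0 : 0 <= r' by rewrite le_max lexx orbT.
have r'1 : r' < 1 by rewrite gt_max r1 ltr01.
have d0 : 0 < 1 - r' ^+ 2 by rewrite subr_gt0 expr2; nra.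
exists (2 / (1 - r' ^+ 2) + 1); first by rewrite lerDr divr_ge0 // ltW.
move=> v w e.
(* [z |-> al * z + be * conjc z] sends 1 and the imaginary unit to [v] and [w]; the corresponding
   Moebius map sends the origin to [be / conjc al], to which cocompactness is applied. *)
pose al := (v - Complex 0 1 * w) / 2; pose be := (v + Complex 0 1 * w) / 2.
have h2 (t : R[i]) : t / 2 = rs (1/2) t.
  have -> : (2 : R[i]) = Complex 2 0.
    by rewrite mulr2n; apply/eqP; rewrite eq_complex /= addr0 -mulr2n !eqxx.
  apply: (mulIf (_ : Complex 2 0 != 0 :> R[i])); first by rewrite eq_complex /= negb_and pnatr_eq0.
  rewrite divfK; last by rewrite eq_complex /= negb_and pnatr_eq0.
  by case: t => p q; apply/eqP; rewrite eq_complex /=; apply/andP; split; apply/eqP; lra.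
have ev : al + be = v by rewrite /al /be !h2; case: (v) (w) => p q [s t]; apply/eqP; rewrite eq_complex /=; apply/andP; split; apply/eqP; lra.
have ew : Complex 0 1 * (al - be) = w by rewrite /al /be !h2; case: (v) (w) => p q [s t]; apply/eqP; rewrite eq_complex /=; apply/andP; split; apply/eqP; lra.
have nrm : cabs al ^+ 2 - cabs be ^+ 2 = 1.
  rewrite -[RHS]e !cabs_sq /al /be !h2 /om; case: (v) (w) => p q [s t] /=; by field.
have a0 : al != 0.
  by apply/eqP => a0; move: nrm; rewrite a0 cabs0; have := sqr_ge0 (cabs be); rewrite expr0n /=; lra.
have ca0 : 0 < cabs al.
  by rewrite lt_neqAle cabs_ge0 andbT eq_sym; apply/eqP => /cabs_eq0/eqP; apply/negP.
have jz : conjc al != 0 by rewrite conjc_eq0.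
have z1 : cabs (be / conjc al) < 1.
  rewrite cabsM cabsV cabsJ ltr_pdivrMr // mul1r -(@ltr_pXn2r _ 2) ?nnegrE ?cabs_ge0 //; lra.
have [g [u [Gg ur eu]]] := hr _ z1.
have ur' : cabs u <= r' by rewrite le_max ur.
exists (invmx g); have sg := G_su11 Gg.
have [a [b [e1 e2 e3 e4 det]]] := su11_det sg.
have u1 : cabs u < 1 by lra.
have den : conjc b * u + conjc a != 0.
  apply/eqP => de; have : conjc a = - (conjc b * u) by apply/eqP; rewrite -addr_eq0 addrC de.
  move=> /(congr1 (@cabs R)); rewrite cabsN cabsM !cabsJ => h.
  have : cabs a ^+ 2 - cabs b ^+ 2 = 1 by rewrite !cabs_sq.
  have : 0 <= cabs b ^+ 2 * (1 - cabs u ^+ 2).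
    by apply: mulr_ge0; rewrite ?sqr_ge0 // expr2; have := cabs_ge0 u; nra.
  rewrite h; lra.
have detl : a * conjc a - b * conjc b = 1.
  move: det; clear; case: a b => a1 a2 [b1 b2] /= det.
  by apply/eqP; rewrite eq_complex /=; apply/andP; split; apply/eqP; lra.
have si := G_su11 (G_inv Gg).
have [i1 i2] : invmx g ord0 ord0 = conjc a /\ invmx g ord0 ord_max = - b.
  have := mulVmx (G_unit Gg) => /matrixP h.
  have k1 := h ord0 ord0; have k2 := h ord0 ord_max.
  rewrite !mulmx2E !mxE /= e1 e2 e3 e4 in k1 k2.
  move: k1 k2; move: (invmx g ord0 ord0) (invmx g ord0 ord_max) => p q k1 k2; split.
    transitivity (conjc a * (p * a + q * conjc b) - conjc b * (p * b + q * conjc a)).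
      by rewrite -[LHS]mulr1 -detl; ring.
    by rewrite k1 k2 mulr1 mulr0 subr0.
  transitivity (a * (p * b + q * conjc a) - b * (p * a + q * conjc b)).
    by rewrite -[LHS]mulr1 -detl; ring.
  by rewrite k1 k2 mulr0 mulr1 sub0r.
(* Coefficients of that map followed by the inverse of [g]. The composite sends the origin to [u],
   in the disk of radius [r'], which bounds both coefficients by [disk_bound]. *)
pose ka := conjc a * al - b * conjc be; pose la := conjc a * be - b * conjc al.
have kl : la = u * conjc ka.
  have eb : be = (a * u + b) / (conjc b * u + conjc a) * conjc al.
    by move: eu; rewrite /mob e1 e2 e3 e4 => <-; rewrite divfK.
  have cka : conjc ka = a * conjc al - conjc b * be.
    rewrite /ka; clear; case: a b al be => a1 a2 [b1 b2] [c1 c2] [d1 d2].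
    by apply/eqP; rewrite eq_complex /=; apply/andP; split; apply/eqP; ring.
  have c1 : conjc ka = conjc al / (conjc b * u + conjc a).
    rewrite cka eb -[conjc al in RHS]mulr1 -detl; field; exact: den.
  rewrite c1 /la eb -[conjc al in RHS]mulr1 -detl; field; exact: den.
have nk : cabs ka ^+ 2 - cabs la ^+ 2 = 1.
  rewrite -nrm !cabs_sq; transitivity ((complex.Re a ^+ 2 + complex.Im a ^+ 2 - (complex.Re b ^+ 2 + complex.Im b ^+ 2)) *
     (complex.Re al ^+ 2 + complex.Im al ^+ 2 - (complex.Re be ^+ 2 + complex.Im be ^+ 2))); last by rewrite det mul1r.
  rewrite /ka /la; clear; case: a b al be => a1 a2 [b1 b2] [c1 c2] [d1 d2] /=; ring.
have nl : cabs la <= r' * cabs ka.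
  by rewrite kl cabsM cabsJ ler_wpM2r ?cabs_ge0.
have kb : cabs ka <= 1 / (1 - r' ^+ 2) by apply: disk_bound nk _ _ _ _ nl; rewrite ?cabs_ge0.
have lb : cabs la <= cabs ka by have := cabs_ge0 ka; nra.
have dd : 2 / (1 - r' ^+ 2) = 1 / (1 - r' ^+ 2) + 1 / (1 - r' ^+ 2) by field; rewrite gt_eqF.
have B0 : 0 <= 1 / (1 - r' ^+ 2) by rewrite divr_ge0 // ltW.
split; first exact: G_inv.
  have -> : act (invmx g) v = ka + la.
    rewrite /act i1 i2 -ev /ka /la; clear; case: a b al be => a1 a2 [b1 b2] [c1 c2] [d1 d2].
    by apply/eqP; rewrite eq_complex /=; apply/andP; split; apply/eqP; ring.
  by have := cabsD ka la; lra.
have -> : act (invmx g) w = Complex 0 1 * (ka - la).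
  rewrite /act i1 i2 -ew /ka /la; clear; case: a b al be => a1 a2 [b1 b2] [c1 c2] [d1 d2].
  by apply/eqP; rewrite eq_complex /=; apply/andP; split; apply/eqP; ring.
have -> : cabs (Complex 0 1 * (ka - la)) = cabs (ka - la).
  by rewrite cabsM {1}/cabs expr0n add0r expr1n sqrtr1 mul1r.
by have := cabsD ka (- la); rewrite cabsN; lra.
Qed.

End Fuchsian.

(** * Absence of elliptic and parabolic elements *)

Section FuchsianDynamics.
Variable R : realType.
Implicit Types (x y z u v w : R[i]) (g h : 'M[R[i]]_2).
Variable G : set 'M[R[i]]_2.
Hypothesis fG : cocompact_fuchsian G.

Local Notation c1 := (Complex 1 0 : R[i]).
Local Notation ci := (Complex 0 1 : R[i]).

Definition tr g : R := 2 * complex.Re (g ord0 ord0).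

Lemma rsD r s z : rs (r + s) z = rs r z + rs s z.
Proof. by rewrite !rsE -mulrDl; congr (_ * _); apply/eqP; rewrite eq_complex /= addr0 !eqxx. Qed.
Lemma rsA r s z : rs r (rs s z) = rs (r * s) z.
Proof. by apply/eqP; rewrite eq_complex /= !mulrA !eqxx. Qed.
Lemma rs1 z : rs 1 z = z.
Proof. by case: z => a b; rewrite /rs /= !mul1r. Qed.
Lemma rs0 z : rs 0 z = 0.
Proof. by case: z => a b; rewrite /rs /= !mul0r. Qed.
Lemma rsN r z : rs (- r) z = - rs r z.
Proof. by case: z => a b; apply/eqP; rewrite eq_complex /= !mulNr !eqxx. Qed.
Lemma rsDr r z w : rs r (z + w) = rs r z + rs r w.
Proof. by rewrite !rsE mulrDr. Qed.
Lemma rsNr r z : rs r (- z) = - rs r z.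
Proof. by rewrite !rsE mulrN. Qed.

Lemma basis_decomp v w z : om v w = 1 -> z = rs (om z w) v + rs (om v z) w.
Proof.
case: v w z => a b [c d'] [p q]; rewrite /om /= => e.
by apply/eqP; rewrite eq_complex /=; apply/andP; split; apply/eqP; rewrite -[LHS]mulr1 -e; ring.
Qed.

Lemma act_lin g z : act g z = rs (complex.Re z) (act g c1) + rs (complex.Im z) (act g ci).
Proof.
rewrite -!act_rs -actD; congr act; case: z => a b; apply/eqP; rewrite eq_complex /=.
by rewrite !mulr0 !mulr1 addr0 add0r !eqxx.
Qed.

Lemma cayley g z : su11 g -> act g (act g z) = rs (tr g) (act g z) - z.
Proof.
move=> /su11_det[a [b [e1 e2 _ _]]]; rewrite /act /tr {}e1 {}e2.
case: a b z => a1 a2 [b1 b2] [x y] /= h.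
have hx (t : R) : t = t * (a1 ^+ 2 + a2 ^+ 2 - (b1 ^+ 2 + b2 ^+ 2)) by rewrite h mulr1.
apply/eqP; rewrite eq_complex /=; apply/andP; split; apply/eqP.
  by rewrite [X in _ = _ - X]hx; ring.
by rewrite [X in _ = _ - X]hx; ring.
Qed.

Lemma act_exp g n z : G g -> act (g ^+ n.+1) z = act g (act (g ^+ n) z).
Proof. by move=> Gg; rewrite exprS act_mul //; apply: (G_su11 fG); apply: G_exp. Qed.

Lemma scalar_of_act g e : su11 g -> act g c1 = rs e c1 -> act g ci = rs e ci -> g = (Complex e 0)%:M.
Proof.
move=> sg; have [a [b [e1 e2 e3 e4 _]]] := su11_det sg; rewrite /act e1 e2 => h1 h2.
have [ea eb] : a = Complex e 0 /\ b = 0.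
  move: h1 h2; clear; case: a b => a1 a2 [b1 b2].
  move=> /eqP; rewrite eq_complex /= => /andP[/eqP h1 /eqP h2] /eqP; rewrite eq_complex /= => /andP[/eqP h3 /eqP h4].
  by split; apply/eqP; rewrite eq_complex /=; apply/andP; split; apply/eqP; lra.
by apply: mat2_eq; rewrite ?e1 ?e2 ?e3 ?e4 ?ea ?eb !mxE /=; apply/eqP; rewrite eq_complex /= ?oppr0 !eqxx.
Qed.

(** If the trace is less than 2 in absolute value, [om z (act g z)] is a definite quadratic form
    preserved by [g]. The powers of [g] are then bounded, so two of them coincide and [g] is
    torsion. *)
Lemma elliptic_free g : G g -> 4 <= tr g ^+ 2.
Proof.
move=> Gg; rewrite leNgt; apply/negP => t4; have sg := G_su11 fG Gg.
have [a [b [e1 e2 e3 e4 det]]] := su11_det sg.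
pose q z := om z (act g z).
have qi z : q (act g z) = q z by rewrite /q om_act.
have D0 : 0 < 1 - complex.Re a ^+ 2 by move: t4; rewrite /tr e1; lra.
have bd z : (1 - complex.Re a ^+ 2) * cabs z ^+ 2 <= `|2 * complex.Im a| * `|q z|.
  rewrite -normrM; apply: le_trans (ler_norm _); rewrite cabs_sq /q /act e1 e2 /om.
  move: det; clear; case: a b z => a1 a2 [b1 b2] [x y] /= det.
  rewrite -subr_ge0.
  have -> : 2 * a2 * (x * (a1 * y + a2 * x + (b1 * - y + b2 * x)) - y * (a1 * x - a2 * y + (b1 * x - b2 * - y))) -
    (1 - a1 ^+ 2) * (x ^+ 2 + y ^+ 2) = ((a2 + b2) * x - b1 * y) ^+ 2 + ((a2 - b2) * y - b1 * x) ^+ 2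
     + ((a1 ^+ 2 + a2 ^+ 2 - (b1 ^+ 2 + b2 ^+ 2)) - 1) * (x ^+ 2 + y ^+ 2) by ring.
  by rewrite det subrr mul0r addr0 addr_ge0 ?sqr_ge0.
have qn n z : q (act (g ^+ n) z) = q z.
  by elim: n => [|n IH]; [rewrite expr0 act1|rewrite act_exp // qi IH].
pose M z := `|2 * complex.Im a| * `|q z| / (1 - complex.Re a ^+ 2).
have Mb n z : cabs (act (g ^+ n) z) ^+ 2 <= M z.
  by rewrite /M ler_pdivlMr // mulrC -(qn n z).
have M0 z : 0 <= M z by rewrite /M !mulr_ge0 ?invr_ge0 ?(ltW D0).
pose B := 1 + M c1 + M ci.
have B1 : 1 <= B by rewrite /B; have := M0 c1; have := M0 ci; lra.
have le (t m : R) : 0 <= t -> t ^+ 2 <= m -> t <= 1 + m by rewrite expr2 => t0; nra.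
have [s hs] := discrete_list fG B.
have hin n : g ^+ n \in s.
  apply: (hs _ c1 ci); first exact: G_exp.
  - by rewrite /om /=; ring.
  - by rewrite /cabs expr0n addr0 expr1n sqrtr1.
  - by rewrite /cabs expr0n add0r expr1n sqrtr1.
  - by have := le _ _ (cabs_ge0 _) (Mb n c1); have := M0 ci; rewrite /B; lra.
  - by have := le _ _ (cabs_ge0 _) (Mb n ci); have := M0 c1; rewrite /B; lra.
pose t := mkseq (fun n => g ^+ n) (size s).+1.
have : ~~ uniq t.
  apply/negP => ut; have := uniq_leq_size (s1 := t) (s2 := s) ut.
  rewrite size_mkseq ltnn => /(_ _)/negP; case=> // x /mapP[n _ ->]; exact: hin.
move=> /(uniqPn 0)[i [j [ij js]]]; rewrite size_mkseq in js.
rewrite !nth_mkseq // ?(ltn_trans ij js) // => e.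
have e1' : g ^+ (j - i) = 1.
  have ui : g ^+ i \in unitmx by apply: (G_unit fG); apply: G_exp.
  have : g ^+ i *m g ^+ (j - i) = g ^+ i by rewrite -[_ *m _]/(_ * _) -exprD subnKC ?(ltnW ij).
  by move=> /(congr1 (mulmx (invmx (g ^+ i)))); rewrite mulKmx // mulVmx.
have [_ _ tf _] := fG.
have t1 : tr 1%:M = 2 by rewrite /tr mxE /= mulr1.
have tN1 : tr (- 1%:M) = - 2 by rewrite /tr mxE mxE /=; lra.
have := tf g (j - i)%N Gg; rewrite subn_gt0 => /(_ ij (or_introl e1')) [] eg; move: t4; rewrite eg.
  by rewrite -[1]/(1%:M) t1 expr2; lra.
by rewrite -[1]/(1%:M) tN1 expr2; lra.
Qed.

Lemma list_min (T : eqType) (s : seq T) (f : T -> R) :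
  exists2 e, 0 < e & forall t, t \in s -> 0 < f t -> e <= f t.
Proof.
elim: s => [|t s [e e0 IH]]; first by exists 1.
case: (ltP 0 (f t)) => ft.
  exists (Num.min e (f t)); first by rewrite lt_min e0.
  move=> t'; rewrite inE => /orP[/eqP->|/IH h /h]; first by rewrite ge_min lexx orbT.
  by rewrite ge_min => ->.
by exists e => // t'; rewrite inE => /orP[/eqP->|/IH //]; rewrite ltNge ft.
Qed.

Lemma dual_vector v : v != 0 -> exists w, om v w = 1.
Proof.
move=> v0; exists (rs (complex.Re v ^+ 2 + complex.Im v ^+ 2)^-1 (ci * v)).
have n0 : complex.Re v ^+ 2 + complex.Im v ^+ 2 != 0.
  rewrite -cabs_sq expf_eq0 /=; apply/eqP => /cabs_eq0/eqP; exact/negP.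
rewrite om_rsr; apply: (mulfI n0); rewrite mulrA divff // mul1r mulr1.
by case: v {v0 n0} => a b; rewrite /om /=; ring.
Qed.

(** Stretching along the fixed direction of a parabolic element and returning to bounded bases
    yields conjugates that tend to the scalar [e], which is 1 or -1. By discreteness such a
    conjugate equals [e]. *)
Lemma parabolic_free g : G g -> tr g ^+ 2 = 4 -> g = 1%:M \/ g = - 1%:M.
Proof.
move=> Gg t4; have sg := G_su11 fG Gg.
pose e := tr g / 2; have e2 : e * e = 1 by move: t4; rewrite /e expr2; lra.
have tre : tr g = e + e by rewrite /e; lra.
case: (pselect (forall z, act g z = rs e z)) => [h|].
  have eg := scalar_of_act sg (h _) (h _).
  have : (e - 1) * (e + 1) = 0 by rewrite -[LHS]addr0; lra.
  move=> /eqP; rewrite mulf_eq0 subr_eq0 addr_eq0 => /orP[]/eqP ee; rewrite eg ee; [left|right].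
    by congr (_%:M).
  by rewrite -raddfN; congr (_%:M); apply/eqP; rewrite eq_complex /= oppr0 !eqxx.
move=> /existsNP[w0 hw0]; exfalso.
(* By Cayley-Hamilton [g - e] squares to zero, so anything in its image is an eigenvector. *)
pose v0 := act g w0 - rs e w0.
have v00 : v0 != 0 by rewrite subr_eq0; apply/eqP.
have gv0 : act g v0 = rs e v0.
  rewrite /v0 actD cayley // tre -rsN act_rs rsD rsDr rsA mulrN e2 rsN rsN rs1.
  by rewrite addrAC addrK.
have [w omw] := dual_vector v00.
pose ka := om (act g w) w.
have gw : act g w = rs ka v0 + rs e w.
  rewrite {1}(basis_decomp (act g w) omw); congr (_ + rs _ _).
  have := om_act v0 w sg; rewrite gv0 om_rsl omw => h.
  by rewrite -[LHS]mul1r -e2 -mulrA h mulr1.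
have [C C1 hC] := cocompact_basis fG.
have C0 : 0 <= C by lra.
pose B := C * (1 + `|ka|) + C.
have CB : C <= B by rewrite /B lerDr mulr_ge0 // addr_ge0.
have [s hs] := discrete_list fG B.
pose f g' := cabs (act g' c1 - rs e c1) + cabs (act g' ci - rs e ci).
have [eta eta0 heta] := list_min s f.
have e1n : `|e| = 1.
  have : `|e| * `|e| = 1 by rewrite -normrM e2 normr1.
  have := normr_ge0 e; move: `|e| => n n0 nn; nra.
(* Stretching by [t] brings the conjugate to distance at most [(t - 1) * eta / t^2] from [e], below
   the least positive distance [eta] in the finite list. *)
pose t := 1 + (2 * C ^+ 2 * `|ka|) / eta.
have q0 : 0 <= (2 * C ^+ 2 * `|ka|) / eta by rewrite !mulr_ge0 ?sqr_ge0 ?invr_ge0 // ltW.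
have t1 : 1 <= t by rewrite /t lerDl.
have t0 : 0 < t by lra.
have tn0 : t != 0 by rewrite gt_eqF.
have omt : om (rs t v0) (rs t^-1 w) = 1 by rewrite om_rsl om_rsr omw mulr1 mulfV.
have [h [Gh hv hw]] := hC _ _ omt.
set V := act h _ in hv; set W := act h _ in hw.
pose g' := h *m g *m invmx h.
have Gg' : G g' by apply: (G_mul fG); [apply: (G_mul fG)|apply: (G_inv fG)].
have sh := G_su11 fG Gh.
have ag' z : act g' (act h z) = act h (act g z).
  rewrite /g' !act_mul ?(act_invK fG) //; first exact: (G_su11 fG (G_inv fG Gh)).
have gV : act g' V = rs e V by rewrite /V ag' act_rs gv0 -act_rs !rsA mulrC.
have gW : act g' W = rs (ka / (t * t)) V + rs e W.
  rewrite /W ag' act_rs gw rsDr !rsA actD !act_rs /V act_rs !rsA; congr (rs _ _ + rs _ _).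
    by field.
  by rewrite mulrC.
have VW : om V W = 1 by rewrite /V /W om_act.
have tt : 1 <= t * t by nra.
have gin : g' \in s.
  apply: (hs g' V W) => //; try lra.
    by rewrite gV cabs_rs e1n mul1r; lra.
  rewrite gW; apply: le_trans (cabsD _ _) _; rewrite !cabs_rs e1n mul1r /B.
  have : `|ka / (t * t)| <= `|ka|.
    rewrite normrM normfV (ger0_norm (_ : 0 <= t * t)); last lra.
    by rewrite ler_pdivrMr ?ler_peMr //; lra.
  have := normr_ge0 (ka / (t * t)); have := cabs_ge0 V; have := normr_ge0 ka; nra.
have dz z : cabs z = 1 -> cabs (act g' z - rs e z) <= C ^+ 2 * `|ka| / (t * t).
  move=> z1.
  have -> : act g' z - rs e z = rs (om V z * (ka / (t * t))) V.
    rewrite {1}(basis_decomp z VW) actD !act_rs gV gW [X in _ - rs e X](basis_decomp z VW).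
    move: (om z W) (om V z) (ka / (t * t)) (V) (W) => p q k [x1 x2] [y1 y2].
    by apply/eqP; rewrite eq_complex /=; apply/andP; split; apply/eqP; ring.
  rewrite cabs_rs normrM.
  have h1 : `|om V z| <= C by apply: le_trans (om_le _ _) _; rewrite z1 mulr1.
  have -> : C ^+ 2 * `|ka| / (t * t) = C * `|ka / (t * t)| * C.
    by rewrite normrM normfV (ger0_norm (_ : 0 <= t * t)); [ring|lra].
  by apply: ler_pM; rewrite ?mulr_ge0 ?normr_ge0 ?cabs_ge0 // ler_wpM2r.
have n1 : cabs c1 = 1 by rewrite /cabs expr0n addr0 expr1n sqrtr1.
have n2 : cabs ci = 1 by rewrite /cabs expr0n add0r expr1n sqrtr1.
have fpos : 0 < f g'.
  rewrite lt_neqAle eq_sym addr_ge0 ?cabs_ge0 // andbT; apply/eqP => f0.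
  have z1 : cabs (act g' c1 - rs e c1) = 0 by have := cabs_ge0 (act g' c1 - rs e c1); have := cabs_ge0 (act g' ci - rs e ci); rewrite /f in f0; lra.
  have z2 : cabs (act g' ci - rs e ci) = 0 by rewrite /f z1 add0r in f0.
  move: z1 z2 => /cabs_eq0/eqP; rewrite subr_eq0 => /eqP z1 /cabs_eq0/eqP; rewrite subr_eq0 => /eqP z2.
  have all z : act g' z = rs e z.
    rewrite act_lin z1 z2 !rsA; case: (z) => p q; apply/eqP; rewrite eq_complex /=.
    by apply/andP; split; apply/eqP; ring.
  have : act h (act g w0) = act h (rs e w0) by rewrite -ag' all act_rs.
  by move=> /(congr1 (act (invmx h))); rewrite !(act_invK fG).
have := heta _ gin fpos; rewrite leNgt => /negP; apply.
rewrite /f; apply: le_lt_trans (lerD (dz _ n1) (dz _ n2)) _.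
have -> : C ^+ 2 * `|ka| / (t * t) + C ^+ 2 * `|ka| / (t * t) = (2 * C ^+ 2 * `|ka|) / (t * t) by ring.
have h2 : 2 * C ^+ 2 * `|ka| = (t - 1) * eta by rewrite /t addrC addKr divfK // gt_eqF.
rewrite ltr_pdivrMr; last lra.
rewrite h2 [eta * _]mulrC ltr_pM2r //; nra.
Qed.

Lemma hyperbolic g : G g -> [\/ g = 1%:M, g = - 1%:M | 4 < tr g ^+ 2].
Proof.
move=> Gg; have := elliptic_free Gg; rewrite le_eqVlt => /orP[/eqP h|h]; last by constructor 3.
by have [] := parabolic_free Gg (esym h); [constructor 1|constructor 2].
Qed.

End FuchsianDynamics.

(** * Renormalisation at a point of the circle *)

Section Expansion.
Variable R : realType.
Variable G : set 'M[R[i]]_2.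
Hypothesis fG : cocompact_fuchsian G.
Implicit Types (g h : 'M[R[i]]_2) (z w v x y : R[i]).

(** If the whole group fixed [w], commutators would have trace 2 and so act trivially; the group
    would commute and be diagonal in one basis. It could then not bring back a basis sheared far
    along the fixed direction. *)
Lemma no_fixed_point w : circle w -> exists g, G g /\ mob g w <> w.
Proof.
move=> cw; apply: contrapT => /forallNP H.
have fx g : G g -> exists2 a : R, a != 0 & act g (hv w) = rs a (hv w).
  move=> Gg; have sg := G_su11 fG Gg.
  have e : mob g w = w by apply: contrapT => ne; apply: (H g).
  have nz1 := act_neq0 sg (hv_neq0 w).
  have : pt (hv w) = pt (act g (hv w)) by rewrite -mob_hv // pt_hv.
  move=> /(pt_eq (hv_neq0 w) nz1)/(om0_rs (hv_neq0 w)) [a ea].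
  by exists a => //; apply: contra_neq nz1 => a0; rewrite ea a0 rs0.
have [w' ow] := dual_vector (hv_neq0 w).
set e := hv w in fx ow *.
have e0 : e != 0 by exact: hv_neq0.
have fxi g a : G g -> a != 0 -> act g e = rs a e -> act (invmx g) e = rs a^-1 e.
  move=> Gg a0 ea; have := congr1 (act (invmx g)) ea; rewrite (act_invK fG) // act_rs => h1.
  by rewrite [in RHS]h1 rsA mulVf // rs1.
have rse (s t : R) : rs s e = rs t e -> s = t.
  by move=> /(congr1 (fun z => om z w')); rewrite !om_rsl ow !mulr1.
have ab g h : G g -> G h -> forall z, act g (act h z) = act h (act g z).
  move=> Gg Gh; have [a a0 ea] := fx g Gg; have [b b0 eb] := fx h Gh.
  pose k := g *m h *m (invmx g *m invmx h).
  have Gk : G k by do !apply: (G_mul fG) => //; exact: (G_inv fG).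
  have su := G_su11 fG.
  have Gi := G_inv fG.
  have kE z : act k z = act g (act h (act (invmx g) (act (invmx h) z))).
    rewrite /k act_mul; last by apply: su; apply: (G_mul fG); exact: Gi.
    rewrite act_mul; last exact: su.
    by rewrite act_mul //; apply: su; exact: Gi.
  have ke : act k e = e.
    rewrite kE (fxi _ _ Gh b0 eb) !act_rs (fxi _ _ Gg a0 ea) !act_rs eb act_rs ea !rsA.
    rewrite [X in rs X _](_ : _ = 1) ?rs1 //; field; exact/andP.
  have tk : tr k = 2.
    have := cayley e (su _ Gk); rewrite !ke => /(congr1 (fun z => om z w')).
    rewrite omDl om_rsl ow mulr1 -[- e]rs1 rsNr -rsN om_rsl ow; lra.
  have k1 z : act k z = z.
    have t4 : tr k ^+ 2 = 4 by rewrite tk; ring.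
    have [-> | kN] := parabolic_free fG Gk t4; first exact: act1.
    have : om e w' = - om e w'.
      by rewrite -{1}ke kN actN act1 -[- e]rs1 rsNr -rsN om_rsl ow mulr1.
    by rewrite ow => h1; exfalso; lra.
  move=> z; have := k1 (act h (act g z)); rewrite kE (act_invK fG) // (act_invK fG) // => ->.
have [C C1 HC] := cocompact_basis fG.
have cabse : cabs e = 1 by exact: cabs_hv.
have omb (T : R) : T != 0 -> om (rs T e) (rs T^-1 w') = 1.
  by move=> T0; rewrite om_rsl om_rsr ow; field.
(* Bringing back a basis stretched by [C + 1] contracts [e], which produces a hyperbolic element. *)
have [h [Gh hb1 _]] := HC _ _ (omb (C + 1) ltac:(apply/eqP; lra)).
have [p p0 hp] := fx h Gh.
have p1 : `|p| < 1.
  move: hb1; rewrite act_rs hp !cabs_rs cabse mulr1 ger0_norm; last lra.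
  have := normr_ge0 p; nra.
pose b := om (act h w') w'.
have hw' : act h w' = rs b e + rs p^-1 w'.
  rewrite [LHS](basis_decomp (act h w') ow) -/b; congr (_ + rs _ _).
  have := om_act e w' (G_su11 fG Gh); rewrite hp om_rsl ow => h1.
  by rewrite -[LHS]mul1r -(mulVf p0) -mulrA h1 mulr1.
have pp : p^-1 - p != 0.
  apply/eqP => e1; have : p * p = 1.
    by rewrite -{1}(_ : p^-1 = p) ?mulVf //; lra.
  move/(congr1 Num.norm); rewrite normrM normr1; have := normr_ge0 p; nra.
(* [w2] is the second eigenvector of [h]; commutation makes it an eigenvector of the whole group. *)
pose c := b / (p^-1 - p); pose w2 := w' + rs c e.
have ow2 : om e w2 = 1 by rewrite /w2 omDr om_rsr ow om_self mulr0 addr0.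
have hw2 : act h w2 = rs p^-1 w2.
  rewrite /w2 actD act_rs hp hw' rsDr !rsA addrAC -rsD addrC; congr (_ + rs _ _).
  have ec : c * (p^-1 - p) = b by rewrite divfK.
  by rewrite -ec; ring.
have aw2 g a : G g -> act g e = rs a e -> a != 0 -> act g w2 = rs a^-1 w2.
  move=> Gg ga a0.
  have h1 : act h (act g w2) = rs p^-1 (act g w2) by rewrite -ab // hw2 act_rs.
  have h2 := om_act e w2 (G_su11 fG Gg).
  have o1 : om e (act g w2) = a^-1.
    by move: h2; rewrite ga om_rsl ow2 => h2; rewrite -[LHS]mul1r -(mulVf a0) -mulrA h2 mulr1.
  rewrite [LHS](basis_decomp _ ow2) o1.
  suff -> : om (act g w2) w2 = 0 by rewrite rs0 add0r.
  have h3 := om_act (act g w2) w2 (G_su11 fG Gh).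
  move: h3; rewrite h1 hw2 om_rsl om_rsr => h3.
  apply/eqP; apply: contraT => q0; have : p^-1 * p^-1 = 1.
    by apply: (mulIf q0); rewrite mul1r -mulrA.
  move=> h4; have : p * p = 1 by rewrite -[RHS](invr1) -h4; field.
  move/(congr1 Num.norm); rewrite normrM normr1; have := normr_ge0 p; nra.
(* A diagonal element bringing the sheared basis back to size [C] would give that [t] is at most
   [C^2] times the length of [w2]. *)
pose t := C ^+ 2 * cabs w2 + 1.
have [g [Gg g1 g2]] : exists g, [/\ G g, cabs (act g e) <= C & cabs (act g (w2 + rs t e)) <= C].
  by apply: HC; rewrite omDr ow2 om_rsr om_self mulr0 addr0.
have [a a0 ga] := fx g Gg; move: g1 g2; rewrite actD act_rs ga (aw2 _ _ Gg ga a0) !rsA => g1 g2.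
have c0 := cabs_ge0 w2.
have i1 := le_trans (om_le e (rs a^-1 w2 + rs (t * a) e)) (ler_wpM2l (cabs_ge0 e) g2).
have i2 := le_trans (om_le (rs a^-1 w2 + rs (t * a) e) w2) (ler_wpM2r c0 g2).
move: i1 i2; rewrite omDr !omDl !om_rsr !om_rsl ow2 !om_self !mulr0 addr0 add0r !mulr1 cabse mul1r => i1 i2.
have : `|a^-1| * `|t * a| <= C * (C * cabs w2) by apply: ler_pM.
rewrite -normrM [a^-1 * _](_ : _ = t); last by field.
by rewrite ger0_norm /t; [lra|nra].
Qed.

(** [g] brings the basis [r^-1 e], [r e'] back to bounded size, where [e] is the lift of [y]. Hence
    [nz g u] is comparable to [r + |om (hv y) (hv u)| / r], and an arc of radius [r^2] at [y] is
    blown up to size about 1. *)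
Lemma expansion : exists2 C : R, 1 <= C & forall y (r : R), circle y -> 0 < r -> r <= 1 ->
  exists g, G g /\ forall u, circle u ->
    r ^+ 2 + `|om (hv y) (hv u)| <= C * (r * nz g u) /\ r * nz g u <= C * (r ^+ 2 + `|om (hv y) (hv u)|).
Proof.
have [C C1 HC] := cocompact_basis fG; exists (3 * C); first lra.
move=> y r cy r0 r1; pose e := hv y; pose e' : R[i] := Complex 0 1 * e.
have ne : complex.Re e ^+ 2 + complex.Im e ^+ 2 = 1 by rewrite -cabs_sq cabs_hv expr1n.
have oe : om e e' = 1.
  by move: ne; rewrite /e' /om; case: (e) => a b /= h; rewrite -[RHS]h; ring.
have [g [Gg g1 g2]] : exists g, [/\ G g, cabs (act g (rs r^-1 e)) <= C & cabs (act g (rs r e')) <= C].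
  by apply: HC; rewrite om_rsl om_rsr oe mulr1 mulVf // gt_eqF.
have sg := G_su11 fG Gg.
exists g; split=> // u cu.
pose al := om (hv u) e'; pose be := om e (hv u).
have nab : al ^+ 2 + be ^+ 2 = 1.
  have : complex.Re (hv u) ^+ 2 + complex.Im (hv u) ^+ 2 = 1 by rewrite -cabs_sq cabs_hv expr1n.
  move: ne; rewrite /al /be /e' /om; case: (e) => a b; case: (hv u) => c f /= h1 h2.
  have -> : (c * (0 * b + 1 * a) - f * (0 * a - 1 * b)) ^+ 2 + (a * f - b * c) ^+ 2 =
    (a ^+ 2 + b ^+ 2) * (c ^+ 2 + f ^+ 2) by ring.
  by rewrite h1 h2 mulr1.
set V := act g (rs r^-1 e) in g1; set W := act g (rs r e') in g2.
have oVW : om V W = 1 by rewrite om_act // om_rsl om_rsr oe mulr1 mulVf // gt_eqF.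
pose z := rs (al * r ^+ 2) V + rs be W.
have zE : r * nz g u = cabs z.
  rewrite -[r in LHS](ger0_norm (ltW r0)) /nz -cabs_rs -act_rs (basis_decomp (hv u) oe) -/al -/be.
  congr cabs; rewrite /z /V /W -!act_rs -actD !rsDr !rsA; congr (act g (rs _ _ + rs _ _)); field.
  by rewrite gt_eqF.
  by [].
have b1 : `|be| <= 1 by rewrite ler_norml; apply/andP; split; nra.
have a1 : `|al| <= 1 by rewrite ler_norml; apply/andP; split; nra.
have r2 : 0 <= r ^+ 2 by rewrite sqr_ge0.
rewrite zE -/be; split.
  have i1 : `|be| <= C * cabs z.
    apply: le_trans (_ : `|om V z| <= _).
      by rewrite /z omDr !om_rsr om_self oVW mulr0 add0r mulr1.
    by apply: le_trans (om_le _ _) _; rewrite ler_wpM2r // cabs_ge0.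
  have i2 : `|al| * r ^+ 2 <= C * cabs z.
    apply: le_trans (_ : `|om z W| <= _).
      by rewrite /z omDl !om_rsl om_self oVW mulr0 addr0 mulr1 normrM (ger0_norm r2).
    by apply: le_trans (om_le _ _) _; rewrite mulrC ler_wpM2r // cabs_ge0.
  have : 1 / 2 <= `|al| \/ 1 / 2 <= `|be|.
    case: (leP (1/2) `|al|) => h; [by left|right]; rewrite leNgt; apply/negP => h'.
    move: nab; rewrite -[al ^+ 2]real_normK ?num_real // -[be ^+ 2]real_normK ?num_real //.
    have := normr_ge0 al; have := normr_ge0 be; nra.
  have r21 : r ^+ 2 <= 1 by rewrite expr_le1 // ltW.
  by case=> h; nra.
apply: le_trans (cabsD _ _) _; rewrite !cabs_rs normrM (ger0_norm r2).
have := cabs_ge0 V; have := cabs_ge0 W; have := normr_ge0 be; have := normr_ge0 al.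
set p := cabs V in g1 *; set q := cabs W in g2 *; set n1 := `|al| in a1 *; set n2 := `|be| in b1 *; set s := r ^+ 2 in r2 *.
move=> h1 h2 h3 h4.
have : n1 * s * p <= s * C by rewrite -mulrA; apply: le_trans (_ : 1 * (s * C) <= _); [apply: ler_pM => //; nra|lra].
have : n2 * q <= n2 * C by nra.
nra.
Qed.

End Expansion.

(** * Dense strips *)

Section SineBounds.
Import numFieldNormedType.Exports.
Variable R : realType.
Implicit Types a b t : R.

Lemma sin_mvt a b : a < b -> exists2 c, a < c < b & sin b - sin a = cos c * (b - a).
Proof.
move=> ab; have cs : {within `[a, b], continuous (@sin R)}%classic.
  by apply: continuous_subspaceT => x; exact: continuous_sin.
have [c] := MVT ab (fun x _ => is_derive_sin x) cs.
by rewrite in_itv /=; exists c.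
Qed.

Lemma abs_sin_sub a b : `|sin b - sin a| <= `|b - a|.
Proof.
wlog ab : a b / a < b.
  move=> H; case: (ltgtP a b) => [|h|->]; first exact: H.
    by rewrite -normrN opprB -[`|b - a|]normrN opprB; apply: H.
  by rewrite !subrr.
have [c _ ->] := sin_mvt ab; rewrite normrM; apply: ler_piMl => //.
by rewrite ler_norml cos_geN1 cos_le1.
Qed.

Lemma abs_sin_le a : `|sin a| <= `|a|.
Proof. by have := abs_sin_sub 0 a; rewrite sin0 !subr0. Qed.

(* Concavity: the sine lies above its chord on [0, M]. *)
Lemma sin_lower (M : R) : 0 < M -> M < pi -> exists2 c : R, 0 < c & forall t, 0 <= t <= M -> c * t <= sin t.
Proof.
move=> M0 M1; have pp := pi_gt0 R.
have dec : forall u v : R, 0 <= u -> u <= v -> v <= pi -> cos v <= cos u.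
  move=> u v u0; rewrite le_eqVlt => /orP[/eqP -> //|uv] vp; apply: ltW.
  by rewrite ltr_cos // in_itv /=; apply/andP; split; lra.
pose c := Num.min (sin M / M) (cos (M / 2)).
have sM : 0 < sin M by apply: sin_gt0_pi; apply/andP.
have cM : 0 < cos (M / 2) by apply: cos_gt0_pihalf; apply/andP; split; lra.
exists c; first by rewrite lt_min divr_gt0 ?cM.
move=> t /andP[t0 tM]; have [->|tn0] := eqVneq t 0; first by rewrite mulr0 sin0.
have tp : 0 < t by rewrite lt_neqAle eq_sym tn0.
have [->|tnM] := eqVneq t M; first by rewrite -ler_pdivlMr // ge_min lexx.
have tM' : t < M by rewrite lt_neqAle tnM.
have [x /andP[x0 x1]] := sin_mvt tp; rewrite sin0 !subr0 => e1.
have [y /andP[y0 y1] e2] := sin_mvt tM'.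
have xy : cos y <= cos x by apply: dec; lra.
have h : sin M * t <= sin t * M.
  rewrite (_ : sin M = sin t + cos y * (M - t)); last lra.
  by rewrite e1; have : 0 < t * (M - t); [apply: mulr_gt0; lra|nra].
apply: le_trans (_ : sin M / M * t <= _); first by rewrite ler_pM2r // ge_min lexx.
by rewrite mulrAC ler_pdivrMr.
Qed.

Lemma abs_sin_lower : exists2 c : R, 0 < c & forall t, `|t| <= pi / 2 -> c * `|t| <= `|sin t|.
Proof.
have pp := pi_gt0 R; have [c c0 H] := @sin_lower (pi/2) ltac:(lra) ltac:(lra).
exists c => // t ht; have [t0|t0] := leP 0 t.
  rewrite ger0_norm // in ht *; apply: le_trans (ler_norm _); apply: H; lra.
rewrite ltr0_norm // in ht *; rewrite -normrN -sinN; apply: le_trans (ler_norm _); apply: H; lra.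
Qed.

Lemma dy_le1 n : dy R n <= 1.
Proof. by have := dy_le R (leq0n n); rewrite {2}/dy expr0. Qed.

(** The cluster point is the upper limit of the sequence. *)
Lemma bounded_cluster (a : nat -> R) (M : R) : (forall n, 0 <= a n <= M) ->
  exists s : R, forall e N, 0 < e -> exists2 n, (N <= n)%N & `|a n - s| < e.
Proof.
move=> ha; pose A : set R := fun x => forall N, exists2 n, (N <= n)%N & x <= a n.
have A0 : A 0 by move=> N; exists N => //; have /andP[] := ha N.
have hA : has_sup A.
  split; first by exists 0.
  by exists M => x /(_ 0%N) [n _ h]; have /andP[_] := ha n; apply: le_trans.
exists (sup A) => e N e0.
have : ~ A (sup A + e) by move=> /(sup_upper_bound hA); lra.
move=> /existsNP[N0 HN0].
have [x Ax hx] := sup_adherent e0 hA; have [n hn xn] := Ax (maxn N N0).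
move: hn; rewrite geq_max => /andP[n1 n2]; exists n => //.
have : a n < sup A + e by rewrite ltNge; apply/negP => h; apply: HN0; exists n.
by move=> h; rewrite ltr_norml; apply/andP; split; lra.
Qed.

End SineBounds.

Section NoStrip.
Variable R : realType.
Variables (G : set 'M[R[i]]_2) (L : set (set R[i])).
Hypothesis fG : cocompact_fuchsian G.
Hypothesis LL : lifted_lamination G L.
Implicit Types (g h : 'M[R[i]]_2) (z w v x y : R[i]).

Lemma geodC' x y : geod x y = geod y x.
Proof. by apply/seteqP; split=> t [|]; [right|left|right|left]. Qed.

Lemma L_leaf (g : set R[i]) : L g -> exists x y, [/\ circle x, circle y, x <> y & g = geod x y].
Proof. by case: LL => h _ _ _; exact: h. Qed.
Lemma L_nc (g h : set R[i]) : L g -> L h -> ~ crosses g h.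
Proof. by case: LL => _ H _ _; exact: H. Qed.
Lemma L_mob c x y : G c -> L (geod x y) -> L (geod (mob c x) (mob c y)).
Proof. by move=> Gc Lg; rewrite -image_mob_geod; case: LL => _ _ h _; exact: h. Qed.
Lemma L_closed x y : circle x -> circle y -> x <> y ->
  (forall e : R, 0 < e -> exists u v, [/\ L (geod u v), cabs (u - x) < e & cabs (v - y) < e]) -> L (geod x y).
Proof. by case: LL => _ _ _; apply. Qed.

(** An element moving [w] carries the fan at [w] to the fan at another point, and two full fans
    cross. *)
Lemma no_fan w : circle w -> ~ (forall z, circle z -> z <> w -> L (geod z w)).
Proof.
move=> cw fan; have [g [Gg gw]] := no_fixed_point fG cw.
have sg := G_su11 fG Gg; have cgw := circle_mob sg cw.
have pp := pi_gt0 R.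
have a0 : 0 < ha w (mob g w).
  rewrite lt_neqAle ha_ge0 // andbT eq_sym; apply/eqP => e; apply: gw.
  by apply: (ha_inj cw) => //; rewrite e ha_self.
have a1 := ha_ltpi cw cgw; set a := ha w (mob g w) in a0 a1.
pose pw t : R[i] := w * expi (2 * t).
have cp t : circle (pw t) by apply: circleM => //; exact: circle_expi.
have hp (t : R) : 0 <= t < pi -> ha w (pw t) = t by move=> h; rewrite haK.
pose b := pw (a / 2); pose c := pw (a * (3 / 4)).
have hb : ha w b = a / 2 by apply: hp; apply/andP; split; lra.
have hc : ha w c = a * (3 / 4) by apply: hp; apply/andP; split; lra.
have a34 : a * (3 / 4) != 0 by apply/eqP; lra.
have a12 : a / 2 != a by apply/eqP; lra.
have L1 : L (geod c w).
  apply: fan => [|e]; first exact: cp.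
  by move/eqP: a34; apply; rewrite -hc e ha_self.
have Gi := G_inv fG Gg; have si := G_su11 fG Gi.
have L2 : L (geod (mob g (mob (invmx g) b)) (mob g w)).
  apply: L_mob => //; apply: fan; first by apply: circle_mob => //; exact: cp.
  move=> e; have : b = mob g w by rewrite -e (mob_Kinv fG) //; exact: cp.
  by move=> e'; move/eqP: a12; apply; rewrite -hb e'.
rewrite (mob_Kinv fG) // in L2; last exact: cp.
apply: (L_nc L1 L2); apply/(@crossesE _ w) => //; try exact: cp.
rewrite ha_self // hb hc -/a /spl /btw /ext; apply/orP; left; apply/andP; split; apply/orP.
  right; apply/andP; split; lra.
right; apply/andP; split; lra.
Qed.

(** Suppose leaves started from an arc at relative density [e] and ended outside it, for every [e].
    Renormalised, they would converge to all geodesics ending at one point [w], against [no_fan]. *)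
Lemma no_strip : exists2 e : R, 0 < e & forall y (tau : R), circle y -> 0 < tau -> tau <= pi / 4 ->
  exists2 t, `|t| <= tau & forall t' t'', `|t' - t| <= e * tau -> tau <= `|t''| -> `|t''| <= pi / 2 ->
    ~ L (geod (y * expi (2 * t')) (y * expi (2 * t''))).
Proof.
apply: contrapT => /forallPNP NS.
have pp := pi_gt0 R.
have [C C1 HC] := expansion fG; have [c c0 Hc] := abs_sin_lower R.
have cle : c <= 1.
  have := Hc 1 ltac:(have := pi_ge2 R; rewrite normr1; lra).
  by rewrite normr1 mulr1; have := abs_sin_le (1 : R); rewrite normr1; lra.
pose K := 2 * C ^+ 2 / c.
have K0 : 0 < K by rewrite /K divr_gt0 //; nra.
(* With density [de^2] and [r^2 = de * tau] both errors are of order [de]: the spacing [de^2 * tau]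
   is magnified at most by a multiple of [1 / (de * tau)], and all points outside the arc land
   within [K * de] of [w]. *)
have step (de : R) : 0 < de -> de <= 1 -> exists2 w, circle w & forall z, circle z -> K * de < cabs (z - w) ->
    exists u v, [/\ L (geod u v), cabs (u - z) <= K * de & cabs (v - w) <= K * de].
  move=> d0 d1; have := NS (de ^+ 2) ltac:(by rewrite exprn_gt0).
  move=> /existsNP[y /existsNP[tau /not_implyP[cy /not_implyP[t0 /not_implyP[t1]]]]].
  move=> /forall2NP NSt.
  have pi4 : pi <= 4 :> R by have := @pihalf_lt2 R; lra.
  have dt : 0 < de * tau by rewrite mulr_gt0.
  pose r := Num.sqrt (de * tau).
  have r0 : 0 < r by rewrite sqrtr_gt0.
  have r2 : r ^+ 2 = de * tau by rewrite sqr_sqrtr // ltW.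
  have tau1 : tau <= 1 by lra.
  have r1 : r <= 1 by rewrite -sqrtr1; apply: ler_wsqrtr; apply: mulr_ile1 => //; exact: ltW.
  have [g [Gg Hg]] := HC y r cy r0 r1; have sg := G_su11 fG Gg.
  pose P t : R[i] := y * expi (2 * t).
  have cP t : circle (P t) by apply: circleM => //; exact: circle_expi.
  have chP s t : cabs (P s - P t) = 2 * `|sin (t - s)|.
    by rewrite /P -mulrBr cabsM (_ : cabs y = 1) // mul1r chord_expi.
  have omP t : `|om (hv y) (hv (P t))| = `|sin t|.
    have := chord_hv cy (cP t); have := chP 0 t; rewrite /P mulr0 expi0 mulr1 subr0; lra.
  have nzP t : r ^+ 2 + `|sin t| <= C * (r * nz g (P t)) by have [] := Hg _ (cP t); rewrite omP.
  have nz0 t : 0 < nz g (P t) by exact: nz_gt0.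
  have sp2 : `|sin (pi / 2 : R)| = 1 by rewrite sin_pihalf normr1.
  (* The image of the point antipodal to [y]. *)
  pose w := mob g (P (pi / 2)).
  have far t : tau <= `|t| -> `|t| <= pi / 2 -> cabs (mob g (P t) - w) <= K * de.
    move=> h1 h2; rewrite chord_mob // chP ler_pdivrMr; last by rewrite mulr_gt0.
    have i1 := nzP (pi / 2); rewrite sp2 in i1; have i2 := nzP t; have i3 := Hc _ h2.
    have s1 : `|sin (pi / 2 - t)| <= 1 by rewrite ler_norml sin_geN1 sin_le1.
    have j1 : 1 <= C * (r * nz g (P (pi / 2))) by apply: le_trans i1; rewrite lerDr sqr_ge0.
    have j2 : c * tau <= C * (r * nz g (P t)).
      by apply: le_trans i2; have := sqr_ge0 r; nra.
    have : 1 * (c * tau) <= (C * (r * nz g (P (pi / 2)))) * (C * (r * nz g (P t))).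
      by apply: ler_pM => //; apply: mulr_ge0; exact: ltW.
    have -> : (C * (r * nz g (P (pi / 2)))) * (C * (r * nz g (P t))) = (C ^+ 2 * de * (nz g (P (pi / 2)) * nz g (P t))) * tau.
      by transitivity (C ^+ 2 * r ^+ 2 * (nz g (P (pi / 2)) * nz g (P t))); [ring|rewrite r2; ring].
    rewrite mul1r ler_pM2r // => h3.
    apply: le_trans (_ : 2 <= _); first by rewrite ler_piMr.
    have -> : K * de * (nz g (P t) * nz g (P (pi / 2))) =
      2 * (C ^+ 2 * de * (nz g (P (pi / 2)) * nz g (P t)) / c) by rewrite /K; ring.
    by rewrite ler_peMr // ler_pdivlMr // mul1r.
  exists w; first exact: circle_mob.
  move=> z cz zw; pose z' := mob (invmx g) z.
  have cz' : circle z' by apply: circle_mob => //; apply: (G_su11 fG); exact: (G_inv fG).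
  have zE : z = mob g z' by rewrite (mob_Kinv fG).
  have [t [tE th]] : exists t, z' = P t /\ `|t| <= pi / 2.
    have [h e] := haP cy cz'; case: (leP (ha y z') (pi / 2)) => h1.
      by exists (ha y z'); split => //; rewrite ger0_norm //; case/andP: h.
    exists (ha y z' - pi); split; last by rewrite ler0_norm; move: h => /andP[]; lra.
    by rewrite {1}e /P -[ha y z' in LHS](subrK pi) expi2Dpi.
  have tt : `|t| <= tau.
    by rewrite leNgt; apply/negP => h; have := far t (ltW h) th; rewrite -tE -zE; lra.
  have [//|] := NSt t; move=> /existsNP[t' /existsNP[t'' /not_implyP[h1 /not_implyP[h2 /not_implyP[h3 /contrapT h4]]]]].
  exists (mob g (P t')), (mob g (P t'')); split; [exact: L_mob| |exact: far].
  rewrite zE tE chord_mob // chP ler_pdivrMr; last by rewrite mulr_gt0.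
  have s1 : `|sin (t - t')| <= de ^+ 2 * tau by apply: le_trans (abs_sin_le _) _; rewrite distrC.
  have j1 : r ^+ 2 <= C * (r * nz g (P t)) by apply: le_trans (nzP t); rewrite lerDl normr_ge0.
  have j2 : r ^+ 2 <= C * (r * nz g (P t')) by apply: le_trans (nzP t'); rewrite lerDl normr_ge0.
  have : r ^+ 2 * r ^+ 2 <= (C * (r * nz g (P t'))) * (C * (r * nz g (P t))).
    by apply: ler_pM => //; rewrite sqr_ge0.
  have -> : (C * (r * nz g (P t'))) * (C * (r * nz g (P t))) = r ^+ 2 * (C ^+ 2 * (nz g (P t') * nz g (P t))) by ring.
  rewrite ler_pM2l ?exprn_gt0 // r2 => h5.
  have h6 : de * (de * tau) <= de * (C ^+ 2 * (nz g (P t') * nz g (P t))) by rewrite ler_pM2l.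
  apply: le_trans (_ : 2 * (de * (C ^+ 2 * (nz g (P t') * nz g (P t)))) <= _).
    apply: le_trans (_ : 2 * (de ^+ 2 * tau) <= _); first by rewrite ler_pM2l.
    by rewrite expr2 ler_pM2l // -mulrA.
  rewrite /K; set q := nz g (P t') * nz g (P t).
  have q0 : 0 < q by rewrite mulr_gt0.
  have -> : 2 * (de * (C ^+ 2 * q)) = (2 * C ^+ 2 * de * q) * 1 by ring.
  have -> : 2 * C ^+ 2 / c * de * q = (2 * C ^+ 2 * de * q) * c^-1 by ring.
  apply: ler_wpM2l; last by rewrite invf_ge1.
  apply: mulr_ge0 (ltW q0); apply: mulr_ge0 (ltW d0); apply: mulr_ge0 (sqr_ge0 C).
  exact: ler0n.
have /choice[w' Hw'] : forall n, exists w, circle w /\ forall z, circle z -> K * dy R n < cabs (z - w) ->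
    exists u v, [/\ L (geod u v), cabs (u - z) <= K * dy R n & cabs (v - w) <= K * dy R n].
  by move=> n; have [w h1 h2] := step (dy R n) (dy_gt0 R n) (dy_le1 R n); exists w.
have Mw n : 0 <= ha 1 (w' n) <= pi.
  by have [cn _] := Hw' n; rewrite ha_ge0 ?(ltW (ha_ltpi _ cn)) //; exact: (circle1 R).
have [s Hs] := @bounded_cluster R (fun n => ha 1 (w' n)) pi Mw.
pose w := expi (2 * s).
have near e N : 0 < e -> exists2 n, (N <= n)%N & cabs (w' n - w) < e.
  move=> e0; have [n nN hn] := Hs (e / 2) N ltac:(lra); exists n => //.
  have [cwn _] := Hw' n.
  have [_ ->] := haP (circle1 R) cwn; rewrite mul1r /w chord_expi distrC in hn *.
  by have := abs_sin_le (s - ha 1 (w' n)); lra.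
apply: (no_fan (w := w)); first exact: circle_expi.
move=> z cz zw; apply: L_closed => // [|e e0]; first exact: circle_expi.
have d0 : 0 < cabs (z - w).
  by rewrite lt_neqAle cabs_ge0 andbT eq_sym; apply/eqP => /cabs_eq0/eqP; rewrite subr_eq0 => /eqP.
pose m := Num.min (e / 2) (cabs (z - w) / 2).
have m0 : 0 < m by rewrite lt_min; apply/andP; split; lra.
have [N HN] := dy_small (divr_gt0 m0 K0).
have [n nN hn] := near m N m0.
have Kn : K * dy R n < m.
  by rewrite mulrC -ltr_pdivlMr //; apply: le_lt_trans HN; exact: dy_le.
have m1 : m <= e / 2 by rewrite ge_min lexx.
have m2 : m <= cabs (z - w) / 2 by rewrite ge_min lexx orbT.
have [_ /(_ z cz)] := Hw' n; case.
  by have := cabs_tri z (w' n) w; lra.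
move=> u [v [h1 h2 h3]]; exists u, v; split=> //; first lra.
have := cabs_tri v (w' n) w; lra.
Qed.

End NoStrip.

(** * Free geodesics of a maximal lamination *)

Section MaximalLeaf.
Variable R : realType.
Variables (G : set 'M[R[i]]_2) (L : set (set R[i])).
Hypothesis fG : cocompact_fuchsian G.
Hypothesis ML : maximal_lamination G L.
Implicit Types (g h : 'M[R[i]]_2) (z w v x y u : R[i]).

Let LL : lifted_lamination G L. Proof. by case: ML. Qed.

Lemma crosses_sym x y u v : circle x -> circle y -> circle u -> circle v ->
  crosses (geod x y) (geod u v) -> crosses (geod u v) (geod x y).
Proof.
move=> cx cy cu cv; rewrite -(pt_hv cx) -(pt_hv cy) -(pt_hv cu) -(pt_hv cv).
move=> /crosses_om H; apply/crosses_om; rewrite ?hv_neq0 //.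
move: (H (hv_neq0 x) (hv_neq0 y) (hv_neq0 u) (hv_neq0 v)).
rewrite [om (hv u) (hv x)]omC [om (hv y) (hv v)]omC; nra.
Qed.

(** Twice the signed area of the Euclidean triangle [x, y, u]. Unlike the half-angle lifts it is
    continuous on the whole circle, which shows that crossing is an open condition. *)
Definition cs x y u : R := om (y - x) (u - x).

Lemma cs_hv x y u : circle x -> circle y -> circle u ->
  cs x y u = 4 * (om (hv x) (hv u) * om (hv x) (hv y) * om (hv y) (hv u)).
Proof.
move=> cx cy cu.
have e z : circle z -> exists a b : R, [/\ hv z = Complex a b, a ^+ 2 + b ^+ 2 = 1 & z = Complex (a ^+ 2 - b ^+ 2) (2 * a * b)].
  move=> cz; have := cabs_hv z; have := pt_hv cz; rewrite /pt; case: (hv z) => a b /= h1 h2.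
  have n : a ^+ 2 + b ^+ 2 = 1.
    by move: h2 => /(congr1 (fun t => t ^+ 2)); rewrite sqr_sqrtr ?addr_ge0 ?sqr_ge0 // expr1n.
  have n0 : Complex a (- b) != 0.
    apply/eqP => /(congr1 (fun t => complex.Re t ^+ 2 + complex.Im t ^+ 2)) /=.
    by rewrite sqrrN n expr0n addr0 => /eqP; rewrite oner_eq0.
  exists a, b; split=> //; rewrite -h1.
  have -> : Complex a b = Complex (a ^+ 2 - b ^+ 2) (2 * a * b) * Complex a (- b).
    by apply/eqP; rewrite eq_complex /=; apply/andP; split; apply/eqP;
      [transitivity (a * (a ^+ 2 + b ^+ 2))|transitivity (b * (a ^+ 2 + b ^+ 2))]; try (by rewrite n mulr1); ring.
  by rewrite mulfK.
have [a [b [-> n1 ->]]] := e x cx; have [c [d [-> n2 ->]]] := e y cy; have [p [q [-> n3 ->]]] := e u cu.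
rewrite /cs /om /=.
have -> : 4 * ((a * q - b * p) * (a * d - b * c) * (c * q - d * p)) =
   2 * ((c ^+ 2 - d ^+ 2) * (2 * p * q) - (p ^+ 2 - q ^+ 2) * (2 * c * d)) * (a ^+ 2 + b ^+ 2) / 2
  + ((p ^+ 2 - q ^+ 2) * (2 * a * b) - (a ^+ 2 - b ^+ 2) * (2 * p * q)) * (c ^+ 2 + d ^+ 2)
  + ((a ^+ 2 - b ^+ 2) * (2 * c * d) - (c ^+ 2 - d ^+ 2) * (2 * a * b)) * (p ^+ 2 + q ^+ 2) by field.
by rewrite n1 n2 n3; field.
Qed.

Lemma crosses_cs x y u v : circle x -> circle y -> circle u -> circle v -> x <> y ->
  crosses (geod x y) (geod u v) <-> cs x y u * cs x y v < 0.
Proof.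
move=> cx cy cu cv xy; rewrite !cs_hv //.
have o0 : 0 < om (hv x) (hv y) ^+ 2.
  rewrite exprn_even_gt0 //=; apply/eqP => o0; apply: xy; rewrite -(pt_hv cx) -(pt_hv cy).
  by apply/pt_eq; rewrite ?hv_neq0.
rewrite -{1}(pt_hv cx) -{1}(pt_hv cy) -{1}(pt_hv cu) -{1}(pt_hv cv).
have := crosses_om (hv_neq0 x) (hv_neq0 y) (hv_neq0 u) (hv_neq0 v).
rewrite [om (hv u) (hv y)]omC [om (hv v) (hv y)]omC => ->.
set A := om (hv x) (hv u); set B := om (hv y) (hv u); set C := om (hv x) (hv v); set D := om (hv y) (hv v).
set E := om (hv x) (hv y) in o0 *.
have -> : 4 * (A * E * B) * (4 * (C * E * D)) = (16 * E ^+ 2) * (A * - B * (C * - D)) by ring.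
have k0 : 0 < 16 * E ^+ 2 by rewrite mulr_gt0.
by rewrite (pmulr_rlt0 _ k0).
Qed.

Lemma cs_cont x y u x' y' u' (e : R) : circle x -> circle y -> circle u -> circle x' -> circle y' -> circle u' ->
  cabs (x' - x) < e -> cabs (y' - y) < e -> cabs (u' - u) < e -> `|cs x' y' u' - cs x y u| <= 8 * e.
Proof.
move=> cx cy cu cx' cy' cu' h1 h2 h3.
have -> : cs x' y' u' - cs x y u = om ((y' - y) - (x' - x)) (u' - x') + om (y - x) ((u' - u) - (x' - x)).
  rewrite /cs; clear; case: x y u x' y' u' => a b [c d] [e f] [a' b'] [c' d'] [e' f'].
  by rewrite /om /=; ring.
have b2 z z' : circle z -> circle z' -> cabs (z - z') <= 2.
  by move=> c c'; apply: le_trans (cabsD _ _) _; rewrite cabsN (_ : cabs z = 1) // (_ : cabs z' = 1) //; lra.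
apply: le_trans (ler_normD _ _) _.
have k1 : cabs (y' - y - (x' - x)) <= 2 * e by apply: le_trans (cabsD _ _) _; rewrite cabsN; lra.
have k2 : cabs (u' - u - (x' - x)) <= 2 * e by apply: le_trans (cabsD _ _) _; rewrite cabsN; lra.
have := ler_pM (cabs_ge0 _) (cabs_ge0 _) k1 (b2 _ _ cu' cx').
have := ler_pM (cabs_ge0 _) (cabs_ge0 _) (b2 _ _ cy cx) k2.
have := om_le (y' - y - (x' - x)) (u' - x'); have := om_le (y - x) (u' - u - (x' - x)).
lra.
Qed.

Lemma act_le g z : cabs (act g z) <= (cabs (g ord0 ord0) + cabs (g ord0 ord_max)) * cabs z.
Proof. by apply: le_trans (cabsD _ _) _; rewrite !cabsM cabsJ mulrDl. Qed.

Lemma mob_lipschitz g : G g -> exists2 K : R, 0 < K & forall x y, circle x -> circle y ->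
  cabs (mob g x - mob g y) <= K * cabs (x - y).
Proof.
move=> Gg; have sg := G_su11 fG Gg; set h := invmx g.
pose M := cabs (h ord0 ord0) + cabs (h ord0 ord_max).
have nzM x : 1 <= M * nz g x.
  by have := act_le h (act g (hv x)); rewrite (act_invK fG) // cabs_hv.
have M0 : 0 < M.
  have := nzM 0; have := nz_gt0 0 sg; have : 0 <= M by rewrite addr_ge0 ?cabs_ge0.
  by rewrite le_eqVlt => /orP[/eqP <-|//]; lra.
exists (M ^+ 2); first by rewrite exprn_gt0.
move=> x y cx cy; rewrite chord_mob // ler_pdivrMr ?mulr_gt0 ?nz_gt0 //.
have -> : M ^+ 2 * cabs (x - y) * (nz g x * nz g y) = cabs (x - y) * ((M * nz g x) * (M * nz g y)) by ring.
apply: ler_peMr; first exact: cabs_ge0.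
by rewrite -[X in X <= _](mulr1 1); apply: ler_pM.
Qed.

(** Adding the orbit of the geodesic to [L] and taking the closure gives a lamination containing
    [L], hence equal to it by maximality. *)
Lemma maximal_leaf x y : circle x -> circle y -> x <> y ->
  (forall u v, L (geod u v) -> ~ crosses (geod u v) (geod x y)) ->
  (forall g, G g -> ~ crosses (geod x y) (geod (mob g x) (mob g y))) -> L (geod x y).
Proof.
move=> cx cy xy H1 H2; have su g : G g -> su11 g by exact: (G_su11 fG).
have leafc u v : L (geod u v) -> [/\ circle u, circle v & u <> v].
  by apply: leaf_circle; exact: (L_leaf LL).
pose S0 u v := L (geod u v) \/ exists c, G c /\ geod u v = geod (mob c x) (mob c y).
have S0c u v : S0 u v -> circle u /\ circle v.
  case=> [/leafc[]//|[c [Gc /geod_eq [[-> ->]|[-> ->]]]]].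
    by split; apply: circle_mob => //; exact: su.
  by split; apply: circle_mob => //; exact: su.
have S0C u v : S0 u v -> S0 v u by rewrite /S0 [geod v u]geodC'.
have Gi g : G g -> G (invmx g) by exact: (G_inv fG).
have S0m c u v : G c -> S0 u v -> S0 (mob c u) (mob c v).
  move=> Gc [h|[c' [Gc' e]]]; first by left; apply: (L_mob LL).
  right; exists (c *m c'); split; first exact: (G_mul fG).
  by rewrite -image_mob_geod e image_mob_geod !mob_mul //; exact: su.
have lg c u v : G c -> L (geod u v) -> ~ crosses (geod u v) (geod (mob c x) (mob c y)).
  move=> Gc Luv; have [cu cv _] := leafc _ _ Luv.
  have cu' := circle_mob (su _ (Gi _ Gc)) cu; have cv' := circle_mob (su _ (Gi _ Gc)) cv.
  rewrite -(mob_Kinv fG Gc cu) -(mob_Kinv fG Gc cv) crosses_mob //; last exact: su.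
  by apply: H1; apply: (L_mob LL) => //; exact: Gi.
have S0n u v u' v' : S0 u v -> S0 u' v' -> ~ crosses (geod u v) (geod u' v').
  move=> s1 s2; have [cu cv] := S0c _ _ s1; have [cu' cv'] := S0c _ _ s2.
  case: s1 s2 => [l1|[c [Gc e]]] [l2|[c' [Gc' e']]].
  - exact: (L_nc LL).
  - by rewrite e'; apply: lg.
  - by move=> /(crosses_sym cu cv cu' cv'); rewrite e; apply: lg.
  rewrite e e'; have ce : G (invmx c *m c') by apply: (G_mul fG) => //; exact: Gi.
  have E z : circle z -> mob c' z = mob c (mob (invmx c *m c') z).
    move=> cz; rewrite mob_mul //; [|by apply: su; exact: Gi|exact: su].
    by rewrite (mob_Kinv fG) //; apply: circle_mob => //; exact: su.
  rewrite (E x) // (E y) // crosses_mob //; try (apply: circle_mob => //); try exact: su.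
  exact: H2.
pose cl x' y' := forall e : R, 0 < e -> exists u v, [/\ S0 u v, cabs (u - x') < e & cabs (v - y') < e].
have clC x' y' : cl x' y' -> cl y' x'.
  by move=> h e e0; have [u [v [s a b]]] := h e e0; exists v, u; split=> //; exact: S0C.
pose L' : set (set R[i]) := fun (g : set R[i]) => exists x' y', [/\ circle x', circle y', x' <> y', g = geod x' y' & cl x' y'].
have L'g x' y' : L' (geod x' y') -> [/\ circle x', circle y', x' <> y' & cl x' y'].
  move=> [a [b [ca cb ab /geod_eq [[-> ->]|[-> ->]] h]]]; first by split.
  by split=> //; [move=> e; apply: ab|exact: clC].
have clS u v : S0 u v -> cl u v.
  by move=> s e e0; exists u, v; rewrite !subrr cabs0.
have LL' : lifted_lamination G L'.
  split.
  - by move=> g [a [b [ca cb ab -> _]]]; exists a, b.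
  - move=> g h [a [b [ca cb ab -> k1]]] [p [q [cp cq pq -> k2]]].
    move=> /(crosses_cs ca cb cp cq ab) neg.
    (* Approximants within [m / 16] change [cs] by at most [m / 2], so they would cross just as
       their limits do. *)
    pose m := Num.min `|cs a b p| `|cs a b q|.
    have m0 : 0 < m.
      rewrite lt_min !normr_gt0; apply/andP; split; apply/eqP => z.
        by move: neg; rewrite z mul0r ltxx.
      by move: neg; rewrite z mulr0 ltxx.
    have e0 : 0 < m / 16 by lra.
    have [u [v [s1 d1 d2]]] := k1 _ e0; have [u' [v' [s2 d3 d4]]] := k2 _ e0.
    have [cu cv] := S0c _ _ s1; have [cu' cv'] := S0c _ _ s2.
    have c1 := cs_cont ca cb cp cu cv cu' d1 d2 d3.
    have c2 := cs_cont ca cb cq cu cv cv' d1 d2 d4.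
    have m1 : m <= `|cs a b p| by rewrite ge_min lexx.
    have m2 : m <= `|cs a b q| by rewrite ge_min lexx orbT.
    have uv : u <> v.
      move=> e; subst v; move: c1 m1; rewrite {1}/cs subrr (_ : om 0 _ = 0); last by rewrite /om !mul0r subrr.
      by rewrite sub0r normrN; lra.
    apply: (S0n _ _ _ _ s1 s2); apply/crosses_cs => //.
    move: c1 c2 m1 m2 neg; set A := cs u v u'; set B := cs u v v'; set A' := cs a b p; set B' := cs a b q.
    rewrite !ler_norml => /andP[i1 i2] /andP[i3 i4].
    case: (ger0P A') => hA; case: (ger0P B') => hB k3 k4 k5.
    - by have : 0 <= A' * B' by [apply: mulr_ge0]; lra.
    - by have a0 : 0 < A by [lra]; have b0 : B < 0 by [lra]; rewrite pmulr_rlt0.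
    - by have a0 : 0 < B by [lra]; have b0 : A < 0 by [lra]; rewrite pmulr_llt0.
    - by have : 0 < A' * B' by [rewrite nmulr_rgt0]; lra.
  - move=> c g Gc [a [b [ca cb ab -> k1]]]; rewrite image_mob_geod.
    have sc := su _ Gc; exists (mob c a), (mob c b); split; try exact: circle_mob.
    - by move=> /(mob_inj sc ca cb).
    - by [].
    move=> e e0; have [K K0 HK] := mob_lipschitz Gc.
    have [u [v [s d1 d2]]] := k1 (e / K) ltac:(by rewrite divr_gt0).
    have [cu cv] := S0c _ _ s.
    exists (mob c u), (mob c v); split; first exact: S0m.
      by apply: le_lt_trans (HK _ _ cu ca) _; rewrite mulrC -ltr_pdivlMr.
    by apply: le_lt_trans (HK _ _ cv cb) _; rewrite mulrC -ltr_pdivlMr.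
  move=> a b ca cb ab H; exists a, b; split=> // e e0.
  have [u [v [/L'g [cu cv _ k] d1 d2]]] := H (e / 2) ltac:(lra).
  have [u' [v' [s d3 d4]]] := k (e / 2) ltac:(lra).
  exists u', v'; split=> //.
    by have := cabs_tri u' u a; lra.
  by have := cabs_tri v' v b; lra.
have <- : L' = L.
  apply: (proj2 ML) LL' _ => g Lg; have [a [b [ca cb ab e]]] := L_leaf LL Lg.
  by exists a, b; split=> //; apply: clS; left; rewrite -e.
exists x, y; split=> //; apply: clS; right; exists 1%:M; split; first exact: (G_1 fG).
by rewrite !mob1.
Qed.

End MaximalLeaf.

(** * Complementary regions *)

Section Triangles.
Variable R : realType.
Variables (G : set 'M[R[i]]_2) (L : set (set R[i])).
Hypothesis fG : cocompact_fuchsian G.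
Hypothesis ML : maximal_lamination G L.
Implicit Types (g h : 'M[R[i]]_2) (z w v x y u a b c d e : R[i]).

Let LL : lifted_lamination G L. Proof. by case: ML. Qed.

Local Notation c1 := (Complex 1 0 : R[i]).
Local Notation ci := (Complex 0 1 : R[i]).

Lemma om0l z : om 0 z = 0. Proof. by rewrite /om !mul0r subrr. Qed.
Lemma om0r z : om z 0 = 0. Proof. by rewrite omC om0l oppr0. Qed.
Lemma omNl z w : om (- z) w = - om z w.
Proof. by rewrite -{1}[z]rs1 -rsN om_rsl mulN1r. Qed.
Lemma omNr z w : om z (- w) = - om z w.
Proof. by rewrite omC omNl omC opprK. Qed.
Lemma om_neq0 z w : om z w != 0 -> z != 0 /\ w != 0.
Proof. by move=> h; split; apply: contra_neq h => ->; rewrite ?om0l ?om0r. Qed.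

Lemma om0_trans a b c : b != 0 -> om a b = 0 -> om b c = 0 -> om a c = 0.
Proof.
move=> b0 h1 h2; have h3 : om b a = 0 by rewrite omC h1 oppr0.
by have [r ->] := om0_rs b0 h3; rewrite om_rsl h2 mulr0.
Qed.

(* Quadratic in each argument, so its sign does not depend on the lifts: it tells on which side of the
   geodesic from [c] to [d] the point [a] lies. *)
Definition side c d a : R := om a c * om a d.

Lemma side_act g c d a : su11 g -> side (act g c) (act g d) (act g a) = side c d a.
Proof. by move=> sg; rewrite /side !om_act. Qed.

Lemma side_swap a b c d : side c d a * side c d b = side a b c * side a b d.
Proof. by rewrite /side [om c a]omC [om c b]omC [om d a]omC [om d b]omC; ring. Qed.

Lemma crosses_side a b c d : a != 0 -> b != 0 -> c != 0 -> d != 0 ->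
  crosses (geod (pt a) (pt b)) (geod (pt c) (pt d)) <-> side c d a * side c d b < 0.
Proof.
move=> a0 b0 c0 d0; have := crosses_om a0 b0 c0 d0.
rewrite /side [om c b]omC [om d b]omC => ->.
by rewrite (_ : om a c * - om b c * (om a d * - om b d) = om a c * om a d * (om b c * om b d)) //; ring.
Qed.

(** If [a, b] lie on one side of a line and [a', b'] on the other, the geodesics [a b] and [a' b']
    do not cross. *)
Lemma side_uncrossed a b c d a' b' : om c d != 0 -> 0 <= side c d a -> 0 <= side c d b ->
  side c d a' <= 0 -> side c d b' <= 0 -> 0 <= side a b a' * side a b b'.
Proof.
move=> k0; rewrite /side.
(* Pluecker relation, expressing all forms between the four points by their forms with [c] and
   [d]. *)
have pl z t : om z t * om c d = om z c * om t d - om z d * om t c.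
  by rewrite /om; ring.
have k4 : 0 < om c d ^+ 4 by rewrite exprn_even_gt0.
move=> s1 s2 s3 s4; rewrite -(pmulr_rge0 _ k4); move: s1 s2 s3 s4.
have -> : om c d ^+ 4 * (om a' a * om a' b * (om b' a * om b' b)) =
  (om a' a * om c d) * (om a' b * om c d) * ((om b' a * om c d) * (om b' b * om c d)) by ring.
rewrite !pl.
have sg p q : 0 <= p * q -> exists s : R, [/\ s * s = 1, 0 <= s * p & 0 <= s * q].
  move=> h; have [p0|p0|p0] := ltgtP p 0.
  - by exists (-1); split; [ring|lra|nra].
  - by exists 1; split; [ring|lra|nra].
  have [q0|q0] := leP 0 q; [exists 1|exists (-1)]; (split; [ring|rewrite p0; lra|lra]).
move=> /sg[s1 [e1 u1 v1]] /sg[s2 [e2 u2 v2]].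
rewrite -oppr_ge0 -mulNr => /sg[s3 [e3 u3 v3]].
rewrite -oppr_ge0 -mulNr => /sg[s4 [e4 u4 v4]].
move: (om a c) (om a d) (om b c) (om b d) (om a' c) (om a' d) (om b' c) (om b' d) u1 v1 u2 v2 u3 v3 u4 v4.
move=> A1 A2 B1 B2 P1 P2 Q1 Q2 u1 v1 u2 v2 u3 v3 u4 v4.
have -> : (P1 * A2 - P2 * A1) * (P1 * B2 - P2 * B1) * ((Q1 * A2 - Q2 * A1) * (Q1 * B2 - Q2 * B1)) =
  (((s3 * - P1) * (s1 * A2) + (s3 * P2) * (s1 * A1)) * ((s3 * - P1) * (s2 * B2) + (s3 * P2) * (s2 * B1))) *
  (((s4 * - Q1) * (s1 * A2) + (s4 * Q2) * (s1 * A1)) * ((s4 * - Q1) * (s2 * B2) + (s4 * Q2) * (s2 * B1))).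
  transitivity ((s1 * s1) * (s2 * s2) * (s3 * s3) * (s4 * s4) * ((P1 * A2 - P2 * A1) * (P1 * B2 - P2 * B1) * ((Q1 * A2 - Q2 * A1) * (Q1 * B2 - Q2 * B1)))); last by ring.
  by rewrite e1 e2 e3 e4 !mul1r.
by rewrite !mulr_ge0 // addr_ge0 // mulr_ge0.
Qed.

Definition leafv c d := L (geod (pt c) (pt d)).

Lemma leafv_om c d : leafv c d -> c != 0 -> d != 0 -> om c d != 0.
Proof.
move=> h c0 d0; have [_ _ ne] := leaf_circle (L_leaf LL) h.
by apply/eqP => e; apply: ne; apply/pt_eq.
Qed.

Lemma leafvC c d : leafv c d -> leafv d c.
Proof. by rewrite /leafv geodC'. Qed.

Lemma leafv_eq c d c' : c != 0 -> c' != 0 -> om c c' = 0 -> leafv c d -> leafv c' d.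
Proof. by move=> c0 c0' e; rewrite /leafv (proj2 (pt_eq c0 c0') e). Qed.

Lemma leafv_act g c d : G g -> c != 0 -> d != 0 -> leafv c d -> leafv (act g c) (act g d).
Proof.
move=> Gg c0 d0 h; have sg := G_su11 fG Gg.
by rewrite /leafv -!mob_pt //; apply: (L_mob LL).
Qed.

(** No leaf strictly separates [a] from [b]; the two points may coincide. *)
Definition frv a b := forall c d, c != 0 -> d != 0 -> leafv c d -> 0 <= side c d a * side c d b.

Lemma finite_min (T : Type) (P : T -> Prop) (f : T -> R) (s : seq R) : (exists x : T, P x) ->
  (forall x : T, P x -> f x \in s) -> exists2 x : T, P x & forall y : T, P y -> f x <= f y.
Proof.
elim: s P => [|k s IH] P [x Px] H; first by have := H x Px.
case: (pselect (exists y : T, P y /\ f y < k)) => [[y [Py yk]]|N].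
  have [||z [Pz zk] Hz] := IH (fun t => P t /\ f t < k); first by exists y.
    by move=> t [Pt tk]; have := H t Pt; rewrite inE (lt_eqF tk).
  exists z => // t Pt; case: (ltP (f t) k) => tk; first exact: Hz.
  exact: ltW (lt_le_trans zk tk).
have ge t : P t -> k <= f t by move=> Pt; rewrite leNgt; apply/negP => h; apply: N; exists t.
case: (pselect (exists y : T, P y /\ f y = k)) => [[y [Py yk]]|N'].
  by exists y => // t Pt; rewrite yk ge.
apply: IH; first by exists x.
by move=> t Pt; have := H t Pt; rewrite inE => /orP[/eqP e|//]; case: N'; exists t.
Qed.

Lemma eigen_basis g : G g -> 4 < tr g ^+ 2 -> exists v w (m : R),
  [/\ om v w = 1, act g v = rs m v, act g w = rs m^-1 w, tr g = m + m^-1 & 1 < `|m|].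
Proof.
move=> Gg t4; have sg := G_su11 fG Gg; set t := tr g in t4 *.
have [m [m0 mt m1]] : exists m : R, [/\ m != 0, t = m + m^-1 & 1 < `|m|].
  have d0 : 0 < t ^+ 2 - 4 by lra.
  pose q := Num.sqrt (t ^+ 2 - 4); have q0 : 0 < q by rewrite sqrtr_gt0.
  have q2 : q ^+ 2 = t ^+ 2 - 4 by rewrite sqr_sqrtr // ltW.
  have key m : m != 0 -> m ^+ 2 = t * m - 1 -> t = m + m^-1.
    by move=> m0 e; apply: (mulIf m0); rewrite mulrDl mulVf // -expr2 e; ring.
  have [tp|tn] := leP 0 t.
    have mp : 1 < (t + q) / 2 by nra.
    exists ((t + q) / 2); split; [lra| |by rewrite ger0_norm; lra].
    apply: key; first lra.
    by transitivity ((t ^+ 2 + 2 * t * q + q ^+ 2) / 4); [field|rewrite q2; field].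
  have mp : (t - q) / 2 < - 1 by nra.
  exists ((t - q) / 2); split; [lra| |by rewrite ltr0_norm; lra].
  apply: key; first lra.
  by transitivity ((t ^+ 2 - 2 * t * q + q ^+ 2) / 4); [field|rewrite q2; field].
(* If every vector were an eigenvector, [g] would be scalar, of trace 2 or -2. *)
have [z oz] : exists z, om (act g z) z != 0.
  apply: contrapT => /forallNP H.
  have H' z : om (act g z) z = 0 by apply/eqP; apply: contrapT => /negP; exact: H.
  have n1 : c1 != 0 by rewrite eq_complex /= oner_eq0.
  have n2 : ci != 0 by rewrite eq_complex /= oner_eq0 andbF.
  have [|p hp] := @om0_rs _ c1 (act g c1) n1; first by rewrite omC H' oppr0.
  have [|q hq] := @om0_rs _ ci (act g ci) n2; first by rewrite omC H' oppr0.
  have o1 : om c1 ci = 1 by rewrite /om /=; ring.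
  have := H' (c1 + ci); rewrite actD hp hq omDl !om_rsl !omDr !om_self [om ci c1]omC o1 => pq.
  have := om_act c1 ci sg; rewrite hp hq om_rsl om_rsr o1 => p2.
  have e : p = q by lra.
  have gE := scalar_of_act sg hp (etrans hq (congr1 (fun t => rs t ci) (esym e))).
  by move: t4; rewrite /t /tr gE !mxE eqxx mulr1n /=; nra.
have cy := cayley z sg; rewrite -/t in cy.
(* By Cayley-Hamilton [g - m^-1] and [g - m] map into the eigenspaces of [m] and [m^-1]. *)
pose v := act g z - rs m^-1 z; pose w0 := act g z - rs m z.
have rsc (p : R) (s q : R[i]) : rs p (s - q) = rs p s - rs p q by rewrite rsDr rsNr.
have actN' u : act g (- u) = - act g u.
  by rewrite -[u]rs1 -rsN !act_rs rsN.
have gv : act g v = rs m v.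
  rewrite /v actD actN' act_rs cy rsc rsA divff // rs1 mt rsD.
  by rewrite addrAC addrK.
have gw : act g w0 = rs m^-1 w0.
  rewrite /w0 actD actN' act_rs cy rsc rsA mulVf // rs1 mt rsD.
  by rewrite [rs m (act g z) + _]addrC addrAC addrK.
have k0 : om v w0 != 0.
  have -> : om v w0 = (m^-1 - m) * om (act g z) z.
    rewrite /v /w0; move: (act g z) => Z; rewrite !omDl !omDr !omNl !omNr !om_rsl !om_rsr !om_self [om z Z]omC; ring.
  rewrite mulf_neq0 //; apply/eqP => e; have : m * m = 1.
    by rewrite -{1}(_ : m^-1 = m) ?mulVf //; lra.
  by move/(congr1 Num.norm); rewrite normrM normr1; nra.
exists v, (rs (om v w0)^-1 w0), m; split=> //.
  by rewrite om_rsr mulVf.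
by rewrite act_rs gw !rsA mulrC.
Qed.

Lemma coord_tr g v w : su11 g -> om v w = 1 ->
  tr g = om (act g v) w + om v (act g w) /\
  om (act g v) w * om v (act g w) - om (act g w) w * om v (act g v) = 1.
Proof.
move=> sg o; set A := om (act g v) w; set D := om v (act g w); set B := om (act g w) w; set C := om v (act g v).
have gv : act g v = rs A v + rs C w by exact: basis_decomp.
have gw : act g w = rs B v + rs D w by exact: basis_decomp.
have owv : om w v = -1 by rewrite omC o.
have det : A * D - B * C = 1.
  rewrite -[RHS]o -[RHS](om_act v w sg) gv gw !omDl !omDr !om_rsl !om_rsr !om_self o owv; ring.
split=> //.
have cy := cayley v sg; rewrite {1}gv actD !act_rs in cy.
have lin (p q r : R) X Y Z W u : rs p X + rs q Y = rs r Z - W ->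
    p * om u X + q * om u Y = r * om u Z - om u W.
  by move/(congr1 (om u)); rewrite !omDr !om_rsr omNr.
have e1 := lin _ _ _ _ _ _ _ v cy; have e2 := lin _ _ _ _ _ _ _ w cy.
rewrite om_self -/C -/D subr0 in e1.
rewrite -(opprK (om w _)) -(omC (act g v)) -(opprK (om w (act g w))) -(omC (act g w)) in e2.
rewrite owv -/A -/B in e2.
have h1 : C * (tr g - A - D) = 0 by lra.
have h2 : A * (tr g - A - D) = 0 by nra.
case/eqP: h1; rewrite mulf_eq0 => /orP[/eqP C0|/eqP]; last by lra.
case/eqP: h2; rewrite mulf_eq0 => /orP[/eqP A0|/eqP]; last by lra.
by move: det; rewrite A0 C0 mul0r mulr0; lra.
Qed.

(** Conjugation brings an eigenbasis back to bounded size, where discreteness leaves finitely many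
    elements with bounded eigenvalues: the length spectrum is discrete. *)
Lemma finite_traces (T0 : R) : exists s : seq R, forall g, G g -> 4 < tr g ^+ 2 -> tr g ^+ 2 <= T0 -> tr g ^+ 2 \in s.
Proof.
have [C C1 HC] := cocompact_basis fG.
have [s Hs] := discrete_list fG ((T0 + 2) * C).
exists [seq tr g ^+ 2 | g <- s] => g Gg t4 tT.
have [v [w [m [k1 gv gw gt m1]]]] := eigen_basis Gg t4.
have [h [Gh h1 h2]] := HC v w k1.
pose k := h *m g *m invmx h.
have Gi := G_inv fG Gh.
have Gk : G k by do !apply: (G_mul fG).
have su := G_su11 fG.
have kE z : act k (act h z) = act h (act g z).
  by rewrite /k !act_mul ?(act_invK fG) //; exact: su.
have oh : om (act h v) (act h w) = 1 by rewrite om_act //; exact: su.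
have kv : act k (act h v) = rs m (act h v) by rewrite kE gv act_rs.
have kw : act k (act h w) = rs m^-1 (act h w) by rewrite kE gw act_rs.
have tk : tr k = tr g.
  have [-> _] := coord_tr (su _ Gk) oh.
  by rewrite kv kw om_rsl om_rsr oh !mulr1 gt.
rewrite -tk; apply: map_f.
have m2 : `|m| <= T0 + 2.
  have n1 : 0 < `|m| by lra.
  have : `|m| <= `|tr g| + 1.
    have := ler_normD (m + m^-1) (- m^-1); rewrite addrK normrN normfV gt => j.
    have : `|m|^-1 <= 1 by rewrite invf_le1 //; exact: ltW.
    lra.
  have : `|tr g| ^+ 2 <= T0 by rewrite real_normK ?num_real.
  by have := normr_ge0 (tr g); nra.
have mi : `|m^-1| <= 1 by rewrite normfV invf_le1; [exact: ltW|lra].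
have b1 := cabs_ge0 (act h v); have b2 := cabs_ge0 (act h w).
apply: (Hs _ _ _ Gk oh); rewrite ?kv ?kw ?cabs_rs.
- by nra.
- by nra.
- by apply: ler_pM => //; lra.
by have := normr_ge0 m^-1; nra.
Qed.

Lemma pow_large (m B : R) : 1 < `|m| -> exists n, B < (m ^+ n) ^+ 2.
Proof.
move=> m1; have m2 : 1 < m ^+ 2 by rewrite -real_normK ?num_real //; nra.
have m2p : 0 < m ^+ 2 by apply: lt_trans m2.
have B0 := normr_ge0 B.
have [|||n hn] := @expr_small R (m ^+ 2)^-1 (`|B| + 1)^-1.
- by rewrite invr_ge0 ltW.
- by rewrite invf_lt1.
- by rewrite invr_gt0; lra.
have B1 : 0 < `|B| + 1 by lra.
exists n; move: hn; rewrite exprVn (@ltf_pV2 _ ((m ^+ 2) ^+ n) (`|B| + 1) (exprn_gt0 n m2p) B1).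
by rewrite -!exprM mulnC; have := ler_norm B; lra.
Qed.

End Triangles.

(** * Complementary regions with a diagonal that is not a leaf *)

Section Polygon.
Variable R : realType.
Variables (G : set 'M[R[i]]_2) (L : set (set R[i])).
Hypothesis fG : cocompact_fuchsian G.
Hypothesis ML : maximal_lamination G L.
Implicit Types (g h : 'M[R[i]]_2) (z w v u a b c d e : R[i]).

Let LL : lifted_lamination G L. Proof. by case: ML. Qed.
Let su g : G g -> su11 g. Proof. exact: (G_su11 fG). Qed.
Let Gi g : G g -> G (invmx g). Proof. exact: (G_inv fG). Qed.
Local Notation leafv := (leafv L).
Local Notation frv := (frv L).

Lemma inv_rs g v (r : R) : G g -> r != 0 -> act g v = rs r v -> act (invmx g) v = rs r^-1 v.
Proof.
move=> Gg r0 e; have := congr1 (act (invmx g)) e; rewrite (act_invK fG) // act_rs => h.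
by rewrite [in RHS]h rsA mulVf // rs1.
Qed.

Variables x y : R[i].
Hypotheses (oxy : om x y != 0) (nL : ~ leafv x y) (fxy : frv x y).

Let x0 : x != 0. Proof. by have [] := om_neq0 oxy. Qed.
Let y0 : y != 0. Proof. by have [] := om_neq0 oxy. Qed.

(* Lifts of the ideal vertices of the complementary region having [x] and [y] as vertices. *)
Definition vertex e := [/\ e != 0, frv x e & frv y e].

Lemma vertex_x : vertex x.
Proof.
split=> // c d c0 d0 h; first by rewrite -expr2 sqr_ge0.
by rewrite mulrC; apply: fxy.
Qed.

Lemma vertex_y : vertex y.
Proof. by split=> // c d c0 d0 h; rewrite -expr2 sqr_ge0. Qed.

(** A leaf separating two vertices would have both [x] and [y] on it, hence be the geodesic from [x]
    to [y], which is not a leaf. *)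
Lemma vertex_free e1 e2 : vertex e1 -> vertex e2 -> frv e1 e2.
Proof.
move=> [_ x1 y1] [_ x2 y2] c d c0 d0 h; rewrite leNgt; apply/negP => neg.
have z t : 0 <= side c d t * side c d e1 -> 0 <= side c d t * side c d e2 -> side c d t = 0.
  move=> h1 h2; apply/eqP; apply: contraT => n0; have t2 : 0 < side c d t ^+ 2 by rewrite exprn_even_gt0.
  have := mulr_ge0 h1 h2; nra.
have zx := z x (x1 _ _ c0 d0 h) (x2 _ _ c0 d0 h); have zy := z y (y1 _ _ c0 d0 h) (y2 _ _ c0 d0 h).
move/eqP: zx; move/eqP: zy; rewrite /side !mulf_eq0.
have t1 : om x c = 0 -> om y c = 0 -> False.
  move=> p q; move/eqP: oxy; apply; apply: (om0_trans c0 p); by rewrite omC q oppr0.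
have t2 : om x d = 0 -> om y d = 0 -> False.
  move=> p q; move/eqP: oxy; apply; apply: (om0_trans d0 p); by rewrite omC q oppr0.
have sw (p q : R[i]) : om p q = 0 -> om q p = 0 by move=> k; rewrite omC k oppr0.
move=> /orP[/eqP q|/eqP q] /orP[/eqP p|/eqP p].
- exact: t1.
- apply: nL; apply: leafv_eq d0 x0 (sw _ _ p) _; apply: leafvC.
  exact: leafv_eq c0 y0 (sw _ _ q) h.
- apply: nL; apply: leafv_eq c0 x0 (sw _ _ p) _; apply: leafvC.
  by apply: leafv_eq d0 y0 (sw _ _ q) _; exact: leafvC.
exact: t2.
Qed.

Definition stab g := [/\ G g, forall e, vertex e -> vertex (act g e) & forall e, vertex e -> vertex (act (invmx g) e)].

Lemma stab_mul g h : stab g -> stab h -> stab (g *m h).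
Proof.
move=> [Gg g1 g2] [Gh h1 h2]; split; first exact: (G_mul fG).
  by move=> e ve; rewrite act_mul; [apply: g1; exact: h1|exact: su].
move=> e ve; rewrite invmx_mul; [|exact: (G_unit fG)|exact: (G_unit fG)].
by rewrite act_mul; [apply: h2; exact: g2|apply: su; exact: Gi].
Qed.

Lemma stab_inv g : stab g -> stab (invmx g).
Proof. by move=> [Gg g1 g2]; split; [exact: Gi|exact: g2|rewrite invmxK]. Qed.

Lemma stab1 : stab 1%:M.
Proof. by split=> [|e|e]; [exact: (G_1 fG)| |rewrite invmx1]; rewrite act1. Qed.

(** A leaf separating [act g e] from a vertex [z] would have the translated diagonal on one side and
    the diagonal [e3 e4] on the other, although these cross. *)
Lemma cross_vertex g e1 e2 e3 e4 : G g -> vertex e1 -> vertex e2 -> vertex e3 -> vertex e4 ->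
  side e3 e4 (act g e1) * side e3 e4 (act g e2) < 0 -> forall e, vertex e -> vertex (act g e).
Proof.
move=> Gg v1 v2 v3 v4 neg e ve.
suff H z : z = x \/ z = y -> frv z (act g e).
  by split; [apply: (act_neq0 (su Gg)); case: ve|apply: H; left|apply: H; right].
move=> zE; have vz : vertex z by case: zE => ->; [exact: vertex_x|exact: vertex_y].
move=> c d c0 d0 h; rewrite leNgt; apply/negP => sneg.
pose c' := act (invmx g) c; pose d' := act (invmx g) d.
have c'0 : c' != 0 by apply: (act_neq0 (su (Gi Gg))).
have d'0 : d' != 0 by apply: (act_neq0 (su (Gi Gg))).
have h' : leafv c' d' by apply: (leafv_act fG ML) => //; exact: Gi.
have sE t : side c d (act g t) = side c' d' t.
  by rewrite -(act_Kinv fG c Gg) -(act_Kinv fG d Gg) side_act //; exact: su.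
have k1 t : vertex t -> 0 <= side c d (act g e) * side c d (act g t).
  by move=> vt; rewrite !sE; apply: (vertex_free ve vt).
have k2 t : vertex t -> 0 <= side c d z * side c d t by move=> vt; apply: (vertex_free vz vt).
have k0 := leafv_om ML h c0 d0.
have i1 := k1 _ v1; have i2 := k1 _ v2; have i3 := k2 _ v3; have i4 := k2 _ v4.
case: (ltrgt0P (side c d z)) => [p|p|p]; last by rewrite p mul0r ltxx in sneg.
  rewrite (pmulr_rlt0 _ p) in sneg; rewrite (nmulr_rge0 _ sneg) in i1; rewrite (nmulr_rge0 _ sneg) in i2; rewrite (pmulr_rge0 _ p) in i3; rewrite (pmulr_rge0 _ p) in i4.
  by have := side_uncrossed k0 i3 i4 i1 i2; lra.
rewrite (nmulr_rlt0 _ p) in sneg; rewrite (pmulr_rge0 _ sneg) in i1; rewrite (pmulr_rge0 _ sneg) in i2; rewrite (nmulr_rge0 _ p) in i3; rewrite (nmulr_rge0 _ p) in i4.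
by have := side_uncrossed k0 i1 i2 i3 i4; rewrite -side_swap; lra.
Qed.

Lemma cross_stab g e1 e2 e3 e4 : G g -> vertex e1 -> vertex e2 -> vertex e3 -> vertex e4 ->
  side e3 e4 (act g e1) * side e3 e4 (act g e2) < 0 -> stab g.
Proof.
move=> Gg v1 v2 v3 v4 neg; split=> //; first exact: cross_vertex neg.
apply: (cross_vertex (Gi Gg) v3 v4 v1 v2).
rewrite -(side_act e1 e2 (act (invmx g) e3) (su Gg)) -(side_act e1 e2 (act (invmx g) e4) (su Gg)).
by rewrite !(act_Kinv fG) // -side_swap.
Qed.

(** Otherwise [maximal_leaf] makes the diagonal a leaf: no leaf crosses it, and by [cross_stab] only
    elements of the stabiliser can make it cross itself. *)
Lemma diagonal_stab e1 e2 : vertex e1 -> vertex e2 -> om e1 e2 != 0 -> ~ leafv e1 e2 ->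
  exists2 g, stab g & side e1 e2 (act g e1) * side e1 e2 (act g e2) < 0.
Proof.
move=> v1 v2 o12 n12; have [e10 e20] := om_neq0 o12.
apply: contrapT => /forall2NP N; apply: n12.
have neg g : G g -> ~ side e1 e2 (act g e1) * side e1 e2 (act g e2) < 0.
  move=> Gg h; have [|//] := N g; apply; exact: cross_stab h.
apply: (maximal_leaf fG ML); try exact: circle_pt.
- by move=> /(pt_eq e10 e20) e; rewrite e eqxx in o12.
- move=> u v Luv; have [cu cv _] := leaf_circle (L_leaf LL) Luv.
  rewrite -(pt_hv cu) -(pt_hv cv) => /crosses_side H.
  have := H (hv_neq0 u) (hv_neq0 v) e10 e20; rewrite side_swap ltNge => /negP; apply.
  by apply: (vertex_free v1 v2); rewrite ?hv_neq0 //; rewrite /leafv !pt_hv.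
move=> g Gg; rewrite !mob_pt //; try exact: su.
have g1 := act_neq0 (su Gg) e10; have g2 := act_neq0 (su Gg) e20.
by move=> /crosses_side H; have := H e10 e20 g1 g2; rewrite side_swap; exact: neg.
Qed.

Lemma stab_pow g v w (m : R) n : stab g -> m != 0 -> act g v = rs m v -> act g w = rs m^-1 w ->
  exists h, [/\ stab h, act h v = rs (m ^+ n) v & act h w = rs (m ^+ n)^-1 w].
Proof.
move=> sg m0 gv gw; elim: n => [|n [h [sh hv hw]]].
  by exists 1%:M; rewrite !act1 expr0 invr1 !rs1; split=> //; exact: stab1.
exists (g *m h); split; first exact: stab_mul.
  rewrite act_mul; last by case: sh => Gh _ _; exact: su.
  by rewrite hv act_rs gv rsA exprS mulrC.
rewrite act_mul; last by case: sh => Gh _ _; exact: su.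
by rewrite hw act_rs gw rsA exprS invfM mulrC.
Qed.

(** [v] is the limit of the images of some vertex under powers of [g], and being a vertex is a
    closed condition. *)
Lemma vertex_limit g v w (m : R) : stab g -> om v w = 1 -> 1 < `|m| -> act g v = rs m v -> act g w = rs m^-1 w ->
  vertex v.
Proof.
move=> sg vw1 m1 gv gw.
have m0 : m != 0 by rewrite -normr_eq0; apply/eqP; lra.
have [v0 w0] : v != 0 /\ w != 0 by apply: om_neq0; rewrite vw1 oner_eq0.
have [e ve p0] : exists2 e, vertex e & om e w != 0.
  have [xw|xw] := eqVneq (om x w) 0; last by exists x => //; exact: vertex_x.
  exists y; first exact: vertex_y.
  apply: contra_neq oxy => yw; apply: (om0_trans w0 xw); by rewrite omC yw oppr0.
suff H z : z = x \/ z = y -> frv z v by split=> //; apply: H; [left|right].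
move=> zE; have vz : vertex z by case: zE => ->; [exact: vertex_x|exact: vertex_y].
move=> c d c0 d0 h; rewrite leNgt; apply/negP => neg.
pose p := om e w; pose q := om v e; pose A := side c d z.
pose B := `|A * (p * q * (om v c * om w d + om w c * om v d))| + `|A * (q ^+ 2 * (om w c * om w d))|.
have eta0 : 0 < - (A * side c d v) * p ^+ 2 by rewrite mulr_gt0 ?oppr_gt0 // exprn_even_gt0.
(* For this [n] the term in [P^2] dominates the side of the translate [act k e], and it has the
   forbidden sign. *)
have [n hn] := pow_large (B / (- (A * side c d v) * p ^+ 2)) m1.
have [k [sk kv kw]] := stab_pow n sg m0 gv gw.
have vk : vertex (act k e) by case: sk => _ hk _; exact: hk.
have := vertex_free vz vk c0 d0 h; rewrite -/A.
rewrite (basis_decomp e vw1) -/p -/q actD !act_rs kv kw !rsA; set P := m ^+ n in hn *.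
have P0 : P != 0 by rewrite expf_neq0.
rewrite /side !omDl !om_rsl.
have -> : (p * P * om v c + q * P^-1 * om w c) * (p * P * om v d + q * P^-1 * om w d) =
  P ^+ 2 * p ^+ 2 * (om v c * om v d) + p * q * (om v c * om w d + om w c * om v d) +
  (P ^+ 2)^-1 * (q ^+ 2 * (om w c * om w d)) by field.
rewrite ltr_pdivrMr // in hn.
have P2 : 1 <= P ^+ 2.
  by rewrite -real_normK ?num_real // normrX -exprM exprn_ege1 // ltW.
have P2i : (P ^+ 2)^-1 <= 1 by rewrite invf_le1 // (lt_le_trans ltr01).
have P2p : 0 <= (P ^+ 2)^-1 by rewrite invr_ge0 sqr_ge0.
move: hn; rewrite /B /side; set U := A * (p * q * _); set V := A * (q ^+ 2 * _) => hn.
have -> : A * (P ^+ 2 * p ^+ 2 * (om v c * om v d) + p * q * (om v c * om w d + om w c * om v d) +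
  (P ^+ 2)^-1 * (q ^+ 2 * (om w c * om w d))) = A * (om v c * om v d) * p ^+ 2 * P ^+ 2 + U + (P ^+ 2)^-1 * V.
  by rewrite /U /V; ring.
have i1 := ler_norm U.
have i2 : (P ^+ 2)^-1 * V <= `|V|.
  apply: le_trans (_ : (P ^+ 2)^-1 * `|V| <= _); first by rewrite ler_wpM2l // ler_norm.
  by rewrite ler_piMl.
lra.
Qed.

(** The non-leaf diagonal [x y] provides a hyperbolic element of the stabiliser, and by
    [finite_traces] the least trace is attained. *)
Lemma stab_hyperbolic : exists g v w (m : R), [/\ stab g, om v w = 1, act g v = rs m v, act g w = rs m^-1 w &
  1 < `|m| /\ forall h, stab h -> 4 < tr h ^+ 2 -> (m + m^-1) ^+ 2 <= tr h ^+ 2].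
Proof.
have [g0 sg0 neg] := diagonal_stab vertex_x vertex_y oxy nL.
have t0 : 4 < tr g0 ^+ 2.
  have [Gg0 _ _] := sg0; case: (hyperbolic fG Gg0) => // gE; exfalso; move: neg; rewrite gE /side.
    by rewrite !act1 !om_self !mul0r ltxx.
  by rewrite !actN !act1 !omNl !om_self oppr0 !mul0r ltxx.
have [s Hs] := finite_traces fG (tr g0 ^+ 2).
have [||g [sg tg tg0] gmin] := @finite_min R _ (fun h => [/\ stab h, 4 < tr h ^+ 2 & tr h ^+ 2 <= tr g0 ^+ 2]) (fun h => tr h ^+ 2) s.
- by exists g0.
- by move=> h [[Gh _ _] h1 h2]; exact: Hs.
have [Gg _ _] := sg; have [v [w [m [k1 gv gw gt m1]]]] := eigen_basis fG Gg tg.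
exists g, v, w, m; split=> //; split=> // h sh th; rewrite -gt.
by case: (leP (tr h ^+ 2) (tr g0 ^+ 2)) => hg; [apply: gmin|exact: le_trans tg0 (ltW hg)].
Qed.


(** Put the ends of an axis at 0 and infinity. Then [s, t] are the ends of its nearest translate,
    and [i, o] and [s', t'] are the ends of the images of the axis and of this translate under an
    element [k]. The first two inequalities say that neither new pair of axes is closer, the
    equation that [k] is an isometry. The conclusions exclude the two ways in which the diagonals
    could cross. *)
Lemma surgery (s t i o s' t' : R) : 0 < s -> 0 < t -> 0 < i -> 0 < o -> 0 < s' -> 0 < t' ->
  s < t -> i < o -> s' < t' -> s * t' <= s' * t -> s * (o - i) <= (s - o) * (t - i) ->
  s * (t' - s') * (o - i) = (s' - o) * (t' - i) * (t - s) ->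
  (i < s -> s < s' -> o <= s -> t <= s' -> False) /\
  (s' < s -> s < i -> t' <= s -> t <= i -> False).
Proof.
move=> s0 t0 i0 o0 s'0 t'0 st io s't' H1 H2 H3.
have k1 : s * (t' - s') * (o - i) <= s' * (t - s) * (o - i) by rewrite ler_pM2r; lra.
suff k : s' * (o - i) < (s' - o) * (t' - i) \/ ~ ((i < s /\ s < s' /\ o <= s /\ t <= s') \/ (s' < s /\ s < i /\ t' <= s /\ t <= i)).
  case: k => [k|k]; last by split=> *; apply: k; [left|right].
  have : s' * (o - i) * (t - s) < (s' - o) * (t' - i) * (t - s) by rewrite ltr_pM2r; lra.
  lra.
case: (pselect ((i < s /\ s < s' /\ o <= s /\ t <= s') \/ (s' < s /\ s < i /\ t' <= s /\ t <= i))) => [D|D]; [left|by right].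
case: D => [[a [b [c e]]]|[a [b [c e]]]].
  rewrite -(ltr_pM2l s0).
  have j1 : s' * (s - o) <= s * (s' - o) by nra.
  have j2 : s' * (s * (o - i)) <= s' * ((s - o) * (t - i)) by rewrite ler_pM2l.
  have j3 : s' * (s - o) * (t - i) <= s * (s' - o) * (t - i) by rewrite ler_pM2r; lra.
  have j4 : s * (s' - o) * (t - i) < s * (s' - o) * (t' - i) by rewrite ltr_pM2l ?mulr_gt0 //; lra.
  lra.
have j1 : (o - s) * (i - t) <= (o - s) * (i - t') by rewrite ler_pM2l; lra.
have j2 : (o - s) * (i - t') < (o - s') * (i - t') by rewrite ltr_pM2r; lra.
have j3 : s' * (o - i) <= s * (o - i) by rewrite ler_pM2r; lra.
lra.
Qed.

Lemma add2_lt_sqr (t : R) : 2 < t -> t + 2 < t ^+ 2.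
Proof. by move=> ?; nra. Qed.

Section Axis.
Variables (g : 'M[R[i]]_2) (v w : R[i]) (m : R).
Hypotheses (sg : stab g) (vw1 : om v w = 1) (gv : act g v = rs m v) (gw : act g w = rs m^-1 w) (m1 : 1 < `|m|).
Hypothesis trmin : forall h, stab h -> 4 < tr h ^+ 2 -> (m + m^-1) ^+ 2 <= tr h ^+ 2.

Let m0 : m != 0. Proof. by apply: contraTneq m1 => ->; rewrite normr0 ltr10. Qed.
Let wv1 : om w v = -1. Proof. by rewrite omC vw1. Qed.
Let v0 : v != 0. Proof. by have [] := om_neq0 (_ : om v w != 0); rewrite ?vw1 ?oner_eq0. Qed.
Let w0 : w != 0. Proof. by have [] := om_neq0 (_ : om v w != 0); rewrite ?vw1 ?oner_eq0. Qed.
Let m2 : 1 < m ^+ 2. Proof. by rewrite -real_normK ?num_real //; have h := m1; nra. Qed.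
Let m20 : 0 < m ^+ 2. Proof. exact: lt_trans m2. Qed.
Let stG h : stab h -> G h. Proof. by case. Qed.
Let stV h e : stab h -> vertex e -> vertex (act h e). Proof. by case=> _ H _; exact: H. Qed.
Let stn0 h e : stab h -> e != 0 -> act h e != 0. Proof. by case=> Gh _ _; exact: (act_neq0 (su Gh)). Qed.

Lemma fixed_vertex_v : vertex v. Proof. exact: vertex_limit sg vw1 m1 gv gw. Qed.
Lemma fixed_vertex_w : vertex w.
Proof.
apply: (@vertex_limit (invmx g) w (- v) m) => //; first exact: stab_inv.
- by rewrite omNr wv1 opprK.
- by rewrite (inv_rs (stG sg) _ gw) ?invrK ?invr_eq0.
by rewrite -[- v]rs1 rsNr -rsN act_rs (inv_rs (stG sg) m0 gv) !rsA mulrC.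
Qed.
Let Vv := fixed_vertex_v.
Let Vw := fixed_vertex_w.

(** Powers of [g] scale by powers of [m^2], so one of them moves [X] into the fundamental interval
    from 1 to [m^2]. *)
Lemma adjust (X : R) : 0 < X -> exists h q, [/\ stab h, q != 0, act h v = rs q v, act h w = rs q^-1 w &
  1 <= q ^+ 2 * X <= m ^+ 2].
Proof.
move=> X0; have [X1|X1] := leP 1 X.
  have ex : exists n, X < (m ^+ n) ^+ 2 by exact: pow_large.
  case: (ex_minnP ex) => [[|n] hn hmin]; first by rewrite expr0 expr1n in hn; lra.
  have gi := inv_rs (stG sg) m0 gv.
  have mi0 : m^-1 != 0 by rewrite invr_eq0.
  have gi' : act (invmx g) w = rs (m^-1)^-1 w by apply: inv_rs gw; rewrite ?invr_eq0 //; exact: stG.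
  have [h [sh hv hw]] := stab_pow n (stab_inv sg) mi0 gi gi'.
  exists h, (m^-1 ^+ n); split=> //; first by rewrite expf_neq0.
  have h1 : (m ^+ n) ^+ 2 <= X by rewrite leNgt; apply/negP => /hmin; rewrite ltnn.
  have p0 : 0 < (m ^+ n) ^+ 2 by rewrite exprn_even_gt0 //= expf_neq0.
  rewrite exprVn exprVn mulrC; apply/andP; split; first by rewrite ler_pdivlMr // mul1r.
  rewrite ler_pdivrMr //; apply: ltW; apply: lt_le_trans hn _.
  by rewrite [m ^+ n.+1]exprS exprMn.
have ex : exists n, 1 <= (m ^+ n) ^+ 2 * X.
  have [n hn] := pow_large X^-1 m1; exists n.
  by rewrite -ler_pdivrMr // mul1r ltW.
case: (ex_minnP ex) => [[|n] hn hmin]; first by rewrite expr0 expr1n mul1r in hn; lra.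
have [h [sh hv hw]] := stab_pow n.+1 sg m0 gv gw.
exists h, (m ^+ n.+1); split=> //; first by rewrite expf_neq0.
apply/andP; split=> //.
have h1 : (m ^+ n) ^+ 2 * X <= 1 by rewrite leNgt; apply/negP => h1; have := hmin n (ltW h1); rewrite ltnn.
rewrite [m ^+ n.+1]exprS exprMn -mulrA; apply: ler_piMr => //; exact: ltW.
Qed.

Lemma tr_coord h : stab h -> tr h = om (act h v) w + om v (act h w).
Proof. by move=> sh; have [] := coord_tr (su (stG sh)) vw1. Qed.
Lemma det_coord h : stab h -> om (act h v) w * om v (act h w) - om (act h w) w * om v (act h v) = 1.
Proof. by move=> sh; have [] := coord_tr (su (stG sh)) vw1. Qed.

(* If a translate of the axis crossed it, composing with a power of [g] would decrease the trace. *)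
Lemma axis_leaf : leafv v w.
Proof.
apply: contrapT => nl.
have ow : om v w != 0 by rewrite vw1 oner_eq0.
have [h sh neg] := diagonal_stab Vv Vw ow nl.
have det := det_coord sh.
set A := om (act h v) w in det *; set D := om v (act h w) in det *.
set B := om (act h w) w in det *; set C := om v (act h v) in det *.
(* Crossing makes the product of [A D] and [B C] negative; with [A D - B C = 1] this places [A D]
   strictly between 0 and 1. *)
have neg' : A * D * (B * C) < 0.
  by move: neg; rewrite /side [om _ v]omC [om (act h w) v]omC -/A -/B -/C -/D; nra.
have AD1 : A * D < 1 by nra.
have AD0 : 0 < A * D by nra.
have D0 : D != 0 by apply: contraTneq AD0 => ->; rewrite mulr0 ltxx.
have AD : 0 < A / D.
  have -> : A / D = A * D / D ^+ 2 by field.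
  by rewrite divr_gt0 // exprn_even_gt0.
have n0 : 0 < `|m| by apply: lt_trans m1.
have [k [q [sk q0 kv kw /andP[q1 q2]]]] := adjust (mulr_gt0 AD n0).
have skh := stab_mul sk sh.
have act_kh z : act (k *m h) z = act k (act h z) by rewrite act_mul //; exact: su (stG sh).
have okw z : om (act k z) w = q * om z w.
  by rewrite -(om_act z w (su (stG sk))) kw om_rsr mulrA divff // mul1r.
have okv z : om v (act k z) = q^-1 * om v z.
  by rewrite -(om_act v z (su (stG sk))) kv om_rsl mulrA mulVf // mul1r.
have t1 : tr (k *m h) = q * A + q^-1 * D by rewrite (tr_coord skh) !act_kh okw okv.
(* The squared trace is [A D (rho + 1/rho + 2)], and the power [k] keeps [rho] between [1/|m|] and
   [|m|]. With [M = |m| + 1/|m|] it is thus below [M + 2], which is less than the minimum [M^2]. *)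
pose rho := q ^+ 2 * (A / D).
have rho0 : 0 < rho by rewrite mulr_gt0 // exprn_even_gt0.
have t2 : tr (k *m h) ^+ 2 = A * D * (rho + rho^-1 + 2).
  rewrite t1 /rho; have A0 : A != 0 by apply: contraTneq AD0 => ->; rewrite mul0r ltxx.
  by field; rewrite A0 D0.
have r1 : 1 <= rho * `|m| by rewrite /rho -mulrA.
have r2 : rho <= `|m|.
  rewrite -(ler_pM2r n0) -expr2 real_normK ?num_real //; by rewrite /rho -mulrA.
have r3 : rho^-1 <= `|m| by rewrite -(ler_pM2l rho0) divff ?gt_eqF.
have r4 : rho + rho^-1 <= `|m| + `|m|^-1.
  have e : `|m| * `|m|^-1 = 1 by rewrite divff // gt_eqF.
  have e' : rho * rho^-1 = 1 by rewrite divff // gt_eqF.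
  have i0 : 0 < `|m|^-1 by rewrite invr_gt0.
  have : 0 <= (`|m| - rho) * (`|m| - rho^-1) by rewrite mulr_ge0; lra.
  rewrite mulrBl !mulrBr e' => h1.
  have h2 : 0 <= `|m|^-1 * (`|m| * `|m| - `|m| * rho^-1 - (rho * `|m| - 1)) by rewrite mulr_ge0 // ltW.
  have : `|m|^-1 * (`|m| * `|m| - `|m| * rho^-1 - (rho * `|m| - 1)) = (`|m| * `|m|^-1) * (`|m| - rho^-1 - rho) + `|m|^-1 by ring.
  rewrite e mul1r; lra.
have t3 : (m + m^-1) ^+ 2 = (`|m| + `|m|^-1) ^+ 2.
  transitivity (m ^+ 2 + 2 + (m ^+ 2)^-1); first by field.
  by rewrite -[m ^+ 2]real_normK ?num_real //; field; rewrite gt_eqF.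
have t4 : 4 < tr (k *m h) ^+ 2.
  have [e|e|//] := hyperbolic fG (stG skh).
    have : om (act (k *m h) w) w = 0 by rewrite e act1 om_self.
    rewrite act_kh okw -/B => /eqP; rewrite mulf_eq0 (negbTE q0) /= => /eqP B0.
    by move: neg'; rewrite B0 mul0r mulr0 ltxx.
  have : om (act (k *m h) w) w = 0 by rewrite e actN act1 omNl om_self oppr0.
  rewrite act_kh okw -/B => /eqP; rewrite mulf_eq0 (negbTE q0) /= => /eqP B0.
  by move: neg'; rewrite B0 mul0r mulr0 ltxx.
have n1 := m1; have := trmin skh t4; rewrite t3 t2.
have i0 : 0 < `|m|^-1 by rewrite invr_gt0.
set M := `|m| + `|m|^-1 in r4 *.
have M2 : 2 < M.
  have e : `|m| * `|m|^-1 = 1 by rewrite divff // gt_eqF.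
  have e2 : M * `|m| = `|m| * `|m| + 1 by rewrite /M [LHS]mulrDl [`|m|^-1 * _]mulrC e.
  rewrite -(ltr_pM2r n0) e2; nra.
have ri : 0 < rho^-1 by rewrite invr_gt0.
have : A * D * (rho + rho^-1 + 2) < rho + rho^-1 + 2 by rewrite gtr_pMl //; lra.
have := add2_lt_sqr M2; lra.
Qed.


(** [h] would carry a leaf from its fixed point [a] to [e] to another leaf ending at [a], and this
    one would separate [e] from its image under [h] applied twice. *)
Lemma fan_nonleaf h a b (k : R) e : stab h -> act h a = rs k a -> act h b = rs k^-1 b -> k != 0 -> k * k != 1 ->
  vertex a -> vertex e -> om e a != 0 -> om e b != 0 -> ~ leafv a e.
Proof.
move=> sh ha hb k0 k1 va ve ea eb lf; have sh' := su (stG sh).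
have a0 : a != 0 by case: va.
have e0 : e != 0 by case: ve.
have ka0 : act h a != 0 by exact: stn0.
have l1 : leafv a (act h e).
  apply: (leafv_eq ka0 a0); last by apply: (leafv_act fG ML) => //; exact: stG.
  by rewrite ha om_rsl om_self mulr0.
have vh := stV sh ve; have := vertex_free ve (stV sh vh) a0 (stn0 sh e0) l1.
have p1 : om (act h (act h e)) a = om e a / k ^+ 2.
  have := om_act (act h e) a sh'; have := om_act e a sh'; rewrite ha !om_rsr => h1 h2.
  by rewrite -h1 -h2; field.
have p2 : om (act h (act h e)) (act h e) = - om e (act h e) by rewrite om_act // omC.
rewrite /side p1 p2; set be := om e (act h e); set al := om e a.
have -> : al * be * (al / k ^+ 2 * - be) = - (al * be / k) ^+ 2 by field.
rewrite oppr_ge0 => h1; have : (al * be / k) ^+ 2 == 0 by rewrite eq_le h1 sqr_ge0.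
rewrite expf_eq0 /= !mulf_eq0 invr_eq0 (negbTE k0) orbF (negbTE ea) /= => /eqP be0.
have [r hr] := om0_rs e0 be0.
have q1 := om_act e a sh'; rewrite hr ha om_rsl om_rsr in q1.
have q2 := om_act e b sh'; rewrite hr hb om_rsl om_rsr in q2.
have q3 : r * k = 1 by apply: (mulIf ea); rewrite mul1r -mulrA.
have q4 : r * k^-1 = 1 by apply: (mulIf eb); rewrite mul1r -mulrA.
move/eqP: k1; apply.
by have rk : r = k by [rewrite -[r]mulr1 -(mulVf k0) mulrA q4 mul1r]; rewrite -{1}rk.
Qed.

Let mm : m * m != 1. Proof. by rewrite -expr2; apply/eqP => e; have := m2; rewrite e ltxx. Qed.

Lemma v_nonleaf e : vertex e -> om e v != 0 -> om e w != 0 -> ~ leafv v e.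
Proof. by move=> ve h1 h2; apply: (fan_nonleaf sg gv gw). Qed.

Lemma w_nonleaf e : vertex e -> om e v != 0 -> om e w != 0 -> ~ leafv w e.
Proof.
move=> ve h1 h2; apply: (@fan_nonleaf g w v m^-1) => //; rewrite ?invrK ?invr_eq0 //.
by rewrite -invfM invr_eq1.
Qed.

(** Otherwise [x] and [y] would be the ends of the axis, and the axis is a leaf. *)
Lemma vertex_off_axis : exists2 e, vertex e & om e v != 0 /\ om e w != 0.
Proof.
apply: contrapT => N.
have H e : vertex e -> om e v = 0 \/ om e w = 0.
  move=> ve; apply: contrapT => N'; apply: N; exists e => //.
  by split; apply/eqP => h; apply: N'; [left|right].
have sw (p q : R[i]) : om p q = 0 -> om q p = 0 by move=> k; rewrite omC k oppr0.
apply: nL; have lf := axis_leaf.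
have [p|p] := H x vertex_x; have [q|q] := H y vertex_y.
- by exfalso; move/eqP: oxy; apply; apply: (om0_trans v0 p); exact: sw.
- apply: leafv_eq v0 x0 (sw _ _ p) _; apply: leafvC.
  by apply: leafv_eq w0 y0 (sw _ _ q) _; exact: leafvC.
- apply: leafv_eq w0 x0 (sw _ _ p) _; apply: leafvC.
  exact: leafv_eq v0 y0 (sw _ _ q) _.
by exfalso; move/eqP: oxy; apply; apply: (om0_trans w0 p); exact: sw.
Qed.

(** A translate of the axis sharing one end with it is a leaf from [v] or [w] to another vertex,
    which [fan_nonleaf] forbids; exchanging the two ends would give trace 0. *)
Lemma stab_dichotomy h : stab h ->
  (om (act h w) w = 0 /\ om v (act h v) = 0) \/
  [/\ om (act h v) w != 0, om (act h w) w != 0, om v (act h v) != 0 & om v (act h w) != 0].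
Proof.
move=> sh; have det := det_coord sh; have trE := tr_coord sh; have Gh := stG sh.
have ell := elliptic_free fG Gh.
have lf : leafv (act h v) (act h w) by apply: (leafv_act fG ML) => //; exact: axis_leaf.
have n1 := stn0 sh v0; have n2 := stn0 sh w0.
have V1 := stV sh Vv; have V2 := stV sh Vw.
have opp (p q : R[i]) : om p q != 0 -> om q p != 0 by rewrite [om q p]omC oppr_eq0.
have sw (p q : R[i]) : om p q = 0 -> om q p = 0 by move=> k; rewrite omC k oppr0.
have tr0 : om (act h v) w = 0 -> om v (act h w) = 0 -> False.
  by move=> e1 e2; move: ell; rewrite trE e1 e2 addr0 expr0n /=; lra.
have [C0|C0] := eqVneq (om v (act h v)) 0.
  left; split=> //; apply/eqP; apply: contraT => B0; exfalso.
  apply: (v_nonleaf V2 _ B0).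
    by apply: opp; apply/eqP => e; move: det; rewrite C0 e !mulr0 subr0 => /eqP; rewrite eq_sym oner_eq0.
  exact: leafv_eq n1 v0 (sw _ _ C0) lf.
have [B0|B0] := eqVneq (om (act h w) w) 0.
  exfalso; apply: (w_nonleaf V1 (opp _ _ C0)).
    by apply/eqP => e; move: det; rewrite B0 e !mul0r subr0 => /eqP; rewrite eq_sym oner_eq0.
  exact: leafv_eq n2 w0 B0 (leafvC lf).
right; have [A0|A0] := eqVneq (om (act h v) w) 0.
  exfalso; have l1 : leafv w (act h w) by exact: leafv_eq n1 w0 A0 lf.
  have [D0|D0] := eqVneq (om v (act h w)) 0; first exact: tr0.
  exact: (w_nonleaf V2 (opp _ _ D0) B0).
split=> //; apply/eqP => D0.
exact: (v_nonleaf V1 (opp _ _ C0) A0 (leafv_eq n2 v0 (sw _ _ D0) (leafvC lf))).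
Qed.

Definition moving h := stab h /\ om v (act h v) != 0.

Lemma movingP h : moving h ->
  [/\ om (act h v) w != 0, om (act h w) w != 0, om v (act h v) != 0 & om v (act h w) != 0].
Proof. by move=> [/stab_dichotomy [[_ e]|//]]; rewrite e eqxx. Qed.

Section OffAxis.
Variable e0 : R[i].
Hypotheses (Ve0 : vertex e0) (e0v : om e0 v != 0) (e0w : om e0 w != 0).
Let ka : R := om e0 w * om v e0.
(* Affine coordinate of the ideal point of [z] for which the axis joins 0 to infinity, normalised so that
   the vertices have positive coordinates. *)
Definition ratio z : R := ka * (om z w / om v z).

Let ve0 : om v e0 != 0. Proof. by rewrite omC oppr_eq0. Qed.
Let ka0 : ka != 0. Proof. by rewrite mulf_neq0. Qed.

Lemma vertex_side e : vertex e -> 0 <= ka * (om e w * om v e).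
Proof.
move=> ve; have := vertex_free Ve0 ve v0 w0 axis_leaf.
rewrite /side /ka [om v e0]omC [om v e]omC; lra.
Qed.

Lemma ratio_gt0 e : vertex e -> om e w != 0 -> om v e != 0 -> 0 < ratio e.
Proof.
move=> ve h1 h2; have h := vertex_side ve; rewrite /ratio lt_neqAle; apply/andP; split.
  by rewrite eq_sym !mulf_neq0 ?invr_eq0 //.
have -> : ka * (om e w / om v e) = ka * (om e w * om v e) / om v e ^+ 2 by field.
by rewrite divr_ge0 // sqr_ge0.
Qed.

Lemma om_ratio z t : om v z != 0 -> om v t != 0 -> om z t = om v z * om v t * (ratio z - ratio t) / ka.
Proof.
move=> h1 h2; rewrite {1}(basis_decomp z vw1) {1}(basis_decomp t vw1) !omDl !omDr !om_rsl !om_rsr !om_self vw1 wv1 /ratio.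
by field; rewrite ka0 h1 h2.
Qed.

(** The image of [v] under the inverse of [h] is a vertex, so it lies on the same side of the axis
    as all others. Applying [h], this tells in which order the images of [v] and [w] occur. *)
Lemma ratio_lt h : moving h -> ratio (act h v) < ratio (act h w).
Proof.
move=> mh; have [A0 B0 C0 D0] := movingP mh; have [sh _] := mh.
have o1 : om (act h v) (act h w) = 1 by rewrite om_act //; exact: su (stG sh).
have s1 := vertex_side (stV sh Vv).
have s2 : 0 <= ka * (om v (act h w) * - om v (act h v)).
  have := vertex_side (stV (stab_inv sh) Vv).
  have si := su (Gi (stG sh)); have e1 := om_act v (act h w) si; have e2 := om_act (act h v) v si.
  rewrite (act_invK fG) in e1; last exact: stG. rewrite (act_invK fG) in e2; last exact: stG.
  by rewrite e1 e2 [om (act h v) v]omC.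
have key : om v (act h v) * om v (act h w) * (ratio (act h v) - ratio (act h w)) = ka.
  by have := om_ratio C0 D0; rewrite o1 => /(congr1 (fun t => t * ka)); rewrite mul1r divfK.
rewrite ltNge; apply/negP => h1.
set C := om v (act h v) in C0 s1 s2 key; set D := om v (act h w) in D0 s2 key.
set r := _ - _ in key; have r0 : 0 <= r by rewrite subr_ge0.
have : 0 <= (ka * (D * - C)) * r by rewrite mulr_ge0.
have -> : (ka * (D * - C)) * r = - ka * (C * D * r) by ring.
rewrite key mulNr oppr_ge0 => h2; move/eqP: ka0; apply; apply/eqP; rewrite -sqrf_eq0 expr2.
by rewrite eq_le h2 -expr2 sqr_ge0.
Qed.

Lemma ratio_outside h e : moving h -> vertex e -> om v e != 0 ->
  0 <= (ratio e - ratio (act h v)) * (ratio e - ratio (act h w)).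
Proof.
move=> mh ve e1; have [A0 B0 C0 D0] := movingP mh; have [sh _] := mh.
have lf : leafv (act h v) (act h w) by apply: (leafv_act fG ML) => //; [exact: stG|exact: axis_leaf].
have := vertex_free Vv ve (stn0 sh v0) (stn0 sh w0) lf.
rewrite /side (om_ratio e1 C0) (om_ratio e1 D0).
set C := om v (act h v) in C0 *; set D := om v (act h w) in D0 *; set E := om v e in e1 *.
set p := ratio e - _; set q := ratio e - _.
have -> : C * D * (E * C * p / ka * (E * D * q / ka)) = (C * D * E / ka) ^+ 2 * (p * q) by field.
by rewrite pmulr_rge0 // exprn_even_gt0 //= !mulf_neq0 ?invr_eq0 //.
Qed.

(* Depends only on the double coset of [h] modulo the stabiliser of the axis, and increases with the distance
   from the axis to its image. *)
Definition energy h : R := - (om (act h v) w * om v (act h w)).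

Lemma energyE h : moving h ->
  energy h * (ratio (act h w) - ratio (act h v)) = ratio (act h v).
Proof.
move=> mh; have [A0 B0 C0 D0] := movingP mh; have [sh _] := mh.
have o1 : om (act h v) (act h w) = 1 by rewrite om_act //; exact: su (stG sh).
have key : om v (act h v) * om v (act h w) * (ratio (act h w) - ratio (act h v)) = - ka.
  by have := om_ratio C0 D0; rewrite o1 => /(congr1 (fun t => t * ka)); rewrite mul1r divfK // => ->; ring.
rewrite /energy [in RHS]/ratio; set r := _ - _ in key *.
have -> : - (om (act h v) w * om v (act h w)) * r = - (om (act h v) w / om v (act h v)) * (om v (act h v) * om v (act h w) * r) by field.
by rewrite key; ring.
Qed.

Lemma le_sqr_bound (t K : R) : 0 <= t -> t ^+ 2 <= K -> t <= K + 1.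
Proof. by move=> *; nra. Qed.

Lemma box_bounds (k a b : R) : 0 <= k -> 0 <= a -> 0 <= b ->
  [/\ a <= 2 * (k + 1) * (1 + a + b), b <= 2 * (k + 1) * (1 + a + b) & (k + 1) * a + (k + 1) * b <= 2 * (k + 1) * (1 + a + b)].
Proof.
by move=> k0 a0 b0; have h1 := mulr_ge0 k0 a0; have h2 := mulr_ge0 k0 b0; split; lra.
Qed.

(** Multiplication by powers of the translation on either side preserves the energy and can be used
    to bound all four coefficients, so below a given value only finitely many energies occur. *)
Lemma energy_min : (exists h, moving h) -> exists2 h, moving h & forall k, moving k -> energy h <= energy k.
Proof.
move=> [h0 mh0].
pose K := (1 + energy h0) * m ^+ 2 * m ^+ 2 + 1.
pose B := 2 * (K + 1) * (1 + cabs v + cabs w).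
have [s Hs] := discrete_list fG B.
have [||h [mh hh] hmin] := @finite_min R _ (fun h => moving h /\ energy h <= energy h0) energy [seq energy k | k <- s].
- by exists h0.
- move=> h [mh hh]; have [A0 B0 C0 D0] := movingP mh; have [sh _] := mh.
  have f0 : 0 < energy h.
    have k0 := energyE mh; have k1 := ratio_lt mh; have k2 := ratio_gt0 (stV sh Vv) A0 C0.
    by rewrite -(pmulr_lgt0 _ (_ : 0 < ratio (act h w) - ratio (act h v))) ?k0 // subr_gt0.
  have e00 : 0 <= 1 + energy h0 by rewrite addr_ge0 // (le_trans (ltW f0)).
  have pos (p q : R) : p != 0 -> q != 0 -> 0 < `|p / q| by move=> *; rewrite normr_gt0 mulf_neq0 ?invr_eq0 //.
  (* Multiplication on the left balances the coefficient [om (act h v) w] against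
     [om v (act h w)]. *)
  have [k [q [sk q0 kv kw kq]]] := adjust (pos _ _ A0 D0).
  (* Conjugation by [l] leaves those two alone and multiplies the ratio of the other two by [p^4];
     since [adjust] controls [p^2], a square root is taken. *)
  have X0 : 0 < Num.sqrt `|(q * om (act h w) w) / (q^-1 * om v (act h v))|.
    by rewrite sqrtr_gt0; apply: pos; rewrite mulf_neq0 ?invr_eq0 //.
  have [l [p [sl p0 lv lw lp]]] := adjust X0.
  pose n := l *m (k *m h) *m invmx l.
  have skh := stab_mul sk sh; have sn : stab n := stab_mul (stab_mul sl skh) (stab_inv sl).
  have nE z : act n z = act l (act k (act h (act (invmx l) z))).
    by rewrite /n !act_mul //; try exact: su (stG sk); try exact: su (stG sh); try exact: su (stG skh); exact: su (Gi (stG sl)).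
  have lv' : act (invmx l) v = rs p^-1 v by exact: inv_rs (stG sl) p0 lv.
  have lw' : act (invmx l) w = rs p w by rewrite (inv_rs (stG sl) _ lw) ?invrK ?invr_eq0.
  have okw j z (r : R) : stab j -> r != 0 -> act j w = rs r^-1 w -> om (act j z) w = r * om z w.
    by move=> sj r0 jw; rewrite -(om_act z w (su (stG sj))) jw om_rsr mulrA divff // mul1r.
  have okv j z (r : R) : stab j -> r != 0 -> act j v = rs r v -> om v (act j z) = r^-1 * om v z.
    by move=> sj r0 jv; rewrite -(om_act v z (su (stG sj))) jv om_rsl mulrA mulVf // mul1r.
  have nA : om (act n v) w = q * om (act h v) w.
    by rewrite nE lv' !act_rs om_rsl (okw l _ p) // (okw k _ q) //; field.
  have nB : om (act n w) w = p ^+ 2 * (q * om (act h w) w).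
    by rewrite nE lw' !act_rs om_rsl (okw l _ p) // (okw k _ q) //; ring.
  have nC : om v (act n v) = (p ^+ 2)^-1 * (q^-1 * om v (act h v)).
    by rewrite nE lv' !act_rs om_rsr (okv l _ p) // (okv k _ q) //; field; rewrite p0 q0.
  have nD : om v (act n w) = q^-1 * om v (act h w).
    by rewrite nE lw' !act_rs om_rsr (okv l _ p) // (okv k _ q) //; field; rewrite p0 q0.
  have en : energy n = energy h by rewrite /energy nA nD; field.
  have dn := det_coord sn.
  have bnd (s1 t1 M0 : R) : t1 != 0 -> `|s1 * t1| <= 1 + energy h0 -> 1 <= `|s1 / t1| <= M0 -> 1 <= M0 -> M0 <= m ^+ 2 * m ^+ 2 ->
      `|s1| <= K + 1 /\ `|t1| <= K + 1.
    move=> t10 h1 /andP[h2 h3] M1 M2.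
    have Kb : (1 + energy h0) * M0 <= K.
      by rewrite /K -mulrA; apply: le_trans (ler_wpM2l e00 M2) _; rewrite lerDl.
    have e1 : s1 ^+ 2 = `|s1 * t1| * `|s1 / t1|.
      rewrite -normrM -[LHS]ger0_norm ?sqr_ge0 //; congr Num.norm; by field.
    have e2 : t1 ^+ 2 <= `|s1 * t1|.
      have -> : t1 ^+ 2 = `|t1| * `|t1| by rewrite -expr2 real_normK ?num_real.
      rewrite normrM ler_wpM2r //.
      have : 1 * `|t1| <= `|s1 / t1| * `|t1| by rewrite ler_wpM2r.
      by rewrite -normrM divfK // mul1r.
    have b1 : `|s1| ^+ 2 <= K.
      rewrite real_normK ?num_real // e1; apply: le_trans Kb; apply: ler_pM => //; lra.
    have b2 : `|t1| ^+ 2 <= K.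
      by rewrite real_normK ?num_real //; apply: le_trans e2 _; apply: le_trans h1 _; apply: le_trans Kb; rewrite ler_peMr //; lra.
    by split; apply: le_sqr_bound.
  have mm1 := m2; have mm4 : m ^+ 2 <= m ^+ 2 * m ^+ 2 by rewrite ler_peMr // ltW.
  have [bA bD] : `|om (act n v) w| <= K + 1 /\ `|om v (act n w)| <= K + 1.
    apply: (bnd _ _ (m ^+ 2)) => //; last exact: ltW.
    - by rewrite nD mulf_neq0 ?invr_eq0 //.
    - rewrite -normrN -/(energy n) en (ger0_norm (ltW f0)).
      by apply: le_trans hh _; rewrite lerDr.
    rewrite nA nD.
    have -> : q * om (act h v) w / (q^-1 * om v (act h w)) = q ^+ 2 * (om (act h v) w / om v (act h w)) by field; rewrite D0 q0.
    by rewrite normrM ger0_norm ?sqr_ge0.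
  have [bB bC] : `|om (act n w) w| <= K + 1 /\ `|om v (act n v)| <= K + 1.
    apply: (bnd _ _ (m ^+ 2 * m ^+ 2)) => //; last by lra.
    - by rewrite nC !mulf_neq0 ?invr_eq0 // expf_neq0.
    - have -> : om (act n w) w * om v (act n v) = - (1 + energy n) by rewrite /energy; lra.
      by rewrite en normrN ger0_norm ?lerD2l // addr_ge0 // ltW.
    rewrite nB nC; set S := q * _ in X0 lp *; set T := q^-1 * _ in X0 lp *.
    have T0 : T != 0 by rewrite mulf_neq0 ?invr_eq0 //.
    have -> : p ^+ 2 * S / ((p ^+ 2)^-1 * T) = (p ^+ 2) ^+ 2 * (S / T) by field; rewrite T0 p0.
    rewrite normrM ger0_norm ?sqr_ge0 //.
    have -> : (p ^+ 2) ^+ 2 * `|S / T| = (p ^+ 2 * Num.sqrt `|S / T|) ^+ 2 by rewrite [RHS]exprMn sqr_sqrtr.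
    move: lp; set X := p ^+ 2 * _ => /andP[l1 l2]; rewrite expr2; have X1 : 0 <= X by lra.
    by apply/andP; split; [apply: mulr_ege1|apply: ler_pM].
  rewrite -en; apply: map_f; have c1 := cabs_ge0 v; have c2 := cabs_ge0 w.
  have K0 : 0 <= K.
    by rewrite /K addr_ge0 // mulr_ge0 ?(ltW m20) // mulr_ge0 ?(ltW m20).
  have [B1 B2 B3] := box_bounds K0 c1 c2; rewrite -/B in B1 B2 B3.
  have comb (s1 t1 : R) : `|s1| <= K + 1 -> `|t1| <= K + 1 -> cabs (rs s1 v + rs t1 w) <= B.
    move=> h1 h2; apply: le_trans (cabsD _ _) _; rewrite !cabs_rs; apply: le_trans B3.
    by apply: lerD; exact: ler_wpM2r.
  apply: (Hs _ v w (stG sn)) => //.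
  - by rewrite (basis_decomp (act n v) vw1); exact: comb.
  by rewrite (basis_decomp (act n w) vw1); exact: comb.
by exists h => // k mk; case: (leP (energy k) (energy h0)) => hk; [exact: hmin|exact: le_trans hh (ltW hk)].
Qed.


Lemma exists_moving : exists h, moving h.
Proof.
have owe : om v e0 != 0 by exact: ve0.
have [h sh neg] := diagonal_stab Vv Ve0 owe (v_nonleaf Ve0 e0v e0w).
exists h; split=> //; apply: contraTneq neg => e.
by rewrite {1}/side omC e oppr0 !mul0r ltxx.
Qed.

(** Let [h] carry the axis to a nearest translate. The diagonal from [v] to [act h v] is no leaf, so
    some [k] in the stabiliser makes it cross its image; then [k *m h] and [invmx k *m h] contradict
    minimality through [surgery]. *)
Lemma off_axis_false : False.
Proof.
have [h mh hmin] := energy_min exists_moving.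
have [A0 B0 C0 D0] := movingP mh; have [sh _] := mh.
have nl : ~ leafv v (act h v).
  by apply: v_nonleaf => //; [exact: stV|rewrite omC oppr_eq0].
have [k sk neg] := diagonal_stab Vv (stV sh Vv) C0 nl.
have mk : moving k.
  split=> //; apply: contraTneq neg => e.
  by rewrite {1}/side omC e oppr0 !mul0r ltxx.
have skh := stab_mul sk sh.
have act_kh z : act (k *m h) z = act k (act h z) by rewrite act_mul //; exact: su (stG sh).
have mkh : moving (k *m h).
  split=> //; rewrite act_kh; apply: contraTneq neg => e.
  by rewrite [X in _ * X]/side [om (act k (act h v)) v]omC e oppr0 !mul0r mulr0 ltxx.
have [kA kB kC kD] := movingP mk; have [khA khB khC khD] := movingP mkh; rewrite !act_kh in khA khB khC khD.
have ski := stab_inv sk; have sikh := stab_mul ski sh.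
have act_ikh z : act (invmx k *m h) z = act (invmx k) (act h z) by rewrite act_mul //; exact: su (stG sh).
have omi z t : om (act (invmx k) z) t = om z (act k t).
  by rewrite -(om_act _ t (su (stG sk))) (act_Kinv fG) //; exact: stG.
have omi' z t : om z (act (invmx k) t) = om (act k z) t.
  by rewrite -(om_act z _ (su (stG sk))) (act_Kinv fG) //; exact: stG.
set s := ratio (act h v); set t := ratio (act h w); set i := ratio (act k v); set o := ratio (act k w).
set s' := ratio (act k (act h v)); set t' := ratio (act k (act h w)).
(* In the affine coordinate [v] is at infinity, so the diagonal is the vertical line over [s], and
   its image, from [i] to [s'], crosses it. *)
have cross : (i - s) * (s' - s) < 0.
  move: neg; rewrite /side (om_ratio kC C0) (om_ratio khC C0) -/i -/s -/s'.
  rewrite [om _ v]omC [om (act k (act h v)) v]omC.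
  set a := om v (act k v) in kC *; set b := om v (act h v) in C0 *; set c := om v (act k (act h v)) in khC *.
  have -> : - a * (a * b * (i - s) / ka) * (- c * (c * b * (s' - s) / ka)) = (a * b * c / ka) ^+ 2 * ((i - s) * (s' - s)) by field.
  by rewrite pmulr_rlt0 // exprn_even_gt0 //= !mulf_neq0 ?invr_eq0.
have mikh : moving (invmx k *m h).
  split=> //; rewrite act_ikh omi'; apply: contraTneq cross => e.
  rewrite -leNgt (_ : i = s) ?subrr ?mul0r //.
  have := om_ratio kC C0; rewrite e => /esym/eqP; rewrite !mulf_eq0 invr_eq0 (negbTE kC) (negbTE C0) (negbTE ka0) /= orbF subr_eq0.
  by move/eqP.
have s0 : 0 < s by exact: ratio_gt0 (stV sh Vv) A0 C0.
have t0 : 0 < t by exact: ratio_gt0 (stV sh Vw) B0 D0.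
have i0 : 0 < i by exact: ratio_gt0 (stV sk Vv) kA kC.
have o0 : 0 < o by exact: ratio_gt0 (stV sk Vw) kB kD.
have s'0 : 0 < s' by exact: ratio_gt0 (stV sk (stV sh Vv)) khA khC.
have t'0 : 0 < t' by exact: ratio_gt0 (stV sk (stV sh Vw)) khB khD.
have st : s < t by exact: ratio_lt.
have io : i < o by exact: ratio_lt.
have s't' : s' < t' by have := ratio_lt mkh; rewrite !act_kh.
have E1 : energy h * (t - s) = s by exact: energyE.
have E2 : energy (k *m h) * (t' - s') = s' by have := energyE mkh; rewrite !act_kh.
have H1 : s * t' <= s' * t.
  have := hmin _ mkh; have ts : 0 < t - s by rewrite subr_gt0.
  have ts' : 0 < t' - s' by rewrite subr_gt0.
  rewrite -(ler_pM2r ts) -(ler_pM2r ts') E1 [X in _ <= X]mulrAC E2; lra.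
have unit_om z1 z2 : om z1 z2 = 1 -> om v z1 != 0 -> om v z2 != 0 -> om v z1 * om v z2 * (ratio z1 - ratio z2) = ka.
  by move=> e h1 h2; have := om_ratio h1 h2; rewrite e => /(congr1 (fun t => t * ka)); rewrite mul1r divfK.
have u1 : om v (act h v) * om v (act h w) * (s - t) = ka.
  by apply: unit_om => //; rewrite om_act //; exact: su (stG sh).
have u2 : om v (act k v) * om v (act k w) * (i - o) = ka.
  by apply: unit_om => //; rewrite om_act //; exact: su (stG sk).
have u3 : om v (act k (act h v)) * om v (act k (act h w)) * (s' - t') = ka.
  by apply: unit_om => //; rewrite om_act ?om_act //; [exact: su (stG sh)|exact: su (stG sk)].
have E3 : energy (invmx k *m h) * ((t - s) * (o - i)) = (s - o) * (t - i).
  rewrite /energy !act_ikh omi omi' (om_ratio C0 kD) (om_ratio kC D0) -/s -/t -/i -/o.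
  have -> : - (om v (act h v) * om v (act k w) * (s - o) / ka * (om v (act k v) * om v (act h w) * (i - t) / ka)) * ((t - s) * (o - i)) =
    - ((om v (act h v) * om v (act h w) * (s - t)) * (om v (act k v) * om v (act k w) * (i - o)) * (s - o) * (i - t) / ka ^+ 2) by field.
  by rewrite u1 u2; field.
have H2 : s * (o - i) <= (s - o) * (t - i).
  have := hmin _ mikh; have ts : 0 < t - s by rewrite subr_gt0.
  have oi : 0 < o - i by rewrite subr_gt0.
  by rewrite -(ler_pM2r (mulr_gt0 ts oi)) E3 mulrA E1.
have H3 : s * (t' - s') * (o - i) = (s' - o) * (t' - i) * (t - s).
  have e1 : energy h * ((t' - s') * (o - i)) = (s' - o) * (t' - i).
    rewrite /energy -(om_act (act h v) w (su (stG sk))) -(om_act v (act h w) (su (stG sk))).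
    rewrite (om_ratio khC kD) (om_ratio kC khD) -/i -/o -/s' -/t'.
    set a := om v (act k v) in u2 *; set b := om v (act k w) in u2 *; set c := om v (act k (act h v)) in u3 *; set d := om v (act k (act h w)) in u3 *.
    have -> : - (c * b * (s' - o) / ka * (a * d * (i - t') / ka)) * ((t' - s') * (o - i)) =
      - ((c * d * (s' - t')) * (a * b * (i - o)) * (s' - o) * (i - t') / ka ^+ 2) by field.
    by rewrite u2 u3; field.
  by transitivity (energy h * (t - s) * (t' - s') * (o - i)); [rewrite E1|rewrite -e1; ring].
have [N1 N2] := surgery s0 t0 i0 o0 s'0 t'0 st io s't' H1 H2 H3.
(* Vertices never lie strictly between the ends of a translate of the axis; this leaves only the two
   patterns that [surgery] excludes. *)
have X1 : 0 <= (s - i) * (s - o) by exact: ratio_outside mk (stV sh Vv) C0.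
have X2 : 0 <= (s' - s) * (s' - t) by exact: ratio_outside mh (stV sk (stV sh Vv)) khC.
have X3 : 0 <= (i - s) * (i - t) by exact: ratio_outside mh (stV sk Vv) kC.
have X4 : 0 <= (s - s') * (s - t') by have := ratio_outside mkh (stV sh Vv) C0; rewrite !act_kh.
have [is'|is'|is'] := ltgtP i s.
- have p : 0 < s' - s by rewrite nmulr_rlt0 ?subr_lt0 // in cross.
  have ss : s < s' by rewrite -subr_gt0.
  apply: N1 => //.
    by move: X1; rewrite pmulr_rge0 ?subr_gt0 // subr_ge0.
  by move: X2; rewrite (pmulr_rge0 _ p) subr_ge0.
- have p : s' - s < 0 by rewrite pmulr_rlt0 ?subr_gt0 // in cross.
  have ss : s' < s by rewrite -subr_lt0.
  apply: N2 => //.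
    by move: X4; rewrite pmulr_rge0 ?subr_gt0 // subr_ge0.
  by move: X3; rewrite pmulr_rge0 ?subr_gt0 // subr_ge0.
by rewrite is' subrr mul0r ltxx in cross.
Qed.

End OffAxis.

Lemma axis_false : False.
Proof. by have [e ve [h1 h2]] := vertex_off_axis; exact: off_axis_false h1 h2. Qed.

End Axis.

Lemma no_polygon : False.
Proof.
have [g [v [w [m [sg vw gv gw [m1 mmin]]]]]] := stab_hyperbolic.
exact: axis_false sg vw gv gw m1 mmin.
Qed.

End Polygon.

Section FreeLeaf.
Variable R : realType.

(* The complementary regions of a maximal lamination are ideal triangles. *)
Lemma free_leaf G L (x y : R[i]) : cocompact_fuchsian G -> maximal_lamination G L ->
  circle x -> circle y -> x <> y -> (forall u v, L (geod u v) -> ~ crosses (geod u v) (geod x y)) -> L (geod x y).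
Proof.
move=> fG ML cx cy xy H; apply: contrapT => nL.
apply: (@no_polygon R G L fG ML (hv x) (hv y)).
- apply/eqP => e; apply: xy; rewrite -(pt_hv cx) -(pt_hv cy); apply/pt_eq => //; exact: hv_neq0.
- by rewrite /leafv !pt_hv.
move=> c d c0 d0 h; rewrite leNgt; apply/negP => neg.
apply: (H _ _ h); apply: crosses_sym; rewrite ?circle_pt //; try exact: circle_pt.
rewrite -(pt_hv cx) -(pt_hv cy); apply/crosses_side => //; exact: hv_neq0.
Qed.

End FreeLeaf.

(** * Construction of charts *)

Section RealLemmas.
Variable R : realType.

(** The intervals of radius [C r^n / (1 - r)] about the terms are nested. *)
Lemma geometric_complete (u : nat -> R) (C r : R) : 0 <= r -> r < 1 ->
  (forall n, `|u n.+1 - u n| <= C * r ^+ n) -> exists l, forall n, `|u n - l| <= C * r ^+ n / (1 - r).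
Proof.
move=> r0 r1 H; have q0 : 0 < 1 - r by lra.
pose E n := C * r ^+ n / (1 - r).
have ES n : E n - E n.+1 = C * r ^+ n by rewrite /E exprS; field; rewrite gt_eqF.
have tel n k : `|u (n + k)%N - u n| <= E n - E (n + k)%N.
  elim: k => [|k IH]; first by rewrite addn0 !subrr normr0.
  rewrite addnS; have := ler_distD (u (n + k)%N) (u (n + k).+1) (u n).
  have := H (n + k)%N; rewrite -ES; lra.
have C0 : 0 <= C by have := H 0%N; rewrite expr0 mulr1; apply: le_trans.
have E0 n : 0 <= E n by rewrite /E divr_ge0 ?mulr_ge0 ?exprn_ge0 // ltW.
have cross n k : u n - E n <= u k + E k.
  have [nk|nk] := leqP n k.
    by have := tel n (k - n)%N; rewrite subnKC // ler_norml => /andP[]; have := E0 k; lra.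
  have := tel k (n - k)%N; rewrite subnKC; last exact: ltnW.
  by rewrite ler_norml => /andP[]; have := E0 n; lra.
pose A : set R := fun t => exists n, t = u n - E n.
have hA : has_sup A.
  by split; [exists (u 0%N - E 0%N), 0%N|exists (u 0%N + E 0%N) => t [n ->]; exact: cross].
exists (sup A) => n; rewrite -/(E n).
have h1 : u n - E n <= sup A by apply: (sup_upper_bound hA); exists n.
have h2 : sup A <= u n + E n by apply: ge_sup; [by exists (u 0%N - E 0%N), 0%N|move=> t [k ->]; exact: cross].
rewrite ler_norml; apply/andP; split; lra.
Qed.

Lemma gap_around (X : set R) x y r : seq_closed X -> X x -> X y -> x <= r -> r <= y ->
  X r \/ exists a b, [/\ gap X a b, x <= a, b <= y & a < r < b].
Proof.
move=> clX Xx Xy xr ry; case: (pselect (X r)) => [|nr]; [by left|right].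
pose A : set R := fun s => X s /\ s <= r; pose B : set R := fun s => X (- s) /\ r <= - s.
have hA : has_sup A by split; [exists x|exists r => s []].
have hB : has_sup B by split; [exists (- y); rewrite /B opprK|exists (- r) => s [_]; lra].
have XA : X (sup A).
  apply: clX => e e0; have [s [Xs sr] hs] := sup_adherent e0 hA; exists s; split=> //.
  have := sup_upper_bound hA (conj Xs sr); rewrite ltr_norml; lra.
have XB : X (- sup B).
  apply: clX => e e0; have [s [Xs sr] hs] := sup_adherent e0 hB; exists (- s); split=> //.
  have := sup_upper_bound hB (conj Xs sr); rewrite ltr_norml; lra.
have Ar : sup A <= r by apply: ge_sup; [exists x|move=> s []].
have Br : sup B <= - r by apply: ge_sup; [exists (- y); rewrite /B opprK|move=> s [_]; lra].
have A1 : sup A < r by rewrite lt_neqAle Ar andbT; apply/eqP => e; apply: nr; rewrite -e.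
have B1 : r < - sup B by rewrite lt_neqAle; apply/andP; split; [apply/eqP => e; apply: nr; rewrite e|lra].
have xA : x <= sup A by apply: (sup_upper_bound hA).
have By : - y <= sup B by apply: (sup_upper_bound hB); rewrite /B opprK.
exists (sup A), (- sup B); split; [|lra|lra|lra].
split=> //; first lra.
move=> s Xs; apply/negP => /andP[s1 s2]; case: (leP s r) => sr.
  by have := sup_upper_bound hA (conj Xs sr); lra.
have : B (- s) by rewrite /B opprK; split=> //; exact: ltW.
by move=> /(sup_upper_bound hB); lra.
Qed.

(** Just beyond the last parameter where [f] is at most [th], a point of [X] or the end of a short
    gap is met, so the two values bracketing [th] have parameters at most [4 * de] apart. *)
Lemma dense_values (X : set R) (f : R -> R) (K de x y th : R) : seq_closed X -> X x -> X y -> 0 < de -> 0 <= K ->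
  (forall s t, X s -> X t -> s <= t -> f s <= f t <= f s + K * (t - s)) ->
  (forall a b, gap X a b -> x <= a -> b <= y -> b - a < de) -> x <= y ->
  f x <= th <= f y -> exists s, [/\ X s, x <= s, s <= y & `|f s - th| <= K * (4 * de)].
Proof.
move=> clX Xx Xy d0 K0 Hf Hg xy /andP[fx fy].
pose A : set R := fun s => [/\ X s, x <= s, s <= y & f s <= th].
have hA : has_sup A by split; [exists x|exists y => s []].
have [s1 [X1 x1 y1 f1] hs1] := sup_adherent d0 hA.
have ub s2 : X s2 -> x <= s2 -> s2 <= y -> sup A < s2 -> th < f s2.
  move=> X2 x2 y2 h; rewrite ltNge; apply/negP => h'.
  by have := sup_upper_bound hA (And4 X2 x2 y2 h'); lra.
have s1A := sup_upper_bound hA (And4 X1 x1 y1 f1).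
have [s2 [X2 s12 s24 f2]] : exists s2, [/\ X s2, s1 <= s2, s2 <= s1 + 4 * de & th <= f s2].
  have [h|h] := leP (sup A + 2 * de) y; last by exists y; split=> //; lra.
  have := @gap_around X x y (sup A + 2 * de) clX Xx Xy.
  case=> [||h1|[a [b [gab xa yb ab]]]]; [lra|lra| |].
    by exists (sup A + 2 * de); split=> //; [lra|lra|apply: ltW; apply: ub => //; lra].
  have := Hg a b gab xa yb => ab'; have [_ Xb _ _] := gab.
  by exists b; split=> //; [lra|lra|apply: ltW; apply: ub => //; lra].
exists s1; split=> //; have /andP[h1 h2] := Hf _ _ X1 X2 s12.
have : K * (s2 - s1) <= K * (4 * de) by apply: ler_wpM2l => //; lra.
rewrite ler_norml; lra.
Qed.

Lemma size_by_classes (T : eqType) (C : finType) (code : T -> C) (l : seq T) (S : nat) :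
  (forall c, (size [seq t <- l | code t == c] <= S)%N) -> (size l <= #|C| * S)%N.
Proof.
move=> H; have -> : size l = (\sum_(c : C) size [seq t <- l | code t == c])%N.
  elim: l {H} => [|t l IH]; first by rewrite big1.
  rewrite /= IH (bigD1 (code t)) //= [in RHS](bigD1 (code t)) //= eqxx /= addSn; congr (_ + _).+1.
  by apply: eq_bigr => c /negbTE; rewrite eq_sym => ->.
by rewrite -sum_nat_const; apply: leq_sum => c _.
Qed.

Lemma cell_exists (k : nat) (eta t : R) : 0 <= t -> t < k%:R * eta ->
  exists j : 'I_k, j%:R * eta <= t < j.+1%:R * eta.
Proof.
move=> t0; elim: k => [|k IH]; first by rewrite mul0r; lra.
case: (ltP t (k%:R * eta)) => h h'.
  by have [j hj] := IH h; exists (widen_ord (leqnSn k) j).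
by exists (@Ordinal k.+1 k (ltnSn k)); rewrite h.
Qed.

(** If [b1] were close to [a1] but different, then, depending on the side on which it lies, [b1 b3]
    would cross [a1 a2] or [b1 b2] would cross [a1 a3]. *)
Lemma triangle_rigid (a1 a2 a3 b1 b2 b3 : R[i]) (c eta : R) :
  cabs a1 = 1 -> cabs a2 = 1 -> cabs a3 = 1 ->
  cabs (b1 - a1) <= eta -> cabs (b2 - a2) <= eta -> cabs (b3 - a3) <= eta -> eta < c ->
  c <= `|om a1 a2| -> c <= `|om a1 a3| -> c <= `|om a2 a3| ->
  0 <= side a1 a2 b1 * side a1 a2 b3 -> 0 <= side a1 a3 b1 * side a1 a3 b2 -> om a1 b1 = 0.
Proof.
move=> n1 n2 n3 d1 d2 d3 ec h12 h13 h23; rewrite /side.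
have c23 : c <= `|om a3 a2| by rewrite omC normrN.
have c21 : c <= `|om a2 a1| by rewrite omC normrN.
have c31 : c <= `|om a3 a1| by rewrite omC normrN.
have near a b t : cabs t = 1 -> cabs (b - a) <= eta -> c <= `|om a t| -> 0 < om b t * om a t.
  move=> nt d h; have : `|om b t - om a t| <= eta.
    by have -> : om b t - om a t = om (b - a) t; [rewrite omDl omNl|apply: le_trans (om_le _ _) _; rewrite nt mulr1].
  by rewrite ler_norml => /andP[]; case: (ger0P (om a t)) h => h0 h; nra.
have p12 := near _ _ _ n2 d1 h12; have p13 := near _ _ _ n3 d1 h13.
have p31 := near _ _ _ n1 d3 c31; have p32 := near _ _ _ n2 d3 c23.
have p21 := near _ _ _ n1 d2 c21; have p23 := near _ _ _ n3 d2 h23.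
have sgn (al u v w u' v' w' : R) : 0 < u * u' -> 0 < v * v' -> 0 < w * w' -> 0 <= al * u * (v * w) -> 0 <= al * (u' * v' * w').
  move=> k1 k2 k3 k; have z (p q : R) : 0 < p * q -> p != 0 by apply: contraTneq => ->; rewrite mul0r ltxx.
  have pp : 0 < (u * v * w) ^+ 2 by rewrite exprn_even_gt0 //= !mulf_neq0 // (z _ _ k1, z _ _ k2, z _ _ k3).
  rewrite -(pmulr_rge0 _ pp).
  have -> : (u * v * w) ^+ 2 * (al * (u' * v' * w')) = (al * u * (v * w)) * ((u * u') * (v * v') * (w * w')) by ring.
  by apply: mulr_ge0 => //; apply: ltW; apply: mulr_gt0 => //; exact: mulr_gt0.
move=> /(sgn _ _ _ _ _ _ _ p12 p31 p32) q1 /(sgn _ _ _ _ _ _ _ p13 p21 p23) q2.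
have z a b : 0 <= eta -> c <= `|om a b| -> om a b != 0 by move=> e0 h; rewrite -normr_gt0; lra.
have e0 : 0 <= eta by apply: le_trans d1; exact: cabs_ge0.
apply/eqP; rewrite omC oppr_eq0; apply: contraT => al0.
have t0 : om a1 a2 * om a3 a1 * om a3 a2 != 0 by rewrite !mulf_neq0 // z.
have : om b1 a1 * (om a1 a2 * om a3 a1 * om a3 a2) = 0.
  apply/eqP; rewrite eq_le q1 andbT; move: q2; rewrite [om a1 a3]omC [om a2 a1]omC [om a2 a3]omC; lra.
by move/eqP; rewrite mulf_eq0 (negbTE al0) (negbTE t0).
Qed.

Lemma hv_near x y (e : R) : `|ha 1 x - ha 1 y| <= e -> cabs (hv x - hv y) <= e.
Proof.
move=> h; have -> : hv x = expi (2 * (ha 1 x / 2)) by rewrite /hv; congr expi; field.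
have -> : hv y = expi (2 * (ha 1 y / 2)) by rewrite /hv; congr expi; field.
rewrite chord_expi; apply: le_trans (_ : 2 * `|ha 1 y / 2 - ha 1 x / 2| <= _); first by rewrite ler_pM2l // abs_sin_le.
by rewrite -mulrBl normrM (ger0_norm (_ : 0 <= 2^-1)) ?invr_ge0 // mulrCA divff // mulr1 distrC.
Qed.

End RealLemmas.

(** * Linear inequalities between half-angles *)

Section CyclicOrder.
Variable R : realType.

Lemma spl_ends (al be s t : R) : s < t -> spl al be s t ->
  (s < al < t /\ ext s t be) \/ (s < be < t /\ ext s t al).
Proof.
rewrite /spl /btw /ext => st sp; have [q|q] : s < al < t \/ s < be < t by lra.
  by left; split=> //; lra.
by right; split=> //; lra.
Qed.

(** A leaf that crosses the diagonal [a1 b2] of two nested leaves, but neither of them, runs between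
    them. *)
Lemma not_spl_nested (al be a1 a2 b1 b2 : R) : a1 < b1 -> b1 < b2 -> b2 < a2 -> a1 < al < b2 -> ext a1 b2 be ->
  ~~ spl al be a1 a2 -> ~~ spl al be b1 b2 -> a1 < al <= b1 /\ b2 < be <= a2.
Proof.
rewrite /ext => h1 h2 h3 h4 h5 n1 n2.
have k1 : al <= b1.
  rewrite leNgt; apply/negP => q; clear n1; move: n2; rewrite /spl /btw /ext; lra.
have k2 : be <= a2.
  rewrite leNgt; apply/negP => q; clear n2; move: n1; rewrite /spl /btw /ext; lra.
have k3 : b2 < be.
  rewrite ltNge; apply/negP => q; clear n2; move: n1; rewrite /spl /btw /ext; lra.
by split; lra.
Qed.

(** A leaf that crosses the side [b1 b2] of a triangle, but neither of the sides at [a], must end at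
    [a]. *)
Lemma not_spl_fan (al be a b1 b2 : R) : a < b1 -> b1 < b2 -> b1 < al < b2 -> ext b1 b2 be ->
  ~~ spl al be a b1 -> ~~ spl al be a b2 -> be = a.
Proof.
rewrite /ext => h1 h2 h4 h5 n1 n2; apply/eqP; rewrite eq_le; apply/andP; split; rewrite leNgt; apply/negP => q.
  by case: (ltP be b1) => q'; [clear n2; move: n1|clear n1; move: n2]; rewrite /spl /btw /ext; lra.
by clear n1; move: n2; rewrite /spl /btw /ext; lra.
Qed.

Lemma not_spl_fan' (al be a b1 b2 : R) : b2 < a -> b1 < b2 -> b1 < al < b2 -> ext b1 b2 be ->
  ~~ spl al be b1 a -> ~~ spl al be b2 a -> be = a.
Proof.
rewrite /ext => h1 h2 h4 h5 n1 n2; apply/eqP; rewrite eq_le; apply/andP; split; rewrite leNgt; apply/negP => q.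
  by clear n2; move: n1; rewrite /spl /btw /ext; lra.
by case: (ltP be b1) => q'; [clear n2; move: n1|clear n1; move: n2]; rewrite /spl /btw /ext; lra.
Qed.

Lemma incoherent_angles (p a b c e : R) : 0 <= a -> a < b -> b < p -> 0 <= c -> c < e -> e < p -> c < b -> a < e ->
  ((a - e + p < (if e <= b then b - e else b - e + p) <= c - e + p) ||
   (e - a < (if a <= c then c - a else c - a + p) <= b - a)) = false.
Proof.
move=> *; apply/negbTE/norP; split; apply/negP => /andP[].
  by case: (leP e b) => *; lra.
by case: (leP a c) => *; lra.
Qed.

Lemma band_above (u v b p : R) : 0 <= u -> u <= v -> v <= b -> b <= p ->
  [/\ 0 <= b - (u + v) / 2, (v - u) / 4 <= b - (u + v) / 2 & b - (u + v) / 2 <= p - (v - u) / 4].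
Proof. by move=> *; split; lra. Qed.

Lemma band_below (u v a p : R) : 0 <= a -> a <= u -> u <= v -> v <= p ->
  [/\ a - (v + u) / 2 <= 0, (v - u) / 4 <= - (a - (v + u) / 2) & - (a - (v + u) / 2) <= p - (v - u) / 4].
Proof. by move=> *; split; lra. Qed.

Lemma band_middle (u v t : R) : u <= v -> (u + v) / 2 - (v - u) / 4 <= t -> t <= (u + v) / 2 + (v - u) / 4 -> u <= t <= v.
Proof. by move=> *; apply/andP; split; lra. Qed.

Lemma lipschitz_split (a b c e q p : R) : a <= b -> e <= c -> q * p = b - a + (c - e) ->
  (a <= b <= a + p * q) /\ (- c <= - e <= - c + p * q).
Proof. by move=> *; split; apply/andP; split; lra. Qed.

End CyclicOrder.

(** * Coordinates on the leaves between two given leaves *)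

Section ChartExists.
Variable R : realType.
Variables (G : set 'M[R[i]]_2) (L : set (set R[i])).
Hypothesis fG : cocompact_fuchsian G.
Hypothesis ML : maximal_lamination G L.
Variables (g1 g2 : set R[i]) (o m1 p2 m2 : R[i]).
Hypotheses (Lg1 : L g1) (Lg2 : L g2) (lab : labelled o g1 g2 o m1 p2 m2).

Let LL : lifted_lamination G L. Proof. by case: ML. Qed.
Let co : circle o. Proof. by case: lab => _ _ []. Qed.
Local Notation phi2 := (ha o p2).
Local Notation psi1 := (ha o m1).
Local Notation psi2 := (ha o m2).
Lemma phi2_ge0 : 0 <= phi2. Proof. by case: lab => _ _ [_ _ _ c _] _; exact: ha_ge0. Qed.
Lemma phi_psi : phi2 < psi2. Proof. by case: lab => _ _ _ [_ /andP[]]. Qed.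
Lemma psi21 : psi2 <= psi1. Proof. by case: lab => _ _ _ [_ /andP[]]. Qed.
Lemma psi1_pi : psi1 < pi. Proof. by case: lab => _ _ [_ _ c _ _] _; exact: ha_ltpi. Qed.
Lemma pi0 : 0 < pi :> R. Proof. exact: pi_gt0. Qed.
Lemma rng : [/\ 0 <= phi2, phi2 < psi2, psi2 <= psi1, psi1 < pi & 0 < pi :> R].
Proof. by split; [exact: phi2_ge0|exact: phi_psi|exact: psi21|exact: psi1_pi|exact: pi0]. Qed.
Let lgc u v : L (geod u v) -> [/\ circle u, circle v & u <> v].
Proof. by apply: leaf_circle; exact: (L_leaf LL). Qed.

Definition pol (t : R) : R[i] := o * expi (2 * t).
Lemma circle_pol t : circle (pol t).
Proof. by apply: circleM => //; exact: circle_expi. Qed.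
Lemma ha_pol t : 0 <= t < pi -> ha o (pol t) = t.
Proof. by move=> h; apply: haK. Qed.
Lemma pol_ha x : circle x -> x = pol (ha o x).
Proof. by move=> cx; have [] := haP co cx. Qed.
Lemma pol_pi t : pol (t + pi) = pol t.
Proof. by rewrite /pol expi2Dpi. Qed.
Lemma chord_pol s t : cabs (pol s - pol t) = 2 * `|sin (t - s)|.
Proof. by rewrite /pol -mulrBr cabsM (_ : cabs o = 1) // mul1r chord_expi. Qed.
Lemma om_pol s t : `|om (hv (pol s)) (hv (pol t))| = `|sin (t - s)|.
Proof. have := chord_hv (circle_pol s) (circle_pol t); rewrite chord_pol; lra. Qed.

Definition fam (a b : R) := [/\ 0 <= a <= phi2, psi2 <= b <= psi1 & L (geod (pol a) (pol b))].
(** The half-angles swept by both endpoints since [g1], added up. As separating leaves are nested,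
    each endpoint is a monotone Lipschitz function of this sum; division by [pi] brings it into
    [0,1). *)
Definition coor (a b : R) : R := (a + psi1 - b) / pi.
Definition Xc : set R := fun s => exists a b, fam a b /\ s = coor a b.
Definition fs (s : R) : R * R := xget (0, 0) (fun p => fam p.1 p.2 /\ s = coor p.1 p.2).
Definition f1 s := (fs s).1.
Definition f2 s := (fs s).2.
Definition Pc s := pol (f1 s).
Definition Mc s := pol (f2 s).

Lemma leaf_nc a b c e : 0 <= a < pi -> 0 <= b < pi -> 0 <= c < pi -> 0 <= e < pi ->
  L (geod (pol a) (pol b)) -> L (geod (pol c) (pol e)) -> ~~ spl a b c e.
Proof.
move=> ha1 hb hc he l1 l2; apply/negP => h; apply: (L_nc LL l1 l2).
by apply/(crossesE co); rewrite ?ha_pol //; exact: circle_pol.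
Qed.

Lemma fam_rng a b : fam a b -> [/\ 0 <= a < pi, 0 <= b < pi, a <= phi2 & psi2 <= b <= psi1].
Proof. have [r0 r1 r2 r3 r4] := rng. by move=> [/andP[h1 h2] /andP[h3 h4] _]; split=> //; apply/andP; split; lra. Qed.

Lemma nested a b c e : fam a b -> fam c e -> (a <= c /\ e <= b) \/ (c <= a /\ b <= e).
Proof.
move=> h1 h2; have [r1 r2 r3 r4] := fam_rng h1; have [r5 r6 r7 r8] := fam_rng h2.
have := leaf_nc r1 r2 r5 r6 (let: And3 _ _ l := h1 in l) (let: And3 _ _ l := h2 in l).
rewrite /spl /btw /ext => n; have ph := phi_psi; case: (ltgtP a c) => h.
- by left; split=> //; rewrite leNgt; apply/negP => h'; lra.
- by right; split=> //; rewrite leNgt; apply/negP => h'; lra.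
by case: (leP e b) => h'; [left|right; split=> //; exact: ltW].
Qed.

Lemma XcE s : Xc s -> fam (f1 s) (f2 s) /\ s = coor (f1 s) (f2 s).
Proof.
move=> [a [b h]]; rewrite /f1 /f2 /fs.
by apply: (@xgetPex _ (0, 0) (fun p : R * R => fam p.1 p.2 /\ s = coor p.1 p.2)); exists (a, b).
Qed.

Lemma coor_diff a b c e : coor a b - coor c e = ((a - c) + (e - b)) / pi.
Proof. by rewrite /coor -mulrBl; congr (_ / _); ring. Qed.

Lemma Xc_coor a b : fam a b -> Xc (coor a b).
Proof. by move=> h; exists a, b. Qed.

Lemma coor_mono a b c e : fam a b -> fam c e -> coor a b <= coor c e -> a <= c /\ e <= b.
Proof.
move=> h1 h2; rewrite -subr_ge0 coor_diff pmulr_lge0 ?invr_gt0 ?pi0 // => h.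
by have [//|[h3 h4]] := nested h1 h2; split; lra.
Qed.

Lemma f_coor a b : fam a b -> f1 (coor a b) = a /\ f2 (coor a b) = b.
Proof.
move=> h; have [h1 e] := XcE (Xc_coor h).
have [a1 b1] := coor_mono h h1 (eq_ind _ (fun t => _ <= t) (lexx _) _ e).
have [a2 b2] : f1 (coor a b) <= a /\ b <= f2 (coor a b) by apply: (coor_mono h1 h); rewrite -e.
by split; apply/eqP; rewrite eq_le ?a1 ?a2 ?b1 ?b2.
Qed.

Lemma f_mono s t : Xc s -> Xc t -> s <= t -> f1 s <= f1 t /\ f2 t <= f2 s.
Proof.
move=> /XcE[h1 e1] /XcE[h2 e2] st; apply: (coor_mono h1 h2).
by rewrite -e1 -e2.
Qed.

Lemma f_diff s t : Xc s -> Xc t -> (t - s) * pi = (f1 t - f1 s) + (f2 s - f2 t).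
Proof. by move=> /XcE[h1 e1] /XcE[h2 e2]; rewrite {1}e1 {1}e2 coor_diff divfK // gt_eqF // pi0. Qed.

Lemma f_rng s : Xc s -> [/\ 0 <= f1 s, f1 s <= phi2, psi2 <= f2 s & f2 s <= psi1].
Proof. by move=> /XcE[[/andP[? ?] /andP[? ?] _] _]. Qed.

Lemma f_abs s t : Xc s -> Xc t -> `|f1 t - f1 s| <= pi * `|t - s| /\ `|f2 t - f2 s| <= pi * `|t - s|.
Proof.
move=> Xs Xt; have e := f_diff Xs Xt; rewrite -[X in X * `|_|](ger0_norm (ltW pi0)) -normrM mulrC e.
have [st|ts] := leP s t.
  have [h1 h2] := f_mono Xs Xt st; rewrite !ler_norml (ger0_norm (_ : 0 <= f1 t - f1 s + (f2 s - f2 t))); last lra.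
  by split; apply/andP; split; lra.
have [h1 h2] := f_mono Xt Xs (ltW ts); rewrite !ler_norml (ler0_norm (_ : f1 t - f1 s + (f2 s - f2 t) <= 0)); last lra.
by split; apply/andP; split; lra.
Qed.

Lemma Xc_leaf s : Xc s -> L (geod (Pc s) (Mc s)).
Proof. by move=> /XcE[[]]. Qed.

Lemma Xc_range s : Xc s -> 0 <= s < 1.
Proof.
have [r0 r1 r2 r3 r4] := rng; move=> Xs; have [h1 h2 h3 h4] := f_rng Xs; have [_ ->] := XcE Xs.
apply/andP; split; first by rewrite /coor divr_ge0 ?(ltW pi0) //; lra.
by rewrite /coor ltr_pdivrMr // mul1r; lra.
Qed.

Lemma f_rng_pi s : Xc s -> 0 <= f1 s < pi /\ 0 <= f2 s < pi.
Proof.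
have [r0 r1 r2 r3 r4] := rng; move=> Xs; have [h1 h2 h3 h4] := f_rng Xs.
by split; apply/andP; split; lra.
Qed.

Lemma ha_Pc s : Xc s -> ha o (Pc s) = f1 s.
Proof. have [r0 r1 r2 r3 r4] := rng. by move=> Xs; have [h1 h2 h3 h4] := f_rng Xs; rewrite ha_pol //; apply/andP; split; lra. Qed.
Lemma ha_Mc s : Xc s -> ha o (Mc s) = f2 s.
Proof. have [r0 r1 r2 r3 r4] := rng. by move=> Xs; have [h1 h2 h3 h4] := f_rng Xs; rewrite ha_pol //; apply/andP; split; lra. Qed.

Lemma Xc_closed : seq_closed Xc.
Proof.
have [r0 r1 r2 r3 r4] := rng; move=> t H.
have /choice[a Ha] : forall n, exists s, Xc s /\ `|s - t| < dy R n by move=> n; apply: H; exact: dy_gt0.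
have step n : `|a n.+1 - a n| <= 2 * dy R n.
  have [_ h1] := Ha n; have [_ h2] := Ha n.+1; have := dy_gt0 R n; move: h1 h2; rewrite dyS !ltr_norml ler_norml; lra.
have dE n : dy R n = 2^-1 ^+ n by [].
have limf (f : R -> R) : (forall s s', Xc s -> Xc s' -> `|f s' - f s| <= pi * `|s' - s|) ->
    exists l, forall n, `|f (a n) - l| <= 4 * pi * dy R n.
  move=> Hf; have [||n|l Hl] := @geometric_complete R (fun n => f (a n)) (2 * pi) 2^-1.
  - by rewrite invr_ge0.
  - by rewrite invf_lt1 // ltr1n.
  - apply: le_trans (Hf _ _ (proj1 (Ha n)) (proj1 (Ha n.+1))) _; rewrite -dE.
    by have := step n; have := pi0; nra.
  exists l => n; apply: le_trans (Hl n) _; have -> : 1 - 2^-1 = 2^-1 :> R by [lra]; rewrite invrK -dE; lra.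
have [l1 H1] := limf f1 (fun s s' h h' => proj1 (f_abs h h')).
have [l2 H2] := limf f2 (fun s s' h h' => proj2 (f_abs h h')).
have small e : 0 < e -> exists n, [/\ `|f1 (a n) - l1| < e, `|f2 (a n) - l2| < e & `|a n - t| < e].
  move=> e0; have k0 : 0 < 4 * pi + 1 :> R by have := pi0; lra.
  have [n hn] := dy_small (divr_gt0 e0 k0); exists n.
  have d0 := dy_gt0 R n; rewrite ltr_pdivlMr // in hn.
  have [_ h3] := Ha n; have h1 := H1 n; have h2 := H2 n; have := pi0; split; nra.
have close (x y : R) : (forall e, 0 < e -> x - y < e) -> x <= y.
  by move=> h; rewrite leNgt; apply/negP => h'; have := h (x - y) ltac:(lra); lra.
have F : fam l1 l2.
  have r : forall e, 0 < e -> [/\ 0 - l1 < e, l1 - phi2 < e, psi2 - l2 < e & l2 - psi1 < e].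
    move=> e e0; have [n [h1 h2 _]] := small e e0; have [k1 k2 k3 k4] := f_rng (proj1 (Ha n)).
    by move: h1 h2; rewrite !ltr_norml => /andP[? ?] /andP[? ?]; split; lra.
  have q1 : 0 <= l1 by apply: close => e /r[].
  have q2 : l1 <= phi2 by apply: close => e /r[].
  have q3 : psi2 <= l2 by apply: close => e /r[].
  have q4 : l2 <= psi1 by apply: close => e /r[].
  split; [by rewrite q1|by rewrite q3|].
  apply: (L_closed LL); try exact: circle_pol.
    move=> /(congr1 (ha o)); rewrite !ha_pol; [lra|apply/andP; split; lra|apply/andP; split; lra].
  move=> e e0; have [n [h1 h2 _]] := small (e / 2) ltac:(lra).
  exists (Pc (a n)), (Mc (a n)); split; first exact: (Xc_leaf (proj1 (Ha n))).
    by rewrite chord_pol; have := abs_sin_le (l1 - f1 (a n)); rewrite distrC; lra.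
  by rewrite chord_pol; have := abs_sin_le (l2 - f2 (a n)); rewrite distrC; lra.
have D e : 0 < e -> `|t - coor l1 l2| < e.
  move=> e0; have [n [h1 h2 h3]] := small (e / 2) ltac:(lra).
  have [_ ea] := XcE (proj1 (Ha n)).
  have : (a n - coor l1 l2) * pi = (f1 (a n) - l1) + (l2 - f2 (a n)).
    by rewrite {1}ea coor_diff divfK // gt_eqF.
  have pg := pi_ge2 R; move: h1 h2 h3; rewrite !ltr_norml => /andP[? ?] /andP[? ?] /andP[? ?] h.
  set d := a n - coor l1 l2 in h; have -> : t - coor l1 l2 = d - (a n - t) by rewrite /d; ring.
  have d1 : d < e / 2 by rewrite ltNge; apply/negP => ?; nra.
  have d2 : - (e / 2) < d by rewrite ltNge; apply/negP => ?; nra.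
  by apply/andP; split; lra.
exists l1, l2; split=> //; apply/eqP; rewrite -subr_eq0 -normr_eq0; apply: contraT => n0.
have p0 : 0 < `|t - coor l1 l2| by rewrite lt_neqAle eq_sym n0 normr_ge0.
by have := D _ p0; rewrite ltxx.
Qed.

Lemma sin_lower_psi : exists2 c : R, 0 < c & forall t, 0 <= t <= psi1 -> c * t <= sin t.
Proof.
have [r0 r1 r2 r3 r4] := rng; apply: sin_lower => //; lra.
Qed.

Lemma inside_gap a b p m : gap Xc a b -> f1 a <= p <= f1 b -> f2 b <= m <= f2 a -> (f1 a < p \/ m < f2 a) ->
  (p < f1 b \/ f2 b < m) -> ~ L (geod (pol p) (pol m)).
Proof.
move=> [Xa Xb ab nX] /andP[h1 h2] /andP[h3 h4] h5 h6 lf; have [Fa ea] := XcE Xa; have [Fb eb] := XcE Xb.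
have [a1 a2 a3 a4] := f_rng Xa; have [b1 b2 b3 b4] := f_rng Xb.
have F : fam p m.
  split=> //; apply/andP; split; [exact: le_trans h1|exact: le_trans b2|exact: le_trans h3|exact: le_trans a4].
have := nX _ (Xc_coor F); rewrite ea eb -subr_gt0 -[X in _ && X]subr_gt0 !coor_diff !divr_gt0 ?pi0 //.
  by case: h6; lra.
by case: h5; lra.
Qed.

(** Maximality enters the charts here, through [free_leaf]; an uncrossed geodesic is a leaf, and
    exactly one endpoint of a crossing leaf lies between [s] and [t]. *)
Lemma third_side s t : 0 <= s -> s < t -> t < pi ->
  (forall al be, 0 <= al < pi -> 0 <= be < pi -> s < al < t -> ext s t be -> L (geod (pol al) (pol be)) -> False) ->
  L (geod (pol s) (pol t)).
Proof.
move=> s0 st t1 H; have rs : 0 <= s < pi by rewrite s0 (lt_trans st).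
have rt : 0 <= t < pi by rewrite t1 (le_trans s0 (ltW st)).
apply: (free_leaf fG ML); try exact: circle_pol.
  by move=> /(congr1 (ha o)); rewrite !ha_pol // => e; rewrite e ltxx in st.
move=> u v Luv; have [cu cv _] := lgc Luv; move=> /(crossesE co cu cv (circle_pol _) (circle_pol _)).
have [hu _] := haP co cu; have [hv' _] := haP co cv.
have lu : L (geod (pol (ha o u)) (pol (ha o v))) by rewrite -!pol_ha.
have lu' : L (geod (pol (ha o v)) (pol (ha o u))) by rewrite geodC.
rewrite !ha_pol // => /(spl_ends st) [[k1 k2]|[k1 k2]]; [exact: (H _ _ hu hv')|exact: (H _ _ hv' hu)].
Qed.

(** If both endpoints moved, a leaf crossing the diagonal from [f1 a] to [f2 b] would lie inside the
    gap. So nothing crosses it, and the diagonal is itself a leaf inside the gap. *)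
Lemma gap_shared a b : gap Xc a b -> f1 a = f1 b \/ f2 a = f2 b.
Proof.
have [r0 r1 r2 r3 r4] := rng.
move=> gab; have [Xa Xb ab nX] := gab; have [a1 a2 a3 a4] := f_rng Xa; have [b1 b2 b3 b4] := f_rng Xb.
have [m1' m2'] := f_mono Xa Xb (ltW ab).
have [/eqP|e1] := eqVneq (f1 a) (f1 b); first by move/eqP; left.
have [/eqP|e2] := eqVneq (f2 a) (f2 b); first by move/eqP; right.
exfalso; have lt1 : f1 a < f1 b by rewrite lt_neqAle e1.
have lt2 : f2 b < f2 a by rewrite lt_neqAle eq_sym e2.
have [pa1 pa2] := f_rng_pi Xa; have [pb1 pb2] := f_rng_pi Xb.
have lt3 : f1 b < f2 b by apply: le_lt_trans b2 (lt_le_trans r1 b3).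
apply: (@inside_gap a b (f1 a) (f2 b) gab); rewrite ?lexx ?m1' ?m2' //; try by [left|right].
apply: third_side; [exact: a1|exact: lt_trans lt3|by case/andP: pb2|].
move=> al be hal hbe sal sbe lf.
have [k1 k2] := not_spl_nested lt1 lt3 lt2 sal sbe (leaf_nc hal hbe pa1 pa2 lf (Xc_leaf Xa)) (leaf_nc hal hbe pb1 pb2 lf (Xc_leaf Xb)).
move: k1 k2 => /andP[k1 k2] /andP[k3 k4].
by apply: (inside_gap gab _ _ _ _ lf); rewrite ?k2 ?k4 ?ltW //; [left|right].
Qed.

(** The side joining the two endpoints that are not shared is a leaf as well, and comparable in
    length to the gap; the other two sides join arcs at positive distance, so their length is
    bounded below. *)
Lemma gap_triangle : exists d c : R, [/\ 0 < d, d <= 1, 0 < c, c <= 1 & forall a b, gap Xc a b -> exists x y z : R[i],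
  [/\ [/\ circle x, circle y & circle z],
      [/\ geod (Pc a) (Mc a) = geod x y, geod (Pc b) (Mc b) = geod x z & L (geod y z)],
      d <= `|om (hv x) (hv y)|, d <= `|om (hv x) (hv z)| &
      c * (b - a) <= `|om (hv y) (hv z)| <= pi * (b - a)]].
Proof.
have [r0 r1 r2 r3 r4] := rng; have [c c0 Hc] := sin_lower_psi.
pose d := Num.min (c * (psi2 - phi2)) 1.
have d0 : 0 < d by rewrite lt_min ltr01 andbT mulr_gt0 ?subr_gt0.
have cc : 0 < Num.min c 1 by rewrite lt_min c0 ltr01.
exists d, (Num.min c 1); split=> //; try by rewrite ge_min lexx orbT.
move=> a b gab; have gs := gap_shared gab; have [Xa Xb ab nX] := gab.
have [a1 a2 a3 a4] := f_rng Xa; have [b1 b2 b3 b4] := f_rng Xb.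
have [m1' m2'] := f_mono Xa Xb (ltW ab); have fd := f_diff Xa Xb.
have rg t : 0 <= t -> t <= psi1 -> 0 <= t < pi by move=> *; apply/andP; split; lra.
have far s t : 0 <= s -> s <= phi2 -> psi2 <= t -> t <= psi1 -> d <= `|om (hv (pol s)) (hv (pol t))|.
  move=> s0 s1 t0 t1; rewrite om_pol; apply: le_trans (ler_norm _).
  apply: le_trans (Hc _ _); last by apply/andP; split; lra.
  apply: le_trans (_ : c * (psi2 - phi2) <= _); first by rewrite ge_min lexx.
  by rewrite ler_pM2l //; lra.
have near s t : 0 <= s -> s <= t -> t <= psi1 -> (t - s = (b - a) * pi) ->
    Num.min c 1 * (b - a) <= `|om (hv (pol s)) (hv (pol t))| <= pi * (b - a).
  move=> s0 st t1 e; rewrite om_pol e; apply/andP; split; last first.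
    by apply: le_trans (abs_sin_le _) _; rewrite -e ger0_norm; lra.
  apply: le_trans (ler_norm _); apply: le_trans (Hc _ _); last by apply/andP; split; lra.
  have h1 : Num.min c 1 <= c by rewrite ge_min lexx.
  have h2 : c * (b - a) <= c * ((b - a) * pi) by rewrite ler_pM2l // ler_peMr; have := pi_ge2 R; lra.
  by apply: le_trans h2; rewrite ler_pM2r //; lra.
have [pa1 pa2] := f_rng_pi Xa; have [pb1 pb2] := f_rng_pi Xb.
case: gs => e.
  have lt2 : f2 b < f2 a by rewrite lt_neqAle m2' andbT; apply/eqP => e2; move: fd; rewrite e e2; have : 0 < (b - a) * pi by [rewrite mulr_gt0 // subr_gt0]; lra.
  have ePc : Pc a = Pc b by rewrite /Pc e.
  exists (Pc a), (Mc a), (Mc b); split.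
  - by split; exact: circle_pol.
  - split; [by []|by rewrite ePc|]; rewrite geodC; apply: third_side => //; [exact: le_trans phi2_ge0 (le_trans (ltW r1) b3)|exact: le_lt_trans r3|].
    move=> al be hal hbe sal sbe lf.
    have lt3 : f1 a < f2 b by apply: le_lt_trans a2 (lt_le_trans r1 b3).
    have n2 := leaf_nc hal hbe pb1 pb2 lf (Xc_leaf Xb); rewrite -e in n2.
    have be1 := not_spl_fan lt3 lt2 sal sbe n2 (leaf_nc hal hbe pa1 pa2 lf (Xc_leaf Xa)).
    move: sal => /andP[k1 k2].
    apply: (@inside_gap a b (f1 a) al gab); rewrite ?e ?lexx ?ltW //; [by right|by right|].
    by rewrite geodC -e -be1.
  - exact: (far (f1 a) (f2 a) a1 a2 a3 a4).
  - exact: (far (f1 a) (f2 b) a1 a2 b3 b4).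
  - have := near (f2 b) (f2 a) ltac:(lra) m2' a4 ltac:(lra).
    by rewrite omC normrN.
have lt1 : f1 a < f1 b by rewrite lt_neqAle m1' andbT; apply/eqP => e2; move: fd; rewrite e e2; have : 0 < (b - a) * pi by [rewrite mulr_gt0 // subr_gt0]; lra.
have sw x y : `|om (hv x) (hv y)| = `|om (hv y) (hv x)| by rewrite omC normrN.
have eMc : Mc a = Mc b by rewrite /Mc e.
exists (Mc a), (Pc a), (Pc b); split.
- by split; exact: circle_pol.
- split; [by rewrite geodC|by rewrite geodC eMc|].
  apply: third_side => //; first by case/andP: pb1.
  move=> al be hal hbe sal sbe lf.
  have lt3 : f1 b < f2 a by apply: le_lt_trans b2 (lt_le_trans r1 a3).
  have n2 := leaf_nc hal hbe pb1 pb2 lf (Xc_leaf Xb); rewrite -e in n2.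
  have be1 := not_spl_fan' lt3 lt1 sal sbe (leaf_nc hal hbe pa1 pa2 lf (Xc_leaf Xa)) n2.
  move: sal => /andP[k1 k2].
  apply: (@inside_gap a b al (f2 a) gab); rewrite ?e ?lexx ?ltW //; [by left|by left|].
  by rewrite -e -be1.
- by rewrite sw; exact: (far (f1 a) (f2 a) a1 a2 a3 a4).
- by rewrite sw; exact: (far (f1 b) (f2 a) b1 b2 a3 a4).
- by apply: near => //; lra.
Qed.

Lemma pol_add th t : pol th * expi (2 * t) = pol (th + t).
Proof. by rewrite /pol -mulrA -expi2D. Qed.

(** If all gaps between [x] and [y] were short, the endpoint sweeping the greater angle would pass
    close to every point of an arc while the other endpoint stayed away from it, against
    [no_strip]. *)
Lemma Xc_porous : exists2 c : R, 0 < c & forall x y, Xc x -> Xc y -> x < y ->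
  exists a b, [/\ gap Xc a b, x <= a, b <= y & c * (y - x) <= b - a].
Proof.
have [e e0 He] := no_strip fG LL; exists (e / 32); first lra.
(* [no_strip] with [tau = D / 4]; a shift by [pi] brings the far endpoint into its range of
   half-angles. *)
have strip_false th0 D : 0 < D -> D <= pi -> (forall th, th0 - D / 4 <= th <= th0 + D / 4 -> exists al be,
    [/\ `|al - th| <= e * (D / 4), L (geod (pol al) (pol be)), D / 4 <= `|be - th0| & `|be - th0| <= pi - D / 4]) -> False.
  move=> D0 Dp H; have [t ht Ht] := He (pol th0) (D / 4) (circle_pol _) ltac:(lra) ltac:(lra).
  have [al [be [h1 h2 h3 h4]]] := H (th0 + t) ltac:(move: ht; rewrite ler_norml; lra).
  have t'E : `|(al - th0) - t| <= e * (D / 4) by rewrite (_ : al - th0 - t = al - (th0 + t)) //; ring.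
  have L' t'' : pol (th0 + t'') = pol be -> L (geod (pol th0 * expi (2 * (al - th0))) (pol th0 * expi (2 * t''))).
    by move=> E; rewrite !pol_add E addrC subrK.
  have [q|q] := leP `|be - th0| (pi / 2).
    by apply: (Ht (al - th0) (be - th0)) => //; apply: L'; rewrite addrC subrK.
  case: (ger0P (be - th0)) h3 h4 q => sg h3 h4 q.
    apply: (Ht (al - th0) (be - th0 - pi)) => //.
    - by rewrite ler0_norm; lra.
    - by rewrite ler0_norm; lra.
    by apply: L'; rewrite -[RHS](congr1 pol (subrK pi be)) pol_pi; congr pol; ring.
  apply: (Ht (al - th0) (be - th0 + pi)) => //.
  - by rewrite ger0_norm; lra.
  - by rewrite ger0_norm; lra.
  by apply: L'; rewrite -[RHS]pol_pi; congr pol; ring.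
have pp := pi0; move=> x y Xx Xy xy; apply: contrapT => /forallNP N.
(* One endpoint sweeps an angle [D] of at least half of [(y - x) * pi]; with this constant the error
   [pi * (4 * de)] of [dense_values] is at most the tolerance [e * (D / 4)]. *)
pose de := e / 32 * (y - x).
have d0 : 0 < de by rewrite mulr_gt0 ?subr_gt0 // divr_gt0.
have N' a b : gap Xc a b -> x <= a -> b <= y -> b - a < de.
  move=> gab xa yb; rewrite ltNge; apply/negP => h.
  by apply: (N a); exists b.
have [xm1 xm2] := f_mono Xx Xy (ltW xy); have fd := f_diff Xx Xy.
have [ya1 ya2 ya3 ya4] := f_rng Xy; have [xa1 xa2 xa3 xa4] := f_rng Xx.
have [r0 r1 r2 r3 r4] := rng.
have big D : (y - x) * pi / 2 <= D -> pi * (4 * de) <= e * (D / 4).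
  move=> h; have -> : pi * (4 * de) = e / 4 * ((y - x) * pi / 2) by rewrite /de; field.
  have -> : e * (D / 4) = e / 4 * D by field.
  by rewrite ler_pM2l // divr_gt0.
have [h|h] := leP ((y - x) * pi / 2) (f1 y - f1 x).
  have D0 : 0 < f1 y - f1 x by apply: lt_le_trans h; rewrite divr_gt0 // mulr_gt0 // subr_gt0.
  apply: (strip_false ((f1 x + f1 y) / 2) (f1 y - f1 x)) => //; first lra.
  move=> th /andP[th1 th2].
  have mo s t : Xc s -> Xc t -> s <= t -> f1 s <= f1 t <= f1 s + pi * (t - s).
    by move=> Xs Xt st; have [k1 k2] := f_mono Xs Xt st; case: (lipschitz_split k1 k2 (f_diff Xs Xt)).
  have hth := band_middle xm1 th1 th2.
  have [s [Xs s1 s2 s3]] := @dense_values _ Xc f1 pi de x y th Xc_closed Xx Xy d0 (ltW pp) mo N' (ltW xy) hth.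
  have [t1 t2 t3 t4] := f_rng Xs.
  have [ge0 ge1 ge2] := band_above xa1 xm1 (le_trans ya2 (le_trans (ltW r1) t3)) (le_trans t4 (ltW r3)).
  exists (f1 s), (f2 s); rewrite (ger0_norm ge0); split; [|exact: Xc_leaf|exact: ge1|exact: ge2].
  by apply: le_trans s3 _; apply: big.
have h' : (y - x) * pi / 2 <= f2 x - f2 y by lra.
have D0 : 0 < f2 x - f2 y by apply: lt_le_trans h'; rewrite divr_gt0 // mulr_gt0 // subr_gt0.
apply: (strip_false ((f2 x + f2 y) / 2) (f2 x - f2 y)) => //; first lra.
move=> th /andP[th1 th2].
have mo s t : Xc s -> Xc t -> s <= t -> - f2 s <= - f2 t <= - f2 s + pi * (t - s).
  by move=> Xs Xt st; have [k1 k2] := f_mono Xs Xt st; case: (lipschitz_split k1 k2 (f_diff Xs Xt)).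
rewrite [f2 x + f2 y]addrC in th1 th2.
have hth : - f2 x <= - th <= - f2 y by rewrite !lerN2 andbC; exact: band_middle xm2 th1 th2.
have [s [Xs s1 s2 s3]] := @dense_values _ Xc (fun s => - f2 s) pi de x y (- th) Xc_closed Xx Xy d0 (ltW pp) mo N' (ltW xy) hth.
have [t1 t2 t3 t4] := f_rng Xs.
have [le0 le1 le2] := band_below t1 (le_trans t2 (le_trans (ltW r1) ya3)) xm2 (le_trans xa4 (ltW r3)).
exists (f2 s), (f1 s); rewrite (ler0_norm le0); split; [|by rewrite geodC; exact: Xc_leaf|exact: le1|exact: le2].
rewrite (_ : f2 s - th = - (- f2 s - - th)); last by ring.
by rewrite normrN; apply: le_trans s3 _; apply: big.
Qed.

Lemma leaf_Xc_inj s t : Xc s -> Xc t -> geod (Pc s) (Mc s) = geod (Pc t) (Mc t) -> s = t.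
Proof.
move=> Xs Xt; have [s1 s2 s3 s4] := f_rng Xs; have [t1 t2 t3 t4] := f_rng Xt; have ph := phi_psi.
have [_ es] := XcE Xs; have [_ et] := XcE Xt.
move=> /geod_eq [[e1 e2]|[e1 e2]].
  have q1 := congr1 (ha o) e1; have q2 := congr1 (ha o) e2; rewrite !ha_Pc // in q1; rewrite !ha_Mc // in q2.
  by rewrite es et q1 q2.
have q1 := congr1 (ha o) e1; rewrite ha_Pc // ha_Mc // in q1; exfalso; lra.
Qed.

Lemma om_mob g u v : G g -> circle u -> circle v ->
  `|om (hv (mob g u)) (hv (mob g v))| = `|om (hv u) (hv v)| / (nz g u * nz g v).
Proof.
move=> Gg cu cv; have sg := G_su11 fG Gg; have := chord_mob sg cu cv.
rewrite (chord_hv (circle_mob sg cu) (circle_mob sg cv)) (chord_hv cu cv) -mulrA; lra.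
Qed.

(* Moebius maps in [G] renormalise thin ideal triangles to thick ones. *)
Lemma expand_triangle (d : R) : 0 < d -> d <= 1 -> exists2 c1 : R, 0 < c1 & forall x y z, circle x -> circle y -> circle z ->
  d <= `|om (hv x) (hv y)| -> d <= `|om (hv x) (hv z)| -> 0 < `|om (hv y) (hv z)| ->
  exists g, [/\ G g, c1 <= `|om (hv (mob g x)) (hv (mob g y))|, c1 <= `|om (hv (mob g x)) (hv (mob g z))| &
    c1 <= `|om (hv (mob g y)) (hv (mob g z))|].
Proof.
move=> d0 d1; have [C C1 HC] := expansion fG; exists (d / (4 * C ^+ 2)).
  by rewrite divr_gt0 // mulr_gt0 // exprn_gt0 //; lra.
move=> x y z cx cy cz hxy hxz; pose w : R := `|om (hv y) (hv z)|; rewrite -/w => w0.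
have le1 (u v : R[i]) : `|om (hv u) (hv v)| <= 1 by apply: le_trans (om_le _ _) _; rewrite !cabs_hv mulr1.
(* [r^2] is the size of the short side, which the expansion at [y] blows up to size about 1. *)
pose r : R := Num.sqrt w; have r0 : 0 < r by rewrite sqrtr_gt0.
have r2 : r ^+ 2 = w by rewrite sqr_sqrtr // ltW.
have r1 : r <= 1 by rewrite -sqrtr1; apply: ler_wsqrtr; exact: le1.
have [g [Gg Hg]] := HC y r cy r0 r1; exists g; have sg := G_su11 fG Gg.
have [_ ny] := Hg _ cy; have [_ nz'] := Hg _ cz; have [_ nx] := Hg _ cx.
rewrite om_self normr0 addr0 r2 in ny; rewrite -/w r2 in nz'; rewrite r2 in nx.
have X0 := mulr_gt0 r0 (nz_gt0 x sg); have Y0 := mulr_gt0 r0 (nz_gt0 y sg); have Z0 := mulr_gt0 r0 (nz_gt0 z sg).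
have w1 : w <= 1 by exact: le1.
have nx2 : r * nz g x <= 2 * C.
  apply: le_trans nx _; rewrite [2 * C]mulrC; apply: ler_wpM2l; first lra.
  by have := le1 y x; lra.
have nz2 : r * nz g z <= 2 * (C * w) by lra.
have key (A a b p q : R) u v : circle u -> circle v -> A <= `|om (hv u) (hv v)| -> 0 <= A -> r * nz g u <= p -> r * nz g v <= q ->
    0 < p -> 0 < q -> A * r ^+ 2 / (p * q) <= `|om (hv (mob g u)) (hv (mob g v))|.
  move=> cu cv hA A0 hp hq p0 q0; rewrite om_mob // ler_pdivrMr ?mulr_gt0 // mulrAC ler_pdivlMr ?mulr_gt0 ?nz_gt0 //.
  have -> : A * r ^+ 2 * (nz g u * nz g v) = A * ((r * nz g u) * (r * nz g v)) by ring.
  have u0 := ltW (mulr_gt0 r0 (nz_gt0 u sg)); have v0 := ltW (mulr_gt0 r0 (nz_gt0 v sg)).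
  by apply: ler_pM => //; [apply: mulr_ge0|apply: ler_pM].
have C0 : 0 < C by lra.
have Cw : 0 < C * w by rewrite mulr_gt0.
have wn : w != 0 by rewrite gt_eqF.
have Cn : C != 0 by rewrite gt_eqF.
have k0 : 0 < (4 * C ^+ 2)^-1 by rewrite invr_gt0 mulr_gt0 // exprn_gt0.
have dk : 0 < d * (4 * C ^+ 2)^-1 by rewrite mulr_gt0.
split=> //.
- apply: le_trans (key d 0 0 (2 * C) (C * w) _ _ cx cy hxy (ltW d0) nx2 ny _ _) => //; last lra.
  rewrite r2 (_ : d * w / (2 * C * (C * w)) = 2 * (d * (4 * C ^+ 2)^-1)); last by field; rewrite wn Cn.
  lra.
- apply: le_trans (key d 0 0 (2 * C) (2 * (C * w)) _ _ cx cz hxz (ltW d0) nx2 nz2 _ _) => //; try lra.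
  by rewrite r2 (_ : d * w / (2 * C * (2 * (C * w))) = d * (4 * C ^+ 2)^-1) //; field; rewrite wn Cn.
apply: le_trans (key w 0 0 (C * w) (2 * (C * w)) _ _ cy cz (lexx _) (ltW w0) ny nz2 _ _) => //; try lra.
rewrite r2 (_ : w * w / (C * w * (2 * (C * w))) = 2 * (4 * C ^+ 2)^-1); last by field; rewrite wn Cn.
have : d * (4 * C ^+ 2)^-1 <= 1 * (4 * C ^+ 2)^-1 by rewrite ler_pM2r.
lra.
Qed.

(* Ideal triangles of the lamination with close vertices coincide. *)
Lemma same_vertex a1 a2 a3 b1 b2 b3 (c eta : R) : eta < c ->
  L (geod a1 a2) -> L (geod a1 a3) -> L (geod b1 b2) -> L (geod b1 b3) ->
  c <= `|om (hv a1) (hv a2)| -> c <= `|om (hv a1) (hv a3)| -> c <= `|om (hv a2) (hv a3)| ->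
  cabs (hv b1 - hv a1) <= eta -> cabs (hv b2 - hv a2) <= eta -> cabs (hv b3 - hv a3) <= eta -> b1 = a1.
Proof.
move=> ec l12 l13 k12 k13 h12 h13 h23 d1 d2 d3.
have [ca1 ca2 _] := lgc l12; have [_ ca3 _] := lgc l13; have [cb1 cb2 _] := lgc k12; have [_ cb3 _] := lgc k13.
have nc u v s t : circle u -> circle v -> circle s -> circle t -> L (geod u v) -> L (geod s t) ->
    0 <= side (hv u) (hv v) (hv s) * side (hv u) (hv v) (hv t).
  move=> cu cv cs ct l l'; rewrite leNgt; apply/negP => neg; apply: (L_nc LL l' l).
  rewrite -(pt_hv cs) -(pt_hv ct) -(pt_hv cu) -(pt_hv cv); apply/crosses_side => //; exact: hv_neq0.
have := triangle_rigid (cabs_hv a1) (cabs_hv a2) (cabs_hv a3) d1 d2 d3 ec h12 h13 h23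
  (nc _ _ _ _ ca1 ca2 cb1 cb3 l12 k13) (nc _ _ _ _ ca1 ca3 cb1 cb2 l13 k12).
by move=> /(pt_eq (hv_neq0 _) (hv_neq0 _)); rewrite !pt_hv.
Qed.

(** If [g] carries a triangle to one of comparable shape, [nz g] is bounded at [x] and at [y], and
    the lifts of these points span an area of at least [d]. The bound is independent of [w], so one
    list serves all scales. *)
Lemma transport_list (d c : R) : 0 < d -> d <= 1 -> 0 < c -> c <= 1 -> exists s : seq 'M[R[i]]_2, forall g x y z (w : R),
  G g -> circle x -> circle y -> circle z -> 0 < w ->
  d <= `|om (hv x) (hv y)| -> d <= `|om (hv (mob g x)) (hv (mob g y))| ->
  d <= `|om (hv x) (hv z)| -> d <= `|om (hv (mob g x)) (hv (mob g z))| ->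
  c * w <= `|om (hv y) (hv z)| <= w -> c * w <= `|om (hv (mob g y)) (hv (mob g z))| <= w -> g \in s.
Proof.
move=> d0 d1 c0 cl1; pose K := (c * d ^+ 2)^-1 + 1.
have cd0 : 0 < c * d ^+ 2 by rewrite mulr_gt0 // exprn_gt0.
have K1 : 1 <= K by rewrite /K lerDr invr_ge0 ltW.
have [s Hs] := discrete_list fG (K / d).
exists s => g x y z w Gg cx cy cz w0 a1 a2 b1 b2 /andP[e1 e2] /andP[e3 e4]; have sg := G_su11 fG Gg.
have le1 (u v : R[i]) : `|om (hv u) (hv v)| <= 1 by apply: le_trans (om_le _ _) _; rewrite !cabs_hv mulr1.
have X0 := nz_gt0 x sg; have Y0 := nz_gt0 y sg; have Z0 := nz_gt0 z sg.
have rel u v : circle u -> circle v -> `|om (hv (mob g u)) (hv (mob g v))| * (nz g u * nz g v) = `|om (hv u) (hv v)|.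
  by move=> cu cv; rewrite om_mob // divfK // mulf_neq0 // gt_eqF // nz_gt0.
have rxy := rel _ _ cx cy; have rxz := rel _ _ cx cz; have ryz := rel _ _ cy cz.
have lxy := le1 x y; have lxz := le1 x z.
set X := nz g x in X0 rxy rxz; set Y := nz g y in Y0 rxy ryz; set Z := nz g z in Z0 rxz ryz.
have cw : 0 < c * w by rewrite mulr_gt0.
have u1 : d * (X * Y) <= 1.
  by apply: le_trans lxy; rewrite -rxy ler_pM2r // mulr_gt0.
have u2 : d * (X * Z) <= 1.
  by apply: le_trans lxz; rewrite -rxz ler_pM2r // mulr_gt0.
have u3 : c <= Y * Z.
  rewrite -(ler_pM2r w0); apply: le_trans e1 _; rewrite -ryz mulrC ler_pM2l //; exact: mulr_gt0.
have u4 : c * (Y * Z) <= 1.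
  rewrite -(ler_pM2r w0) mul1r; apply: le_trans e2; rewrite -ryz mulrAC ler_pM2r //; exact: mulr_gt0.
have u5 : d <= X * Z.
  have : `|om (hv (mob g x)) (hv (mob g z))| * (X * Z) <= 1 * (X * Z) by rewrite ler_pM2r ?mulr_gt0.
  by rewrite rxz mul1r; apply: le_trans.
have bX : X ^+ 2 <= (c * d ^+ 2)^-1.
  rewrite -[X in _ <= X]mul1r ler_pdivlMr //.
  have : (d * (X * Y)) * (d * (X * Z)) <= 1 * 1 by apply: ler_pM => //; rewrite !mulr_ge0 // ltW.
  have : X ^+ 2 * d ^+ 2 * c <= X ^+ 2 * d ^+ 2 * (Y * Z) by rewrite ler_pM2l // mulr_gt0 // exprn_gt0.
  have -> : d * (X * Y) * (d * (X * Z)) = X ^+ 2 * d ^+ 2 * (Y * Z) by ring.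
  have -> : X ^+ 2 * (c * d ^+ 2) = X ^+ 2 * d ^+ 2 * c by ring.
  lra.
have bY : Y ^+ 2 <= (c * d ^+ 2)^-1.
  rewrite -[X in _ <= X]mul1r ler_pdivlMr //.
  have : (d * (X * Y)) * (c * (Y * Z)) <= 1 * 1 by apply: ler_pM => //; rewrite !mulr_ge0 // ltW.
  have : Y ^+ 2 * d * c * d <= Y ^+ 2 * d * c * (X * Z) by rewrite ler_pM2l // !mulr_gt0 // exprn_gt0.
  have -> : d * (X * Y) * (c * (Y * Z)) = Y ^+ 2 * d * c * (X * Z) by ring.
  have -> : Y ^+ 2 * (c * d ^+ 2) = Y ^+ 2 * d * c * d by ring.
  lra.
have kX : X <= K by apply: le_sqr_bound bX; exact: ltW.
have kY : Y <= K by apply: le_sqr_bound bY; exact: ltW.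
have Kd : K <= K / d by rewrite ler_pdivlMr // ler_piMr //; lra.
have A0 : om (hv x) (hv y) != 0 by rewrite -normr_gt0; apply: lt_le_trans a1.
have Ai : `|(om (hv x) (hv y))^-1| <= d^-1 by rewrite normfV lef_pV2 ?posrE // normr_gt0.
have di : 0 <= d^-1 by rewrite invr_ge0 ltW.
apply: (Hs g (hv x) (rs (om (hv x) (hv y))^-1 (hv y)) Gg).
- by rewrite om_rsr mulVf.
- by rewrite cabs_hv; apply: le_trans Kd.
- rewrite cabs_rs cabs_hv mulr1; apply: le_trans Ai _.
  by rewrite -[X in X <= _]mul1r ler_pM2r // invr_gt0.
- exact: le_trans kX Kd.
rewrite act_rs cabs_rs mulrC; apply: ler_pM => //; exact: cabs_ge0.
Qed.

(** The triangles of gaps become thick when renormalised. Those with vertices in the same cells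
    coincide by rigidity, so the original triangles differ by a group element; for gaps of
    comparable length it lies in a finite list, and it determines the gap. *)
Lemma gap_count : exists N : nat, forall n (l : seq (R * R)), uniq l ->
  (forall g, g \in l -> gap Xc g.1 g.2 /\ dy R n.+1 <= g.2 - g.1 < dy R n) -> (size l <= N)%N.
Proof.
have [d [c [d0 d1 c0 cl1 HT]]] := gap_triangle; have [c1 c10 HE] := expand_triangle d0 d1.
pose Tri (g : R * R) (w : R[i] * R[i] * R[i] * 'M[R[i]]_2) := gap Xc g.1 g.2 ->
  [/\ [/\ circle w.1.1.1, circle w.1.1.2, circle w.1.2 & G w.2],
      [/\ geod (Pc g.1) (Mc g.1) = geod w.1.1.1 w.1.1.2, geod (Pc g.2) (Mc g.2) = geod w.1.1.1 w.1.2 & L (geod w.1.1.2 w.1.2)],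
      d <= `|om (hv w.1.1.1) (hv w.1.1.2)| /\ d <= `|om (hv w.1.1.1) (hv w.1.2)|,
      c * (g.2 - g.1) <= `|om (hv w.1.1.2) (hv w.1.2)| <= pi * (g.2 - g.1) &
      [/\ c1 <= `|om (hv (mob w.2 w.1.1.1)) (hv (mob w.2 w.1.1.2))|, c1 <= `|om (hv (mob w.2 w.1.1.1)) (hv (mob w.2 w.1.2))| &
          c1 <= `|om (hv (mob w.2 w.1.1.2)) (hv (mob w.2 w.1.2))|]].
have /choice[W HW] : forall g, exists w, Tri g w.
  move=> g; case: (pselect (gap Xc g.1 g.2)) => [gg|]; last by exists (0, 0, 0, 0).
  have [x [y [z [[cx cy cz] lf hxy hxz hyz]]]] := HT _ _ gg.
  have yz0 : 0 < `|om (hv y) (hv z)|.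
    by case/andP: hyz => h _; apply: lt_le_trans h; rewrite mulr_gt0 // subr_gt0; case: gg.
  have [h [Gh k1 k2 k3]] := HE x y z cx cy cz hxy hxz yz0.
  by exists (x, y, z, h).
pose X g := (W g).1.1.1; pose Y g := (W g).1.1.2; pose Z g := (W g).1.2; pose E g := (W g).2.
have pg2 := pi_ge2 R; have pp := pi0.
have [s Hs] := @transport_list d (c / (2 * pi)) d0 d1 ltac:(by rewrite divr_gt0 // mulr_gt0)
  ltac:(by rewrite ler_pdivrMr ?mulr_gt0 // mul1r; lra).
have cpE (q D : R) : q != 0 -> c / (2 * q) * (q * D) = c * (D / 2) by move=> ?; field.
(* Cells of half the thickness, as [same_vertex] needs an error below [c1]. *)
pose eta := c1 / 2; have eta0 : 0 < eta by rewrite divr_gt0.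
have [k hk] : exists k : nat, pi < k%:R * eta.
  exists (Num.truncn (pi / eta)).+1; rewrite -ltr_pdivrMr //.
  by apply: truncnS_gt.
have /choice[cell Hcell] : forall u : R[i], exists j : 'I_k, circle u -> j%:R * eta <= ha 1 u < j.+1%:R * eta.
  move=> u; case: (pselect (circle u)) => cu.
    have [j hj] := @cell_exists R k eta (ha 1 u) (ha_ge0 (circle1 R) cu) (lt_trans (ha_ltpi (circle1 R) cu) hk).
    by exists j.
  have [j hj] := @cell_exists R k eta 0 (lexx _) (lt_trans pp hk).
  by exists j.
have near u v : circle u -> circle v -> cell u = cell v -> cabs (hv u - hv v) <= eta.
  move=> cu cv e; have /andP[h1 h2] := Hcell u cu; have /andP[h3 h4] := Hcell v cv; apply: hv_near.
  rewrite e in h1 h2; move: h2 h4; rewrite -addn1 natrD mulrDl mul1r => h2 h4.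
  by rewrite ler_norml; apply/andP; split; lra.
pose code g := (cell (mob (E g) (X g)), cell (mob (E g) (Y g)), cell (mob (E g) (Z g))).
exists (#|{: 'I_k * 'I_k * 'I_k}| * size s)%N => n l ul Hl.
apply: (size_by_classes (code := code)) => cc.
set l' := [seq t <- l | code t == cc].
have ul' : uniq l' by exact: filter_uniq.
have Hl' g : g \in l' -> [/\ gap Xc g.1 g.2, dy R n.+1 <= g.2 - g.1 < dy R n & code g = cc].
  by rewrite mem_filter => /andP[/eqP e /Hl[]].
clearbody l'; case: l' ul' Hl' => [//|g0 l0]; set l1 := g0 :: l0 => ul1 Hl1.
have g0in : g0 \in l1 by rewrite inE eqxx.
have [gap0 sz0 cd0] := Hl1 _ g0in.
have [[cx0 cy0 cz0 GE0] [la0 lb0 lc0] [hd0 hd0'] hw0 [t1 t2 t3]] := HW _ gap0.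
have Xgap g : gap Xc g.1 g.2 -> L (geod (X g) (Y g)) /\ L (geod (X g) (Z g)).
  move=> gg; have [_ [la lb _] _ _ _] := HW _ gg; have [Xa Xb _ _] := gg.
  by rewrite -[geod (X g) _]la -[geod (X g) (Z g)]lb; split; exact: Xc_leaf.
have su g : G g -> su11 g by exact: (G_su11 fG).
have same g : g \in l1 -> exists h, h \in s /\ [/\ mob h (X g0) = X g, mob h (Y g0) = Y g & mob h (Z g0) = Z g].
  move=> gl; have [gg sz cd] := Hl1 _ gl.
  have [[cx cy cz GE] [la lb lc] [hd hd'] hw [u1 u2 u3]] := HW _ gg.
  have [lxy0 lxz0] := Xgap _ gap0; have [lxy lxz] := Xgap _ gg.
  have LM u v := @L_mob R G L LL (E g0) u v GE0; have LM' u v := @L_mob R G L LL (E g) u v GE.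
  have C u : circle u -> circle (mob (E g0) u) by move=> ?; apply: circle_mob => //; exact: su.
  have C' u : circle u -> circle (mob (E g) u) by move=> ?; apply: circle_mob => //; exact: su.
  move: cd; rewrite -cd0 => -[e1 e2 e3].
  have dx := near _ _ (C' _ cx) (C _ cx0) e1; have dy' := near _ _ (C' _ cy) (C _ cy0) e2; have dz := near _ _ (C' _ cz) (C _ cz0) e3.
  have ec : eta < c1 by rewrite /eta ltr_pdivrMr // ltr_pMr // ltr1n.
  have gC (u v : R[i]) : L (geod u v) -> L (geod v u) by rewrite geodC.
  have oC (u v : R[i]) : `|om u v| = `|om v u| by rewrite omC normrN.
  have qx : mob (E g) (X g) = mob (E g0) (X g0).
    exact: (same_vertex ec (LM _ _ lxy0) (LM _ _ lxz0) (LM' _ _ lxy) (LM' _ _ lxz) t1 t2 t3 dx dy' dz).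
  have qy : mob (E g) (Y g) = mob (E g0) (Y g0).
    by apply: (same_vertex ec (gC _ _ (LM _ _ lxy0)) (LM _ _ lc0) (gC _ _ (LM' _ _ lxy)) (LM' _ _ lc) _ _ _ dy' dx dz) => //; rewrite oC.
  have qz : mob (E g) (Z g) = mob (E g0) (Z g0).
    by apply: (same_vertex ec (gC _ _ (LM _ _ lxz0)) (gC _ _ (LM _ _ lc0)) (gC _ _ (LM' _ _ lxz)) (gC _ _ (LM' _ _ lc)) _ _ _ dz dx dy') => //; rewrite oC.
  have GEi := G_inv fG GE.
  have mv u v : circle u -> circle v -> mob (E g) v = mob (E g0) u -> mob (invmx (E g) *m E g0) u = v.
    move=> cu cv q; rewrite mob_mul //; [|exact: su|exact: su].
    by rewrite -q (mob_invK fG).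
  have mx := mv _ _ cx0 cx qx; have my := mv _ _ cy0 cy qy; have mz := mv _ _ cz0 cz qz.
  exists (invmx (E g) *m E g0); split=> //.
  apply: (Hs _ _ _ _ (pi * dy R n) (G_mul fG GEi GE0) cx0 cy0 cz0) => //; rewrite ?mx ?my ?mz //.
  - by rewrite mulr_gt0 // dy_gt0.
  - move: hw0 sz0 => /andP[v1 v2] /andP[v3 v4]; rewrite dyS in v3; apply/andP; split.
      apply: le_trans v1; rewrite (cpE _ _ (lt0r_neq0 pp)).
      by rewrite ler_pM2l.
    by apply: le_trans v2 _; rewrite ler_pM2l // ltW.
  move: hw sz => /andP[v1 v2] /andP[v3 v4]; rewrite dyS in v3; apply/andP; split.
    apply: le_trans v1; rewrite (cpE _ _ (lt0r_neq0 pp)).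
    by rewrite ler_pM2l.
  by apply: le_trans v2 _; rewrite ler_pM2l // ltW.
have /choice[D HD] : forall g, exists h, g \in l1 -> h \in s /\ [/\ mob h (X g0) = X g, mob h (Y g0) = Y g & mob h (Z g0) = Z g].
  move=> g; case: (boolP (g \in l1)) => [/same[h hh]|_]; first by exists h.
  by exists 0.
rewrite -(size_map D); apply: uniq_leq_size; last first.
  by move=> h /mapP[g gl ->]; have [] := HD g gl.
rewrite map_inj_in_uniq // => g h gl hl e.
have [_ [e1 e2 e3]] := HD g gl; have [_ [e1' e2' e3']] := HD h hl; rewrite e e1' in e1; rewrite e e2' in e2; rewrite e e3' in e3.
have [gg _ _] := Hl1 _ gl; have [gh _ _] := Hl1 _ hl.
have [Xg1 Xg2 _ _] := gg; have [Xh1 Xh2 _ _] := gh.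
have [_ [a1 a2 _] _ _ _] := HW _ gg; have [_ [b1 b2 _] _ _ _] := HW _ gh.
have E1 : g.1 = h.1 by apply: leaf_Xc_inj => //; rewrite a1 b1 -/(X g) -/(Y g) -/(X h) -/(Y h) e1 e2.
have E2 : g.2 = h.2 by apply: leaf_Xc_inj => //; rewrite a2 b2 -/(X g) -/(Z g) -/(X h) -/(Z h) e1 e3.
by move: E1 E2; case: (g) => ? ?; case: (h) => ? ? /= -> ->.
Qed.

Lemma Xc_thin : thin Xc.
Proof. by split; [exact: Xc_range|exact: Xc_closed|exact: Xc_porous|exact: gap_count]. Qed.

Lemma coherentE (p1' m1' p2' m2' : R[i]) : circle p1' -> circle m1' -> circle p2' -> circle m2' ->
  coherent p1' m1' p2' m2' <-> (ha p2' p1' < ha p2' m1' <= ha p2' m2') || (ha p1' p2' < ha p1' m2' <= ha p1' m1').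
Proof.
move=> c1 c2 c3 c4; split.
  case=> [[t2 [t3 [t4 [/ccw_angleE-> // /ccw_angleE-> // /ccw_angleE-> // h]]]]|[t2 [t3 [t4 [/ccw_angleE-> // /ccw_angleE-> // /ccw_angleE-> // h]]]]].
    by apply/orP; left; lra.
  by apply/orP; right; lra.
have tw a b c : a < b <= c -> (2 : R) * a < 2 * b <= 2 * c by move=> ?; lra.
case/orP=> h; [left|right].
  by exists (2 * ha p2' p1'), (2 * ha p2' m1'), (2 * ha p2' m2'); split; try (exact/ccw_angleE); exact: tw.
by exists (2 * ha p1' p2'), (2 * ha p1' m2'), (2 * ha p1' m1'); split; try (exact/ccw_angleE); exact: tw.
Qed.

Lemma ha_pol2 s t : 0 <= s < pi -> 0 <= t < pi -> ha (pol s) (pol t) = if s <= t then t - s else t - s + pi.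
Proof. by move=> hs ht; rewrite (ha_base co (circle_pol s) (circle_pol t)) !ha_pol. Qed.

Lemma Xc_coherent s t : Xc s -> Xc t -> coherent (Pc s) (Mc s) (Pc t) (Mc t).
Proof.
move=> Xs Xt; apply/coherentE; try exact: circle_pol.
have [s1 s2] := f_rng_pi Xs; have [t1 t2] := f_rng_pi Xt.
have [s3 s4 s5 s6] := f_rng Xs; have [t3 t4 t5 t6] := f_rng Xt; have ph := phi_psi.
have a1 : f1 t <= f2 s by lra. have a2 : f1 s <= f2 t by lra.
have a3 : f1 s <= f2 s by lra. have a4 : f1 t <= f2 t by lra.
rewrite !ha_pol2 // a1 a2 a3 a4.
have [st|st] := leP s t.
  have [k1 k2] := f_mono Xs Xt st; rewrite k1; apply/orP; right; lra.
have [k1 k2] := f_mono Xt Xs (ltW st); rewrite k1; apply/orP; left; lra.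
Qed.

Lemma Xc_incoherent s t : Xc s -> Xc t ->
  ~ coherent (Pc s) (Mc s) (Mc t) (Pc t) /\ ~ coherent (Mc s) (Pc s) (Pc t) (Mc t).
Proof.
move=> Xs Xt; have [s1 s2] := f_rng_pi Xs; have [t1 t2] := f_rng_pi Xt.
have [s3 s4 s5 s6] := f_rng Xs; have [t3 t4 t5 t6] := f_rng Xt; have [r0 r1 r2 r3 r4] := rng.
have a1 : f1 t < f2 s by exact: le_lt_trans t4 (lt_le_trans r1 s5).
have a2 : f1 s < f2 t by exact: le_lt_trans s4 (lt_le_trans r1 t5).
have a3 : f1 s < f2 s by exact: le_lt_trans s4 (lt_le_trans r1 s5).
have a4 : f1 t < f2 t by exact: le_lt_trans t4 (lt_le_trans r1 t5).
have b1 : f2 s < pi by exact: le_lt_trans r3. have b2 : f2 t < pi by exact: le_lt_trans r3.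
split=> /coherentE H; have := H (circle_pol _) (circle_pol _) (circle_pol _) (circle_pol _); rewrite !ha_pol2 //.
  by rewrite [f2 t <= f1 s]leNgt [f2 t <= f1 t]leNgt a2 a4 (ltW a2) (ltW a3) incoherent_angles.
by rewrite orbC [f2 s <= f1 s]leNgt [f2 s <= f1 t]leNgt a1 a3 (ltW a1) (ltW a4) incoherent_angles.
Qed.

Lemma fam_first : fam 0 psi1 /\ g1 = geod (pol 0) (pol psi1).
Proof.
have [r0 r1 r2 r3 r4] := rng; have [e1 e2 [_ _ cm _ _] _] := lab.
have e : g1 = geod (pol 0) (pol psi1) by rewrite -pol_ha // e1 /pol mulr0 expi0 mulr1.
by split=> //; split; rewrite ?lexx ?r0 ?r2 // -e.
Qed.

Lemma fam_last : fam phi2 psi2 /\ g2 = geod (pol phi2) (pol psi2).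
Proof.
have [r0 r1 r2 r3 r4] := rng; have [e1 e2 [_ _ _ cp cm] _] := lab.
have e : g2 = geod (pol phi2) (pol psi2) by rewrite -!pol_ha.
by split=> //; split; rewrite ?lexx ?r0 ?r2 // -e.
Qed.

Lemma coor0 : coor 0 psi1 = 0.
Proof. by rewrite /coor add0r subrr mul0r. Qed.

Lemma Xc_sep h : separates L h g1 g2 <-> exists s, Xc s /\ h = geod (Pc s) (Mc s).
Proof.
split.
  move=> /(separatesE (L_leaf LL) h lab) [Lh [p [m [cp cm eh h1 h2]]]].
  rewrite ha_self // in h1.
  have F : fam (ha o p) (ha o m) by split=> //; rewrite -!pol_ha // -eh.
  exists (coor (ha o p) (ha o m)); split; first exact: Xc_coor.
  by have [q1 q2] := f_coor F; rewrite /Pc /Mc q1 q2 -!pol_ha.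
move=> [s [Xs ->]]; apply/(separatesE (L_leaf LL) _ lab); split; first exact: Xc_leaf.
have [s1 s2 s3 s4] := f_rng Xs.
by exists (Pc s), (Mc s); split; rewrite ?ha_self ?ha_Pc ?ha_Mc ?s1 ?s2 ?s3 ?s4 //; exact: circle_pol.
Qed.

Lemma Xc_low : exists2 C : R, 0 <= C & forall s t a b c e, Xc s -> Xc t ->
    geod a b = geod (Pc s) (Mc s) -> geod c e = geod (Pc t) (Mc t) -> `|s - t| <= C * dol a b c e.
Proof.
have [r0 r1 r2 r3 r4] := rng; have [c c0 Hc] := sin_lower_psi.
have k0 : 0 < psi2 - phi2 by rewrite subr_gt0.
pose C := c^-1 + (c * (psi2 - phi2))^-1; have ci0 : 0 < c^-1 by rewrite invr_gt0.
have ck0 : 0 < (c * (psi2 - phi2))^-1 by rewrite invr_gt0 mulr_gt0.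
exists C; first by rewrite /C; lra.
have same s t : Xc s -> Xc t -> `|s - t| <= C * dol (Pc s) (Mc s) (Pc t) (Mc t).
  wlog st : s t / s <= t.
    move=> wl Xs Xt; have [h|/ltW h] := leP s t; first exact: wl.
    rewrite distrC (_ : dol _ _ _ _ = dol (Pc t) (Mc t) (Pc s) (Mc s)); first exact: wl.
    by rewrite /dol [cabs (Pc s - Pc t)]cabs_sub [cabs (Mc s - Mc t)]cabs_sub.
  move=> Xs Xt; have [k1 k2] := f_mono Xs Xt st; have fd := f_diff Xs Xt.
  have [s1 s2 s3 s4] := f_rng Xs; have [t1 t2 t3 t4] := f_rng Xt.
  have h1 : 2 * (c * (f1 t - f1 s)) <= dol (Pc s) (Mc s) (Pc t) (Mc t).
    rewrite /dol le_max; apply/orP; left; rewrite chord_pol ler_pM2l //; apply: le_trans (ler_norm _).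
    by apply: Hc; apply/andP; split; lra.
  have h2 : 2 * (c * (f2 s - f2 t)) <= dol (Pc s) (Mc s) (Pc t) (Mc t).
    rewrite /dol le_max; apply/orP; right; rewrite cabs_sub chord_pol ler_pM2l //; apply: le_trans (ler_norm _).
    by apply: Hc; apply/andP; split; lra.
  set D := dol _ _ _ _ in h1 h2 *; have D0 : 0 <= D by exact: dol_ge0.
  rewrite ler0_norm ?subr_le0 // opprB.
  have h3 : c * ((t - s) * pi) <= D by rewrite fd; lra.
  have h4 : c * (t - s) <= c * ((t - s) * pi).
    by rewrite ler_pM2l // ler_peMr ?subr_ge0 //; have := pi_ge2 R; lra.
  apply: le_trans (_ : c^-1 * D <= _); first by rewrite -ler_pdivrMl // mulrC invrK mulrC; lra.
  by rewrite /C mulrDl lerDl mulr_ge0 // ltW.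
(* With labels exchanged the chord joins two arcs at positive distance, so [C] times its length is
   at least 1, while parameters differ by less than 1. *)
have opp s t : Xc s -> Xc t -> `|s - t| <= C * cabs (Pc s - Mc t).
  move=> Xs Xt; have [s1 s2 s3 s4] := f_rng Xs; have [t1 t2 t3 t4] := f_rng Xt.
  have /andP[q1 q2] := Xc_range Xs; have /andP[q3 q4] := Xc_range Xt.
  have h1 : c * (psi2 - phi2) <= cabs (Pc s - Mc t).
    rewrite chord_pol; apply: le_trans (_ : sin (f2 t - f1 s) <= _); last by have := ler_norm (sin (f2 t - f1 s)); have := normr_ge0 (sin (f2 t - f1 s)); lra.
    apply: le_trans (Hc _ _); last by apply/andP; split; lra.
    by rewrite ler_pM2l //; lra.
  apply: le_trans (_ : 1 <= _); first by rewrite ler_norml; apply/andP; split; lra.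
  have h2 : 1 <= (c * (psi2 - phi2))^-1 * cabs (Pc s - Mc t).
    by rewrite mulrC ler_pdivlMr ?mul1r // mulr_gt0.
  by apply: le_trans h2 _; rewrite /C ler_wpM2r ?cabs_ge0 //; lra.
have C0 : 0 <= C by rewrite /C; lra.
have mx (p m p' m' : R[i]) : cabs (p - p') <= dol p m p' m' /\ cabs (m - m') <= dol p m p' m'.
  by rewrite /dol !le_max !lexx orbT.
move=> s t a b p e Xs Xt /geod_eq [[-> ->]|[-> ->]] /geod_eq [[-> ->]|[-> ->]]; [exact: same| | |].
- by apply: le_trans (opp s t Xs Xt) _; rewrite ler_wpM2l //; have [] := mx (Pc s) (Mc s) (Mc t) (Pc t).
- rewrite distrC; apply: le_trans (opp t s Xt Xs) _; rewrite ler_wpM2l // cabs_sub.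
  by have [] := mx (Mc s) (Pc s) (Pc t) (Mc t).
by rewrite /dol Order.TotalTheory.maxC; exact: same.
Qed.

Lemma label_chart : exists X P M t1, chart L g1 g2 X P M t1.
Proof.
have [r0 r1 r2 r3 r4] := rng.
have [F0 e0] := fam_first; have [F1 e1] := fam_last.
have X0 := Xc_coor F0; rewrite coor0 in X0.
have [f01 f02] := f_coor F0; rewrite coor0 in f01 f02.
exists Xc, Pc, Mc, (coor phi2 psi2); split.
- exact: Xc_thin.
- by move=> s Xs; split; [exact: Xc_leaf|have [] := lgc (Xc_leaf Xs)].
- exact: Xc_sep.
- by split=> //; rewrite /Pc /Mc f01 f02.
- split; [exact: Xc_coor|by have [q1 q2] := f_coor F1; rewrite /Pc /Mc q1 q2|].
  move=> s Xs; have [s1 s2 s3 s4] := f_rng Xs; have [_ ->] := XcE Xs.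
  by rewrite -subr_ge0 coor_diff divr_ge0 ?(ltW r4) //; lra.
- exists (2 * pi); first by rewrite mulr_ge0 // ltW.
  move=> s t Xs Xt; have [h1 h2] := f_abs Xt Xs.
  rewrite /dol ge_max !chord_pol -mulrA; apply/andP; split; rewrite ler_pM2l //.
    by apply: le_trans (abs_sin_le _) _; rewrite distrC.
  by apply: le_trans (abs_sin_le _) _; rewrite distrC.
- exact: Xc_low.
- by move=> a b /gap_shared[e|e]; [left; rewrite /Pc e|right; rewrite /Mc e].
- move=> s t Xs Xt st [x [hx hx']].
  have [s1 s2 s3 s4] := f_rng Xs; have [t1 t2 t3 t4] := f_rng Xt; have [k1 k2] := f_mono Xs Xt st.
  have cross u v : Xc u -> Xc v -> Pc u = Mc v -> False.
    move=> Xu Xv /(congr1 (ha o)); rewrite ha_Pc // ha_Mc // => e; have [? ? ? ?] := f_rng Xu; have [? ? ? ?] := f_rng Xv; lra.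
  have [e|e] : Pc s = Pc t \/ Mc s = Mc t.
    case: hx => q; case: hx' => q'; rewrite q in q'; [by left|by case: (cross s t)|by case: (cross t s)|by right].
  + have e' : f1 s = f1 t by rewrite -ha_Pc // e ha_Pc.
    left=> r Xr /andP[sr rt]; have [h1 _] := f_mono Xs Xr sr; have [h2 _] := f_mono Xr Xt rt.
    by rewrite /Pc; congr pol; apply/eqP; rewrite eq_le h1 e' h2.
  have e' : f2 s = f2 t by rewrite -ha_Mc // e ha_Mc.
  right=> r Xr /andP[sr rt]; have [_ h1] := f_mono Xs Xr sr; have [_ h2] := f_mono Xr Xt rt.
  by rewrite /Mc; congr pol; apply/eqP; rewrite eq_le h1 e' h2.
- exact: Xc_coherent.
- move=> s t a b p m Xs Xt; have [n1 n2] := Xc_incoherent Xs Xt.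
  move=> /geod_eq [[-> ->]|[-> ->]] /geod_eq [[-> ->]|[-> ->]] h; [by left|by case: n1|by case: n2|by right].
move=> s t Xs Xt st; have [s1 s2 s3 s4] := f_rng Xs; have [t1 t2 t3 t4] := f_rng Xt; have [k1 k2] := f_mono Xs Xt st.
have lb : labelled o (geod (Pc 0) (Mc 0)) (geod (Pc t) (Mc t)) (Pc 0) (Mc 0) (Pc t) (Mc t).
  by apply: labelledI; rewrite ?ha_Pc ?ha_Mc // ?f01 ?f02 //; try exact: circle_pol; lra.
apply/(separatesE (L_leaf LL) _ lb); split; first exact: Xc_leaf.
exists (Pc s), (Mc s); split; try exact: circle_pol; first by [].
  by rewrite !ha_Pc // f01 s1 k1.
by rewrite !ha_Mc // f02 s4 k2.
Qed.

End ChartExists.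

(** * Gluing *)

Lemma chart_exists (R : realType) (G : set 'M[R[i]]_2) (L : set (set R[i])) (g1 g2 : set R[i]) :
  cocompact_fuchsian G -> maximal_lamination G L -> L g1 -> L g2 ->
  exists X P M t1, chart L g1 g2 X P M t1.
Proof.
move=> fG ML L1 L2; have [LL _] := ML.
have [p1 [m1 [p2 [m2 lab]]]] := label_exists (L_leaf LL) (L_nc LL) L1 L2.
exact: (label_chart fG ML L1 L2 lab).
Qed.

Section AbsoluteValues.
Variable R : realType.

Lemma absval_real : absval (fun x : R => `|x|).
Proof.
split; [exact: normrM|exact: ler_normD|exact: normrN|exact: normr0|exact: normr1|by move=> x /normr0_eq0|exact: normr_ge0|].
by move=> u C r r0 r1; exact: geometric_complete.
Qed.

Lemma absval_complex : absval (@cabs R).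
Proof.
split; [exact: cabsM|exact: cabsD|exact: cabsN|exact: cabs0|exact: cabs1|exact: cabs_eq0|exact: cabs_ge0|].
move=> u C r r0 r1 H; have q0 : 0 < 1 - r by lra.
have leR (z : R[i]) : `|complex.Re z| <= cabs z.
  by rewrite cabsE -sqrtr_sqr; apply: ler_wsqrtr; rewrite lerDl sqr_ge0.
have leI (z : R[i]) : `|complex.Im z| <= cabs z.
  by rewrite cabsE -sqrtr_sqr; apply: ler_wsqrtr; rewrite lerDr sqr_ge0.
have [||n|a Ha] := @geometric_complete R (fun n => complex.Re (u n)) C r => //.
  rewrite (_ : _ - _ = complex.Re (u n.+1 - u n)); last by case: (u n.+1) (u n) => ? ? [].
  exact: le_trans (leR _) (H n).
have [||n|b Hb] := @geometric_complete R (fun n => complex.Im (u n)) C r => //.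
  rewrite (_ : _ - _ = complex.Im (u n.+1 - u n)); last by case: (u n.+1) (u n) => ? ? [].
  exact: le_trans (leI _) (H n).
pose l := Complex a b; pose E n := C * r ^+ n / (1 - r).
have C0 : 0 <= C by have := H 0%N; rewrite expr0 mulr1; apply: le_trans; exact: cabs_ge0.
have E0 n : 0 <= E n by rewrite /E divr_ge0 ?mulr_ge0 ?exprn_ge0 // ltW.
have ES n : E n - E n.+1 = C * r ^+ n by rewrite /E exprS; field; rewrite gt_eqF.
have tel n k : cabs (u (n + k)%N - u n) <= E n - E (n + k)%N.
  elim: k => [|k IH]; first by rewrite addn0 !subrr cabs0.
  rewrite addnS; have := cabs_tri (u (n + k).+1) (u (n + k)%N) (u n).
  have := H (n + k)%N; rewrite -ES; lra.
(* Convergence of the two coordinates gives only twice the required bound; the exact one follows by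
   letting the second index of [tel] tend to infinity. *)
have lim n : cabs (u n - l) <= 2 * E n.
  have -> : u n - l = Complex (complex.Re (u n) - a) 0 + Complex 0 (complex.Im (u n) - b).
    by rewrite /l; case: (u n) => p q; apply/eqP; rewrite eq_complex /= addr0 add0r !eqxx.
  apply: le_trans (cabsD _ _) _; rewrite !cabsE /= expr0n addr0 add0r !sqrtr_sqr.
  have := Ha n; have := Hb n; rewrite -/(E n); lra.
exists l => n; rewrite -/(E n) leNgt; apply/negP => lt.
pose e := cabs (u n - l) - E n; have e0 : 0 < e by rewrite subr_gt0.
have k0 : 0 < e * (1 - r) / (C + 1) by rewrite !(divr_gt0, mulr_gt0) //; lra.
have [m hm] := expr_small r0 r1 k0.
have : E (n + m)%N < e.
  rewrite /E ltr_pdivrMr //; have C1 : 0 < C + 1 by lra.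
  rewrite ltr_pdivlMr // in hm; apply: le_lt_trans hm; rewrite mulrC exprD.
  have h1 : r ^+ n <= 1 by rewrite exprn_ile1 // ltW.
  have h2 := exprn_ge0 m r0; have h3 := exprn_ge0 n r0.
  have : r ^+ n * r ^+ m <= 1 * r ^+ m by apply: ler_wpM2r.
  by have := mulr_ge0 h3 h2; nra.
have := tel n m; have := cabs_tri (u n) (u (n + m)%N) l; have := lim (n + m)%N.
rewrite [cabs (u n - u _)]cabs_sub /e; lra.
Qed.

End AbsoluteValues.

Section MaxNorm.
Variables (R : realType) (K : fieldType) (nK : K -> R) (d : nat).
Hypothesis aK : absval nK.

Lemma mxnorm_mul (A B : 'M[K]_d) : mxnorm nK (A *m B) <= d%:R * mxnorm nK A * mxnorm nK B.
Proof.
have n0 (M : 'M[K]_d) : 0 <= mxnorm nK M by rewrite /mxnorm; apply: bigmax_ge_id.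
apply: mxnorm_le; first by rewrite !mulr_ge0.
move=> i j; rewrite !mxE.
have : nK (\sum_k A i k * B k j) <= \sum_(k < d) mxnorm nK A * mxnorm nK B.
  elim/big_ind2: _ => [|x1 x2 y1 y2 h1 h2|k _]; first by rewrite (av0 aK).
    by apply: le_trans (avD aK _ _) _; exact: lerD.
  by rewrite (avM aK); apply: ler_pM; rewrite ?(av_ge0 aK) // mxnorm_entry.
by rewrite sumr_const card_ord -mulrA mulr_natl.
Qed.

End MaxNorm.

Section Existence.
Variables (R : realType) (K : fieldType) (nK : K -> R) (d : nat).
Hypothesis aK : absval nK.
Variables (G : set 'M[R[i]]_2) (L : set (set R[i])) (xi : R[i] -> nat -> 'M[K]_d).
Hypotheses (fG : cocompact_fuchsian G) (ML : maximal_lamination G L).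
Hypothesis fxi : forall x, bdry L x -> is_flag (xi x).
Hypothesis txi : forall p m, oleaf L p m -> transverse (xi p) (xi m).
Hypothesis hxi : loc_holder nK L xi.

Let LL : lifted_lamination G L. Proof. by case: ML. Qed.
Let Lf := L_leaf LL.
Let Ln := L_nc LL.
Let su g : G g -> su11 g. Proof. exact: (G_su11 fG). Qed.
Local Notation Q := (sepset L).

Lemma slithering_sub (L1 L2 : set (set R[i])) T : (forall g, L2 g -> L1 g) -> slithering nK L1 xi T -> slithering nK L2 xi T.
Proof.
move=> sub [h0 [h1 h2 h3] h4 h5 h6].
have ss h a b : separates L2 h a b -> separates L1 h a b by move=> [Lh k]; split=> //; exact: sub.
split.
- by move=> a b /sub La /sub Lb; exact: h0.
- split=> [a /sub|a b /sub La /sub Lb|a b c /sub La /sub Lb /sub Lc /ss]; [exact: h1|exact: h2|exact: h3].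
- move=> a b /sub La /sub Lb; have [A [nu [A0 [n0 H]]]] := h4 a b La Lb.
  by exists A, nu; split=> //; split=> // *; apply: H; exact: ss.
- by move=> a b /sub La /sub Lb; exact: h5.
by move=> p1 m1 p2 m2 [/sub l1 n1] [/sub l2 n2]; apply: h6.
Qed.

Lemma local_slithering g1 g2 : L g1 -> L g2 -> (exists T, slithering nK (Q g1 g2) xi T) /\
  (forall T T', slithering nK (Q g1 g2) xi T -> slithering nK (Q g1 g2) xi T' -> T g1 g2 = T' g1 g2).
Proof.
move=> L1 L2; have [X [P [M [t1 ch]]]] := chart_exists fG ML L1 L2.
exact: (chart_slithering aK fxi txi hxi ch).
Qed.

(** The value at this pair of any slithering map on [Q g1 g2]. Local uniqueness makes it well
    defined and lets the local maps agree on overlaps ([gluedE]). *)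
Definition glued g1 g2 : 'M[K]_d := xget 1%:M (fun A => exists T, slithering nK (Q g1 g2) xi T /\ A = T g1 g2).

Lemma gluedE T g1 g2 h k : L g1 -> L g2 -> slithering nK (Q g1 g2) xi T -> Q g1 g2 h -> Q g1 g2 k -> glued h k = T h k.
Proof.
move=> L1 L2 hT qh qk; have [Lh _] := qh; have [Lk _] := qk.
have hT' : slithering nK (Q h k) xi T.
  apply: slithering_sub hT => l ql; exact: (separates_trans Lf Ln L1 L2 qh qk ql).
have ex : exists A : 'M[K]_d, exists T, slithering nK (Q h k) xi T /\ A = T h k by exists (T h k), T.
have [T2 [hT2 e]] := @xgetPex _ 1%:M (fun A => exists T, slithering nK (Q h k) xi T /\ A = T h k) ex.
rewrite /glued e; exact: (proj2 (local_slithering Lh Lk) _ _ hT2 hT').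
Qed.

(** Every axiom concerns leaves within a single [Q g1 g2], where [glued] agrees with a local map. *)
Lemma glued_slithering : slithering nK L xi glued.
Proof.
have loc g1 g2 : L g1 -> L g2 -> exists T, [/\ slithering nK (Q g1 g2) xi T, Q g1 g2 g1, Q g1 g2 g2 &
    forall h k, Q g1 g2 h -> Q g1 g2 k -> glued h k = T h k].
  move=> L1 L2; have [[T hT] _] := local_slithering L1 L2; exists T; split=> //.
  - exact: (separates_l Lf Ln L1 L2).
  - exact: (separates_r Lf Ln L1 L2).
  by move=> h k; exact: gluedE.
have sepQ g1 g2 h : separates L h g1 g2 -> separates (Q g1 g2) h g1 g2.
  by move=> q; split=> //; case: q.
split.
- by move=> a b La Lb; have [T [[h0 _ _ _ _] qa qb E]] := loc a b La Lb; rewrite E //; exact: h0.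
- split=> [a La|a b La Lb|a b c La Lb Lc s].
  + by have [T [[_ [h1 _ _] _ _ _] qa qb E]] := loc a a La La; rewrite E //; exact: h1.
  + have [T [[_ [_ h2 _] _ _ _] qa qb E]] := loc a b La Lb.
    by rewrite (E a b) // (E b a) //; exact: h2.
  have [T [[_ [_ _ h3] _ _ _] qa qc E]] := loc a c La Lc.
  by rewrite !E //; apply: h3 => //; exact: sepQ.
- move=> a b La Lb; have [T [[_ _ h4 _ _] qa qb E]] := loc a b La Lb.
  have [A [nu [A0 [n0 H]]]] := h4 a b qa qb.
  exists A, nu; split=> //; split=> // a1 b1 a2 b2 c1 e1 c2 e2 s1 s2 s3 s4.
  by rewrite !E //; apply: H; exact: sepQ.
- by move=> a b La Lb sh; have [T [[_ _ _ h5 _] qa qb E]] := loc a b La Lb; rewrite E //; exact: h5.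
move=> p1 m1 p2 m2 [l1 n1] [l2 n2] co.
by have [T [[_ _ _ _ h6] qa qb E]] := loc _ _ l1 l2; rewrite E //; apply: h6.
Qed.

Lemma slithering_unique S' g1 g2 : slithering nK L xi S' -> L g1 -> L g2 -> S' g1 g2 = glued g1 g2.
Proof.
move=> hS L1 L2.
have sub T : slithering nK L xi T -> slithering nK (Q g1 g2) xi T by apply: slithering_sub => h [].
exact: (proj2 (local_slithering L1 L2) _ _ (sub _ hS) (sub _ glued_slithering)).
Qed.

(** Expressed by equality and cyclic order, the comparison of angles is invariant under Moebius
    maps. *)
Lemma ha_lt (p a b : R[i]) : circle p -> circle a -> circle b ->
  ha p a < ha p b <-> (a = p /\ b <> p) \/ ccw3 p a b.
Proof.
move=> cp ca cb; have h0 := ha_self cp; have a0 := ha_ge0 cp ca; have b0 := ha_ge0 cp cb; split.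
  move=> lt; case: (pselect (a = p)) => [e|ne]; [left|right].
    by split=> // e2; move: lt; rewrite e e2 ltxx.
  apply/ccw3_ha => //; rewrite lt andbT lt_neqAle a0 andbT eq_sym; apply/eqP => e; apply: ne.
  by apply: (ha_inj cp) => //; rewrite e h0.
case=> [[-> ne]|/ccw3_ha H]; last by have /andP[] := H cp ca cb.
rewrite h0 lt_neqAle b0 andbT eq_sym; apply/eqP => e; apply: ne.
by apply: (ha_inj cp) => //; rewrite e h0.
Qed.

Lemma ha_lt_mob c (p a b : R[i]) : G c -> circle p -> circle a -> circle b ->
  ha p a < ha p b -> ha (mob c p) (mob c a) < ha (mob c p) (mob c b).
Proof.
move=> Gc cp ca cb; have sc := su Gc; move=> /(ha_lt cp ca cb) h; apply/ha_lt; try exact: circle_mob.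
case: h => [[-> ne]|h]; [left|right]; last exact/ccw3_mob.
by split=> // /(mob_inj sc cb cp).
Qed.

Lemma coherent_mob c (p1 m1 p2 m2 : R[i]) : G c -> circle p1 -> circle m1 -> circle p2 -> circle m2 ->
  coherent p1 m1 p2 m2 -> coherent (mob c p1) (mob c m1) (mob c p2) (mob c m2).
Proof.
move=> Gc c1 c2 c3 c4; have sc := su Gc; move=> /(coherentE c1 c2 c3 c4) h.
apply/coherentE; try exact: circle_mob.
have le p a b : circle p -> circle a -> circle b -> ha p a <= ha p b -> ha (mob c p) (mob c a) <= ha (mob c p) (mob c b).
  move=> cp ca cb; rewrite le_eqVlt => /orP[/eqP /(ha_inj cp ca cb) -> //|h']; apply: ltW; exact: ha_lt_mob.
by case/orP: h => /andP[h1 h2]; apply/orP; [left|right]; rewrite ha_lt_mob // le.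
Qed.

(** Pulled back by [c] and conjugated by [rho c], the map is again a slithering map for [xi], so
    uniqueness identifies the two. The scalar ambiguity of [rho c] cancels in the conjugation. *)
Lemma glued_equivariant (rho : 'M[R[i]]_2 -> 'M[K]_d) : proj_rep G rho -> xi_equivariant G L rho xi ->
  Sigma_equivariant G L rho glued.
Proof.
move=> [ru _ _] eqv c g1 g2 Gc L1 L2; have sc := su Gc; have uc := ru c Gc.
pose T h k := invmx (rho c) *m glued (mob c @` h)%classic (mob c @` k)%classic *m rho c.
have Lc h : L h -> L (mob c @` h)%classic by move=> Lh; case: LL => _ _ H _; exact: H.
have [h0 [h1 h2 h3] h4 h5 h6] := glued_slithering.
have leafc u v : L (geod u v) -> [/\ circle u, circle v & u <> v] by exact: leaf_circle.
have sepc h a b : L a -> L b -> separates L h a b -> separates L (mob c @` h)%classic (mob c @` a)%classic (mob c @` b)%classic.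
  move=> La Lb [Lh [p [q [pq e s1 s2]]]]; split; first exact: Lc.
  rewrite e in Lh *; have [cp cq _] := leafc _ _ Lh.
  have onc k z : L k -> k z -> circle z.
    by move=> /Lf [u [v [cu cv _ ->]]] [->|->].
  exists (mob c p), (mob c q); split; [by move=> /(mob_inj sc cp cq)|exact: image_mob_geod| |].
    by move=> z [t kt <-]; apply: carc_mob => //; [exact: onc kt|exact: s1].
  by move=> z [t kt <-]; apply: carc_mob => //; [exact: onc kt|exact: s2].
have hT : slithering nK L xi T.
  split.
  - move=> a b La Lb; rewrite /T !det_mulmx h0; [|exact: Lc|exact: Lc].
    by rewrite mulr1 -det_mulmx mulVmx // det1.
  - split=> [a La|a b La Lb|a b k La Lb Lk s].
    + by rewrite /T h1 ?mulmx1 ?mulVmx //; exact: Lc.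
    + have ua : glued (mob c @` b)%classic (mob c @` a)%classic \in unitmx.
        by rewrite unitmxE h0 ?unitr1 //; exact: Lc.
      have u1 : invmx (rho c) \in unitmx by rewrite unitmx_inv.
      have u2 : invmx (rho c) *m glued (mob c @` b)%classic (mob c @` a)%classic \in unitmx by rewrite unitmx_mul u1 ua.
      by rewrite /T (h2 _ _ (Lc _ La) (Lc _ Lb)) (invmx_mul u2 uc) (invmx_mul u1 ua) invmxK mulmxA.
    by rewrite /T -(h3 _ _ _ (Lc _ La) (Lc _ Lb) (Lc _ Lk) (sepc _ _ _ La Lk s)) !mulmxA mulmxK.
  - move=> a b La Lb; have [A [nu [A0 [n0 H]]]] := h4 _ _ (Lc _ La) (Lc _ Lb).
    have [k k0 Hk] := mob_lipschitz fG Gc.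
    (* The maximum-entry norm is submultiplicative up to a factor [d], once for each of the two
       products; 1 is added to keep the constant positive. *)
    pose C := d%:R * mxnorm nK (invmx (rho c)) * d%:R * mxnorm nK (rho c) + 1.
    have nn (M : 'M[K]_d) : 0 <= mxnorm nK M by rewrite /mxnorm; apply: bigmax_ge_id.
    have C0 : 0 < C by rewrite /C ltr_wpDl // !mulr_ge0.
    exists (C * A * powR k nu), nu; split; first by rewrite !mulr_gt0 // powR_gt0.
    split=> // a1 b1 a2 b2 c1 e1 c2 e2 s1 s2 s3 s4.
    have [[ca1 cb1 _] [ca2 cb2 _]] := (leafc _ _ (proj1 s1), leafc _ _ (proj1 s2)).
    have [[cc1 ce1 _] [cc2 ce2 _]] := (leafc _ _ (proj1 s3), leafc _ _ (proj1 s4)).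
    have := H (mob c a1) (mob c b1) (mob c a2) (mob c b2) (mob c c1) (mob c e1) (mob c c2) (mob c e2).
    rewrite -!image_mob_geod => /(_ (sepc _ _ _ La Lb s1) (sepc _ _ _ La Lb s2) (sepc _ _ _ La Lb s3) (sepc _ _ _ La Lb s4)).
    set D := glued _ _ - glued _ _ => hD.
    have -> : T (geod a1 b1) (geod a2 b2) - T (geod c1 e1) (geod c2 e2) = invmx (rho c) *m D *m rho c.
      by rewrite /T /D mulmxBr mulmxBl.
    have m1 : mxnorm nK (invmx (rho c) *m D *m rho c) <= C * mxnorm nK D.
      apply: le_trans (mxnorm_mul aK _ _) _.
      apply: le_trans (_ : d%:R * (d%:R * mxnorm nK (invmx (rho c)) * mxnorm nK D) * mxnorm nK (rho c) <= _).
        by rewrite ler_wpM2r // ler_wpM2l // mxnorm_mul.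
      by rewrite /C mulrDl mul1r ler_wpDr //; lra.
    apply: le_trans m1 _; rewrite -!mulrA ler_pM2l //; apply: le_trans hD _; rewrite ler_pM2l //.
    have dk (u v u' v' : R[i]) : circle u -> circle v -> circle u' -> circle v' ->
        dol (mob c u) (mob c v) (mob c u') (mob c v') <= k * dol u v u' v'.
      move=> cu cv cu' cv'; rewrite {1}/dol ge_max; apply/andP; split.
        by apply: le_trans (Hk _ _ cu cu') _; rewrite ler_pM2l // /dol le_max lexx.
      by apply: le_trans (Hk _ _ cv cv') _; rewrite ler_pM2l // /dol le_max lexx orbT.
    set M1 := Num.max (dol a1 b1 c1 e1) _.
    have M0 : 0 <= M1 by rewrite le_max dol_ge0.
    rewrite -powRM ?(ltW k0) //; apply: ge0_ler_powR; rewrite ?nnegrE ?mulr_ge0 ?(ltW k0) ?(ltW n0) //.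
      by rewrite le_max dol_ge0.
    rewrite ge_max; apply/andP; split.
      by apply: le_trans (dk _ _ _ _ ca1 cb1 cc1 ce1) _; rewrite ler_pM2l // le_max lexx.
    by apply: le_trans (dk _ _ _ _ ca2 cb2 cc2 ce2) _; rewrite ler_pM2l // le_max lexx orbT.
  - move=> a b La Lb [x [ax bx]]; apply: unipotent_conj => //; apply: h5; try exact: Lc.
    by exists (mob c x); split; exists x.
  move=> p1 m1 p2 m2 [l1 n1] [l2 n2] co.
  have [cp1 cm1 _] := leafc _ _ l1; have [cp2 cm2 _] := leafc _ _ l2.
  have ol p m : circle p -> circle m -> L (geod p m) -> p <> m -> oleaf L (mob c p) (mob c m).
    by move=> cp cm l n; split; [rewrite -image_mob_geod; exact: Lc|move=> /(mob_inj sc cp cm)].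
  have [k1 k2] := h6 _ _ _ _ (ol _ _ cp1 cm1 l1 n1) (ol _ _ cp2 cm2 l2 n2) (coherent_mob Gc cp1 cm1 cp2 cm2 co).
  rewrite -!image_mob_geod in k1 k2.
  have bd p m : L (geod p m) -> bdry L p /\ bdry L m.
    by move=> l; split; exists (geod p m); split=> //; [left|right].
  have [bp1 bm1] := bd _ _ l1; have [bp2 bm2] := bd _ _ l2.
  (* Equivariance of [xi] moves the flags at the translated points back through [rho c]. *)
  have tr_ q2 q1 : bdry L q2 -> bdry L q1 ->
      flag_eq (flag_act (glued (mob c @` geod p1 m1)%classic (mob c @` geod p2 m2)%classic) (xi (mob c q2))) (xi (mob c q1)) ->
      flag_eq (flag_act (T (geod p1 m1) (geod p2 m2)) (xi q2)) (xi q1).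
    move=> b2 b1 h j jd; have e2 := eqv c q2 Gc b2 j jd; have e1 := eqv c q1 Gc b1 j jd; have e := h j jd.
    rewrite /flag_act in e e1 e2 *; rewrite /T !trmx_mul !mulmxA.
    set S := glued _ _ in e *.
    move/eqmxP: e1 => e1; move/eqmxP: e2 => e2; move/eqmxP: e => e; apply/eqmxP.
    have k3 : (xi (mob c q1) j *m (invmx (rho c))^T :=: xi q1 j)%MS.
      apply: eqmx_trans (eqmxMr _ e1) _.
      by rewrite -mulmxA -trmx_mul mulVmx // trmx1 mulmx1; exact: eqmx_refl.
    apply: eqmx_trans k3; apply: eqmxMr; apply: eqmx_trans e; apply: eqmxMr; exact: eqmx_sym.
  by split; apply: tr_.
have e := slithering_unique hT L1 L2.
by rewrite -e /T !mulmxA mulmxV // mul1mx mulmxK.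
Qed.

End Existence.

Lemma slithering_exists_unique (R : realType) (K : fieldType) (nK : K -> R) : absval nK -> slithering_theorem nK.
Proof.
move=> aK G L d xi fG ML fxi txi hxi; exists (glued nK L xi); split.
- exact: (glued_slithering aK fG ML fxi txi hxi).
- by move=> S' hS' g1 g2 L1 L2; exact: (slithering_unique aK fG ML fxi txi hxi).
by move=> rho pr eqv; exact: (glued_equivariant aK fG ML fxi txi hxi).
Qed.

(* K = R (real case, |.|) and K = C = R[i] (complex case, modulus). *)
Theorem mainTheorem2 (R : realType) :
  slithering_theorem (fun x : R => `|x|) /\ slithering_theorem (@cabs R).
Proof.
by split; apply: slithering_exists_unique; [exact: absval_real|exact: absval_complex].
Qed.
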